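(* Let $S_1,S_2$ be self-adjoint operators in $\mathcal{H}$, bounded from below, such that $(S_2-zI_{\mathcal{H}})^{-1}-(S_1-zI_{\mathcal{H}})^{-1}$ is trace class for some (and hence for all) $z\in\rho(S_1)\cap\rho(S_2)$, and such that for some $\lambda_1>0$, $\sigma_{ess}(S_j)\subseteq[\lambda_1,\infty)$, $j=1,2$. Suppose that the symmetrized perturbation determinant $$D(z)={\det}_{\mathcal{H}}\Big(\overline{(S_2-zI_{\mathcal{H}})^{1/2}(S_1-zI_{\mathcal{H}})^{-1}(S_2-zI_{\mathcal{H}})^{1/2}}\Big)$$ is well-defined and satisfies $$\mathrm{tr}_{\mathcal{H}}\big((S_2-zI_{\mathcal{H}})^{-1}-(S_1-zI_{\mathcal{H}})^{-1}\big)=-\frac{d}{dz}\ln(D(z)),\quad z\in\mathbb{C}\backslash[\inf(\sigma(S_1)\cup\sigma(S_2)),\infty).$$ In addition, assume that for some $\varepsilon>0$, $$\big|\mathrm{tr}_{\mathcal{H}}\big((S_2-zI_{\mathcal{H}})^{-1}[I_{\mathcal{H}}-P(0;S_2)]-(S_1-zI_{\mathcal{H}})^{-1}[I_{\mathcal{H}}-P(0;S_1)]\big)\big|=\begin{cases}O\big(|z|^{-1-\varepsilon}\big), & \text{as } |z|\to\infty,\\ O(1), & \text{as } |z|\to0,\end{cases}$$ for $z$ on $\gamma$ and in the exterior of $\gamma$. Then, for $\mathrm{Re}(s)\in(-\varepsilon,1)$, $$\zeta(s;S_1,S_2)=e^{is(\pi-\theta)}\pi^{-1}\sin(\pi s)\int_0^\infty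 dt\,t^{-s}\frac{d}{dt}\ln\Big((e^{i\theta}t)^{[m(0;S_1)-m(0;S_2)]}D(e^{i\theta}t)\Big).$$
   Context: $\mathcal{H}$ is a separable complex Hilbert space with identity operator $I_{\mathcal{H}}$; $\sigma$, $\rho$ denote spectrum and resolvent set, and $\sigma_{ess}(T)=\sigma(T)\backslash\sigma_d(T)$, where $\sigma_d(T)$ is the set of isolated points of the spectrum that are eigenvalues of finite algebraic multiplicity. $\mathrm{tr}_{\mathcal{H}}$ and $\det_{\mathcal{H}}$ denote the trace and the Fredholm determinant (for operators of the form identity plus trace class); $\overline{T}$ is the closure of the operator $T$. The determinant $D(z)$ being well-defined means that the displayed closure is a bounded operator differing from $I_{\mathcal{H}}$ by a trace class operator. Any choice of branch cut of the normal operator $(S_2-zI_{\mathcal{H}})^{1/2}$ (via the spectral theorem) is permissible. $\frac{d}{dz}\ln(g)$ denotes the logarithmic derivative $g'/g$. $P(0;S_j)$ is the spectral projection of $S_j$ corresponding to the eigenvalue $0$ (it is $0$ if $0\notin\sigma(S_j)$), and $m(0;S_j)=\dim(\ker(S_j))$. Branch of $z^{-s}$: fix $\theta\in(\pi/2,\pi)$ and take the branch cut of $z^{-s}$ to be the ray $R_\theta=\{te^{i\theta}\mid t\in[0,\infty)\}$, with $\arg z\in(\theta-2\pi,\theta)$ (so $\arg z=0$ for $z>0$). Contour: $\gamma$ is a simple (piecewise smooth) contour which comes in from infinity in the upper half-plane above the positive real axis, passes to the left of $\sigma(S_1)\cup\sigma(S_2)$, and returns to infinity in the lower half-plane below the positive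 real axis (outside a compact set it consists of two straight half-lines along which $\mathrm{Re}(z)\to+\infty$). It is counterclockwise oriented and encircles $\sigma(S_1)\cup\sigma(S_2)$, with the stipulation that $0$ lies neither in the interior of $\gamma$ nor on $\gamma$ ($\gamma$ dips under the point $0$; all nonzero points of $\sigma(S_1)\cup\sigma(S_2)$ are in the interior), and $\gamma$ has no contact with $R_\theta$. The relative spectral $\zeta$-function of the pair $(S_1,S_2)$ is $$\zeta(s;S_1,S_2)=-\frac{1}{2\pi i}\oint_\gamma dz\,z^{-s}\,\mathrm{tr}_{\mathcal{H}}\big((S_2-zI_{\mathcal{H}})^{-1}[I_{\mathcal{H}}-P(0;S_2)]-(S_1-zI_{\mathcal{H}})^{-1}[I_{\mathcal{H}}-P(0;S_1)]\big)$$ for $\mathrm{Re}(s)>0$ sufficiently large, ensuring convergence, and $\zeta(\cdot;S_1,S_2)$ also denotes its analytic continuation in $s$. *)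

(* Defs.v *)
From HB Require Import structures.
From mathcomp Require Import all_boot all_order all_algebra.
From mathcomp Require Import complex.
From mathcomp Require Import all_classical all_reals all_analysis.

Set Implicit Arguments.
Unset Strict Implicit.
Unset Printing Implicit Defensive.

Import Order.TTheory GRing.Theory Num.Theory numFieldNormedType.Exports.

Local Open Scope classical_set_scope.
Local Open Scope complex_scope.
Local Open Scope ring_scope.

(* [R[i]] with the topology of its modulus, so that [derivable f z 1] for
   [f : R[i] -> R[i]] is complex differentiability at [z]. *)
#[warning="-redundant-canonical-projection"]
HB.instance Definition _ (R : realType) :=
  PseudoPointedMetric.copy R[i] R[i]^o.
#[warning="-redundant-canonical-projection"]
HB.instance Definition _ (R : realType) := NormedModule.copy R[i] R[i]^o.

Section ComplexFunctions.
Context {R : realType}.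
Implicit Types (z w s : R[i]) (t : R).

Definition abs z : R := complex.Re `|z|.

Definition expi t : R[i] := cos t +i* sin t.

Definition cexp z : R[i] := (expR (complex.Re z))%:C * expi (complex.Im z).

Definition csin z : R[i] := (cexp ('i * z) - cexp (- ('i * z))) / (2 * 'i).

(* [sqrtC] takes values of argument in [0, pi[, i.e. it has its cut along the
   positive half-line; here the cut is the half-line of direction [expi b]. *)
Definition sqrt_branch (b : R) z : R[i] :=
  expi (b / 2) * sqrtC (expi (- b) * z).

Definition ray (theta : R) : set R[i] :=
  [set z | exists2 t, 0 <= t & z = t%:C * expi theta].

Definition arg_cut (theta : R) z : R :=
  get [set phi : R | theta - 2 * pi < phi < theta /\ z = `|z| * expi phi].

(* z ^ s, with the branch cut of the logarithm along [ray theta] *)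
Definition cpow (theta : R) z s : R[i] :=
  cexp (s * (ln (abs z) +i* arg_cut theta z)).

(* t ^ s for t > 0 *)
Definition rcpow t s : R[i] := cexp (s * (ln t)%:C).

Definition rderiv (g : R -> R[i]) t : R[i] :=
  (derive1 (fun u => complex.Re (g u)) t) +i*
  (derive1 (fun u => complex.Im (g u)) t).

Definition holomorphic_on (U : set R[i]) (f : R[i] -> R[i]) : Prop :=
  forall z, U z -> derivable f z 1.

End ComplexFunctions.

Section ComplexIntegral.
Context {R : realType} {d : measure_display} {T : measurableType d}.
Variables (mu : {measure set T -> \bar R}) (A : set T) (f : T -> R[i]).

Definition cintegrable : Prop :=
  mu.-integrable A (fun x => (complex.Re (f x))%:E) /\
  mu.-integrable A (fun x => (complex.Im (f x))%:E).

Definition cintegral : R[i] :=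
  (\int[mu]_(x in A) complex.Re (f x)) +i* (\int[mu]_(x in A) complex.Im (f x)).

End ComplexIntegral.

(* Unbounded operators are represented by their graphs. *)
Section Operators.
Context {R : realType} {H : completeNormedModType R[i]}.
Variable dot : {dot H for @Num.conj R[i]}.

Definition hilbert : Prop := forall x : H, `|x| ^+ 2 = dot x x.

Definition separable : Prop := exists A : set H, countable A /\ dense A.

Definition operator := set (H * H).

Implicit Types (S T : operator) (A B P : H -> H) (x y w : H) (z : R[i]).

Definition dom T : set H := [set x | exists y, T (x, y)].

Definition graph A : operator := [set xy | xy.2 = A xy.1].

(* T - z *)
Definition shift T z : operator := [set xy | T (xy.1, xy.2 + z *: xy.1)].

Definition inverse T : operator := [set xy | T (xy.2, xy.1)].

(* first T, then S *)
Definition comp S T : operator :=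
  [set xw | exists y, T (xw.1, y) /\ S (y, xw.2)].

Definition ker T : set H := [set x | T (x, 0)].

Definition adjoint T : operator :=
  [set yw | forall x Tx, T (x, Tx) -> dot Tx yw.1 = dot x yw.2].

Definition self_adjoint T : Prop := dense (dom T) /\ adjoint T = T.

Definition bounded_below T : Prop :=
  exists c : R, forall x y, T (x, y) -> c%:C * dot x x <= dot y x.

Definition bounded_op A : Prop := linear A /\ continuous A.

Definition resolvent_set T : set R[i] :=
  [set z | exists A, bounded_op A /\ inverse (shift T z) = graph A].

Definition spectrum T : set R[i] := ~` resolvent_set T.

(* (T - z)^-1 as a total function, meaningful for z in the resolvent set *)
Definition resolvent T z : H -> H :=
  fun y => xget 0 [set x | inverse (shift T z) (y, x)].

Definition has_dim (K : set H) (n : nat) : Prop :=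
  exists v : 'I_n -> H,
    forall x, K x <-> exists! c : 'rV[R[i]]_n, x = \sum_(i < n) c 0 i *: v i.

Definition root_space T z : set H :=
  [set x | exists n, ker (iter n (comp (shift T z)) (graph id)) x].

Definition discrete_spectrum T : set R[i] :=
  [set z | [/\ isolated (spectrum T) z,
               exists2 x, x <> 0 & ker (shift T z) x &
               exists n, has_dim (root_space T z) n]].

Definition ess_spectrum T : set R[i] := spectrum T `\` discrete_spectrum T.

(* A sequence which becomes an orthonormal basis once its zero terms are
   dropped; zero terms make the definition cover finite-dimensional spaces and
   contribute nothing to the sums and determinants below. *)
Definition orthonormal_basis (e : nat -> H) : Prop :=
  [/\ forall m n, m <> n -> dot (e m) (e n) = 0,
      forall n, e n = 0 \/ dot (e n) (e n) = 1 &
      forall x, (forall n, dot x (e n) = 0) -> x = 0].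

(* B = |A| is the positive square root of A^* A. *)
Definition is_absolute_value A B : Prop :=
  [/\ bounded_op B, forall x, 0 <= dot (B x) x &
      forall x y, dot (B (B x)) y = dot (A x) (A y)].

Definition trace_class A : Prop :=
  bounded_op A /\
  exists B, is_absolute_value A B /\
    exists e, orthonormal_basis e /\
      cvgn (series (fun n => dot (B (e n)) (e n))).

Definition tr A : R[i] :=
  get [set t | forall e, orthonormal_basis e ->
    series (fun n => dot (A (e n)) (e n)) @ \oo --> t].

(* det (I + A), as the limit of the determinants of the compressions of I + A
   to the spans of the first n vectors of any orthonormal basis *)
Definition fredholm_det A : R[i] :=
  get [set D | forall e, orthonormal_basis e ->
    (fun n => \det (\matrix_(i < n, j < n)
                      ((i == j)%:R + dot (A (e j)) (e i)))) @ \oo --> D].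

Definition orthogonal_projection P : Prop :=
  [/\ linear P, forall x, P (P x) = P x & forall x y, dot (P x) y = dot x (P y)].

(* Projection-valued measures on the Borel sets of R; countable additivity is
   that of the scalar measures <E(.)x, x>, for every x. *)
Record projection_measure := ProjectionMeasure {
  pm_proj :> set (measurableTypeR R) -> H -> H ;
  pm_scalar : H -> {measure set (measurableTypeR R) -> \bar R} ;
  pm_projP : forall M, measurable M -> orthogonal_projection (pm_proj M) ;
  pm_projT : forall x, pm_proj setT x = x ;
  pm_scalarP : forall x M, measurable M ->
    pm_scalar x M = (complex.Re (dot (pm_proj M x) x))%:E }.

Definition spectral_dom (E : projection_measure) (f : R -> R[i]) : set H :=
  [set x | (\int[pm_scalar E x]_l ((abs (f l)) ^+ 2)%:E < +oo)%E].

(* The operator \int f dE, given on its domain by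
   <(\int f dE) x, w> = \int f d<E(.)x, w>, where the complex measure
   <E(.)x, w> is expressed through the scalar measures by polarization. *)
Definition spectral_integral (E : projection_measure) (f : R -> R[i])
    : operator :=
  [set xy | spectral_dom E f xy.1 /\ forall w, spectral_dom E f w ->
     dot xy.2 w = 4^-1 * \sum_(k < 4) 'i ^+ k *
                    cintegral (pm_scalar E (xy.1 + 'i ^+ k *: w)) setT f].

Definition spectral_measure_of (E : projection_measure) S : Prop :=
  S = spectral_integral E (fun l => l%:C).

(* (S - z)^(1/2) for S with spectral measure E, the square root having its cut
   in the direction [expi b] *)
Definition sqrt_shift (E : projection_measure) (b : R) z : operator :=
  spectral_integral E (fun l => sqrt_branch b (l%:C - z)).

(* D is the value of det (closure ((S2 - z)^(1/2) (S1 - z)^-1 (S2 - z)^(1/2))),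
   the operator being the identity plus a trace class operator. *)
Definition symmetrized_det S1 (E2 : projection_measure) (b : R) z (D : R[i])
    : Prop :=
  exists A, [/\ trace_class A,
    closure (comp (sqrt_shift E2 b z)
               (comp (inverse (shift S1 z)) (sqrt_shift E2 b z)))
      = graph (fun x => x + A x) &
    D = fredholm_det A].

(* tr ((S2 - z)^-1 (I - P(0; S2)) - (S1 - z)^-1 (I - P(0; S1))) *)
Definition reduced_trace S1 S2 (E1 E2 : projection_measure) z : R[i] :=
  tr (fun x => resolvent S2 z (x - E2 [set 0] x)
               - resolvent S1 z (x - E1 [set 0] x)).

(* C \ [inf (sigma(S1) U sigma(S2)), oo[ *)
Definition cut_plane S1 S2 : set R[i] :=
  [set z | ~ (complex.Im z = 0 /\
    (ereal_inf [set l%:E | l in [set l : R |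
        (spectrum S1 `|` spectrum S2) l%:C]] <= (complex.Re z)%:E)%E)].

End Operators.

Arguments operator {R} H.
Arguments separable {R} H.

Section Contour.
Context {R : realType}.
Variable gamma : R -> R[i].

Definition piecewise_smooth : Prop :=
  continuous gamma /\
  exists breaks : seq R,
    (forall t, t \notin breaks ->
       [/\ derivable (fun u => complex.Re (gamma u)) t 1,
           derivable (fun u => complex.Im (gamma u)) t 1,
           {for t, continuous (rderiv gamma)} & rderiv gamma t != 0]) /\
    (forall t, t \in breaks ->
       (exists2 l, l != 0 & rderiv gamma u @[u --> t^'-] --> l) /\
       (exists2 l, l != 0 & rderiv gamma u @[u --> t^'+] --> l)).

(* Affine half-lines with Re -> +oo outside a compact parameter interval, the
   initial one in the upper and the final one in the lower half-plane. *)
Definition straight_ends : Prop :=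
  exists a b : R, exists u v : R[i],
    [/\ a <= b, 0 < complex.Re u, 0 < complex.Re v,
        forall t, t <= a ->
          gamma t = gamma a + (a - t)%:C * u /\ 0 < complex.Im (gamma t) &
        forall t, b <= t ->
          gamma t = gamma b + (t - b)%:C * v /\ complex.Im (gamma t) < 0].

(* The connected component of the complement of gamma which contains the far
   positive half-line, i.e. the region to the left of the oriented gamma. *)
Definition contour_interior : set R[i] :=
  [set z | exists r : R, forall x : R, r <= x ->
     connected_component (~` range gamma) x%:C z].

Definition contour_integrable (f : R[i] -> R[i]) : Prop :=
  cintegrable (@lebesgue_measure R) setT
    (fun t => f (gamma t) * rderiv gamma t).

Definition contour_integral (f : R[i] -> R[i]) : R[i] :=
  cintegral (@lebesgue_measure R) setT
    (fun t => f (gamma t) * rderiv gamma t).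

(* The contour gamma for a set [sigma] of singularities and the cut
   [ray theta]; the last condition places 0 outside. *)
Definition admissible_contour (theta : R) (sigma : set R[i]) : Prop :=
  [/\ injective gamma, piecewise_smooth, straight_ends &
   [/\ sigma `\ 0 `<=` contour_interior,
       range gamma `&` ray theta = set0 &
       ~ range gamma 0 /\ ~ contour_interior 0]].

(* Z is the analytic continuation, to Re s > - eps, of the function
   s |-> - (2 pi i)^-1 \oint_gamma z^(-s) F(z) dz defined for large Re s. *)
Definition is_relative_zeta (theta : R) (F : R[i] -> R[i]) (eps : R)
    (Z : R[i] -> R[i]) : Prop :=
  holomorphic_on [set s | - eps < complex.Re s] Z /\
  exists s0 : R, forall s : R[i], s0 < complex.Re s ->
    contour_integrable (fun z => cpow theta z (- s) * F z) /\
    Z s = - (2 * pi%:C * 'i)^-1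
          * contour_integral (fun z => cpow theta z (- s) * F z).

End Contour.

(* Main.v *)
(* Write F for the reduced trace. By the resolvent identity the difference of
   the resolvents at z is X2 T X1, where T is trace class and X1, X2 are bounded
   in terms of the resolvents at z; hence the partial sums of F in an orthonormal
   basis converge, with a bound quadratic in z, on gamma and on the cut. Riemann
   sums of the spectral representation approximate each partial sum there,
   uniformly, by combinations of simple fractions 1 / (l - z) with l in the
   interior of gamma. For a simple fraction Cauchy's formula reduces to a winding
   number, which is found by moving l off to +oo. Cutting the integrands off by
   factors q / (q - z), with q going to infinity on the cut, and passing to the
   limit one gets
     \oint_gamma z^k F(z) / (z - p) dz = - 2 pi i p^k F(p),
   for p <> 0 on the cut and every natural number k < 1 + eps.
   The reflection formula
     sin (pi s') \int_0^oo t^(-s') / (t + w) dt = pi w^(-s'),   0 < Re s' < 1,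
   with w = exp (i (pi - theta)) z and s' = s + k, expresses z^(-s) for z on
   gamma as an integral over the cut. Exchanging the two integrals yields the
   representation of zeta when Re s is not an integer, and the other s follow by
   continuity. Finally F(z) is the trace of the difference of the resolvents plus
   (m2 - m1) / z, so that by hypothesis - exp (i theta) F (exp (i theta) t) is the
   logarithmic derivative in the theorem. *)
Require Import Defs.
From HB Require Import structures.
From mathcomp Require Import all_boot all_order all_algebra.
From mathcomp Require Import complex.
From mathcomp Require Import all_classical all_reals all_analysis.
From mathcomp Require Import measurable_realfun ring lra.

Set Implicit Arguments.
Unset Strict Implicit.
Unset Printing Implicit Defensive.

Import Order.TTheory GRing.Theory Num.Theory numFieldNormedType.Exports.

Local Open Scope classical_set_scope.
Local Open Scope complex_scope.
Local Open Scope ring_scope.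

(** * Complex numbers *)

(** The decay assumed for F holds off the interior of gamma and for the full trace; the partial
    sums, which are what simple fractions approximate, are only known to grow at most quadratically,
    so 1 / (z - p) cannot be integrated against them. The cutoff therefore takes three factors, with
    distinct poles q, 2 q, 3 q on the cut: the kernel becomes O(|z|^-4), all its poles are simple,
    and none lies inside gamma. The partial sums are replaced by F first; then the cutoff is
    removed, the decay of F now ensuring convergence. The poles l of the fractions have to lie
    inside gamma, hence to be nonzero points of the spectrum; subtracting the projections P(0; S_j)
    achieves this. The strip -eps < Re s < 1 can be wider than the strip 0 < Re s' < 1 of the
    reflection formula. The integer k shifts s into the latter at the price of a factor z^k, and k <
    1 + eps is what the decay of F can pay for. The reflection formula itself comes from a
    differential equation in w, which leaves one constant; the constant is found from a jump across
    the negative half-line, where a difference of two Cauchy kernels concentrates at t = 1 with mass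
    2 pi i. *)

Notation cRe := (@complex.Re _).
Notation cIm := (@complex.Im _).

Section ComplexModulus.
Context {R : realType}.
Implicit Types (z w : R[i]) (a b t : R).

Lemma normE z : `|z| = (abs z)%:C.
Proof. by rewrite /abs normc_def. Qed.

Lemma absE z : abs z = Num.sqrt (cRe z ^+ 2 + cIm z ^+ 2).
Proof. by rewrite /abs normc_def. Qed.

Lemma abs_ge0 z : 0 <= abs z.
Proof. by rewrite absE sqrtr_ge0. Qed.

Lemma abs_sqr z : abs z ^+ 2 = cRe z ^+ 2 + cIm z ^+ 2.
Proof. by rewrite absE sqr_sqrtr // addr_ge0 ?sqr_ge0. Qed.

Lemma absM z w : abs (z * w) = abs z * abs w.
Proof. by apply: complexI; rewrite rmorphM /= -!normE normrM. Qed.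

Lemma absV z : abs z^-1 = (abs z)^-1.
Proof. by apply: complexI; rewrite fmorphV /= -!normE normfV. Qed.

Lemma absX z n : abs (z ^+ n) = abs z ^+ n.
Proof. by apply: complexI; rewrite rmorphXn /= -!normE normrX. Qed.

Lemma absN z : abs (- z) = abs z.
Proof. by apply: complexI; rewrite -!normE normrN. Qed.

Lemma absBC z w : abs (z - w) = abs (w - z).
Proof. by rewrite -absN opprB. Qed.

Lemma absD z w : abs (z + w) <= abs z + abs w.
Proof. by rewrite -lecR rmorphD /= -!normE ler_normD. Qed.

Lemma absB z w : abs (z - w) <= abs z + abs w.
Proof. by rewrite -(absN w) absD. Qed.

Lemma abs_triangle z w : abs z - abs w <= abs (z - w).
Proof. by rewrite lerBlDr -{1}(subrK w z) absD. Qed.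

Lemma abs_eq0 z : (abs z == 0) = (z == 0).
Proof. by rewrite -(inj_eq (@complexI R)) -normE normr_eq0. Qed.

Lemma abs_gt0 z : (0 < abs z) = (z != 0).
Proof. by rewrite lt_def abs_ge0 abs_eq0 andbT. Qed.

Lemma abs0 : abs (0 : R[i]) = 0.
Proof. by apply/eqP; rewrite abs_eq0. Qed.

Lemma absR a : abs a%:C = `|a|.
Proof. by rewrite absE /= expr0n /= addr0 sqrtr_sqr. Qed.

Lemma abs1 : abs (1 : R[i]) = 1.
Proof. by rewrite -[1]/(1%:C) absR normr1. Qed.

Lemma absi : abs ('i : R[i]) = 1.
Proof. by rewrite -complexiE absE /= expr0n /= add0r expr1n sqrtr1. Qed.

Lemma absJ z : abs (Num.conj z) = abs z.
Proof. by apply: complexI; rewrite -!normE norm_conjC. Qed.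

Lemma ler_Re_abs z : `|cRe z| <= abs z.
Proof. by rewrite absE -sqrtr_sqr ler_wsqrtr // lerDl sqr_ge0. Qed.

Lemma ler_Im_abs z : `|cIm z| <= abs z.
Proof. by rewrite absE -sqrtr_sqr ler_wsqrtr // lerDr sqr_ge0. Qed.

Lemma ler_abs_ReIm z : abs z <= `|cRe z| + `|cIm z|.
Proof.
rewrite -(@ler_pXn2r _ 2) ?nnegrE ?addr_ge0 ?abs_ge0 //.
rewrite abs_sqr sqrrD !real_normK ?num_real // -addrA lerD2l lerDr.
by rewrite mulrn_wge0 // mulr_ge0.
Qed.

Lemma abs_sum (I : Type) (r : seq I) (P : pred I) (F : I -> R[i]) :
  abs (\sum_(i <- r | P i) F i) <= \sum_(i <- r | P i) abs (F i).
Proof.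
elim/big_rec2: _ => [|i y x _ h]; first by rewrite abs0.
by rewrite (le_trans (absD _ _)) // lerD2l.
Qed.

Lemma eq_ReIm z w : cRe z = cRe w -> cIm z = cIm w -> z = w.
Proof. by case: z w => [a b] [c d] /= -> ->. Qed.

Lemma cReD z w : cRe (z + w) = cRe z + cRe w.
Proof. by case: z w => [a b] [c d]. Qed.
Lemma cImD z w : cIm (z + w) = cIm z + cIm w.
Proof. by case: z w => [a b] [c d]. Qed.
Lemma cReN z : cRe (- z) = - cRe z.
Proof. by case: z. Qed.
Lemma cImN z : cIm (- z) = - cIm z.
Proof. by case: z. Qed.
Lemma cReB z w : cRe (z - w) = cRe z - cRe w.
Proof. by rewrite cReD cReN. Qed.
Lemma cImB z w : cIm (z - w) = cIm z - cIm w.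
Proof. by rewrite cImD cImN. Qed.
Lemma cReM z w : cRe (z * w) = cRe z * cRe w - cIm z * cIm w.
Proof. by case: z w => [a b] [c d]. Qed.
Lemma cImM z w : cIm (z * w) = cRe z * cIm w + cIm z * cRe w.
Proof. by case: z w => [a b] [c d]. Qed.
Lemma cRe_conj z : cRe (Num.conj z) = cRe z.
Proof. by case: z. Qed.
Lemma cIm_conj z : cIm (Num.conj z) = - cIm z.
Proof. by case: z. Qed.
Lemma cReZ a z : cRe (a%:C * z) = a * cRe z.
Proof. by rewrite cReM /= mul0r subr0. Qed.
Lemma cImZ a z : cIm (a%:C * z) = a * cIm z.
Proof. by rewrite cImM /= mul0r addr0. Qed.

Lemma cReV z : cRe z^-1 = cRe z / abs z ^+ 2.
Proof. by rewrite abs_sqr; case: z. Qed.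
Lemma cImV z : cIm z^-1 = - (cIm z / abs z ^+ 2).
Proof. by rewrite abs_sqr; case: z. Qed.

Lemma cRe_sum (I : Type) (r : seq I) (P : pred I) (F : I -> R[i]) :
  cRe (\sum_(i <- r | P i) F i) = \sum_(i <- r | P i) cRe (F i).
Proof. by elim/big_rec2: _ => // i y x _ <-; rewrite cReD. Qed.
Lemma cIm_sum (I : Type) (r : seq I) (P : pred I) (F : I -> R[i]) :
  cIm (\sum_(i <- r | P i) F i) = \sum_(i <- r | P i) cIm (F i).
Proof. by elim/big_rec2: _ => // i y x _ <-; rewrite cImD. Qed.

Lemma mulJ_abs z : z * Num.conj z = (abs z ^+ 2)%:C.
Proof. by rewrite -normCK normE rmorphXn. Qed.

Lemma ge0_Re z : 0 <= z -> z = (cRe z)%:C /\ 0 <= cRe z.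
Proof. by case: z => a b; rewrite lecE /= => /andP[/eqP -> ?]. Qed.

(** In the partial order of [R[i]] a positive radius is a positive real, so balls of complex radius
    are balls for [abs], and limits in [R[i]] reduce to real ones. *)
Lemma cvg_absP (T : Type) (F : set_system T) (FF : Filter F)
    (f : T -> R[i]) (l : R[i]) :
  f x @[x --> F] --> l <-> abs (f x - l) @[x --> F] --> 0.
Proof.
split=> [/cvgrPdist_lt h|/cvgrPdist_lt h]; apply/cvgrPdist_lt.
  move=> e e0; have := h e%:C; rewrite ltcR => /(_ e0).
  apply: filterS => x; rewrite normE ltcR absBC sub0r normrN ger0_norm //.
  exact: abs_ge0.
case=> a b; rewrite ltcE /= => /andP[/eqP -> /h].
apply: filterS => x; rewrite normE ltcE /= eqxx /= absBC sub0r normrN.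
by rewrite ger0_norm // abs_ge0.
Qed.

Lemma cvg_ReImP (T : Type) (F : set_system T) (FF : Filter F)
    (f : T -> R[i]) (l : R[i]) :
  f x @[x --> F] --> l <->
  cRe (f x) @[x --> F] --> cRe l /\ cIm (f x) @[x --> F] --> cIm l.
Proof.
rewrite cvg_absP; split=> [/cvgrPdist_lt h|[/cvgrPdist_lt hr /cvgrPdist_lt hi]].
  split; apply/cvgrPdist_lt => e /h; apply: filterS => x;
    rewrite sub0r normrN ger0_norm ?abs_ge0//; apply: le_lt_trans.
  - by rewrite distrC -cReB ler_Re_abs.
  - by rewrite distrC -cImB ler_Im_abs.
apply/cvgrPdist_lt => e e0.
have e2 : 0 < e / 2 by rewrite divr_gt0.
apply: filterS2 (hr _ e2) (hi _ e2) => x h1 h2.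
rewrite sub0r normrN ger0_norm ?abs_ge0//.
rewrite (le_lt_trans (ler_abs_ReIm _))// (splitr e) cReB cImB.
by rewrite ltrD// distrC.
Qed.

Lemma cvg_Re (T : Type) (F : set_system T) (FF : Filter F)
    (f : T -> R[i]) (l : R[i]) :
  f x @[x --> F] --> l -> cRe (f x) @[x --> F] --> cRe l.
Proof. by move=> /cvg_ReImP[]. Qed.

Lemma cvg_Im (T : Type) (F : set_system T) (FF : Filter F)
    (f : T -> R[i]) (l : R[i]) :
  f x @[x --> F] --> l -> cIm (f x) @[x --> F] --> cIm l.
Proof. by move=> /cvg_ReImP[]. Qed.

Lemma cvg_real (T : Type) (F : set_system T) (FF : Filter F)
    (f : T -> R) (l : R) :
  f x @[x --> F] --> l -> (f x)%:C @[x --> F] --> l%:C.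
Proof. by move=> h; apply/cvg_ReImP; split => //=; exact: cvg_cst. Qed.

Lemma cvg_abs (T : Type) (F : set_system T) (FF : Filter F)
    (f : T -> R[i]) (l : R[i]) :
  f x @[x --> F] --> l -> abs (f x) @[x --> F] --> abs l.
Proof. by move=> h; apply: cvg_Re; apply: cvg_norm. Qed.

Lemma abs_squeeze (T : Type) (F : set_system T) (FF : Filter F)
    (f : T -> R[i]) (l : R[i]) (g : T -> R) :
  g x @[x --> F] --> 0 -> (\forall x \near F, abs (f x - l) <= g x) ->
  f x @[x --> F] --> l.
Proof.
move=> g0 fg; apply/cvg_absP; apply: squeeze_cvgr (cvg_cst 0) g0.
by apply: filterS fg => x ->; rewrite abs_ge0.
Qed.

Lemma cvg_cmul (T : Type) (F : set_system T) (FF : Filter F)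
    (f : T -> R[i]) (l c : R[i]) :
  f x @[x --> F] --> l -> c * f x @[x --> F] --> c * l.
Proof.
move=> /cvg_absP h; apply: (@abs_squeeze _ _ _ _ _ (fun x => abs c * abs (f x - l))).
  by rewrite -[0](mulr0 (abs c)); apply: cvgM h; exact: cvg_cst.
by apply: nearW => x; rewrite -mulrBr absM.
Qed.

Lemma cvg_csum (I T : Type) (F : set_system T) (FF : Filter F) (r : seq I)
    (f : I -> T -> R[i]) (l : I -> R[i]) :
  (forall i, f i x @[x --> F] --> l i) ->
  \sum_(i <- r) f i x @[x --> F] --> \sum_(i <- r) l i.
Proof.
move=> h; elim: r => [|i r IH].
  by rewrite big_nil; under eq_fun do rewrite big_nil; exact: cvg_cst.
by rewrite big_cons; under eq_fun do rewrite big_cons; apply: cvgD (h i) IH.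
Qed.

End ComplexModulus.

(** * Trace class operators on a Hilbert space *)

Section Hilbert.
Context {R : realType} {H : completeNormedModType R[i]}.
Variable dot : {dot H for @Num.conj R[i]}.
Hypothesis hH : hilbert dot.
Implicit Types (x y z : H) (a b c : R[i]).

Definition vnorm x : R := cRe `|x|.

Lemma normvE x : `|x| = (vnorm x)%:C.
Proof. by have [] := ge0_Re (normr_ge0 x). Qed.

Lemma vnorm_ge0 x : 0 <= vnorm x.
Proof. by have [] := ge0_Re (normr_ge0 x). Qed.

Lemma vnormD x y : vnorm (x + y) <= vnorm x + vnorm y.
Proof. by rewrite -lecR rmorphD /= -!normvE ler_normD. Qed.

Lemma vnormZ a x : vnorm (a *: x) = abs a * vnorm x.
Proof. by apply: complexI; rewrite rmorphM /= -normE -!normvE normrZ. Qed.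

Lemma vnormN x : vnorm (- x) = vnorm x.
Proof. by rewrite /vnorm normrN. Qed.

Lemma vnormB x y : vnorm (x - y) <= vnorm x + vnorm y.
Proof. by rewrite -(vnormN y) vnormD. Qed.

Lemma vnormBC x y : vnorm (x - y) = vnorm (y - x).
Proof. by rewrite -vnormN opprB. Qed.

Lemma vnorm0 : vnorm 0 = 0.
Proof. by rewrite /vnorm normr0. Qed.

Lemma vnorm_eq0 x : (vnorm x == 0) = (x == 0).
Proof. by rewrite -(inj_eq (@complexI R)) -normvE normr_eq0. Qed.

Lemma vnorm_sum (I : Type) (r : seq I) (P : pred I) (F : I -> H) :
  vnorm (\sum_(i <- r | P i) F i) <= \sum_(i <- r | P i) vnorm (F i).
Proof.
elim/big_rec2: _ => [|i y x _ h]; first by rewrite vnorm0.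
by rewrite (le_trans (vnormD _ _)) // lerD2l.
Qed.

Lemma cvg_vnormP (T : Type) (F : set_system T) (FF : Filter F)
    (f : T -> H) (l : H) :
  f t @[t --> F] --> l <-> vnorm (f t - l) @[t --> F] --> 0.
Proof.
split=> [/cvgrPdist_lt h|/cvgrPdist_lt h]; apply/cvgrPdist_lt.
  move=> e e0; have := h e%:C; rewrite ltcR => /(_ e0).
  apply: filterS => x; rewrite normvE ltcR vnormBC sub0r normrN ger0_norm //.
  exact: vnorm_ge0.
case=> a b; rewrite ltcE /= => /andP[/eqP -> /h].
apply: filterS => x; rewrite normvE ltcE /= eqxx /= vnormBC sub0r normrN.
by rewrite ger0_norm // vnorm_ge0.
Qed.

Lemma dotDl x y z : dot (x + y) z = dot x z + dot y z.
Proof. exact: linearDl. Qed.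
Lemma dotDr x y z : dot x (y + z) = dot x y + dot x z.
Proof. exact: linearDr. Qed.
Lemma dotNr x z : dot x (- z) = - dot x z.
Proof. exact: linearNr. Qed.
Lemma dotBl x y z : dot (x - y) z = dot x z - dot y z.
Proof. exact: linearBl. Qed.
Lemma dotBr x y z : dot x (y - z) = dot x y - dot x z.
Proof. exact: linearBr. Qed.
Lemma dotZl a x y : dot (a *: x) y = a * dot x y.
Proof. exact: linearZl_LR. Qed.
Lemma dotZr a x y : dot x (a *: y) = Num.conj a * dot x y.
Proof. exact: linearZr_LR. Qed.
Lemma dot0l y : dot 0 y = 0.
Proof. exact: linear0l. Qed.
Lemma dot0r y : dot y 0 = 0.
Proof. exact: linear0r. Qed.
Lemma dotC x y : dot x y = Num.conj (dot y x).
Proof. by rewrite hermC expr0 mul1r. Qed.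
Lemma dot_suml (I : Type) (r : seq I) (P : pred I) (F : I -> H) y :
  dot (\sum_(i <- r | P i) F i) y = \sum_(i <- r | P i) dot (F i) y.
Proof. exact: linear_sumlz. Qed.
Lemma dot_sumr (I : Type) (r : seq I) (P : pred I) (F : I -> H) y :
  dot y (\sum_(i <- r | P i) F i) = \sum_(i <- r | P i) dot y (F i).
Proof. exact: linear_sumr. Qed.

Lemma dotxx x : dot x x = (vnorm x ^+ 2)%:C.
Proof. by rewrite -hH normvE rmorphXn. Qed.

Lemma dot_eq x y : (forall z, dot x z = dot y z) -> x = y.
Proof.
move=> h; apply/eqP; rewrite -subr_eq0 -vnorm_eq0 -sqrf_eq0.
by rewrite -(inj_eq (@complexI R)) -dotxx dotBl h subrr.
Qed.

Lemma vnorm2 x : vnorm x ^+ 2 = cRe (dot x x).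
Proof. by rewrite dotxx. Qed.

Lemma vnorm2D x y :
  vnorm (x + y) ^+ 2 = vnorm x ^+ 2 + vnorm y ^+ 2 + 2 * cRe (dot x y).
Proof.
rewrite !vnorm2 dotDl !dotDr (dotC y x) !cReD cRe_conj; ring.
Qed.

Lemma vnorm2D0 x y : dot x y = 0 ->
  vnorm (x + y) ^+ 2 = vnorm x ^+ 2 + vnorm y ^+ 2.
Proof. by move=> h; rewrite vnorm2D h mulr0 addr0. Qed.

(** * Positive forms: symmetry and Cauchy-Schwarz *)

Section PositiveForm.
Variable B : H -> H.
Hypotheses (lB : linear B) (B0 : forall x, 0 <= dot (B x) x).

Let q x := cRe (dot (B x) x).

Let q0 x : 0 <= q x.
Proof. by have [] := ge0_Re (B0 x). Qed.

Let qE a b x y : (q (a *: x + b *: y))%:C =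
  a * Num.conj a * (q x)%:C + a * Num.conj b * dot (B x) y
  + b * Num.conj a * dot (B y) x + b * Num.conj b * (q y)%:C.
Proof.
have e z : dot (B z) z = (q z)%:C by have [] := ge0_Re (B0 z).
have BD u v : B (u + v) = B u + B v by rewrite -[u]scale1r lB !scale1r.
have BZ c u : B (c *: u) = c *: B u.
  have B00 : B 0 = 0 by have := lB (-1) 0 0; rewrite scaler0 add0r scaleN1r addNr.
  by rewrite -[c *: u]addr0 lB B00 addr0.
rewrite -!e BD !BZ !dotDl !dotDr !dotZl !dotZr; ring.
Qed.

(** Polarization: the form is real at x + y and at x + i y, and the vanishing of these two imaginary
    parts determines [dot (B y) x] from [dot (B x) y]. *)
Lemma positive_hermitian x y : dot (B y) x = Num.conj (dot (B x) y).
Proof.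
have k1 := congr1 cIm (qE 1 1 x y); have k2 := congr1 cIm (qE 1 'i%C x y).
move: k1 k2; case: (dot (B x) y) (dot (B y) x) => [c d] [e f].
rewrite -![Num.conj _]/(conjc _); simpc => /= k1 k2.
by apply: eq_ReIm => /=; lra.
Qed.

Lemma positive_cauchy_schwarz x y :
  abs (dot (B x) y) ^+ 2 <= cRe (dot (B x) x) * cRe (dot (B y) y).
Proof.
rewrite -/(q x) -/(q y); set w := dot (B x) y.
(* The form may be degenerate. If [q y] vanishes, [q] is affine in the real parameter t along x + t
   w y, with slope 2 |w|^2, and positivity for all t forces w = 0. *)
have [qy0|qy0] := eqVneq (q y) 0.
  rewrite qy0 mulr0.
  have k t : 0 <= q x + 2 * t * abs w ^+ 2.
    have := congr1 cRe (qE 1 (t%:C * w) x y).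
    rewrite qy0 (positive_hermitian x) -/w => /= e.
    suff -> : q x + 2 * t * abs w ^+ 2 = q (1 *: x + (t%:C * w) *: y) by [].
    rewrite e {e} abs_sqr; case: (w) => c d.
    rewrite -![Num.conj _]/(conjc _); simpc => /=; ring.
  rewrite leNgt; apply/negP => w0.
  have := k (- (q x + 1) / (abs w ^+ 2)); rewrite leNgt => /negP; apply.
  have -> : q x + 2 * (- (q x + 1) / abs w ^+ 2) * abs w ^+ 2 = - q x - 2.
    by field; rewrite -sqrf_eq0 gt_eqF.
  by have := q0 x; lra.
have : 0 <= q y * (q x * q y - abs w ^+ 2).
  suff -> : q y * (q x * q y - abs w ^+ 2) = q ((q y)%:C *: x + (- w) *: y) by [].
  have := congr1 cRe (qE (q y)%:C (- w) x y).
  rewrite (positive_hermitian x) -/w => /= ->.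
  rewrite abs_sqr; case: (w) => c d.
  rewrite -![Num.conj _]/(conjc _); simpc => /=; ring.
by rewrite pmulr_rge0 ?lt_def ?qy0 ?q0 // subr_ge0.
Qed.

End PositiveForm.

Lemma cauchy_schwarz x y : abs (dot x y) <= vnorm x * vnorm y.
Proof.
rewrite -(@ler_pXn2r _ 2) ?nnegrE ?abs_ge0 ?mulr_ge0 ?vnorm_ge0 // exprMn !vnorm2.
apply: (@positive_cauchy_schwarz id) => // z; exact: dnorm_ge0.
Qed.

Lemma dot_cvgl (T : Type) (F : set_system T) (FF : Filter F) (f : T -> H) l y :
  f t @[t --> F] --> l -> dot (f t) y @[t --> F] --> dot l y.
Proof.
move=> /cvg_vnormP h; apply: (@abs_squeeze _ _ _ _ _ _ (fun t => vnorm (f t - l) * vnorm y)).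
  by rewrite -[0](mul0r (vnorm y)); apply: cvgM h (cvg_cst _).
by apply: nearW => t; rewrite -dotBl cauchy_schwarz.
Qed.

Section Linear.
Variable A : H -> H.
Hypothesis lA : linear A.
Lemma linD x y : A (x + y) = A x + A y.
Proof. by rewrite -[x]scale1r lA !scale1r. Qed.
Lemma lin0 : A 0 = 0.
Proof. by have := lA (-1) 0 0; rewrite scaler0 add0r scaleN1r addNr. Qed.
Lemma linZ a x : A (a *: x) = a *: A x.
Proof. by rewrite -[a *: x]addr0 lA lin0 addr0. Qed.
Lemma linN x : A (- x) = - A x.
Proof. by rewrite -scaleN1r linZ scaleN1r. Qed.
Lemma linB x y : A (x - y) = A x - A y.
Proof. by rewrite linD linN. Qed.
Lemma lin_sum (I : Type) (r : seq I) (P : pred I) (F : I -> H) :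
  A (\sum_(i <- r | P i) F i) = \sum_(i <- r | P i) A (F i).
Proof. by elim/big_rec2: _ => [|i y x _ <-]; rewrite ?lin0 // linD. Qed.
End Linear.

Definition op_le (A : H -> H) (M : R) := forall x, vnorm (A x) <= M * vnorm x.

Lemma bounded_opP A : bounded_op A ->
  linear A /\ exists2 M, 0 <= M & op_le A M.
Proof.
move=> [lA cA]; split => //.
have /cvgrPdist_lt /(_ 1 ltr01) := cA 0.
move=> /nbhs_normP[e /= e0 he].
have [eE e0'] := ge0_Re (ltW e0).
have {}e0' : 0 < cRe e by rewrite -ltcR -eE.
exists (2 / cRe e); first by rewrite divr_ge0 // ltW.
move=> x; have [->|x0] := eqVneq x 0; first by rewrite lin0 // vnorm0 mulr0.
have vx0 : 0 < vnorm x by rewrite lt_def vnorm_ge0 vnorm_eq0 x0.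
(* Rescaled by [t], x has norm half of [cRe e], so it lies in the ball that continuity at 0 sends
   into the unit ball. *)
set t := cRe e / (2 * vnorm x).
have t0 : 0 < t by rewrite divr_gt0 // mulr_gt0.
have /he : ball_ Num.norm 0 e (t%:C *: x).
  rewrite /ball_ /= sub0r normrN normvE vnormZ absR (gtr0_norm t0) eE ltcR.
  rewrite /t invfM mulrA mulfVK ?gt_eqF //.
  by rewrite ltr_pdivrMr // mulr2n mulrDr mulr1 ltrDl.
rewrite /= (lin0 lA) sub0r normrN normvE ltcR (linZ lA) vnormZ absR gtr0_norm // => h.
rewrite /t in h.
have -> : 2 / cRe e * vnorm x = (cRe e / (2 * vnorm x))^-1.
  by field; rewrite !gt_eqF.
by rewrite -(ler_pM2l t0) divff ?gt_eqF // ltW.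
Qed.

End Hilbert.
Arguments vnorm {R H}.
Arguments op_le {R H}.

(** * Bessel's inequality, Fourier expansions and nuclear operators *)

Section Nuclear.
Context {R : realType} {H : completeNormedModType R[i]}.
Variable dot : {dot H for @Num.conj R[i]}.
Hypothesis hH : hilbert dot.
Implicit Types (x y z : H) (A B X Y T : H -> H) (phi : H -> R[i]).

Lemma sum_cauchy_schwarz (f g : nat -> R) (s t : R) K : 0 <= s -> 0 <= t ->
  \sum_(0 <= k < K) f k ^+ 2 <= s ^+ 2 -> \sum_(0 <= k < K) g k ^+ 2 <= t ^+ 2 ->
  \sum_(0 <= k < K) f k * g k <= s * t.
Proof.
have key (s' t' : R) : 0 < s' -> 0 < t' ->
    \sum_(0 <= k < K) f k ^+ 2 <= s' ^+ 2 -> \sum_(0 <= k < K) g k ^+ 2 <= t' ^+ 2 ->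
    \sum_(0 <= k < K) f k * g k <= s' * t'.
  move=> s0 t0 fs gt.
  have : \sum_(0 <= k < K) f k * g k <=
      \sum_(0 <= k < K) (t' / s' * f k ^+ 2 + s' / t' * g k ^+ 2) / 2.
    apply: ler_sum => k _; rewrite ler_pdivlMr // -subr_ge0.
    have -> : t' / s' * f k ^+ 2 + s' / t' * g k ^+ 2 - f k * g k * 2 =
        (t' * f k - s' * g k) ^+ 2 / (s' * t') by field; rewrite !gt_eqF.
    by rewrite divr_ge0 ?sqr_ge0 // mulr_ge0 // ltW.
  rewrite -mulr_suml big_split /= -!mulr_sumr => /le_trans; apply.
  rewrite ler_pdivrMr //.
  have -> : s' * t' * 2 = t' / s' * s' ^+ 2 + s' / t' * t' ^+ 2.
    by field; rewrite !gt_eqF.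
  by rewrite lerD // ler_wpM2l // divr_ge0 // ltW.
move=> s0 t0 fs gt; apply/ler_addgt0Pr => eps eps0.
set D := s + t + 1.
have D0 : 0 < D by rewrite ltr_wpDl // addr_ge0.
(* (s + h) (t + h) exceeds s t by h (s + t) + h^2, which is at most h D because h <= 1, hence at
   most [eps]. The enlargement makes both bounds positive, as [key] requires. *)
set h := Num.min 1 (eps / D).
have h0 : 0 < h by rewrite lt_min ltr01 divr_gt0.
have hl1 : h <= 1 by rewrite ge_min lexx.
have hl2 : h * D <= eps by rewrite -ler_pdivlMr // ge_min lexx orbT.
have mono (u : R) : 0 <= u -> u ^+ 2 <= (u + h) ^+ 2.
  by move=> u0; rewrite ler_pXn2r ?nnegrE ?lerDl ?addr_ge0 // ltW.
have := key (s + h) (t + h); rewrite !ltr_wpDl //.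
move=> /(_ isT isT (le_trans fs (mono _ s0)) (le_trans gt (mono _ t0))).
move=> /le_trans; apply; rewrite /D in hl2.
have : h * h <= h by rewrite ger_pMl.
by move=> ?; nra.
Qed.

Lemma abs_series_cvg (u : R[i]^nat) (a : R^nat) : (forall n, abs (u n) <= a n) ->
  cvgn (series a) -> exists l : R[i], series u @ \oo --> l.
Proof.
move=> ua ca.
have c (v : R^nat) : (forall n, `|v n| <= a n) -> cvgn (series v).
  move=> va; apply: normed_cvg; apply: (@series_le_cvg _ _ a) => // n.
    by rewrite /= normr_ge0.
  by rewrite (le_trans _ (ua n)) ?abs_ge0.
have cr : cvgn (series (fun n => cRe (u n))).
  by apply: c => n; rewrite (le_trans (ler_Re_abs _)).
have ci : cvgn (series (fun n => cIm (u n))).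
  by apply: c => n; rewrite (le_trans (ler_Im_abs _)).
exists (limn (series (fun n => cRe (u n))) +i* limn (series (fun n => cIm (u n)))).
apply/cvg_ReImP; split.
- by under eq_fun do rewrite /series /= cRe_sum.
- by under eq_fun do rewrite /series /= cIm_sum.
Qed.

Section OrthonormalBasis.
Variable e : nat -> H.
Hypothesis he : orthonormal_basis dot e.

Definition fourier_sum x (K : nat) : H := \sum_(0 <= k < K) dot x (e k) *: e k.

Lemma dot_fourier_sum x K j : (j < K)%N -> dot (fourier_sum x K) (e j) = dot x (e j).
Proof.
move=> jK; rewrite /fourier_sum big_mkord dot_suml (bigD1 (Ordinal jK)) //=.
rewrite big1 ?addr0 => [|i ij].
  rewrite dotZl; case: he => _ h1 _; case: (h1 j) => [-> | ->]; last by rewrite mulr1.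
  by rewrite !dot0r mulr0.
rewrite dotZl; case: he => h0 _ _; rewrite h0 ?mulr0 // => ij'.
by move/eqP: ij; apply; apply/val_inj.
Qed.

Lemma dot_fourier_sum2 x K y : dot (fourier_sum x K) y =
  \sum_(0 <= k < K) dot x (e k) * dot (e k) y.
Proof. by rewrite dot_suml; apply: eq_bigr => i _; rewrite dotZl. Qed.

Lemma vnorm_fourier_sum x K :
  vnorm (fourier_sum x K) ^+ 2 = \sum_(0 <= k < K) abs (dot x (e k)) ^+ 2.
Proof.
rewrite (vnorm2 hH) dot_fourier_sum2 cRe_sum big_nat [RHS]big_nat.
apply: eq_bigr => k /andP[_ kK].
by rewrite (dotC dot (e k)) dot_fourier_sum // mulJ_abs.
Qed.

Lemma bessel x K : \sum_(0 <= k < K) abs (dot x (e k)) ^+ 2 <= vnorm x ^+ 2.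
Proof.
rewrite -vnorm_fourier_sum; set s := fourier_sum x K.
have : dot (x - s) s = 0.
  rewrite /s {2}/fourier_sum dot_sumr big_nat big1 // => k /andP[_ kK].
  by rewrite dotZr dotBl dot_fourier_sum // subrr mulr0.
move=> /(vnorm2D0 hH); rewrite subrK => ->.
by rewrite lerDr sqr_ge0.
Qed.

(** Bessel makes the sums Cauchy, so they converge; the limit minus x is orthogonal to every [e j],
    and the last clause of [orthonormal_basis] makes it vanish. *)
Lemma fourier_sum_cvg x : fourier_sum x K @[K --> \oo] --> x.
Proof.
have cs : cvgn (series (fun k => abs (dot x (e k)) ^+ 2)).
  apply: nondecreasing_is_cvgn.
    by apply: nondecreasing_series => n _ _; rewrite sqr_ge0.
  by exists (vnorm x ^+ 2) => _ [n _ <-]; apply: bessel.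
have cf : cvgn (fourier_sum x).
  apply: cauchy_cvg; apply/cauchy_seriesP => eps eps0.
  have [epsE eps0'] := ge0_Re (ltW eps0).
  have {}eps0' : 0 < cRe eps by rewrite -ltcR -epsE.
  have /cauchy_cvgP/cauchy_seriesP /(_ (cRe eps ^+ 2)) := cs.
  rewrite exprn_gt0 // => /(_ isT); apply: filterS => -[m n] /=.
  rewrite normvE epsE ltcR => h.
  rewrite -(@ltr_pXn2r _ 2) ?nnegrE ?vnorm_ge0 ?ltW //; apply: le_lt_trans h.
  rewrite ger0_norm ?sumr_ge0 // => [|i _]; last by rewrite sqr_ge0.
  have [nm|mn] := leqP n m; first by rewrite !big_geq // vnorm0 expr0n.
  have -> : \sum_(m <= k < n) dot x (e k) *: e k =
      fourier_sum x n - fourier_sum x m.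
    by rewrite /fourier_sum (big_cat_nat (leq0n m) (ltnW mn)) /= addrAC subrr add0r.
  rewrite -(@lerD2l _ (vnorm (fourier_sum x m) ^+ 2)) -(vnorm2D0 hH).
    rewrite addrC subrK !vnorm_fourier_sum.
    by rewrite (big_cat_nat (leq0n m) (ltnW mn)).
  rewrite dotC (_ : dot _ _ = 0) ?rmorph0 //.
  rewrite {3}/fourier_sum dot_sumr big_nat big1 // => k /andP[_ km].
  rewrite dotZr dotBl !dot_fourier_sum ?subrr ?mulr0 //.
  exact: ltn_trans mn.
suff E : limn (fourier_sum x) = x by move: cf; rewrite E.
apply/eqP; rewrite -subr_eq0; apply/eqP; case: he => _ _; apply => j.
rewrite dotBl; apply/eqP; rewrite subr_eq0; apply/eqP.
have h := @dot_cvgl _ _ _ hH _ _ eventually_filter _ _ (e j) cf.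
apply: (norm_cvg_unique h).
apply: cvg_near_cst; exists j.+1 => // K /= jK; exact: dot_fourier_sum.
Qed.

(** The functional is tested on the combination v of the [e k] whose coefficients are the conjugates
    of the [phi (e k)]: then [phi v] is the sum s, and |v|^2 <= s, with a possible loss from the
    zero terms of [e]. *)
Lemma functional_bessel phi (a : R) K : 0 <= a -> scalar phi ->
  (forall x, abs (phi x) <= a * vnorm x) ->
  \sum_(0 <= k < K) abs (phi (e k)) ^+ 2 <= a ^+ 2.
Proof.
move=> a0 lphi hphi; set s := \sum_(_ <= _ < _) _.
have s0 : 0 <= s by rewrite sumr_ge0 // => i _; rewrite sqr_ge0.
pose v := \sum_(0 <= k < K) Num.conj (phi (e k)) *: e k.
have phiD u w : phi (u + w) = phi u + phi w.
  by rewrite -[u]scale1r lphi mul1r scale1r.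
have phi0 : phi 0 = 0 by have := phiD 0 0; rewrite addr0 => /esym/eqP; rewrite -subr_eq0 addrK => /eqP.
have phiZ c w : phi (c *: w) = c * phi w by rewrite -[c *: w]addr0 lphi phi0 addr0.
have phiv : phi v = s%:C.
  rewrite /v /s rmorph_sum /=; elim/big_rec2: _ => // i y w _ <-.
  by rewrite phiD phiZ mulrC mulJ_abs.
have vs : vnorm v ^+ 2 <= s.
  have [K0|K0] := eqVneq K 0%N; first by rewrite /v /s K0 !big_nil vnorm0 expr0n.
  have dv j : (j < K)%N -> dot v (e j) = Num.conj (phi (e j)) * dot (e j) (e j).
    move=> jK; rewrite /v big_mkord dot_suml (bigD1 (Ordinal jK)) //= big1 ?addr0 ?dotZl //.
    move=> i ij; rewrite dotZl; case: he => h0 _ _; rewrite h0 ?mulr0 // => ij'.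
    by move/eqP: ij; apply; apply/val_inj.
  rewrite (vnorm2 hH) {2}/v dot_sumr cRe_sum /s big_nat [leRHS]big_nat.
  apply: ler_sum => k /andP[_ kK]; rewrite dotZr dv // conjCK mulrA mulJ_abs.
  rewrite cReZ; case: he => _ h1 _; case: (h1 k) => [->| ->] /=.
    by rewrite dot0l mulr0 sqr_ge0.
  by rewrite mulr1.
have h : s <= a * vnorm v by have := hphi v; rewrite phiv absR ger0_norm.
have [->|sn0] := eqVneq s 0; first by rewrite sqr_ge0.
have sgt0 : 0 < s by rewrite lt_def sn0.
have : s ^+ 2 <= a ^+ 2 * s.
  rewrite (le_trans (y := (a * vnorm v) ^+ 2)) //.
    by rewrite ler_pXn2r ?nnegrE ?mulr_ge0 ?vnorm_ge0.
  by rewrite exprMn ler_wpM2l ?sqr_ge0.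
by rewrite expr2 ler_pM2r.
Qed.

Lemma functional_fourier_cvg phi (a : R) x : scalar phi ->
  (forall x, abs (phi x) <= a * vnorm x) ->
  series (fun k => phi (e k) * dot x (e k)) @ \oo --> phi x.
Proof.
move=> lphi hphi.
have phiD u w : phi (u + w) = phi u + phi w.
  by rewrite -[u]scale1r lphi mul1r scale1r.
have phi0 : phi 0 = 0 by have := phiD 0 0; rewrite addr0 => /esym/eqP; rewrite -subr_eq0 addrK => /eqP.
have phiZ c w : phi (c *: w) = c * phi w by rewrite -[c *: w]addr0 lphi phi0 addr0.
have phiN w : phi (- w) = - phi w by rewrite -scaleN1r phiZ mulN1r.
have E K : series (fun k => phi (e k) * dot x (e k)) K = phi (fourier_sum x K).
  rewrite /series /fourier_sum /=; elim/big_rec2: _ => // i y w _ ->.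
  by rewrite phiD phiZ mulrC.
apply: (@abs_squeeze _ _ _ _ _ _ (fun K => a * vnorm (fourier_sum x K - x))).
  rewrite -[0](mulr0 a); apply: cvgM; first exact: cvg_cst.
  by apply/cvg_vnormP; exact: fourier_sum_cvg.
by apply: nearW => K; rewrite -[X in abs (X - _)]/(series _ K) E -phiN -phiD.
Qed.

End OrthonormalBasis.

(* [A] is the sum of the rank one operators [x |-> phi n x *: d n], with
   absolute sum of norms at most [S] and trace [t]. *)
Definition nuclear A (t : R[i]) (S : R) : Prop :=
  exists (phi : nat -> H -> R[i]) (d : nat -> H) (a b : nat -> R),
  [/\ forall n, scalar (phi n),
      forall n x, abs (phi n x) <= a n * vnorm x,
      forall n, vnorm (d n) <= b n & [/\ forall n, 0 <= a n,
      cvgn (series (fun n => a n * b n)),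
      forall N, series (fun n => a n * b n) N <= S,
      forall x, series (fun n => phi n x *: d n) @ \oo --> A x &
      series (fun n => phi n (d n)) @ \oo --> t]].

(** By Cauchy-Schwarz and Bessel the n-th rank one term contributes at most [a n * b n] to the
    diagonal sum up to K, for every K at once, and its contribution tends to [phi n (d n)].
    Summation over n and the limit in K can thus be exchanged, and the result does not depend on the
    basis. *)
Lemma nuclear_trace A t S e : nuclear A t S -> orthonormal_basis dot e ->
  series (fun k => dot (A (e k)) (e k)) @ \oo --> t /\
  forall K, abs (series (fun k => dot (A (e k)) (e k)) K) <= S.
Proof.
move=> [phi [d [a [b [lphi hphi hd [a0 cab hS hA ht]]]]]] he.
have b0 n : 0 <= b n by apply: le_trans (hd n); rewrite vnorm_ge0.
pose u n K := series (fun k => phi n (e k) * dot (d n) (e k)) K.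
have u_le n K : abs (u n K) <= a n * b n.
  have h1 := functional_bessel he K (a0 n) (lphi n) (hphi n).
  have h2 := bessel he (d n) K.
  rewrite (le_trans (abs_sum _ _ _)) //.
  under eq_bigr do rewrite absM.
  apply: sum_cauchy_schwarz => //.
  by rewrite (le_trans h2) // ler_pXn2r ?nnegrE ?vnorm_ge0.
have u_cvg n : u n K @[K --> \oo] --> phi n (d n).
  exact: (functional_fourier_cvg he (lphi n) (hphi n)).
have hT K : series (fun n => u n K) @ \oo --> series (fun k => dot (A (e k)) (e k)) K.
  rewrite /series /=.
  rewrite (_ : (fun N => _) = fun N => \sum_(0 <= k < K) \sum_(0 <= n < N) phi n (e k) * dot (d n) (e k)); last first.
    by apply/funext => N; rewrite exchange_big.
  apply: cvg_csum => k.
  rewrite (_ : (fun N => _) = fun N => dot (series (fun n => phi n (e k) *: d n) N) (e k)); last first.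
    by apply/funext => N; rewrite dot_suml; apply: eq_bigr => n _; rewrite dotZl.
  by apply: (dot_cvgl hH); exact: hA.
have tail N K M : (N <= M)%N -> abs (series (fun n => u n K) M - series (fun n => u n K) N) <=
   series (fun n => a n * b n) M - series (fun n => a n * b n) N.
  move=> NM; rewrite !sub_series_geq // (le_trans (abs_sum _ _ _)) //.
  by apply: ler_sum => n _.
have nd : nondecreasing_seq (series (fun n => a n * b n)).
  by apply: nondecreasing_series => n _ _; rewrite mulr_ge0.
set L := limn (series (fun n => a n * b n)).
(* Cutting the sum over n at N costs at most the tail of the series of [a n * b n], uniformly in K;
   [tail3] is the same for the limits, and the convergence is a three-term estimate. *)
have tail2 N K : abs (series (fun k => dot (A (e k)) (e k)) K - series (fun n => u n K) N) <=
   L - series (fun n => a n * b n) N.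
  have c : abs (series (fun n => u n K) M - series (fun n => u n K) N) @[M --> \oo] -->
      abs (series (fun k => dot (A (e k)) (e k)) K - series (fun n => u n K) N).
    by apply: cvg_abs; apply: cvgB (hT K) (cvg_cst _).
  apply: (cvgr_to_le c); exists N => // M /= NM.
  rewrite (le_trans (tail _ _ _ NM)) // lerD2r.
  exact: nondecreasing_cvgn_le.
have tail3 N : abs (t - series (fun n => phi n (d n)) N) <= L - series (fun n => a n * b n) N.
  have c : abs (series (fun n => phi n (d n)) M - series (fun n => phi n (d n)) N) @[M --> \oo] -->
      abs (t - series (fun n => phi n (d n)) N).
    by apply: cvg_abs; apply: cvgB ht (cvg_cst _).
  apply: (cvgr_to_le c); exists N => // M /= NM.
  rewrite !sub_series_geq // (le_trans (abs_sum _ _ _)) //.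
  rewrite (le_trans (y := series (fun n => a n * b n) M - series (fun n => a n * b n) N)) //.
    rewrite !sub_series_geq //; apply: ler_sum => n _.
    rewrite (le_trans (hphi _ _)) // ler_wpM2l //.
  by rewrite lerD2r; exact: nondecreasing_cvgn_le.
split.
  apply/cvg_absP/cvgrPdist_le => eps eps0.
  have e3 : 0 < eps / 3 by rewrite divr_gt0.
  have [N _ hN] : \forall N \near \oo, L - series (fun n => a n * b n) N <= eps / 3.
    move/cvgrPdist_le : cab => /(_ _ e3); apply: filterS => N.
    by apply: le_trans; rewrite ler_norm.
  have {}hN := hN N (leqnn N).
  have : series (fun n => u n K) N @[K --> \oo] --> series (fun n => phi n (d n)) N.
    by apply: cvg_csum => n; exact: u_cvg.
  move=> /cvg_absP/cvgrPdist_le /(_ _ e3); apply: filterS => K.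
  rewrite !sub0r !normrN !ger0_norm ?abs_ge0 // => hK.
  have -> : series (fun k => dot (A (e k)) (e k)) K - t =
    (series (fun k => dot (A (e k)) (e k)) K - series (fun n => u n K) N)
    + (series (fun n => u n K) N - series (fun n => phi n (d n)) N)
    - (t - series (fun n => phi n (d n)) N) by ring.
  rewrite (le_trans (absB _ _)) //.
  have h1 := tail2 N K; have h3 := tail3 N.
  rewrite (le_trans (lerD (absD _ _) (lexx _))) //.
  by lra.
move=> K; have := tail2 0%N K.
have -> : series (u^~ K) 0%N = 0 by rewrite /series /= big_geq.
have -> : series (fun n => a n * b n) 0%N = 0 by rewrite /series /= big_geq.
rewrite !subr0.
move/le_trans; apply; apply: limr_le => //; exact: nearW.
Qed.

End Nuclear.

Section TraceClass.
Context {R : realType} {H : completeNormedModType R[i]}.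
Variable dot : {dot H for @Num.conj R[i]}.
Hypothesis hH : hilbert dot.
Implicit Types (x y z : H) (A B X Y T : H -> H) (phi : H -> R[i]).

Lemma parseval e x : orthonormal_basis dot e ->
  series (fun k => abs (dot x (e k)) ^+ 2) @ \oo --> vnorm x ^+ 2.
Proof.
move=> he; rewrite (_ : series _ = fun K => cRe (dot (fourier_sum dot e x K) x)).
  rewrite (vnorm2 hH); apply: cvg_Re; apply: (dot_cvgl hH).
  exact: (fourier_sum_cvg hH).
apply/funext => K; rewrite /series /= dot_fourier_sum2 cRe_sum.
by apply: eq_bigr => k _; rewrite (dotC dot (e k)) mulJ_abs.
Qed.

(** * A nuclear decomposition by orthonormalization for the form of the absolute value *)

Section GramSchmidt.
Variables (B : H -> H) (e : nat -> H).
Hypotheses (lB : linear B) (B0 : forall x, 0 <= dot (B x) x).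

(** When the seminorm of g vanishes, the factor is the inverse of 0, that is 0: degenerate vectors
    are dropped instead of being normalized. *)
Definition gs_scale g : H := ((Num.sqrt (cRe (dot (B g) g)))^-1)%:C *: g.

(* Gram-Schmidt for the semi-inner product [dot (B x) y]: [gs_rest n x] is what
   is left of [x] after projecting out the first [n] basis vectors. *)
Fixpoint gs_rest n x : H :=
  if n is m.+1 then
    gs_rest m x - dot (B x) (gs_scale (gs_rest m (e m))) *: gs_scale (gs_rest m (e m))
  else x.

Let f n := gs_scale (gs_rest n (e n)).

Let qE x : dot (B x) x = (cRe (dot (B x) x))%:C.
Proof. by have [] := ge0_Re (B0 x). Qed.

Let q0 x : 0 <= cRe (dot (B x) x).
Proof. by have [] := ge0_Re (B0 x). Qed.

Let herm x y : dot (B x) y = dot x (B y).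
Proof. by rewrite (positive_hermitian lB B0) -dotC. Qed.

Lemma positive_null x : cRe (dot (B x) x) = 0 -> B x = 0.
Proof.
move=> h; apply: (dot_eq hH) => y; rewrite dot0l.
have := positive_cauchy_schwarz lB B0 x y; rewrite h mul0r => h'.
by apply/eqP; rewrite -abs_eq0 -sqrf_eq0 eq_le h' sqr_ge0.
Qed.

Let f_norm n : f n = 0 \/ dot (B (f n)) (f n) = 1.
Proof.
rewrite /f /gs_scale; set g := gs_rest _ _.
have [->|n0] := eqVneq (cRe (dot (B g) g)) 0.
  by left; rewrite sqrtr0 invr0 scale0r.
right; rewrite (linZ lB) dotZl dotZr mulrA mulJ_abs qE absR -rmorphM /=.
rewrite real_normK ?num_real // exprVn sqr_sqrtr ?q0 // mulVf //.
Qed.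

Let gsE n x : gs_rest n x = x - \sum_(0 <= i < n) dot (B x) (f i) *: f i.
Proof.
elim: n => [|n IH] /=; first by rewrite big_geq // subr0.
by rewrite IH big_nat_recr //= opprD addrA.
Qed.

Let gs_orth n x j : (j < n)%N -> dot (B (gs_rest n x)) (f j) = 0.
Proof.
elim: n x j => [//|n IH] x j; rewrite ltnS leq_eqVlt => /orP[/eqP->|jn] /=; last first.
  rewrite -/(f n) (linB lB) (linZ lB) dotBl dotZl IH // /f /gs_scale (linZ lB).
  by rewrite dotZl -/(f j) IH // !mulr0 subr0.
rewrite -/(f n) (linB lB) (linZ lB) dotBl dotZl.
have -> : dot (B (gs_rest n x)) (f n) = dot (B x) (f n).
  rewrite gsE (linB lB) dotBl (lin_sum lB) dot_suml big_nat big1 ?subr0 // => i /andP[_ ni].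
  rewrite (linZ lB) dotZl (positive_hermitian lB B0 (f n) (f i)).
  have -> : dot (B (f n)) (f i) = 0 by rewrite {1}/f /gs_scale (linZ lB) dotZl IH // mulr0.
  by rewrite rmorph0 mulr0.
by case: (f_norm n) => ->; rewrite ?dot0r ?mulr0 ?mulr1 subrr.
Qed.

Let f_orth i n : (i < n)%N -> dot (B (f i)) (f n) = 0.
Proof.
move=> ni; rewrite (positive_hermitian lB B0) {1}/f {1}/gs_scale (linZ lB).
by rewrite dotZl gs_orth // mulr0 rmorph0.
Qed.

Let gs_dot n x : dot (B (gs_rest n x)) (f n) = dot (B x) (f n).
Proof.
rewrite gsE (linB lB) dotBl (lin_sum lB) dot_suml big_nat big1 ?subr0 // => i /andP[_ ni].
by rewrite (linZ lB) dotZl f_orth // mulr0.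
Qed.

(** At step j the rest of [e j] either has seminorm 0, so that B kills it already, or is a multiple
    of [f j] and is subtracted entirely; later steps change nothing. *)
Let gs_kill n j : (j < n)%N -> B (gs_rest n (e j)) = 0.
Proof.
elim: n j => [//|n IH] j; rewrite ltnS leq_eqVlt => /orP[/eqP->|jn] /=; last first.
  by rewrite -/(f n) -gs_dot (linB lB) (linZ lB) !IH // dot0l scale0r subr0.
rewrite -/(f n) -gs_dot; set g := gs_rest _ _.
have [g0|n0] := eqVneq (cRe (dot (B g) g)) 0.
  by rewrite (linB lB) (linZ lB) (positive_null g0) dot0l scale0r subr0.
rewrite {2}/f /gs_scale -/g dotZr scalerA.
have -> : Num.conj ((Num.sqrt (cRe (dot (B g) g)))^-1)%:C = ((Num.sqrt (cRe (dot (B g) g)))^-1)%:C.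
  by apply: eq_ReIm; rewrite ?cRe_conj ?cIm_conj //= oppr0.
rewrite -/g mulrAC -expr2 {2}qE -rmorphXn -rmorphM /= exprVn sqr_sqrtr ?q0 // mulVf //.
by rewrite scale1r subrr (lin0 lB).
Qed.

Let gs_bessel N x :
  \sum_(0 <= i < N) abs (dot (B x) (f i)) ^+ 2 <= cRe (dot (B x) x).
Proof.
have e1 : dot (B (gs_rest N x)) (gs_rest N x) = dot (B (gs_rest N x)) x.
  rewrite {2}gsE dotBr dot_sumr big_nat big1 ?subr0 // => i /andP[_ iN].
  by rewrite dotZr gs_orth // mulr0.
have := q0 (gs_rest N x); rewrite e1 {1}gsE (linB lB) dotBl (lin_sum lB) dot_suml.
rewrite cReB subr_ge0 cRe_sum; apply: le_trans; apply: ler_sum => i _.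
by rewrite (linZ lB) dotZl (positive_hermitian lB B0 x) mulJ_abs.
Qed.

(** No eigenvectors are used: with [f] orthonormal for the form <B x, y>, the operator A is the sum
    of the maps x |-> <x, B f_n> A f_n, whose norms are at most |B f_n|^2 because A and B have equal
    norms on every vector. *)
Lemma absolute_value_nuclear A : linear A ->
  (exists2 M, 0 <= M & op_le A M) -> (exists2 M, 0 <= M & op_le B M) ->
  (forall x, vnorm (A x) = vnorm (B x)) -> orthonormal_basis dot e ->
  cvgn (series (fun n => dot (B (e n)) (e n))) ->
  exists t S, nuclear A t S.
Proof.
move=> lA [MA MA0 hMA] [M M0 hM] AB he cB.
pose c n := vnorm (B (f n)).
have c0 n : 0 <= c n by exact: vnorm_ge0.
have cq : cvgn (series (fun n => cRe (dot (B (e n)) (e n)))).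
  apply/cvg_ex; exists (cRe (limn (series (fun n => dot (B (e n)) (e n))))).
  rewrite (_ : series _ = fun N => cRe (series (fun n => dot (B (e n)) (e n)) N)).
    exact: cvg_Re.
  by apply/funext => N; rewrite /series /= cRe_sum.
set L := limn (series (fun n => cRe (dot (B (e n)) (e n)))) in cq.
(* Expanding |B f_n|^2 in the basis [e] and exchanging the sums leaves, for each k, the sum over n
   of |<B e_k, f_n>|^2, which [gs_bessel] bounds by <B e_k, e_k>. *)
have cL N : series (fun n => c n * c n) N <= L.
  have h : (\sum_(0 <= n < N) series (fun k => abs (dot (B (f n)) (e k)) ^+ 2) K) @[K --> \oo] -->
      \sum_(0 <= n < N) vnorm (B (f n)) ^+ 2.
    elim: N => [|N IH].
      by rewrite big_geq //; under eq_fun do rewrite big_geq //; exact: cvg_cst.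
    rewrite big_nat_recr //=; under eq_fun do rewrite big_nat_recr //=.
    by apply: cvgD; [exact: IH | exact: parseval].
  have -> : series (fun n => c n * c n) N = \sum_(0 <= n < N) vnorm (B (f n)) ^+ 2.
    by apply: eq_bigr => n _; rewrite expr2.
  apply: (cvgr_to_le h); apply: nearW => K; rewrite exchange_big /=.
  rewrite (le_trans (y := series (fun n => cRe (dot (B (e n)) (e n))) K)) //.
    apply: ler_sum => k _; rewrite (le_trans _ (gs_bessel N (e k))) //.
    by apply: ler_sum => n _; rewrite (dotC dot (B (f n))) absJ -herm.
  apply: nondecreasing_cvgn_le cq _.
  by apply: nondecreasing_series => n _ _; exact: q0.
have ccv : cvgn (series (fun n => c n * c n)).
  apply: nondecreasing_is_cvgn.
    by apply: nondecreasing_series => n _ _; rewrite mulr_ge0.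
  by exists L => _ [n _ <-]; apply: cL.
pose phi n x := dot x (B (f n)).
have hphi n x : abs (phi n x) <= c n * vnorm x.
  by rewrite mulrC; exact: (cauchy_schwarz hH).
have [t ht] : exists t : R[i], series (fun n => phi n (A (f n))) @ \oo --> t.
  apply: abs_series_cvg ccv => n; rewrite (le_trans (hphi _ _)) //.
  by rewrite AB.
have L0 : 0 <= L by have := cL 0%N; rewrite /series /= big_geq.
have Gle x N : vnorm (series (fun n => phi n x *: A (f n)) N) <= L * vnorm x.
  rewrite (le_trans (vnorm_sum _ _ _)) //.
  rewrite (le_trans _ (ler_wpM2r (vnorm_ge0 x) (cL N))) //.
  rewrite /series /= mulr_suml; apply: ler_sum => n _.
  by rewrite vnormZ AB -/(c n) mulrAC ler_wpM2r // hphi.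
(* The partial sums are exact on [e j] once N > j: the defect is A applied to [gs_rest N (e j)], and
   [gs_kill] with the equality of norms makes it 0. The uniform bound [Gle] then extends convergence
   from the span of [e] to every x. *)
have Ge j N : (j < N)%N -> series (fun n => phi n (e j) *: A (f n)) N = A (e j).
  move=> jN; apply/esym/eqP; rewrite -subr_eq0.
  rewrite (_ : _ - _ = A (gs_rest N (e j))).
    by rewrite -vnorm_eq0 AB gs_kill // vnorm0.
  rewrite gsE (linB lA) (lin_sum lA); congr (_ - _).
  by apply: eq_bigr => n _; rewrite [RHS](linZ lA) herm.
pose G N x := series (fun n => phi n x *: A (f n)) N.
have GD N x y : G N (x + y) = G N x + G N y.
  rewrite /G /series /= -big_split /=; apply: eq_bigr => n _.
  by rewrite /phi dotDl scalerDl.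
have GZ N a x : G N (a *: x) = a *: G N x.
  rewrite /G /series /= scaler_sumr; apply: eq_bigr => n _.
  by rewrite /phi dotZl scalerA.
have Gs x K N : (K <= N)%N -> G N (fourier_sum dot e x K) = A (fourier_sum dot e x K).
  move=> KN; rewrite /fourier_sum.
  rewrite (lin_sum lA) (_ : G N _ = \sum_(0 <= k < K) G N (dot x (e k) *: e k)).
    rewrite big_nat [RHS]big_nat; apply: eq_bigr => k /andP[_ kK].
    by rewrite GZ (linZ lA) /G Ge //; apply: leq_trans KN.
  elim/big_rec2: _ => [|i y w _ <-]; last by rewrite GD.
  by have := GZ N 0 0; rewrite !scale0r.
exists t, L, phi, (fun n => A (f n)), c, c; split => //.
- by move=> n a x y; rewrite /phi dotDl dotZl.
- by move=> n; rewrite AB.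
split => // x; apply/cvg_vnormP/cvgrPdist_le => eps eps0.
have D0 : 0 < 2 * (L + MA + 1) by rewrite mulr_gt0 // ltr_wpDl // addr_ge0.
have /cvg_vnormP/cvgrPdist_le /(_ (eps / (2 * (L + MA + 1)))) := @fourier_sum_cvg _ _ _ hH _ he x.
rewrite divr_gt0 // => /(_ isT)[K _ /(_ K (leqnn K))] /=.
rewrite sub0r normrN ger0_norm ?vnorm_ge0 // => hK.
exists K => // N /= KN; rewrite sub0r normrN ger0_norm ?vnorm_ge0 //.
rewrite -/(G N x); set s := fourier_sum dot e x K.
have -> : G N x - A x = - G N (s - x) + A (s - x).
  rewrite (linB lA) -(Gs x K N) // -/s GD -[- x]scaleN1r GZ scaleN1r opprD opprK.
  by rewrite addrACA addNr add0r.
rewrite (le_trans (vnormD _ _)) // vnormN.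
rewrite (le_trans (lerD (Gle _ _) (hMA _))) // -mulrDl.
rewrite (le_trans (ler_wpM2l (addr_ge0 L0 MA0) hK)) //.
rewrite mulrA ler_pdivrMr // mulrC ler_pM2l //.
by have := L0; have := MA0; lra.
Qed.

End GramSchmidt.

Lemma trace_class_nuclear A : trace_class dot A -> exists t S, nuclear A t S.
Proof.
move=> [bA [B [[bB B0 hB] [e [he cB]]]]].
have [lA hA] := bounded_opP bA; have [lB hB'] := bounded_opP bB.
apply: (@absolute_value_nuclear B e lB B0 A lA hA hB') => // x.
have := hB x x; rewrite dotxx // => e1.
have : vnorm (B x) ^+ 2 = vnorm (A x) ^+ 2.
  rewrite -[RHS]/(cRe (_%:C)) -e1 (positive_hermitian lB B0 x) dotxx //.
by move=> /(congr1 Num.sqrt); rewrite !sqrtr_sqr !ger0_norm ?vnorm_ge0.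
Qed.

Lemma nuclear_comp A t S X Y MX MY : linear X -> linear Y -> 0 <= MX -> 0 <= MY ->
  op_le X MX -> op_le Y MY -> nuclear A t S ->
  exists t', nuclear (fun x => X (A (Y x))) t' (MX * MY * S).
Proof.
move=> lX lY MX0 MY0 hX hY [phi [d [a [b [lphi hphi hd [a0 cab hS hA ht]]]]]].
have b0 n : 0 <= b n by apply: le_trans (hd n); rewrite vnorm_ge0.
have hb n : vnorm (X (d n)) <= MX * b n.
  by rewrite (le_trans (hX _)) // ler_wpM2l.
have hp n x : abs (phi n (Y x)) <= MY * a n * vnorm x.
  by rewrite (le_trans (hphi _ _)) // (mulrC MY) -mulrA ler_wpM2l.
have cab' : cvgn (series (fun n => MY * a n * (MX * b n))).
  rewrite (_ : series _ = fun N => (MX * MY) * series (fun n => a n * b n) N).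
    by apply: is_cvgMr.
  apply/funext => N; rewrite /series /= mulr_sumr; apply: eq_bigr => n _; ring.
have [t' ht'] : exists t' : R[i], series (fun n => phi n (Y (X (d n)))) @ \oo --> t'.
  apply: abs_series_cvg cab' => n; rewrite (le_trans (hp _ _)) //.
  by rewrite ler_wpM2l // mulr_ge0.
exists t', (fun n x => phi n (Y x)), (fun n => X (d n)), (fun n => MY * a n), (fun n => MX * b n).
split => //.
- by move=> n c x y; rewrite lY lphi.
split => //.
- by move=> n; rewrite mulr_ge0.
- move=> N; rewrite (_ : series _ N = (MX * MY) * series (fun n => a n * b n) N).
    by rewrite ler_wpM2l // mulr_ge0.
  rewrite /series /= mulr_sumr; apply: eq_bigr => n _; ring.
- move=> x; apply/cvg_vnormP.
  have /cvg_vnormP h := hA (Y x).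
  apply: (@squeeze_cvgr _ _ _ _ (fun=> 0) (fun N => MX * vnorm (series (fun n => phi n (Y x) *: d n) N - A (Y x)))).
  + apply: nearW => N; rewrite vnorm_ge0 /=.
    rewrite (_ : _ - _ = X (series (fun n => phi n (Y x) *: d n) N - A (Y x))) //.
    rewrite (linB lX) (lin_sum lX); congr (_ - _).
    by apply: eq_bigr => n _; rewrite (linZ lX).
  + exact: cvg_cst.
  + by rewrite -[0](mulr0 MX); apply: cvgM h; exact: cvg_cst.
Qed.

Lemma finite_series_cvg (V : normedModType R[i]) (u : V ^nat) m :
  (forall n, (m <= n)%N -> u n = 0) -> series u @ \oo --> \sum_(i < m) u i.
Proof.
move=> u0; apply: cvg_near_cst; exists m => // N /= mN.
rewrite /series /= (big_cat_nat (leq0n m) mN) /= big_mkord.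
by rewrite [X in _ + X]big_nat [X in _ + X]big1 ?addr0 // => i /andP[/u0].
Qed.

(** The basis of K need not be orthonormal. Its Gram matrix G is invertible, [P x] has the
    coordinate row [r x] times the inverse of G, and the trace is that of G times its inverse. *)
Lemma projection_nuclear P (K : set H) m : orthogonal_projection dot P ->
  (forall x, K x <-> P x = x) -> has_dim K m ->
  exists S, nuclear P m%:R S.
Proof.
move=> [lP PP symP] KP [v hv].
have free_v (c : 'rV[R[i]]_m) : \sum_(i < m) c 0 i *: v i = 0 -> c = 0.
  have /KP/hv [c0 [c00 c0u]] := lin0 lP.
  move=> /esym/c0u <-; apply: c0u.
  by rewrite big1 // => i _; rewrite mxE scale0r.
have v_delta k : v k = \sum_(i < m) (delta_mx 0 k : 'rV[R[i]]_m) 0 i *: v i.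
  rewrite (bigD1 k) //= big1 ?addr0 ?mxE ?eqxx ?scale1r // => j ji.
  by rewrite mxE eqxx (negPf ji) scale0r.
have Pv k : P (v k) = v k.
  apply/KP/hv; exists (delta_mx 0 k); split; first exact: v_delta.
  move=> c vc; apply/eqP; rewrite -subr_eq0; apply/eqP/free_v.
  under eq_bigr do rewrite mxE [(- c) _ _]mxE scalerBl.
  by rewrite sumrB -v_delta -vc subrr.
pose G : 'M[R[i]]_m := \matrix_(i, j) dot (v i) (v j).
have Gu : G \in unitmx.
  rewrite -row_free_unit -kermx_eq0; apply/rowV0P => c /sub_kermxP cG.
  apply: free_v; set w := \sum_(_ < _) _.
  have wv j : dot w (v j) = 0.
    have := congr1 (fun r : 'rV_m => r 0 j) cG; rewrite !mxE => <-.
    by rewrite dot_suml; apply: eq_bigr => i _; rewrite dotZl mxE.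
  apply/eqP; rewrite -vnorm_eq0 -sqrf_eq0 (vnorm2 hH) {2}/w dot_sumr.
  by rewrite big1 // => i _; rewrite dotZr wv mulr0.
pose r x : 'rV[R[i]]_m := \row_j dot x (v j).
pose cf x := r x *m invmx G.
have Pcf x : P x = \sum_(i < m) cf x 0 i *: v i.
  have /hv[c [Pc _]] : K (P x) by apply/KP.
  suff -> : cf x = c by [].
  suff rc : r x = c *m G by rewrite /cf rc mulmxK.
  apply/rowP => j; rewrite !mxE -(Pv j) -symP Pc dot_suml.
  by apply: eq_bigr => i _; rewrite dotZl mxE.
(* The m rank one terms are continued by 0 to sequences indexed by all natural numbers, as [nuclear]
   requires. *)
pose phi n x := if insub n is Some i then cf x 0 i else 0.
pose d n := if insub n is Some i then v i else 0.
have phiE (i : 'I_m) x : phi i x = cf x 0 i by rewrite /phi valK.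
have dE (i : 'I_m) : d i = v i by rewrite /d valK.
have phi0 n x : (m <= n)%N -> phi n x = 0.
  by move=> mn; rewrite /phi insubF // ltnNge mn.
have d0 n : (m <= n)%N -> d n = 0.
  by move=> mn; rewrite /d insubF // ltnNge mn.
pose a' (n : nat) : R := if insub n is Some i then
   \sum_(j < m) abs (invmx G j i) * vnorm (v j) else 0.
exists (\sum_(i < m) a' i * vnorm (d i)), phi, d, a', (fun n => vnorm (d n)).
have a'0 n : 0 <= a' n.
  rewrite /a'; case: insubP => // i _ _.
  by rewrite sumr_ge0 // => j _; rewrite mulr_ge0 ?abs_ge0 ?vnorm_ge0.
split => //.
- move=> n c x y; rewrite /phi; case: insubP => [i _ _|_]; last by rewrite mulr0 addr0.
  rewrite /cf (_ : r _ = c *: r x + r y) ?mulmxDl -?scalemxAl; first by rewrite !mxE.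
  by apply/rowP => j; rewrite !mxE dotDl dotZl.
- move=> n x; rewrite /phi /a'; case: insubP => [i _ _|_]; last by rewrite abs0 mul0r.
  rewrite mxE (le_trans (abs_sum _ _ _)) // mulr_suml; apply: ler_sum => j _.
  rewrite absM mulrC -mulrA ler_wpM2l ?abs_ge0 // mxE mulrC.
  exact: (cauchy_schwarz hH).
have z n : (m <= n)%N -> a' n * vnorm (d n) = 0.
  by move=> mn; rewrite d0 // vnorm0 mulr0.
split => //.
- apply: cvgP; apply: cvg_near_cst; exists m => // N /= mN.
  rewrite /series /= (big_cat_nat (leq0n m) mN) /= [X in _ + X]big_nat [X in _ + X]big1 ?addr0.
    reflexivity.
  by move=> i /andP[/z].
- move=> N; rewrite /series /=.
  have [mN|/ltnW Nm] := leqP m N.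
    rewrite (big_cat_nat (leq0n m) mN) /= [X in _ + X]big_nat [X in _ + X]big1 ?addr0.
      by rewrite big_mkord.
    by move=> i /andP[/z].
  rewrite -(big_mkord xpredT (fun i => a' i * vnorm (d i))) (big_cat_nat (leq0n N) Nm) /=.
  by rewrite lerDl sumr_ge0 // => i _; rewrite mulr_ge0 ?vnorm_ge0.
- move=> x; rewrite Pcf.
  under eq_bigr do rewrite -phiE -dE.
  apply: (@finite_series_cvg _ (fun n => phi n x *: d n)) => n mn.
  by rewrite d0 // scaler0.
- rewrite -[m in m%:R]card_ord -sumr_const.
  rewrite (_ : \sum_(_ in _) _ = \sum_(i < m) phi i (d i)).
    apply: (@finite_series_cvg R[i] (fun n => phi n (d n))) => n mn.
    exact: phi0.
  apply: eq_bigr => i _; rewrite phiE dE /cf.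
  rewrite (_ : r (v i) = row i G); last by apply/rowP => j; rewrite !mxE.
  by rewrite -row_mul mulmxV // !mxE eqxx.
Qed.

End TraceClass.

(** * Resolvents and spectral measures *)

Section Resolvent.
Context {R : realType} {H : completeNormedModType R[i]}.
Variable dot : {dot H for @Num.conj R[i]}.
Hypothesis hH : hilbert dot.
Variable S : operator H.
Hypothesis saS : self_adjoint dot S.
Implicit Types (x y u : H) (z w : R[i]).

Lemma self_adjoint_sym x u y (v : H) : S (x, u) -> S (y, v) -> dot u y = dot x v.
Proof. by move=> xu; case: saS => _ <- /(_ _ _ xu). Qed.

Lemma self_adjoint_linear a x u y (v : H) : S (x, u) -> S (y, v) ->
  S (a *: x + y, a *: u + v).
Proof.
case: saS => _ <- /= h1 h2 t Tt tTt.
by rewrite !dotDr !dotZr (h1 _ _ tTt) (h2 _ _ tTt).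
Qed.

Section Point.
Variable z : R[i].
Hypothesis rz : resolvent_set S z.

Lemma resolventP x y : S (x, y + z *: x) <-> x = resolvent S z y.
Proof.
have [A [_ hA]] := rz.
have hA' v (w : H) : S (v, w + z *: v) <-> v = A w.
  have -> : S (v, w + z *: v) = inverse (Defs.shift S z) (w, v) by [].
  by rewrite hA.
suff -> : resolvent S z y = A y by exact: hA'.
rewrite /resolvent; case: xgetP => [v _ /hA' //|/(_ (A y))].
by case; apply/hA'.
Qed.

Lemma resolvent_in y : S (resolvent S z y, y + z *: resolvent S z y).
Proof. exact/resolventP. Qed.

Lemma resolvent_bounded : bounded_op (resolvent S z).
Proof.
have [A [bA hA]] := rz.
suff -> : resolvent S z = A by [].
apply/funext => y; apply/esym/resolventP.
have -> : S (A y, y + z *: A y) = inverse (Defs.shift S z) (y, A y) by [].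
by rewrite hA.
Qed.

Lemma resolvent_linear : linear (resolvent S z).
Proof. by case: resolvent_bounded. Qed.

(** With x the resolvent applied to y, the number <y + z x, x> = <S x, x> is real, so the imaginary
    part of <y, x> is - Im z |x|^2; Cauchy-Schwarz concludes. *)
Lemma resolvent_Im_le y : `|cIm z| * vnorm (resolvent S z y) <= vnorm y.
Proof.
set x := resolvent S z y.
have sym : dot (y + z *: x) x = dot x (y + z *: x).
  by apply: self_adjoint_sym; exact: resolvent_in.
have e : cIm (dot y x) = - (cIm z * vnorm x ^+ 2).
  have : cIm (dot (y + z *: x) x) = 0.
    have /(congr1 cIm) := sym; rewrite [in RHS](dotC dot x) cIm_conj.
    by move=> h; lra.
  rewrite dotDl dotZl (dotxx hH) cImD cImM /= mulr0 add0r => h; lra.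
have h : `|cIm z| * vnorm x ^+ 2 <= vnorm y * vnorm x.
  rewrite (le_trans _ (cauchy_schwarz hH _ _)) // (le_trans _ (ler_Im_abs _)) //.
  by rewrite e normrN normrM (ger0_norm (sqr_ge0 _)).
have [x0|x0] := eqVneq (vnorm x) 0; first by rewrite x0 mulr0 vnorm_ge0.
by rewrite -(@ler_pM2r _ (vnorm x)) ?lt_def ?x0 ?vnorm_ge0 // -mulrA -expr2.
Qed.

End Point.

Lemma resolvent_identity z w y : resolvent_set S z -> resolvent_set S w ->
  resolvent S z y = resolvent S w y + (z - w) *: resolvent S z (resolvent S w y).
Proof.
move=> rz rw; apply/esym/(resolventP rz).
set a := resolvent S w y; set b := resolvent S z a.
have h1 := resolvent_in rw y; have h2 := resolvent_in rz a.
have := self_adjoint_linear (z - w) h2 h1; rewrite addrC.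
congr (S (_, _)); rewrite -/a -/b.
have -> : (z - w) *: (a + z *: b) = z *: ((z - w) *: b) + (z - w) *: a.
  by rewrite scalerDr !scalerA mulrC addrC.
rewrite [y + _]addrC addrA -(addrA _ ((z - w) *: a)) -scalerDl subrK scalerDr.
by rewrite [RHS]addrC (addrC (z *: a)).
Qed.

Lemma resolvent_identity_swap z w y : resolvent_set S z -> resolvent_set S w ->
  resolvent S z y = resolvent S w y + (z - w) *: resolvent S w (resolvent S z y).
Proof.
move=> rz rw; rewrite {1}(resolvent_identity y rw rz) -opprB scaleNr.
by rewrite subrK.
Qed.

(** In the resolvent identity the second term is at most half of the left side and is absorbed
    there. This yields locally uniform bounds along the contour. *)
Lemma resolvent_local_bound z w M : 0 <= M -> resolvent_set S z -> resolvent_set S w ->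
  op_le (resolvent S w) M -> abs (z - w) * M <= 1 / 2 -> op_le (resolvent S z) (2 * M).
Proof.
move=> M0 rz rw hM zw y.
have h : vnorm (resolvent S z y) <= M * vnorm y + 1 / 2 * vnorm (resolvent S z y).
  rewrite {1}(resolvent_identity_swap y rz rw) (le_trans (vnormD _ _)) // lerD ?hM //.
  rewrite vnormZ (le_trans (ler_wpM2l (abs_ge0 _) (hM _))) // mulrA.
  by rewrite ler_wpM2r ?vnorm_ge0.
have := vnorm_ge0 (resolvent S z y); lra.
Qed.

End Resolvent.

(** [X1] and [X2] are the bounded operators (S_j - z0) (S_j - z)^-1. They carry the trace class
    property from the single point z0 to z, with norms at most 1 plus |z - z0| times a resolvent
    bound. *)
Lemma resolvent_difference (R : realType) (H : completeNormedModType R[i])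
  (dot : {dot H for @Num.conj R[i]}) (S1 S2 : operator H) (z z0 : R[i]) (x : H) :
  self_adjoint dot S1 -> self_adjoint dot S2 ->
  resolvent_set S1 z -> resolvent_set S1 z0 -> resolvent_set S2 z -> resolvent_set S2 z0 ->
  let X1 y := y + (z - z0) *: resolvent S1 z y in
  let X2 y := y + (z - z0) *: resolvent S2 z y in
  resolvent S2 z x - resolvent S1 z x
  = X2 (resolvent S2 z0 (X1 x) - resolvent S1 z0 (X1 x)).
Proof.
move=> sa1 sa2 r1 r10 r2 r20 X1 X2.
have e1 : resolvent S1 z0 (X1 x) = resolvent S1 z x.
  rewrite /X1 (linD (resolvent_linear r10)) (linZ (resolvent_linear r10)).
  by rewrite -(resolvent_identity_swap sa1 x r1 r10).
have e2 y : X2 (resolvent S2 z0 y) = resolvent S2 z y.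
  by rewrite /X2 -(resolvent_identity sa2 y r2 r20).
have lX2 y y' : X2 (y - y') = X2 y - X2 y'.
  by rewrite /X2 (linB (resolvent_linear r2)) scalerBr opprD addrACA.
rewrite e1 lX2 e2.
have -> : resolvent S2 z (X1 x) = resolvent S2 z x + (z - z0) *: resolvent S2 z (resolvent S1 z x).
  by rewrite /X1 (linD (resolvent_linear r2)) (linZ (resolvent_linear r2)).
by rewrite /X2 opprD (addrC (- _)) addrA addrK.
Qed.

(** * Algebra of projection-valued measures and local estimates for the operator *)

Section SpectralMeasure.
Context {R : realType} {H : completeNormedModType R[i]}.
Variable dot : {dot H for @Num.conj R[i]}.
Hypothesis hH : hilbert dot.
Variable E : projection_measure dot.
Implicit Types (x y u v w : H) (z : R[i]) (M A B : set (measurableTypeR R)).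

Lemma pmP M : measurable M -> [/\ linear (E M), forall x, E M (E M x) = E M x &
  forall x y, dot (E M x) y = dot x (E M y)].
Proof. by move=> mM; exact: (pm_projP E). Qed.

Lemma pm_linear M : measurable M -> linear (E M).
Proof. by move=> /pmP[]. Qed.
Lemma pm_idem M x : measurable M -> E M (E M x) = E M x.
Proof. by move=> /pmP[]. Qed.
Lemma pm_sym M x y : measurable M -> dot (E M x) y = dot x (E M y).
Proof. by move=> /pmP[]. Qed.

Lemma pm_dot M x y : measurable M -> dot (E M x) y = dot (E M x) (E M y).
Proof. by move=> mM; rewrite -{1}(pm_idem x mM) (pm_sym _ _ mM). Qed.

Lemma pm_scalarE M x : measurable M -> pm_scalar E x M = (vnorm (E M x) ^+ 2)%:E.
Proof. by move=> mM; rewrite (pm_scalarP E) // pm_dot // (vnorm2 hH). Qed.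

Lemma pm_scalarT x : pm_scalar E x setT = (vnorm x ^+ 2)%:E.
Proof. by rewrite pm_scalarE // (pm_projT E). Qed.

(** Additivity is given for the scalar measures only. The defect D is linear with zero quadratic
    form, hence is 0. *)
Lemma pmU A B x : measurable A -> measurable B -> A `&` B = set0 ->
  E (A `|` B) x = E A x + E B x.
Proof.
move=> mA mB AB; have mAB := measurableU _ _ mA mB.
pose D y := E (A `|` B) y - (E A y + E B y).
have lD : linear D.
  move=> a u v; rewrite /D (pm_linear mAB) (pm_linear mA) (pm_linear mB).
  by rewrite scalerBr scalerDr (addrACA (a *: E A u)) opprD addrACA.
have D0 y : dot (D y) y = 0.
  have Dy : dot (D y) y = (vnorm (E (A `|` B) y) ^+ 2)%:C
      - ((vnorm (E A y) ^+ 2)%:C + (vnorm (E B y) ^+ 2)%:C).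
    by rewrite /D dotBl dotDl (pm_dot _ _ mAB) (pm_dot _ _ mA) (pm_dot _ _ mB) !dotxx.
  apply: eq_ReIm => /=.
    have : pm_scalar E y (A `|` B) = (pm_scalar E y A + pm_scalar E y B)%E.
      by rewrite measureU.
    rewrite !pm_scalarE // -EFinD => -[h].
    by rewrite Dy -rmorphD -rmorphB /= h subrr.
  by rewrite Dy -rmorphD -rmorphB.
have : D x = 0.
  apply: (positive_null hH lD) => [y|]; first by rewrite D0.
  by rewrite D0.
by move=> /eqP; rewrite subr_eq0 => /eqP.
Qed.

(** For v in the range of [E A], the set A already carries the full mass |v|^2, which leaves nothing
    for the disjoint set B. *)
Lemma pm_disj A B x : measurable A -> measurable B -> A `&` B = set0 ->
  E B (E A x) = 0.
Proof.
move=> mA mB AB; set v := E A x.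
have Ev : E A v = v by exact: pm_idem.
have h : pm_scalar E v (A `|` B) = (pm_scalar E v A + pm_scalar E v B)%E.
  by rewrite measureU.
have h2 : (pm_scalar E v (A `|` B) <= pm_scalar E v setT)%E.
  by apply: le_measure => //; rewrite inE //; exact: measurableU.
move: h2; rewrite h pm_scalarT !pm_scalarE // Ev -EFinD lee_fin gerDl => h3.
by apply/eqP; rewrite -vnorm_eq0 -sqrf_eq0 eq_le h3 sqr_ge0.
Qed.

Lemma pmI A B x : measurable A -> measurable B -> E A (E B x) = E (A `&` B) x.
Proof.
move=> mA mB; have mI := measurableI _ _ mA mB.
have mD := measurableD mB mA; have mD' := measurableD mA mB.
have -> : E B x = E (A `&` B) x + E (B `\` A) x.
  rewrite -pmU // ?(setIC A) ?setUIDK //.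
  by apply/seteqP; split => // l [[]] /= ? ? [].
rewrite (linD (pm_linear mA)).
rewrite (pm_disj (A := B `\` A)) ?addr0 //; last first.
  by apply/seteqP; split => // l [[]].
have -> y : E A y = E (A `&` B) y + E (A `\` B) y.
  rewrite -pmU // ?setUIDK //.
  by apply/seteqP; split => // l [[]] /= ? ? [].
rewrite pm_idem // (pm_disj (A := A `&` B)) ?addr0 //.
by apply/seteqP; split => // l [[]] /= ? ? [].
Qed.

Lemma pm_vnorm_le M x : measurable M -> vnorm (E M x) <= vnorm x.
Proof.
move=> mM; rewrite -(@ler_pXn2r _ 2) ?nnegrE ?vnorm_ge0 //.
rewrite -lee_fin -pm_scalarE // -pm_scalarT.
by apply: le_measure; rewrite ?inE.
Qed.

Lemma pm_vnorm_mono A B x : measurable A -> measurable B -> A `<=` B ->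
  vnorm (E A x) <= vnorm (E B x).
Proof.
move=> mA mB AB; rewrite -(@ler_pXn2r _ 2) ?nnegrE ?vnorm_ge0 //.
rewrite -lee_fin -!pm_scalarE //.
by apply: le_measure; rewrite ?inE.
Qed.

Lemma pm0 x : E set0 x = 0.
Proof.
apply/eqP; rewrite -vnorm_eq0 -sqrf_eq0 -(inj_eq (@EFin_inj _)).
by rewrite -pm_scalarE // measure0.
Qed.

(* [y + i^k w] and [y] have the same scalar measure away from the range of
   the projection containing [w]. *)
Lemma pm_scalar_off M A y w a : measurable M -> measurable A -> A `<=` ~` M ->
  E M w = w -> pm_scalar E (y + a *: w) A = pm_scalar E y A.
Proof.
move=> mM mA AM Mw; rewrite !pm_scalarE // (linD (pm_linear mA)).
rewrite (linZ (pm_linear mA)) -Mw (pm_disj (A := M)) ?scaler0 ?addr0 //.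
by apply/seteqP; split => // l [Ml /AM].
Qed.

Lemma pm_integrable_bounded M x (f : R -> R) (C : R) : measurable M ->
  measurable_fun M f -> (forall l, M l -> `|f l| <= C) ->
  (pm_scalar E x).-integrable M (EFin \o f).
Proof.
move=> mM mf fC; apply: measurable_bounded_integrable => //.
  by rewrite pm_scalarE // ltry.
exists C; split; first exact: num_real.
by move=> C' CC' l /fC /le_trans; apply; exact: ltW.
Qed.

Lemma abs_realsqr (l : R) : abs l%:C ^+ 2 = l ^+ 2.
Proof. by rewrite absR real_normK ?num_real. Qed.

Lemma spectral_dom_integrable y : spectral_dom E (fun l => l%:C) y ->
  (pm_scalar E y).-integrable setT (fun l : measurableTypeR R => l%:E).
Proof.
rewrite /spectral_dom /= => h; apply/integrableP; split.
  exact/measurable_EFinP.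
apply: (@le_lt_trans _ _ (\int[pm_scalar E y]_l (1 + (l ^+ 2)%:E))%E).
  apply: ge0_le_integral => //.
  - exact/measurableT_comp/measurable_EFinP.
  - by apply: emeasurable_funD => //; apply/measurable_EFinP; exact: measurable_funX.
  - move=> l _; rewrite /= -EFinD lee_fin.
    by rewrite -(@real_normK _ l) ?num_real //; have := sqr_ge0 (`|l| - 1); nra.
rewrite ge0_integralD //; last 2 first.
  - by move=> l _; rewrite lee_fin sqr_ge0.
  - by apply/measurable_EFinP; exact: measurable_funX.
rewrite integral_cst // mul1e pm_scalarT lte_add_pinfty ?ltry //.
by under eq_integral do rewrite -abs_realsqr.
Qed.

Lemma spectral_dom_bounded M w (C : R) : measurable M -> (forall l, M l -> `|l| <= C) ->
  E M w = w -> spectral_dom E (fun l => l%:C) w.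
Proof.
move=> mM MC Mw; rewrite /spectral_dom /=.
have mf : measurable_fun (setT : set (measurableTypeR R)) (EFin \o (fun l : measurableTypeR R => abs l%:C ^+ 2)).
  apply/measurable_EFinP; under eq_fun do rewrite abs_realsqr; exact: measurable_funX.
rewrite -(setUv M) ge0_integral_setU //; last 4 first.
- exact: measurableC.
- by rewrite setUv.
- by move=> l _; rewrite lee_fin sqr_ge0.
- by apply/disj_setPCl.
rewrite [X in (_ + X)%E](_ : _ = 0%E) ?adde0; last first.
  rewrite (@eq_measure_integral _ _ _ _ mzero) ?integral_measure_zero // => A mA AM.
  rewrite pm_scalarE // -Mw (pm_disj (A := M)) // ?vnorm0 ?expr0n //.
  by apply/seteqP; split => // l [Ml /AM].
apply: (@le_lt_trans _ _ (\int[pm_scalar E w]_(l in M) (cst (C ^+ 2)%:E l))%E).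
  apply: ge0_le_integral => //.
  - by move=> l _; rewrite lee_fin sqr_ge0.
  - exact: measurable_funTS.
  - move=> l Ml; rewrite lee_fin absR ler_pXn2r ?nnegrE ?MC //.
    exact: le_trans (MC _ Ml).
by rewrite integral_cst // pm_scalarE // -EFinM ltry.
Qed.

Section SelfAdjoint.
Variable S : operator H.
Hypothesis hE : spectral_measure_of E S.

(* Polarization of [dot (u - c y) w]: outside [M] the four measures coincide
   and their contributions cancel, and on [M] the integrand is at most [delta]. *)
Lemma spectral_polarization M (c delta : R) y u w : measurable M -> 0 <= delta ->
  (forall l, M l -> `|l - c| <= delta) -> S (y, u) -> E M w = w ->
  abs (dot (u - c%:C *: y) w) <= delta * (vnorm (E M y) ^+ 2 + vnorm w ^+ 2).
Proof.
move=> mM delta0 Mc Syu Mw.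
have [dy hy] : spectral_integral E (fun l => l%:C) (y, u) by rewrite -hE.
have Mb l : M l -> `|l| <= `|c| + delta.
  move=> /Mc h; rewrite -[l](subrK c) (le_trans (ler_normD _ _)) // addrC lerD2l //.
have dw := spectral_dom_bounded mM Mb Mw.
have mMC := measurableC mM.
pose i_ (k : nat) : R[i] := 'i ^+ k.
pose mu k := pm_scalar E (y + i_ k *: w).
have mid (D : set (measurableTypeR R)) : measurable_fun D (fun l : R => l : R).
  by apply: measurable_funTS; exact: measurable_id.
have int_off (f : R -> R) k : \int[mu k]_(l in ~` M) f l = \int[pm_scalar E y]_(l in ~` M) f l.
  rewrite /Rintegral; congr fine; apply: eq_measure_integral => A mA AM.
  exact: (pm_scalar_off _ _ mM mA AM).
have iM k : (mu k).-integrable M (fun l => l%:E).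
  exact: (pm_integrable_bounded _ mM _ Mb).
have iMC k : (mu k).-integrable (~` M) (fun l => l%:E).
  have /integrableP[m1 h1] : (pm_scalar E y).-integrable (~` M) (fun l => l%:E).
    by apply: integrableS (spectral_dom_integrable dy).
  apply/integrableP; split => //.
  rewrite (@eq_measure_integral _ _ _ _ (pm_scalar E y)) // => A mA AM.
  exact: (pm_scalar_off _ _ mM mA AM).
have iT k : (mu k).-integrable setT (fun l => l%:E).
  have m1 (D : set (measurableTypeR R)) : measurable_fun D (fun l : measurableTypeR R => `|l%:E|)%E.
    by apply: measurableT_comp => //; exact/measurable_EFinP/mid.
  have /integrableP[_ h1] := iM k; have /integrableP[_ h2] := iMC k.
  apply/integrableP; split; first by apply/measurable_EFinP; exact: mid.
  rewrite -(setUv M) ge0_integral_setU //; first by rewrite lte_add_pinfty.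
  by apply/disj_setPCl.
pose I k := \int[mu k]_(l in M) l.
pose J := \int[pm_scalar E y]_(l in ~` M) l.
have IJ k : cintegral (mu k) setT (fun l => l%:C) = (I k + J)%:C.
  rewrite /cintegral /= Rintegral_cst // mul0r; congr (_ +i* _).
  rewrite -(setUv M) Rintegral_setU //.
  - by rewrite int_off.
  - by rewrite setUv.
  - by apply/disj_setPCl.
have hu : dot u w = 4^-1 * \sum_(k < 4) i_ k * (I k + J)%:C.
  by have /= -> := hy w dw; congr (_ * _); apply: eq_bigr => k _; rewrite IJ.
pose q k := vnorm (E M y + i_ k *: w) ^+ 2.
pose q' := vnorm (E (~` M) y) ^+ 2.
have ii : 'i * 'i = -1 :> R[i] by rewrite -expr2 sqrCi.
have qE k : vnorm (y + i_ k *: w) ^+ 2 = q k + q'.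
  have e : y = E M y + E (~` M) y.
    by rewrite -pmU // ?setICr // setUv (pm_projT E).
  have vM : E M y + i_ k *: w = E M (y + i_ k *: w).
    by rewrite (linD (pm_linear mM)) (linZ (pm_linear mM)) Mw.
  rewrite {1}e addrAC (vnorm2D0 hH) //.
  by rewrite vM (pm_sym _ _ mM) (pm_disj (A := ~` M)) ?setICl // dot0r.
have hpol : dot y w = 4^-1 * \sum_(k < 4) i_ k * (q k + q')%:C.
  under eq_bigr do rewrite -qE -(dotxx hH) dotDl !dotDr !dotZr !dotZl.
  rewrite !big_ord_recl big_ord0 /i_ /= /bump /= !expr0 !expr1 !exprS !expr0.
  have -> : Num.conj ('i * ('i * 1)) = -1 :> R[i] by rewrite mulr1 ii rmorphN rmorph1.
  have -> : Num.conj ('i * ('i * ('i * 1))) = 'i :> R[i].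
    by rewrite mulr1 ii mulrN1 rmorphN /= conjCi opprK.
  rewrite rmorph1 !mulr1 conjCi !ii.
  set a := dot y y; set b := dot y w; set b' := dot w y; set d := dot w w.
  have -> : 'i * -1 = - 'i :> R[i] by rewrite mulrN1.
  transitivity (4^-1 * (4 * b + 0 * (a + d + b'))); first by field.
  congr (_ * _).
  have i2 : ('i : R[i]) ^+ 2 = -1 by rewrite sqrCi.
  ring: i2.
(* The common integral J and the common mass [q'] off M drop out, because the four powers of i add
   up to 0. *)
have -> : dot (u - c%:C *: y) w = 4^-1 * \sum_(k < 4) i_ k * (I k - c * q k)%:C.
  rewrite dotBl dotZl hu hpol !big_ord_recl !big_ord0 /i_ /= /bump /=.
  rewrite !expr0 !expr1 !exprS !expr0 !mulr1 !ii !(rmorphB, rmorphD, rmorphM) /=.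
  have -> : 'i * -1 = - 'i :> R[i] by rewrite mulrN1.
  by field.
have hI k : `|I k - c * q k| <= delta * q k.
  have mE : fine (mu k M) = q k.
    rewrite /mu pm_scalarE //= /q (linD (pm_linear mM)) (linZ (pm_linear mM)) Mw //.
  have -> : I k - c * q k = \int[mu k]_(l in M) (l - c).
    rewrite RintegralB //.
    - by rewrite Rintegral_cst // mE.
    - apply: (@pm_integrable_bounded _ _ (cst c) `|c|) => //.
  have h1 : (mu k).-integrable M (EFin \o (fun l => l - c)).
    by apply: (@pm_integrable_bounded _ _ _ delta) => //; exact: measurable_funB.
  apply: le_trans (le_normr_Rintegral mM h1) _; rewrite -mE -Rintegral_cst //.
  apply: le_Rintegral => //.
  - apply: (@pm_integrable_bounded _ _ (fun l => `|l - c|) delta) => //.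
      by apply: measurableT_comp => //; exact: measurable_funB.
    by move=> l Ml; rewrite normr_id Mc.
  - by apply: (@pm_integrable_bounded _ _ (cst delta) `|delta|).
rewrite absM absV -[4]/(4%:R) -[4%:R](rmorph_nat (real_complex R)) absR normr_nat.
rewrite ler_pdivrMl // (le_trans (abs_sum _ _ _)) //.
apply: (@le_trans _ _ (\sum_(k < 4) delta * q k)).
  apply: ler_sum => k _; rewrite absM absX absi expr1n mul1r absR; exact: hI.
rewrite -mulr_sumr mulrCA ler_wpM2l //.
(* The parallelogram law, applied with w and with i w, sums the four squared norms to 4 (|E M y|^2 +
   |w|^2), which cancels the factor 1 / 4. *)
have par v1 v2 : vnorm (v1 + v2) ^+ 2 + vnorm (v1 - v2) ^+ 2 =
    2 * (vnorm v1 ^+ 2 + vnorm v2 ^+ 2).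
  by rewrite !(vnorm2D hH) vnormN dotNr cReN; ring.
have q02 := par (E M y) w; have q13 := par (E M y) ('i *: w).
rewrite vnormZ absi mul1r in q13.
rewrite !big_ord_recl big_ord0 /= /bump /= addr0 /q /i_.
rewrite expr0 scale1r expr1 sqrCi scaleN1r.
have -> : ('i : R[i]) ^+ (1 + (1 + 1))%N = - 'i by rewrite exprS sqrCi mulrN1.
rewrite scaleNr (_ : _ + (_ + (_ + _)) = (vnorm (E M y + w) ^+ 2 + vnorm (E M y - w) ^+ 2)
  + (vnorm (E M y + 'i *: w) ^+ 2 + vnorm (E M y - 'i *: w) ^+ 2)); last by ring.
by rewrite q02 q13 -mulrDl -natrD.
Qed.

(** This stands in for a functional calculus: on the range of [E M] the operator acts as the number
    c up to 2 delta. Testing the polarized estimate on w = t r and optimizing over t > 0 makes it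
    linear in |E M y|; the best t is |E M y| / |r|. *)
Lemma spectral_key M (c delta : R) y u : measurable M -> 0 <= delta ->
  (forall l, M l -> `|l - c| <= delta) -> S (y, u) ->
  vnorm (E M u - c%:C *: E M y) <= 2 * delta * vnorm (E M y).
Proof.
move=> mM delta0 Mc Syu; set r := _ - _.
have rE : r = E M (u - c%:C *: y).
  by rewrite (linB (pm_linear mM)) (linZ (pm_linear mM)).
have Mr : E M r = r by rewrite rE pm_idem.
have h (t : R) : 0 < t -> t * vnorm r ^+ 2 <= delta * (vnorm (E M y) ^+ 2 + t ^+ 2 * vnorm r ^+ 2).
  move=> t0; have Mw : E M (t%:C *: r) = t%:C *: r by rewrite (linZ (pm_linear mM)) Mr.
  have := spectral_polarization mM delta0 Mc Syu Mw.
  rewrite dotZr vnormZ absR (gtr0_norm t0) exprMn absM absJ absR (gtr0_norm t0).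
  apply: le_trans; rewrite ler_wpM2l ?(ltW t0) //.
  rewrite (vnorm2 hH) {1}rE (pm_sym _ _ mM) Mr.
  exact: le_trans (ler_norm _) (ler_Re_abs _).
have [->|r0] := eqVneq (vnorm r) 0; first by rewrite !mulr_ge0 // vnorm_ge0.
have {r0} r0 : 0 < vnorm r by rewrite lt_def r0 vnorm_ge0.
(* If [E M y] vanishes while r does not, t = 1 / (delta + 1) would give 1 <= delta / (delta + 1). *)
have [v0|v0] := eqVneq (vnorm (E M y)) 0.
  have := h (delta + 1)^-1; rewrite v0 expr0n add0r invr_gt0 ltr_wpDl // => /(_ isT) h1.
  exfalso; move: h1; rewrite mulrA ler_pM2r ?exprn_gt0 // expr2 mulrA.
  have d1 : 0 < delta + 1 by rewrite ltr_wpDl.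
  rewrite -[leLHS]mul1r ler_pM2r ?invr_gt0 // ler_pdivlMr // mul1r => h1.
  by have : delta + 1 <= delta by []; lra.
have {v0} v0 : 0 < vnorm (E M y) by rewrite lt_def v0 vnorm_ge0.
have := h (vnorm (E M y) / vnorm r); rewrite divr_gt0 // => /(_ isT).
rewrite exprMn exprVn mulfVK ?expf_neq0 ?gt_eqF //.
have -> : vnorm (E M y) / vnorm r * vnorm r ^+ 2 = vnorm (E M y) * vnorm r.
  by field; rewrite gt_eqF.
have -> : delta * (vnorm (E M y) ^+ 2 + vnorm (E M y) ^+ 2) =
  vnorm (E M y) * (2 * delta * vnorm (E M y)) by ring.
by rewrite ler_pM2l.
Qed.

(** The closed support of the spectral measure, from which the sample points of the Riemann sums are
    taken. *)
Definition pm_supp : set R :=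
  [set l | forall r : R, 0 < r -> exists x, E `]l - r, l + r[%classic x <> 0].

(** A nonzero x in the range of the projection of a small interval at l equals (l - z) [E M y] up to
    a small error, where y is the resolvent applied to x. With |y| <= B |x|, this is impossible if B
    |z - l| < 1. *)
Lemma pm_supp_dist l z (B : R) : 0 <= B -> pm_supp l -> resolvent_set S z ->
  op_le (resolvent S z) B -> 1 <= B * abs (z - l%:C).
Proof.
move=> B0 sl rz hB; rewrite leNgt; apply/negP => h.
(* With this radius B (|z - l| + 2 d) is still less than 1. *)
pose d := (1 - B * abs (z - l%:C)) / (4 * (B + 1)).
have B1 : 0 < 4 * (B + 1) by rewrite mulr_gt0 // ltr_wpDl.
have d0 : 0 < d by rewrite divr_gt0 // subr_gt0.
have [x0 Ex0] := sl d d0.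
set M := `]l - d, l + d[%classic in Ex0.
have mM : measurable (M : set (measurableTypeR R)) by exact: measurable_itv.
pose x := E M x0; pose y := resolvent S z x.
have Mx : E M x = x by exact: pm_idem.
have Md k : M k -> `|k - l| <= d.
  by rewrite /M /= in_itv /= => /andP[? ?]; rewrite ler_norml; lra.
have := spectral_key mM (ltW d0) Md (resolvent_in rz x); rewrite -/y.
rewrite (linD (pm_linear mM)) (linZ (pm_linear mM)) Mx -addrA -scalerBl => h1.
have x0' : 0 < vnorm x by rewrite lt_def vnorm_ge0 vnorm_eq0 andbT; apply/eqP.
have h2 : vnorm x <= (abs (z - l%:C) + 2 * d) * vnorm (E M y).
  have -> : x = x + (z - l%:C) *: E M y - (z - l%:C) *: E M y by rewrite addrK.
  rewrite (le_trans (vnormB _ _)) // vnormZ mulrDl addrC lerD2l //.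
have h3 : vnorm (E M y) <= B * vnorm x by exact: le_trans (pm_vnorm_le _ mM) (hB _).
have : vnorm x <= (abs (z - l%:C) + 2 * d) * (B * vnorm x).
  by rewrite (le_trans h2) // ler_wpM2l // addr_ge0 ?abs_ge0 // mulr_ge0 // ltW.
rewrite mulrA -[leLHS]mul1r ler_pM2r // leNgt => /negP; apply.
have e : d * (4 * (B + 1)) = 1 - B * abs (z - l%:C).
  by rewrite /d mulfVK // gt_eqF.
nra.
Qed.

Lemma pm_supp_spectrum l : pm_supp l -> spectrum S l%:C.
Proof.
move=> sl rl; have [_ [B B0 hB]] := bounded_opP (resolvent_bounded rl).
by have := pm_supp_dist B0 sl rl hB; rewrite subrr abs0 mulr0 ler10.
Qed.

End SelfAdjoint.

End SpectralMeasure.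

(** * Support of the spectral measure, kernel of the operator, and Riemann sums *)

Section SpectralApproximation.
Context {R : realType} {H : completeNormedModType R[i]}.
Variable dot : {dot H for @Num.conj R[i]}.
Hypothesis hH : hilbert dot.
Variables (E : projection_measure dot) (S : operator H).
Hypotheses (saS : self_adjoint dot S) (hE : spectral_measure_of E S).
Implicit Types (x y u v w : H) (z : R[i]) (M A B : set (measurableTypeR R)).

(* Lindelof: a union of null open intervals is contained in a countable one. *)
Lemma locally_null_cover (Q : set R -> Prop) (A : set R) :
  (forall I J : set R, I `<=` J -> Q J -> Q I) ->
  (forall l, A l -> exists2 r : R, 0 < r & Q `]l - r, l + r[%classic) ->
  Q set0 ->
  exists F : nat -> set R, [/\ forall n, measurable (F n : set (measurableTypeR R)),
    forall n, Q (F n) & A `<=` \bigcup_n F n].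
Proof.
move=> Qmono hA Q0.
pose I (p : rat * rat) := `](ratr p.1 : R), (ratr p.2 : R)[%classic.
pose F n := if unpickle n is Some p then if `[< Q (I p) >] then I p else set0 else set0.
exists F; split.
- move=> n; rewrite /F; case: (unpickle n) => [p|]; last exact: measurable0.
  by case: ifP => _; [exact: measurable_itv | exact: measurable0].
- move=> n; rewrite /F; case: (unpickle n) => [p|//].
  by case: ifPn => // /asboolP.
move=> l /hA[r r0 Qr].
have [a] : exists q : rat, (ratr q : R) \in `]l - r, l[ by apply: rat_in_itvoo; rewrite ltrBlDr ltrDl.
have [c] : exists q : rat, (ratr q : R) \in `]l, l + r[ by apply: rat_in_itvoo; rewrite ltrDl.
rewrite !in_itv /= => /andP[c1 c2] /andP[a1 a2].
refine (ex_intro2 _ _ (pickle (a, c)) Logic.I _); rewrite /F pickleK.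
have QI : Q (I (a, c)).
  apply: Qmono Qr => k; rewrite /I /= !in_itv /= => /andP[k1 k2].
  by rewrite (lt_trans a1 k1) (lt_trans k2 c2).
by rewrite asboolT //= /I /= in_itv /= a2 c1.
Qed.

Lemma pm_null_bigcup (F : nat -> set (measurableTypeR R)) x :
  (forall n, measurable (F n)) -> (forall n, E (F n) x = 0) ->
  E (\bigcup_n F n) x = 0.
Proof.
move=> mF F0; have mU : measurable (\bigcup_n F n) by exact: bigcup_measurable.
apply/eqP; rewrite -vnorm_eq0 -sqrf_eq0 -(inj_eq (@EFin_inj _)) -pm_scalarE //.
rewrite eq_le measure_ge0 andbT.
rewrite (le_trans (generalized_Boole_inequality _ mF mU)) //.
by rewrite eseries0 // => n _ _; rewrite pm_scalarE // F0 vnorm0 expr0n.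
Qed.

(** Points off the support have null neighbourhoods, and countably many null intervals cover them
    all. The complement of these is a measurable set of admissible sample points that carries the
    whole mass. *)
Lemma pm_supp_carrier : exists K : set (measurableTypeR R),
  [/\ measurable K, K `<=` pm_supp E & forall x, E (~` K) x = 0].
Proof.
pose Q (I : set R) := exists J : set (measurableTypeR R),
  [/\ measurable J, I `<=` J & forall x, E J x = 0].
have [|||F [mF QF AF]] := @locally_null_cover Q (~` pm_supp E).
- move=> I J IJ [J' [mJ JJ J0]].
  by exists J'; split => //; exact: subset_trans JJ.
- move=> l /= nl.
  have [r r0 hr] : exists2 r : R, 0 < r & forall x, E `]l - r, l + r[%classic x = 0.
    apply: contrapT => h; apply: nl => r r0; apply: contrapT => h'.
    by apply: h; exists r => // x; apply: contrapT => hx; apply: h'; exists x.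
  by exists r => //; exists `]l - r, l + r[%classic; split => //; exact: measurable_itv.
- by exists set0; split => // x; exact: (pm0 hH).
have mU : measurable (\bigcup_n (F n : set (measurableTypeR R))) by exact: bigcup_measurable.
exists (~` \bigcup_n (F n : set (measurableTypeR R))); split => //.
- exact: measurableC.
- by move=> l /= h; apply: contrapT => nl; apply: h; exact: AF.
move=> x; rewrite setCK; apply: pm_null_bigcup => // n.
have [J [mJ FJ J0]] := QF n.
have -> : F n = F n `&` J by apply/esym/setIidPl.
by rewrite -(pmI hH) // J0 (lin0 (pm_linear E (mF n))).
Qed.

(** The integrand vanishes at 0, and off 0 the four measures of the polarization coincide with that
    of w because |i^k| = 1; their contributions cancel, the powers of i adding up to 0. *)
Lemma pm_point_in x : S (E [set 0] x, 0).
Proof.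
set v := E _ x; rewrite hE.
have m0 : measurable ([set 0] : set (measurableTypeR R)) by exact: measurable_set1.
have Ev : E [set 0] v = v by exact: pm_idem.
have dv : spectral_dom E (fun l => l%:C) v.
  apply: (spectral_dom_bounded hH (C := 0) m0 _ Ev) => l ->.
  by rewrite normr0.
split => // w dw /=; rewrite dot0l.
have h (u u' : H) : (forall A, measurable A -> A `<=` ~` [set 0] -> pm_scalar E u A = pm_scalar E u' A) ->
    \int[pm_scalar E u]_(l in setT) l = \int[pm_scalar E u']_(l in setT) (l : R).
  move=> huu.
  have e (m : {measure set (measurableTypeR R) -> \bar R}) :
      \int[m]_(l in setT) l = \int[m]_(l in ~` [set (0:R)]) l.
    rewrite [RHS]Rintegral_mkcond; apply: eq_Rintegral => l _.
    by rewrite patchE; case: ifPn => //; rewrite notin_setE /= => /contrapT ->.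
  by rewrite !e /Rintegral; congr fine; apply: eq_measure_integral.
pose c := \int[pm_scalar E w]_(l in setT) (l : R).
rewrite (eq_bigr (fun k : 'I_4 => 'i ^+ k * c%:C)); last first.
  move=> k _; congr (_ * _); rewrite /cintegral /= Rintegral_cst // mul0r.
  congr (_ +i* _); apply: h => A mA A0.
  rewrite !(pm_scalarE hH) // (linD (pm_linear E mA)) (linZ (pm_linear E mA)).
  rewrite -Ev (pm_disj hH E v m0 mA) ?add0r.
  - by rewrite vnormZ absX absi expr1n mul1r.
  - by apply/seteqP; split => // l [-> /A0]; apply.
rewrite !big_ord_recl big_ord0 /= /bump /=.
have -> : ('i : R[i]) ^+ (1 + 1)%N = -1 by rewrite sqrCi.
have -> : ('i : R[i]) ^+ (1 + (1 + (1 + 0)))%N = - 'i by rewrite exprS sqrCi mulrN1.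
by rewrite expr0 expr1; ring.
Qed.

(** If S x = 0, [spectral_key] on the interval of radius |l| / 4 about l <> 0 gives |l| |E x| <=
    (|l| / 2) |E x|, so x has no mass near l; countably many such intervals cover the complement of
    0. *)
Lemma pm_kerP x : ker S x <-> E [set 0] x = x.
Proof.
split=> [Sx|<-]; last exact: pm_point_in.
have m0 : measurable ([set 0] : set (measurableTypeR R)) by exact: measurable_set1.
pose Q (I : set R) := exists J : set (measurableTypeR R),
  [/\ measurable J, I `<=` J & E J x = 0].
have [|||F [mF QF AF]] := @locally_null_cover Q (~` [set 0]).
- move=> I J IJ [J' [mJ JJ J0]].
  by exists J'; split => //; exact: subset_trans JJ.
- move=> l /eqP l0; exists (`|l| / 4); first by rewrite divr_gt0 ?normr_gt0.
  set J := `]_, _[%classic; have mJ : measurable (J : set (measurableTypeR R)) by exact: measurable_itv.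
  exists J; split => //.
  have l4 : 0 <= `|l| / 4 by rewrite divr_ge0.
  have Jl k : J k -> `|k - l| <= `|l| / 4.
    by rewrite /J /= in_itv /= => /andP[? ?]; rewrite ler_norml; lra.
  have := spectral_key hH hE mJ l4 Jl Sx.
  rewrite (lin0 (pm_linear E mJ)) sub0r vnormN vnormZ absR => h.
  apply/eqP; rewrite -vnorm_eq0 eq_le vnorm_ge0 andbT.
  rewrite -(@ler_pM2l _ `|l|) ?normr_gt0 // mulr0.
  by have := vnorm_ge0 (E J x); have : 0 <= `|l| by []; nra.
- by exists set0; split => //; exact: (pm0 hH).
have mU : measurable (\bigcup_n (F n : set (measurableTypeR R))) by exact: bigcup_measurable.
have U0 : E (\bigcup_n (F n : set (measurableTypeR R))) x = 0.
  apply: pm_null_bigcup => // n; have [J [mJ FJ J0]] := QF n.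
  have -> : F n = F n `&` J by apply/esym/setIidPl.
  by rewrite -(pmI hH) // J0 (lin0 (pm_linear E (mF n))).
have mC := measurableC m0.
have C0 : E (~` [set 0]) x = 0.
  have -> : ~` [set 0] = ~` [set 0] `&` \bigcup_n (F n : set (measurableTypeR R)).
    by apply/esym/setIidPl.
  by rewrite -(pmI hH) // U0 (lin0 (pm_linear E mC)).
by rewrite -[RHS](pm_projT E) -(setUv [set 0]) (pmU hH) // ?C0 ?addr0 // setICr.
Qed.

Lemma resolvent_point z x : resolvent_set S z -> z != 0 ->
  resolvent S z (E [set 0] x) = - z^-1 *: E [set 0] x.
Proof.
move=> rz z0; apply/esym/(resolventP rz).
have := self_adjoint_linear saS (- z^-1) (pm_point_in x) (pm_point_in 0).
rewrite scaler0 (lin0 (pm_linear E _)) ?addr0; last exact: measurable_set1.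
by rewrite scalerA mulrN mulfV // scaleN1r addrN.
Qed.

Lemma resolvent_point_proj z x : resolvent_set S z -> z != 0 ->
  E [set 0] (resolvent S z x) = - z^-1 *: E [set 0] x.
Proof.
move=> rz z0; have m0 : measurable ([set 0] : set (measurableTypeR R)) by exact: measurable_set1.
have h0 (l : measurableTypeR R) : [set 0] l -> `|l - 0| <= 0 :> R by move=> ->; rewrite subrr normr0.
have := spectral_key hH hE m0 (lexx 0) h0 (resolvent_in rz x).
rewrite mulr0 mul0r scale0r subr0 => h.
have /eqP : vnorm (E [set 0] (x + z *: resolvent S z x)) == 0 by rewrite eq_le h vnorm_ge0.
move/eqP; rewrite vnorm_eq0 (linD (pm_linear E m0)) (linZ (pm_linear E m0)).
rewrite addrC addr_eq0 => /eqP /(congr1 (fun v => z^-1 *: v)).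
by rewrite scalerA mulVf // scale1r scalerN scaleNr.
Qed.

Lemma pm_tail x (eps : R) : 0 < eps -> exists N : nat,
  vnorm (E (~` `[- N%:R, N%:R[%classic) x) <= eps.
Proof.
move=> eps0.
pose F (n : nat) : set (measurableTypeR R) := `[- n%:R, n%:R[%classic.
have mF n : measurable (F n) by exact: measurable_itv.
have FT : \bigcup_n F n = setT.
  apply/seteqP; split => // l _; exists (Num.bound l) => //.
  rewrite /F /= in_itv /=.
  have := archi_boundP (normr_ge0 l).
  have -> : Num.bound l = Num.bound `|l|.
    by rewrite /Num.bound normr_id.
  by rewrite ltr_norml => /andP[/ltW -> ->].
have h : (pm_scalar E x \o F) n @[n --> \oo] --> pm_scalar E x (\bigcup_n F n).
  apply: nondecreasing_cvg_mu => //; first by rewrite FT.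
  move=> n m nm; apply/subsetPset => l; rewrite /F /= !in_itv /= => /andP[l1 l2].
  have nm' : n%:R <= m%:R :> R by rewrite ler_nat.
  by rewrite (le_trans _ l1) ?lerN2 //= (lt_le_trans l2).
rewrite FT (pm_scalarT hH) in h.
have h' : vnorm (E (F n) x) ^+ 2 @[n --> \oo] --> vnorm x ^+ 2.
  have : fine (pm_scalar E x (F n)) @[n --> \oo] --> vnorm x ^+ 2 by exact: fine_cvg.
  by apply: cvg_trans; apply: near_eq_cvg; apply: nearW => n; rewrite (pm_scalarE hH).
have e2 : 0 < eps ^+ 2 by rewrite exprn_gt0.
have /cvgrPdist_le /(_ _ e2)[N _ /(_ N (leqnn N)) /= hN] := h'.
exists N; rewrite -(@ler_pXn2r _ 2) ?nnegrE ?vnorm_ge0 ?(ltW eps0) //.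
have mC := measurableC (mF N).
have : pm_scalar E x setT = (pm_scalar E x (F N) + pm_scalar E x (~` F N))%E.
  by rewrite -measureU ?setUv // setICr.
rewrite (pm_scalarT hH) !(pm_scalarE hH) // -EFinD => -[e].
by rewrite (le_trans _ hN) // (le_trans _ (ler_norm _)) // e addrAC subrr add0r.
Qed.

(* Riemann sums for [int_(l != 0) (l - z)^-1 d mu_x(l)], with an error that depends
   on [z] only through [z^-1] and the norm of the resolvent at [z]. *)
Lemma resolvent_approx x (eta : R) : 0 < eta ->
  exists (n : nat) (c a : nat -> R),
  [/\ forall j, a j = 0 \/ (pm_supp E (c j) /\ c j != 0), forall j, 0 <= a j,
    \sum_(0 <= j < n) a j <= vnorm x ^+ 2 &
    forall z (B : R), resolvent_set S z -> z != 0 -> 0 <= B -> op_le (resolvent S z) B ->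
    abs (dot (resolvent S z (x - E [set 0] x)) x
         - \sum_(0 <= j < n) (a j)%:C / ((c j)%:C - z))
    <= eta * (B * (1 + (2 + B ^+ 2) * vnorm x ^+ 2))].
Proof.
move=> eta0.
have [K [mK Ksupp K0]] := pm_supp_carrier.
have [N hN] := pm_tail x eta0.
(* The mesh: [-N, N[ is cut into n cells of length 2 N / n, at most [eta]. *)
have [n [n0 hn]] : exists n : nat, (0 < n)%N /\ 2 * N%:R / n%:R <= eta.
  exists (Num.bound (eta^-1 * (2 * N%:R))).+1; split => //.
  rewrite ler_pdivrMr ?ltr0n // -ler_pdivrMl // ltW //.
  rewrite (lt_le_trans (archi_boundP _)) ?mulr_ge0 ?invr_ge0 ?ler0n ?(ltW eta0) //.
  by rewrite ler_nat.
set h := _ / _ in hn.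
have h0 : 0 <= h by rewrite divr_ge0 // mulr_ge0.
pose t (j : nat) : R := - N%:R + j%:R * h.
have m0 : measurable ([set 0] : set (measurableTypeR R)) by exact: measurable_set1.
have mK0 := measurableD mK m0.
(* The cells are restricted to nonzero points of the carrier, so that every sample point is a
   nonzero point of the support. *)
pose M j : set (measurableTypeR R) := (K `\ 0) `&` `[t j, t j.+1[%classic.
pose V j : set (measurableTypeR R) := (K `\ 0) `&` `[t 0%N, t j[%classic.
have mM j : measurable (M j) by apply: measurableI => //; exact: measurable_itv.
have mV j : measurable (V j) by apply: measurableI => //; exact: measurable_itv.
have tS j : t j <= t j.+1 by rewrite /t lerD2l ler_wpM2r // ler_nat.
have t0 j : t 0%N <= t j by rewrite /t mul0r addr0 lerDl mulr_ge0.
have VS j : V j.+1 = V j `|` M j.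
  rewrite /V /M -setIUr; congr (_ `&` _).
  apply/seteqP; split => l /=; rewrite !in_itv /=.
    move=> /andP[l1 l2]; have [lt|tl] := ltP l (t j); first by left; rewrite l1.
    by right; rewrite l2.
  move=> [/andP[-> l2]|/andP[l1 ->]]; first by rewrite (lt_le_trans l2).
  by rewrite (le_trans (t0 j) l1).
have VMj j : V j `&` M j = set0.
  apply/seteqP; split => // l [[_ /=]]; rewrite in_itv /= => /andP[_ l1] [_ /=].
  by rewrite in_itv /= leNgt l1.
have EV j y : E (V j) y = \sum_(0 <= i < j) E (M i) y.
  elim: j => [|j IH].
    rewrite big_geq // (_ : V 0%N = set0) ?(pm0 hH) //.
    apply/seteqP; split => // l [_ /=]; rewrite in_itv /= => /andP[l1].
    by rewrite ltNge l1.
  by rewrite VS (pmU hH) // IH big_nat_recr.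
pose a j := vnorm (E (M j) x) ^+ 2.
(* An arbitrary point of the cell; for an empty cell the value 0 is a dummy, whose weight [a j] is
   0. *)
pose c j : R := if pselect (exists l, M j l) is left e then projT1 (cid e) else 0.
have cM j : E (M j) x <> 0 -> M j (c j).
  move=> Ex; rewrite /c; case: pselect => [e|ne]; first by case: (cid e).
  exfalso; apply: Ex; rewrite (_ : M j = set0) ?(pm0 hH) //.
  by apply/seteqP; split => // l Ml; apply: ne; exists l.
have sumV j w : \sum_(0 <= i < j) vnorm (E (M i) w) ^+ 2 = vnorm (E (V j) w) ^+ 2.
  elim: j => [|j IH].
    by rewrite EV !big_geq // vnorm0 expr0n.
  rewrite big_nat_recr //= IH; apply: EFin_inj; rewrite EFinD -!(pm_scalarE hH) //.
  by rewrite -measureU // -VS.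
have sumV_le w : \sum_(0 <= i < n) vnorm (E (M i) w) ^+ 2 <= vnorm w ^+ 2.
  by rewrite sumV ler_pXn2r ?nnegrE ?vnorm_ge0 // (pm_vnorm_le hH).
have Mc j l : E (M j) x <> 0 -> M j l -> `|l - c j| <= h.
  move=> Ex; have [_ /=] := cM _ Ex; rewrite in_itv /= => /andP[c1 c2].
  move=> [_ /=]; rewrite in_itv /= => /andP[l1 l2].
  have : t j.+1 = t j + h by rewrite /t -addn1 natrD mulrDl mul1r addrA.
  by rewrite ler_norml; lra.
exists n, c, a; split.
- move=> j; have [Ex|Ex] := pselect (E (M j) x = 0).
    by left; rewrite /a Ex vnorm0 expr0n.
  by right; have [[/Ksupp ? /eqP ?] _] := cM _ Ex.
- by move=> j; rewrite sqr_ge0.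
- exact: sumV_le.
move=> z B rz z0 B0 hB; pose y := resolvent S z x.
have mC0 : measurable (~` [set 0] : set (measurableTypeR R)) by exact: measurableC.
(* What the cells miss apart from the point 0; up to a null set it lies outside [-N, N[, where x has
   norm at most [eta]. *)
pose T : set (measurableTypeR R) := ~` [set 0] `\` V n.
have mT : measurable T by exact: measurableD.
have -> : resolvent S z (x - E [set 0] x) = E (V n) y + E T y.
  rewrite (linB (resolvent_linear rz)) (resolvent_point _ rz z0).
  rewrite -(resolvent_point_proj _ rz z0) -/y.
  have {1}-> : y = E [set 0] y + E (~` [set 0]) y.
    by rewrite -(pmU hH) ?setICr // setUv (pm_projT E).
  rewrite addrAC subrr add0r -(pmU hH) //; last by apply/seteqP; split => // l [? []].
  by rewrite /T setDUK // => l [[_]].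
have ET : vnorm (E T x) <= eta.
  have mTK := measurableI _ _ mT mK.
  have mTK' := measurableI _ _ mT (measurableC mK).
  have -> : E T x = E (T `&` K) x.
    have {1}-> : T = (T `&` K) `|` (T `&` ~` K) by rewrite -setIUr setUv setIT.
    rewrite (pmU hH) //; last by apply/seteqP; split => // l [[_ ?] [_]].
    by rewrite -(pmI hH E x mT (measurableC mK)) K0 (lin0 (pm_linear E mT)) addr0.
  apply: le_trans hN; apply: (pm_vnorm_mono hH) => //.
    by apply: measurableC; exact: measurable_itv.
  move=> l [[l0 nV] Kl] /=; apply: contra_not nV => lN; split => //=.
  move: lN; rewrite !in_itv /= /t mul0r addr0 /h.
  by rewrite mulrC mulfVK ?pnatr_eq0 -?lt0n //; have -> : - N%:R + 2 * N%:R = N%:R :> R by ring.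
have yx : vnorm y <= B * vnorm x by exact: hB.
(* On a cell, [spectral_key] gives E x = q E y + r with |r| <= 2 h |E y|, so the error is <r, E x> /
   q up to sign; 1 / |q| <= B because the sample point is in the support. *)
have term j : abs (dot (E (M j) y) x - (a j)%:C / ((c j)%:C - z)) <=
    h * B * (vnorm (E (M j) y) ^+ 2 + vnorm (E (M j) x) ^+ 2).
  rewrite (pm_dot _ _ _ (mM j)); have [Ex|Ex] := pselect (E (M j) x = 0).
    by rewrite /a Ex dot0r vnorm0 expr0n mul0r subrr abs0 !mulr_ge0 // addr0 sqr_ge0.
  have [[/Ksupp sc _] _] := cM _ Ex.
  have hd := pm_supp_dist hH hE B0 sc rz hB; rewrite absBC in hd.
  set q := (c j)%:C - z in hd *.
  have q0 : q != 0.
    by apply/eqP => q0; move: hd; rewrite q0 abs0 mulr0 ler10.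
  have q0' : 0 < abs q by rewrite abs_gt0.
  set r := E (M j) x - q *: E (M j) y.
  have rle : vnorm r <= 2 * h * vnorm (E (M j) y).
    have := spectral_key hH hE (mM j) h0 (fun l => Mc _ l Ex) (resolvent_in rz x).
    rewrite (linD (pm_linear E (mM j))) (linZ (pm_linear E (mM j))).
    by rewrite -addrA -scalerBl -[z - _]opprB scaleNr.
  have -> : dot (E (M j) y) (E (M j) x) - (a j)%:C / q = - (dot r (E (M j) x) / q).
    rewrite /a -(dotxx hH) /r dotBl dotZl; field.
    by [].
  rewrite absN absM absV ler_pdivrMr //.
  rewrite (le_trans (cauchy_schwarz hH _ _)) //.
  rewrite (le_trans (ler_wpM2r (vnorm_ge0 _) rle)) //.
  have amgm : 2 * (vnorm (E (M j) y) * vnorm (E (M j) x)) <=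
      vnorm (E (M j) y) ^+ 2 + vnorm (E (M j) x) ^+ 2.
    by rewrite -subr_ge0 (_ : _ - _ = (vnorm (E (M j) y) - vnorm (E (M j) x)) ^+ 2) ?sqr_ge0 //; ring.
  set Q := _ + _ in amgm *; have Q0 : 0 <= Q by rewrite addr_ge0 ?sqr_ge0.
  apply: (@le_trans _ _ (h * Q)).
    by rewrite [leLHS](_ : _ = h * (2 * (vnorm (E (M j) y) * vnorm (E (M j) x)))) ?ler_wpM2l //; ring.
  by rewrite [leRHS](_ : _ = h * Q * (B * abs q)) ?ler_peMr ?mulr_ge0 //; ring.
rewrite dotDl EV dot_suml addrAC -sumrB.
rewrite (le_trans (absD _ _)) //.
have h2 : abs (dot (E T y) x) <= eta * (B * vnorm x).
  rewrite (pm_sym _ _ _ mT) (le_trans (cauchy_schwarz hH _ _)) // mulrC.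
  by rewrite ler_pM ?vnorm_ge0.
have h1 : abs (\sum_(0 <= j < n) (dot (E (M j) y) x - (a j)%:C / ((c j)%:C - z))) <=
    eta * (B * ((1 + B ^+ 2) * vnorm x ^+ 2)).
  rewrite (le_trans (abs_sum _ _ _)) //.
  rewrite (le_trans (ler_sum _ (fun j _ => term j))) // -mulr_sumr big_split /=.
  have hBh : h * B <= eta * B by rewrite ler_wpM2r.
  rewrite [leRHS]mulrA (le_trans _ (ler_wpM2r _ hBh)) //; last first.
    by rewrite mulr_ge0 ?sqr_ge0 // addr_ge0 ?sqr_ge0.
  rewrite ler_wpM2l ?mulr_ge0 // (le_trans (lerD (sumV_le y) (sumV_le x))) //.
  rewrite mulrDl mul1r addrC lerD2l -exprMn.
  by rewrite ler_pXn2r ?nnegrE ?vnorm_ge0 ?mulr_ge0 ?vnorm_ge0.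
rewrite (le_trans (lerD h1 h2)) // -mulrDr ler_wpM2l ?(ltW eta0) // -mulrDr ler_wpM2l //.
have : 0 <= B ^+ 2 by rewrite sqr_ge0.
have := sqr_ge0 (vnorm x - 1); nra.
Qed.

End SpectralApproximation.

(** * The reduced trace *)

Section Approximable.
Context {R : realType}.
Variables (U : set R[i]) (P : set R).
Implicit Types (G : R[i] -> R[i]).

Definition simple_fractions (s : seq (R * R)) (z : R[i]) : R[i] :=
  \sum_(p <- s) p.1%:C / (p.2%:C - z).

(** Neither the number of fractions nor the size of their coefficients is controlled, so later
    estimates may use only the uniform closeness on U. *)
Definition approximable G : Prop := forall eta : R, 0 < eta ->
  exists s : seq (R * R), (forall p, p \in s -> P p.2) /\
    forall z, U z -> abs (G z - simple_fractions s z) <= eta.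

Lemma approximable0 : approximable (fun=> 0).
Proof.
move=> eta eta0; exists [::]; split => // z _.
by rewrite /simple_fractions big_nil subrr abs0 ltW.
Qed.

Lemma approximableD G1 G2 : approximable G1 -> approximable G2 ->
  approximable (fun z => G1 z + G2 z).
Proof.
move=> h1 h2 eta eta0; have e2 : 0 < eta / 2 by rewrite divr_gt0.
have [s1 [P1 h1']] := h1 _ e2; have [s2 [P2 h2']] := h2 _ e2.
exists (s1 ++ s2); split => [p|z Uz].
  by rewrite mem_cat => /orP[/P1|/P2].
rewrite /simple_fractions big_cat /= opprD addrACA (le_trans (absD _ _)) //.
by rewrite (splitr eta) lerD ?h1' ?h2'.
Qed.

Lemma approximableN G : approximable G -> approximable (fun z => - G z).
Proof.
move=> h eta eta0; have [s [Ps hs]] := h _ eta0.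
exists [seq (- p.1, p.2) | p <- s]; split => [p /mapP[q qs ->]|z Uz]; first by move/Ps: qs.
rewrite /simple_fractions big_map /=.
under eq_bigr do rewrite rmorphN mulNr.
by rewrite sumrN -opprD absN hs.
Qed.

End Approximable.

Section ReducedTrace.
Context {R : realType} {H : completeNormedModType R[i]}.
Variable dot : {dot H for @Num.conj R[i]}.
Hypothesis hH : hilbert dot.
Variables (S1 S2 : operator H) (E1 E2 : projection_measure dot) (m1 m2 : nat).
Hypotheses (saS1 : self_adjoint dot S1) (saS2 : self_adjoint dot S2).
Hypotheses (hE1 : spectral_measure_of E1 S1) (hE2 : spectral_measure_of E2 S2).
Hypotheses (hm1 : has_dim (ker S1) m1) (hm2 : has_dim (ker S2) m2).
Variable z0 : R[i].
Hypotheses (r01 : resolvent_set S1 z0) (r02 : resolvent_set S2 z0).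
Hypothesis tc0 : trace_class dot (fun x => resolvent S2 z0 x - resolvent S1 z0 x).

Definition reduced_term (e : nat -> H) (k : nat) (z : R[i]) : R[i] :=
  dot (resolvent S2 z (e k - E2 [set 0] (e k)) - resolvent S1 z (e k - E1 [set 0] (e k))) (e k).

(** [tr] is a choice among the numbers that are limits in every basis; the existence of one basis
    makes such a number unique. *)
Lemma tr_unique A (t : R[i]) e : orthonormal_basis dot e ->
  (forall e, orthonormal_basis dot e ->
    series (fun n => dot (A (e n)) (e n)) @ \oo --> t) -> tr dot A = t.
Proof.
move=> he h; pose P := [set u : R[i] | forall e, orthonormal_basis dot e ->
  series (fun n => dot (A (e n)) (e n)) @ \oo --> u].
have hg : P (get P) by apply: getPex; exists t.
exact: norm_cvg_unique (hg _ he) (h _ he).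
Qed.

Lemma point_nuclear (S : operator H) (E : projection_measure dot) m : self_adjoint dot S -> spectral_measure_of E S ->
  has_dim (ker S) m -> exists C, nuclear (E [set 0]) m%:R C.
Proof.
move=> saS hE; apply: (projection_nuclear hH).
  by apply: (pm_projP E); exact: measurable_set1.
exact: (pm_kerP hH).
Qed.

(** The resolvent at z acts on the range of the projection onto the kernel as - 1 / z. So the
    reduced trace is the trace of the transported difference plus (m2 - m1) / z, and the nuclear
    bounds of the three operators control all partial sums at once. *)
Lemma reduced_trace_exists : exists (C : R) (e : nat -> H), [/\ 0 <= C,
  orthonormal_basis dot e &
  forall z (B : R), resolvent_set S1 z -> resolvent_set S2 z -> z != 0 -> 0 <= B ->
    op_le (resolvent S1 z) B -> op_le (resolvent S2 z) B ->
  [/\ series (fun k => reduced_term e k z) @ \oo --> reduced_trace S1 S2 E1 E2 z,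
    forall K, abs (series (fun k => reduced_term e k z) K) <=
      C * ((1 + abs (z - z0) * B) ^+ 2 + (abs z)^-1) &
    reduced_trace S1 S2 E1 E2 z =
      tr dot (fun x => resolvent S2 z x - resolvent S1 z x) + (m2%:R - m1%:R) / z]].
Proof.
(* The definition of trace class provides an orthonormal basis, which is then used for every z. *)
have [_ [_ [_ [e [he _]]]]] := tc0.
have [t [C0 hC0]] := trace_class_nuclear hH tc0.
have [C1 hC1] := point_nuclear saS1 hE1 hm1.
have [C2 hC2] := point_nuclear saS2 hE2 hm2.
have Cge0 (A : H -> H) (t' : R[i]) (C : R) : nuclear A t' C -> 0 <= C.
  move=> hA; have [_ /(_ 0%N)] := nuclear_trace hH hA he.
  by apply: le_trans; exact: abs_ge0.
have C00 := Cge0 _ _ _ hC0; have C10 := Cge0 _ _ _ hC1; have C20 := Cge0 _ _ _ hC2.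
exists (C0 + C1 + C2), e; split => //; first by rewrite !addr_ge0.
move=> z B r1 r2 z0' B0 hB1 hB2.
pose X1 y := y + (z - z0) *: resolvent S1 z y.
pose X2 y := y + (z - z0) *: resolvent S2 z y.
have lX (S : operator H) : resolvent_set S z -> linear (fun y => y + (z - z0) *: resolvent S z y).
  move=> rS a u v; rewrite (resolvent_linear rS) scalerDr !scalerA mulrC -scalerA.
  by rewrite scalerDr addrACA.
have leX (S : operator H) : op_le (resolvent S z) B ->
    op_le (fun y => y + (z - z0) *: resolvent S z y) (1 + abs (z - z0) * B).
  move=> hB y; rewrite (le_trans (vnormD _ _)) // mulrDl mul1r lerD2l vnormZ -mulrA.
  by rewrite ler_wpM2l ?abs_ge0.
have D0 : 0 <= 1 + abs (z - z0) * B by rewrite addr_ge0 // mulr_ge0 ?abs_ge0.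
have [t' ht'] := nuclear_comp (lX _ r2) (lX _ r1) D0 D0 (leX _ hB2) (leX _ hB1) hC0.
have dE x : resolvent S2 z x - resolvent S1 z x =
    X2 (resolvent S2 z0 (X1 x) - resolvent S1 z0 (X1 x)).
  exact: (resolvent_difference x saS1 saS2 r1 r01 r2 r02).
have termE e' k : reduced_term e' k z = dot (X2 (resolvent S2 z0 (X1 (e' k)) - resolvent S1 z0 (X1 (e' k)))) (e' k)
    + (z^-1 * dot (E2 [set 0] (e' k)) (e' k) - z^-1 * dot (E1 [set 0] (e' k)) (e' k)).
  rewrite /reduced_term -dE (linB (resolvent_linear r2)) (linB (resolvent_linear r1)).
  rewrite (resolvent_point hH saS2 hE2 _ r2 z0') (resolvent_point hH saS1 hE1 _ r1 z0').
  rewrite !dotBl !dotZl; ring.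
have seriesE e' K : series (fun k => reduced_term e' k z) K =
    series (fun k => dot (X2 (resolvent S2 z0 (X1 (e' k)) - resolvent S1 z0 (X1 (e' k)))) (e' k)) K
    + (z^-1 * series (fun k => dot (E2 [set 0] (e' k)) (e' k)) K
       - z^-1 * series (fun k => dot (E1 [set 0] (e' k)) (e' k)) K).
  rewrite /series /= (eq_bigr _ (fun k _ => termE e' k)) big_split /= sumrB -!mulr_sumr.
  by [].
have lim e' : orthonormal_basis dot e' -> series (fun k => reduced_term e' k z) @ \oo -->
    t' + (z^-1 * m2%:R - z^-1 * m1%:R).
  move=> he'; rewrite (funext (seriesE e')).
  have [h0 _] := nuclear_trace hH ht' he'.
  have [h1 _] := nuclear_trace hH hC1 he'.
  have [h2 _] := nuclear_trace hH hC2 he'.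
  exact: (cvgD h0 (cvgB (cvg_cmul _ h2) (cvg_cmul _ h1))).
have FE : reduced_trace S1 S2 E1 E2 z = t' + (z^-1 * m2%:R - z^-1 * m1%:R).
  exact: tr_unique he lim.
split.
- by rewrite FE; exact: lim.
- move=> K; rewrite seriesE.
  have [_ /(_ K) h0] := nuclear_trace hH ht' he.
  have [_ /(_ K) h1] := nuclear_trace hH hC1 he.
  have [_ /(_ K) h2] := nuclear_trace hH hC2 he.
  rewrite -mulrBr (le_trans (absD _ _)) // absM absV.
  have zV : 0 <= (abs z)^-1 by rewrite invr_ge0 abs_ge0.
  have h12 := le_trans (absB _ _) (lerD h2 h1).
  rewrite (le_trans (lerD h0 (ler_wpM2l zV h12))) // -expr2.
  set p := _ ^+ 2; have p0 : 0 <= p by rewrite sqr_ge0.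
  have := mulr_ge0 C00 zV; have := mulr_ge0 C10 p0; have := mulr_ge0 C20 p0.
  by nra.
- have trE : tr dot (fun x => resolvent S2 z x - resolvent S1 z x) = t'.
    apply: (tr_unique he) => e' he'; have [h0 _] := nuclear_trace hH ht' he'.
    have -> : (fun n => dot (resolvent S2 z (e' n) - resolvent S1 z (e' n)) (e' n)) =
      fun k => dot (X2 (resolvent S2 z0 (X1 (e' k)) - resolvent S1 z0 (X1 (e' k)))) (e' k).
      by apply/funext => k; rewrite dE.
    exact: h0.
  by rewrite FE trE [(_ - _) / z]mulrC mulrBr.
Qed.

Lemma reduced_term_approximable (U : set R[i]) (B : R) e K : 0 <= B ->
  (forall z, U z -> [/\ resolvent_set S1 z, resolvent_set S2 z, z != 0,
     op_le (resolvent S1 z) B & op_le (resolvent S2 z) B]) ->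
  approximable U [set l | [/\ l != 0, (spectrum S1 `|` spectrum S2) l%:C &
      forall z, U z -> 1 <= B * abs (z - l%:C)]]
    (fun z => series (fun k => reduced_term e k z) K).
Proof.
move=> B0 hU.
set Q := [set _ | _].
have one S (E : projection_measure dot) x : self_adjoint dot S -> spectral_measure_of E S ->
    (forall z, U z -> [/\ resolvent_set S z, z != 0 & op_le (resolvent S z) B]) ->
    spectrum S `<=` spectrum S1 `|` spectrum S2 ->
    approximable U Q (fun z => dot (resolvent S z (x - E [set 0] x)) x).
  move=> saS hE hUS sS eta eta0.
  set D := B * (1 + (2 + B ^+ 2) * vnorm x ^+ 2).
  have D0 : 0 <= D by rewrite mulr_ge0 // addr_ge0 // mulr_ge0 ?addr_ge0 ?sqr_ge0.
  have D1 : 0 < D + 1 by rewrite ltr_wpDl.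
  have [n [c [a [ca a0 _ hca]]]] := resolvent_approx hH saS hE x (divr_gt0 eta0 D1).
  (* Terms of weight 0 are discarded, since their points may be dummies outside the admissible set
     of poles. *)
  exists [seq (a j, c j) | j <- iota 0 n & a j != 0]; split.
    move=> p /mapP[j]; rewrite mem_filter => /andP[aj _] -> /=.
    have [aj0|[sc cj]] := ca j; first by rewrite aj0 eqxx in aj.
    split => //.
      by apply: sS; exact: (pm_supp_spectrum hH hE).
    by move=> z /hUS[rz _ hB]; exact: (pm_supp_dist hH hE B0 sc rz hB).
  move=> z /hUS[rz zn0 hB].
  have -> : simple_fractions [seq (a j, c j) | j <- iota 0 n & a j != 0] z =
      \sum_(0 <= j < n) (a j)%:C / ((c j)%:C - z).
    rewrite /simple_fractions big_map big_filter /= big_mkcond /= /index_iota subn0.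
    by apply: eq_bigr => j _; case: eqP => // ->; rewrite mul0r.
  rewrite (le_trans (hca _ _ rz zn0 B0 hB)) // -/D.
  rewrite -mulrA ler_piMr ?(ltW eta0) // mulrC ler_pdivrMr // mul1r lerDl //.
elim: K => [|K IH].
  by rewrite /series /=; under eq_fun do rewrite big_geq //; exact: approximable0.
rewrite /series /=; under eq_fun do rewrite big_nat_recr //=.
apply: approximableD => //; rewrite /reduced_term; under eq_fun do rewrite dotBl.
apply: approximableD; [|apply: approximableN].
- by apply: one => // z /hU[].
- by apply: one => // z /hU[].
Qed.

End ReducedTrace.

(** * Integrals of complex-valued functions *)

Section ComplexMeasurable.
Context {R : realType} {d : measure_display} {T : measurableType d}.
Variable A : set T.
Implicit Types (f g : T -> R[i]).

Definition cmeasurable f : Prop :=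
  measurable_fun A (fun x => cRe (f x)) /\ measurable_fun A (fun x => cIm (f x)).

Lemma cmeasurable_cst c : cmeasurable (fun=> c).
Proof. by split; exact: measurable_cst. Qed.

Lemma cmeasurable_real (h : T -> R) : measurable_fun A h -> cmeasurable (fun x => (h x)%:C).
Proof. by move=> mh; split => //=; exact: measurable_cst. Qed.

Lemma cmeasurableD f g : cmeasurable f -> cmeasurable g -> cmeasurable (fun x => f x + g x).
Proof.
move=> [f1 f2] [g1 g2]; split.
- by under eq_fun do rewrite cReD; exact: measurable_funD.
- by under eq_fun do rewrite cImD; exact: measurable_funD.
Qed.

Lemma cmeasurableN f : cmeasurable f -> cmeasurable (fun x => - f x).
Proof.
move=> [f1 f2]; split.
- by under eq_fun do rewrite cReN; exact: measurable_funN.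
- by under eq_fun do rewrite cImN; exact: measurable_funN.
Qed.

Lemma cmeasurableB f g : cmeasurable f -> cmeasurable g -> cmeasurable (fun x => f x - g x).
Proof. by move=> mf mg; apply: cmeasurableD => //; exact: cmeasurableN. Qed.

Lemma cmeasurableM f g : cmeasurable f -> cmeasurable g -> cmeasurable (fun x => f x * g x).
Proof.
move=> [f1 f2] [g1 g2]; split.
- by under eq_fun do rewrite cReM; apply: measurable_funB; exact: measurable_funM.
- by under eq_fun do rewrite cImM; apply: measurable_funD; exact: measurable_funM.
Qed.

Lemma cmeasurable_sum (I : Type) (r : seq I) (F : I -> T -> R[i]) :
  (forall i, cmeasurable (F i)) -> cmeasurable (fun x => \sum_(i <- r) F i x).
Proof.
move=> mF; elim: r => [|i r IH].
  by under eq_fun do rewrite big_nil; exact: cmeasurable_cst.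
by under eq_fun do rewrite big_cons; exact: cmeasurableD.
Qed.

Lemma measurable_abs_sqr f : cmeasurable f -> measurable_fun A (fun x => abs (f x) ^+ 2).
Proof.
by move=> [f1 f2]; under eq_fun do rewrite abs_sqr; apply: measurable_funD; exact: measurable_funX.
Qed.

Lemma measurable_abs f : cmeasurable f -> measurable_fun A (fun x => abs (f x)).
Proof.
move=> [f1 f2]; under eq_fun do rewrite absE.
apply: (@measurableT_comp _ _ _ _ _ _ (@Num.sqrt R)).
  exact: (continuous_measurable_fun (@sqrt_continuous R)).
by apply: measurable_funD; exact: measurable_funX.
Qed.

(** The functions x / (x^2 + 1 / (n + 1)) are continuous and converge pointwise to the inverse, also
    at 0, where the convention 0^-1 = 0 agrees with the limit. *)
Lemma measurable_fun_inverse (h : T -> R) : measurable_fun A h ->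
  measurable_fun A (fun x => (h x)^-1).
Proof.
move=> mh; apply: (@measurableT_comp _ _ _ _ _ _ (@GRing.inv R)) => //.
apply: (@measurable_fun_cvg _ _ _ _ (fun n (x : R) => x / (x ^+ 2 + n.+1%:R^-1))).
  move=> n; apply: continuous_measurable_fun => x.
  apply: cvgM; first exact: cvg_id.
  apply: cvgV; first by rewrite gt_eqF // ltr_wpDl ?sqr_ge0.
  by apply: cvgD (cvg_cst _); rewrite expr2; under eq_fun do rewrite expr2; apply: cvgM; exact: cvg_id.
move=> x _; have [->|x0] := eqVneq x 0.
  by under eq_fun do rewrite mul0r; rewrite invr0; exact: cvg_cst.
have -> : x^-1 = x / (x ^+ 2 + 0) by field.
apply: cvgM; first exact: cvg_cst.
apply: cvgV; first by rewrite addr0 expf_eq0.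
by apply: cvgD; [exact: cvg_cst | exact: cvg_harmonic].
Qed.

Lemma cmeasurableV f : cmeasurable f -> cmeasurable (fun x => (f x)^-1).
Proof.
move=> mf; have mn := measurable_fun_inverse (measurable_abs_sqr mf); have [f1 f2] := mf; split.
- by under eq_fun do rewrite cReV; exact: measurable_funM.
- by under eq_fun do rewrite cImV; apply: measurable_funN; exact: measurable_funM.
Qed.

Lemma cmeasurableX f n : cmeasurable f -> cmeasurable (fun x => f x ^+ n).
Proof.
move=> mf; elim: n => [|n IH]; first by under eq_fun do rewrite expr0; exact: cmeasurable_cst.
by under eq_fun do rewrite exprS; exact: cmeasurableM.
Qed.

Lemma cmeasurable_cvg (h : nat -> T -> R[i]) f : (forall n, cmeasurable (h n)) ->
  (forall x, A x -> h n x @[n --> \oo] --> f x) -> cmeasurable f.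
Proof.
move=> mh hf; split.
- apply: (@measurable_fun_cvg _ _ _ _ (fun n x => cRe (h n x))) => [n|x /hf]; first by case: (mh n).
  exact: cvg_Re.
- apply: (@measurable_fun_cvg _ _ _ _ (fun n x => cIm (h n x))) => [n|x /hf]; first by case: (mh n).
  exact: cvg_Im.
Qed.

Lemma cmeasurable_expi (h : T -> R) : measurable_fun A h -> cmeasurable (fun x => expi (h x)).
Proof.
move=> mh; split => /=.
- by apply: measurableT_comp mh; exact: (continuous_measurable_fun (@continuous_cos R)).
- by apply: measurableT_comp mh; exact: (continuous_measurable_fun (@continuous_sin R)).
Qed.

Lemma cmeasurable_cexp f : cmeasurable f -> cmeasurable (fun x => cexp (f x)).
Proof.
move=> [f1 f2]; apply: cmeasurableM; last exact: cmeasurable_expi.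
apply: cmeasurable_real; apply: measurableT_comp f1.
exact: (continuous_measurable_fun (@continuous_expR R)).
Qed.

End ComplexMeasurable.

Section ComplexIntegration.
Context {R : realType} {d : measure_display} {T : measurableType d}.
Variables (mu : {measure set T -> \bar R}) (A : set T).
Hypothesis mA : measurable A.
Implicit Types (f g : T -> R[i]).

Lemma cintegrable_measurable f : cintegrable mu A f -> cmeasurable A f.
Proof.
by move=> [/integrableP[/measurable_EFinP ? _] /integrableP[/measurable_EFinP ? _]].
Qed.

Lemma le_cintegrable f (g : T -> R) : cmeasurable A f -> mu.-integrable A (EFin \o g) ->
  (forall x, A x -> abs (f x) <= g x) -> cintegrable mu A f.
Proof.
move=> [f1 f2] ig fg; split; apply: le_integrable ig => //.
- exact/measurable_EFinP.
- move=> x Ax; rewrite lee_fin (le_trans (ler_Re_abs _)) // (le_trans (fg _ Ax)) //.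
  exact: ler_norm.
- exact/measurable_EFinP.
- move=> x Ax; rewrite lee_fin (le_trans (ler_Im_abs _)) // (le_trans (fg _ Ax)) //.
  exact: ler_norm.
Qed.

Lemma integrable_abs f : cintegrable mu A f -> mu.-integrable A (EFin \o (fun x => abs (f x))).
Proof.
move=> cf; have mf := cintegrable_measurable cf; have [i1 i2] := cf.
have h1 : mu.-integrable A (EFin \o (fun x => `|cRe (f x)|)) by exact: integrable_norm.
have h2 : mu.-integrable A (EFin \o (fun x => `|cIm (f x)|)) by exact: integrable_norm.
apply: le_integrable (integrableD mA h1 h2) => //.
  by apply/measurable_EFinP; exact: measurable_abs.
move=> x Ax; rewrite lee_fin ger0_norm ?abs_ge0 // ger0_norm ?addr_ge0 //.
exact: ler_abs_ReIm.
Qed.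

Lemma eq_cintegral f g : (forall x, A x -> f x = g x) -> cintegral mu A f = cintegral mu A g.
Proof.
by move=> fg; congr (_ +i* _); apply: eq_Rintegral => x; rewrite inE => /fg ->.
Qed.

Lemma eq_cintegrable f g : (forall x, A x -> f x = g x) -> cintegrable mu A f -> cintegrable mu A g.
Proof.
by move=> fg [h1 h2]; split; [apply: eq_integrable h1 | apply: eq_integrable h2] => // x;
  rewrite inE => /fg ->.
Qed.

Lemma cintegrableD f g : cintegrable mu A f -> cintegrable mu A g ->
  cintegrable mu A (fun x => f x + g x).
Proof.
move=> [f1 f2] [g1 g2]; split.
- by under eq_fun do rewrite cReD EFinD; exact: integrableD.
- by under eq_fun do rewrite cImD EFinD; exact: integrableD.
Qed.

Lemma cintegralD f g : cintegrable mu A f -> cintegrable mu A g ->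
  cintegral mu A (fun x => f x + g x) = cintegral mu A f + cintegral mu A g.
Proof.
move=> [f1 f2] [g1 g2]; rewrite /cintegral; apply: eq_ReIm => /=.
- by under eq_Rintegral do rewrite cReD; rewrite RintegralD.
- by under eq_Rintegral do rewrite cImD; rewrite RintegralD.
Qed.

Lemma cintegrableZ c f : cintegrable mu A f -> cintegrable mu A (fun x => c * f x).
Proof.
move=> cf; have mf := cintegrable_measurable cf.
have h : mu.-integrable A (EFin \o (fun x => abs c * abs (f x))).
  have -> : EFin \o (fun x => abs c * abs (f x)) = fun x => ((abs c)%:E * (abs (f x))%:E)%E.
    by apply/funext => x /=; rewrite EFinM.
  exact: integrableZl (integrable_abs cf).
apply: le_cintegrable h _; last by move=> x _; rewrite absM.
by apply: cmeasurableM => //; exact: cmeasurable_cst.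
Qed.

Lemma cintegralZ c f : cintegrable mu A f ->
  cintegral mu A (fun x => c * f x) = c * cintegral mu A f.
Proof.
move=> [f1 f2]; have Z (k : R) (h : T -> R) : mu.-integrable A (EFin \o h) ->
    mu.-integrable A (EFin \o (fun x => k * h x)).
  move=> ih; rewrite (_ : _ \o _ = fun x => (k%:E * (h x)%:E)%E); first exact: integrableZl.
  by apply/funext => x /=; rewrite EFinM.
rewrite /cintegral; apply: eq_ReIm; rewrite ?cReM ?cImM /=.
- under eq_Rintegral do rewrite cReM.
  rewrite RintegralB //; [|exact: Z|exact: Z].
  by rewrite !RintegralZl.
- under eq_Rintegral do rewrite cImM.
  rewrite RintegralD //; [|exact: Z|exact: Z].
  by rewrite !RintegralZl.
Qed.

Lemma cintegralB f g : cintegrable mu A f -> cintegrable mu A g ->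
  cintegral mu A (fun x => f x - g x) = cintegral mu A f - cintegral mu A g.
Proof.
move=> cf cg; rewrite -[X in _ = _ + X]mulN1r -cintegralZ // -cintegralD //.
  by apply: eq_cintegral => x _; rewrite mulN1r.
exact: cintegrableZ.
Qed.

Lemma cintegrable0 : cintegrable mu A (fun=> 0).
Proof. by split; exact: integrable0. Qed.

Lemma cintegral0 : cintegral mu A (fun=> 0) = 0.
Proof.
by rewrite /cintegral; apply: eq_ReIm => /=; rewrite /Rintegral integral0_eq.
Qed.

Lemma cintegrable_sum (I : Type) (r : seq I) (F : I -> T -> R[i]) :
  (forall i, cintegrable mu A (F i)) -> cintegrable mu A (fun x => \sum_(i <- r) F i x).
Proof.
move=> cF; elim: r => [|i r IH].
  by under eq_fun do rewrite big_nil; exact: cintegrable0.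
by under eq_fun do rewrite big_cons; exact: cintegrableD.
Qed.

Lemma cintegral_sum (I : Type) (r : seq I) (F : I -> T -> R[i]) :
  (forall i, cintegrable mu A (F i)) ->
  cintegral mu A (fun x => \sum_(i <- r) F i x) = \sum_(i <- r) cintegral mu A (F i).
Proof.
move=> cF; elim: r => [|i r IH].
  by rewrite big_nil; under eq_fun do rewrite big_nil; exact: cintegral0.
rewrite big_cons; under eq_fun do rewrite big_cons.
by rewrite cintegralD // ?IH //; exact: cintegrable_sum.
Qed.

(** A unit number u rotates the integral to its modulus, which reduces the bound to the real part of
    u f. *)
Lemma le_abs_cintegral f (g : T -> R) : cintegrable mu A f -> mu.-integrable A (EFin \o g) ->
  (forall x, A x -> abs (f x) <= g x) -> abs (cintegral mu A f) <= \int[mu]_(x in A) g x.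
Proof.
move=> cf ig fg; set I := cintegral mu A f.
have [I0|I0] := eqVneq I 0.
  by rewrite I0 abs0 Rintegral_ge0 // => x /fg; apply: le_trans; exact: abs_ge0.
pose u : R[i] := Num.conj I / (abs I)%:C.
have aI : 0 < abs I by rewrite abs_gt0.
have uI : u * I = (abs I)%:C.
  rewrite /u mulrAC [_ * I]mulrC mulJ_abs rmorphXn /= expr2 mulfK //.
  by apply/eqP => -[/eqP]; rewrite gt_eqF.
have au : abs u = 1.
  by rewrite /u absM absV absJ absR ger0_norm ?abs_ge0 // divff // gt_eqF.
have -> : abs I = cRe (u * I) by rewrite uI.
rewrite -cintegralZ //=; have [c1 _] := cintegrableZ u cf.
apply: le_Rintegral => // x Ax; rewrite (le_trans (ler_norm _)) //.
by rewrite (le_trans (ler_Re_abs _)) // absM au mul1r fg.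
Qed.

Lemma cdominated_cvg (h : nat -> T -> R[i]) f (g : T -> R) :
  (forall n, cmeasurable A (h n)) -> mu.-integrable A (EFin \o g) ->
  (forall x, A x -> h n x @[n --> \oo] --> f x) ->
  (forall n x, A x -> abs (h n x) <= g x) ->
  cintegrable mu A f /\ cintegral mu A (h n) @[n --> \oo] --> cintegral mu A f.
Proof.
move=> mh ig hf hg.
have mf := cmeasurable_cvg mh hf.
have core (u : R[i] -> R) : (forall z, `|u z| <= abs z) ->
    (forall x, A x -> u (h n x) @[n --> \oo] --> u (f x)) ->
    (forall n, measurable_fun A (fun x => u (h n x))) -> measurable_fun A (fun x => u (f x)) ->
    mu.-integrable A (fun x => (u (f x))%:E) /\
    (\int[mu]_(x in A) u (h n x)) @[n --> \oo] --> \int[mu]_(x in A) u (f x).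
  move=> ub uc um umf.
  have [|||||i1 _ i2] := @dominated_convergence _ _ _ mu A mA (fun n x => (u (h n x))%:E)
      (fun x => (u (f x))%:E) (fun x => (g x)%:E).
  - by move=> n; exact/measurable_EFinP.
  - exact/measurable_EFinP.
  - by apply/aeW => x Ax; apply: cvg_EFin; [exact: nearW | exact: uc].
  - exact: ig.
  - by apply/aeW => x n Ax; rewrite lee_fin (le_trans (ub _)) // hg.
  split => //; apply: fine_cvg; rewrite /= fineK //; exact: integrable_fin_num.
have [] := core (fun z => cRe z) (@ler_Re_abs R).
- by move=> x Ax; apply: cvg_Re; exact: hf.
- by move=> n; case: (mh n).
- by case: mf.
move=> i1 l1; have [] := core (fun z => cIm z) (@ler_Im_abs R).
- by move=> x Ax; apply: cvg_Im; exact: hf.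
- by move=> n; case: (mh n).
- by case: mf.
move=> i2 l2; split => //; exact/cvg_ReImP.
Qed.

End ComplexIntegration.

Lemma cintegral_mkcond (R : realType) (d : measure_display) (T : measurableType d)
  (mu : {measure set T -> \bar R}) (A : set T) (f : T -> R[i]) :
  cintegral mu A f = cintegral mu setT (fun x => if x \in A then f x else 0).
Proof.
rewrite /cintegral !(Rintegral_mkcond mu A).
by congr (_ +i* _); apply: eq_Rintegral => x _; rewrite patchE; case: ifP.
Qed.

Lemma cfubini (R : realType) (d1 d2 : measure_display) (T1 : measurableType d1)
  (T2 : measurableType d2) (m1 : {sigma_finite_measure set T1 -> \bar R})
  (m2 : {sigma_finite_measure set T2 -> \bar R}) (f : T1 * T2 -> R[i]) (G : T1 -> R) :
  cmeasurable setT f -> (forall x, cintegrable m2 setT (fun y => f (x, y))) ->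
  (forall y, cintegrable m1 setT (fun x => f (x, y))) ->
  (forall x, \int[m2]_(y in setT) abs (f (x, y)) <= G x) ->
  m1.-integrable setT (EFin \o G) ->
  cintegral m1 setT (fun x => cintegral m2 setT (fun y => f (x, y))) =
  cintegral m2 setT (fun y => cintegral m1 setT (fun x => f (x, y))).
Proof.
move=> mf cf cf2 fG iG.
have core (u : R[i] -> R) : (forall z, `|u z| <= abs z) ->
    measurable_fun setT (fun xy => u (f xy)) ->
    (forall x, m2.-integrable setT (fun y => (u (f (x, y)))%:E)) ->
    (forall y, m1.-integrable setT (fun x => (u (f (x, y)))%:E)) ->
    \int[m1]_x \int[m2]_y u (f (x, y)) = \int[m2]_y \int[m1]_x u (f (x, y)).
  move=> ub mu_ iu1 iu2.
  have mE : measurable_fun setT (fun xy => (u (f xy))%:E) by exact/measurable_EFinP.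
  have iu : (m1 \x m2)%E.-integrable setT (fun xy => (u (f xy))%:E).
    apply/integrable12ltyP => //.
    have /integrableP[mG hG] := iG; apply: le_lt_trans hG.
    apply: ge0_le_integral => //.
    - by move=> x _; apply: integral_ge0.
    - apply: (measurable_fun_fubini_tonelli_F (fun xy => `|(u (f xy))%:E|%E)) => //.
      exact: measurableT_comp.
    - exact: measurableT_comp.
    - move=> x _; apply: (@le_trans _ _ (\int[m2]_y (abs (f (x, y)))%:E)%E).
        have [mf1 mf2] := cintegrable_measurable (cf x).
        apply: ge0_le_integral => //.
        + by apply: measurableT_comp => //; exact: measurableT_comp mE (pair1_measurable x).
        + by apply/measurable_EFinP; exact: measurable_abs.
        + by move=> y _; rewrite lee_fin.
      have ia := integrable_abs measurableT (cf x).
      rewrite -[leLHS]fineK; last exact: (integrable_fin_num _ ia).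
      by rewrite lee_fin (le_trans (fG x)) // ler_norm.
  have := Fubini iu; rewrite /Rintegral => e.
  congr fine; rewrite (eq_integral (fun x => \int[m2]_y (u (f (x, y)))%:E)%E); last first.
    move=> x _; rewrite fineK //; apply: integrable_fin_num => //; exact: iu1.
  rewrite e; apply: eq_integral => y _; rewrite fineK //.
  by apply: integrable_fin_num => //; exact: iu2.
rewrite /cintegral /=; congr (_ +i* _).
- apply: core; [exact: ler_Re_abs | by case: mf | |].
  + by move=> x; case: (cf x).
  + by move=> y; case: (cf2 y).
- apply: core; [exact: ler_Im_abs | by case: mf | |].
  + by move=> x; case: (cf x).
  + by move=> y; case: (cf2 y).
Qed.

(** * The fundamental theorem of calculus off finitely many points *)

Section FTC.
Context {R : realType}.
Local Notation leb := (@lebesgue_measure R).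
Implicit Types (f F : R -> R) (x y t : R).

(** Induction on the exceptional points: the interval is split at those lying inside it, and the
    mean value theorem applies once none is left. *)
Lemma const_off_finite f (s : seq R) x y : x < y ->
  {within `[x, y], continuous f} ->
  (forall t, x < t < y -> t \notin s -> is_derive t 1 f 0) -> f x = f y.
Proof.
elim: s x y => [|c s IH] x y xy cf df.
  have [t xty|t _] := @MVT _ f (fun=> 0) x y xy _ cf.
    by apply: df => //; move: xty; rewrite in_itv.
  by move/eqP; rewrite mul0r subr_eq0 => /eqP.
have [/andP[xc cy]|nc] := boolP (x < c < y); last first.
  apply: IH => // t xty ts; apply: df => //; rewrite inE negb_or ts andbT.
  by apply: contraNneq nc => <-.
apply: (@eq_trans _ _ (f c)); apply: IH => //.
- apply: continuous_subspaceW cf => t /=; rewrite !in_itv /= => /andP[-> tc].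
  exact: le_trans tc (ltW cy).
- move=> t /andP[xt tc] ts; apply: df; first by rewrite xt (lt_trans tc).
  by rewrite inE negb_or ts andbT lt_eqF.
- apply: continuous_subspaceW cf => t /=; rewrite !in_itv /= => /andP[ct ->].
  by rewrite (le_trans (ltW xc) ct).
- move=> t /andP[ct ty] ts; apply: df; first by rewrite ty (lt_trans xc).
  by rewrite inE negb_or ts andbT gt_eqF.
Qed.

(** At the breaks of a contour the integrand may jump; F and the indefinite integral are continuous
    there all the same, and elsewhere their difference has derivative 0. *)
Lemma FTC2_off_finite f F (s : seq R) x y : x < y ->
  leb.-integrable `[x, y] (EFin \o f) ->
  {within `[x, y], continuous F} ->
  (forall t, x < t < y -> t \notin s -> {for t, continuous f} /\ is_derive t 1 F (f t)) ->
  \int[leb]_(t in `[x, y]) f t = F y - F x.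
Proof.
move=> xy intf cF dF.
pose I u := \int[leb]_(t in `[x, u]) f t.
have cI : {within `[x, y], continuous I}.
  exact: (parameterized_integral_continuous (ltW xy) intf).
have : (F x - I x) = (F y - I y).
  apply: (@const_off_finite (fun u => F u - I u) s) => //.
    by move=> u; apply: cvgB; [exact: cF | exact: cI].
  move=> t /andP[xt ty] ts.
  have [cft dFt] := dF t (introT andP (conj xt ty)) ts.
  have [dI I'] := continuous_FTC1_closed ty intf xt cft.
  have dI' : is_derive t 1 I (f t).
    have e : 'D_1 I t = f t by rewrite -derive1E.
    exact: (DeriveDef dI e).
  have -> : 0 = f t - f t by rewrite subrr.
  exact: is_deriveB.
rewrite {1}/I set_itv1 Rintegral_set1 subr0 => ->.
by rewrite opprB addrC subrK.
Qed.

Lemma Rintegral_setT_cvg f : leb.-integrable setT (EFin \o f) ->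
  \int[leb]_(t in `[- n%:R, n%:R]) f t @[n --> \oo] --> \int[leb]_(t in setT) f t.
Proof.
move=> intf.
have mf : measurable_fun setT f by case/integrableP : intf => /measurable_EFinP.
pose D (n : nat) : set R := `[- n%:R, n%:R]%classic.
have mD n : measurable (D n) by exact: measurable_itv.
pose h n t := ((f \_ (D n)) t)%:E.
have [|||||_ _ h1] := @dominated_convergence _ _ _ leb setT measurableT h (EFin \o f) (fun t => `|f t|%:E).
- by move=> n; apply/measurable_EFinP; apply/(measurable_restrictT _ (mD n));
    exact: measurable_funTS.
- exact/measurable_EFinP.
- apply/aeW => t _; apply: cvg_near_cst; exists (Num.bound t) => // n /= nt.
  rewrite /h patchE ifT // inE /D /= in_itv /=.
  have : `|t| < n%:R.
    rewrite (lt_le_trans (archi_boundP (normr_ge0 t))) // ler_nat.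
    by rewrite (leq_trans _ nt) // /Num.bound normr_id.
  by rewrite ltr_norml => /andP[/ltW -> /ltW ->].
- by have := integrable_norm intf.
- apply/aeW => t n _; rewrite /h patchE; case: ifP => _ //=.
  by rewrite lee_fin normr0.
have := @fine_cvg _ _ _ _ _ (\int[leb]_(t in setT) f t) _.
rewrite /Rintegral fineK; last exact: integrable_fin_num.
move=> /(_ _ _ _ _ h1); apply: cvg_trans; apply: near_eq_cvg; apply: nearW => n.
rewrite /h /=; congr fine; rewrite [RHS]integral_mkcond; apply: eq_integral => t _.
by rewrite !patchE; case: ifP.
Qed.

Lemma FTC2_line f F (s : seq R) (l L : R) : leb.-integrable setT (EFin \o f) ->
  continuous F ->
  (forall t, t \notin s -> {for t, continuous f} /\ is_derive t 1 F (f t)) ->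
  F n%:R @[n --> \oo] --> L -> F (- n%:R) @[n --> \oo] --> l ->
  \int[leb]_(t in setT) f t = L - l.
Proof.
move=> intf cF dF FL Fl.
have h1 := Rintegral_setT_cvg intf.
have h2 : F n%:R - F (- n%:R) @[n --> \oo] --> L - l by exact: cvgB.
suff h3 : \int[leb]_(t in `[- n%:R, n%:R]) f t @[n --> \oo] --> L - l.
  exact: (@cvg_unique _ (@Rhausdorff R) _ _ _ _ h1 h3).
move: h2; apply: cvg_trans; apply: near_eq_cvg; exists 1%N => // n /= n0.
have nn : - n%:R < n%:R :> R by rewrite gt0_cp // ltr0n.
apply/esym; apply: (FTC2_off_finite (s := s)) => //.
- by apply: integrableS intf.
- exact: continuous_subspaceT.
- by move=> t _ /dF.
Qed.

End FTC.

(** * Exponential and logarithm along curves *)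

Section ComplexLimits.
Context {R : realType} {T : Type} {F : set_system T} {FF : Filter F}.
Implicit Types (f g : T -> R[i]) (l m : R[i]).

Lemma cvg_cM f g l m : f x @[x --> F] --> l -> g x @[x --> F] --> m ->
  f x * g x @[x --> F] --> l * m.
Proof.
move=> /cvg_ReImP[f1 f2] /cvg_ReImP[g1 g2]; apply/cvg_ReImP; split.
- by under eq_fun do rewrite cReM; rewrite cReM; apply: cvgB; exact: cvgM.
- by under eq_fun do rewrite cImM; rewrite cImM; apply: cvgD; exact: cvgM.
Qed.

Lemma cvg_cV f l : l != 0 -> f x @[x --> F] --> l -> (f x)^-1 @[x --> F] --> l^-1.
Proof.
move=> l0 fl; have h : (abs (f x) ^+ 2)^-1 @[x --> F] --> (abs l ^+ 2)^-1.
  apply: cvgV; first by rewrite expf_eq0 abs_eq0.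
  by rewrite expr2; under eq_fun do rewrite expr2; apply: cvgM; exact: cvg_abs.
move/cvg_ReImP: fl => [f1 f2]; apply/cvg_ReImP; split.
- by under eq_fun do rewrite cReV; rewrite cReV; exact: cvgM.
- by under eq_fun do rewrite cImV; rewrite cImV; apply: cvgN; exact: cvgM.
Qed.

Lemma cvg_expi (h : T -> R) (a : R) : h x @[x --> F] --> a -> expi (h x) @[x --> F] --> expi a.
Proof.
move=> ha; apply/cvg_ReImP; split => /=.
- exact: continuous_cvg (@continuous_cos R a) ha.
- exact: continuous_cvg (@continuous_sin R a) ha.
Qed.

Lemma cvg_cexp f l : f x @[x --> F] --> l -> cexp (f x) @[x --> F] --> cexp l.
Proof.
move=> fl; apply: cvg_cM.
  by apply: cvg_real; apply: (continuous_cvg _ (@continuous_expR R _)); exact: cvg_Re.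
by apply: cvg_expi; exact: cvg_Im.
Qed.

Lemma cvg_ccst c : (fun=> c : R[i]) @ F --> c.
Proof. exact: cvg_cst. Qed.

Lemma cvg_cD f g l m : f x @[x --> F] --> l -> g x @[x --> F] --> m ->
  f x + g x @[x --> F] --> l + m.
Proof. exact: cvgD. Qed.

Lemma cvg_cB f g l m : f x @[x --> F] --> l -> g x @[x --> F] --> m ->
  f x - g x @[x --> F] --> l - m.
Proof. exact: cvgB. Qed.

Lemma cvg_ccomp (p : R[i] -> R[i]) f l m : f x @[x --> F] --> l -> p w @[w --> l] --> m ->
  p (f x) @[x --> F] --> m.
Proof. by move=> fl pm; exact: cvg_comp fl pm. Qed.

End ComplexLimits.
Arguments cvg_ccst {R T F FF} c.

Section ComplexExponential.
Context {R : realType}.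
Implicit Types (z w : R[i]) (a b : R).

Lemma expiD a b : expi (a + b) = expi a * expi b.
Proof.
by apply: eq_ReIm; rewrite ?cReM ?cImM /= ?cosD ?sinD //; ring.
Qed.

Lemma expi0 : expi (0 : R) = 1.
Proof. by rewrite /expi cos0 sin0. Qed.

Lemma abs_expi a : abs (expi a) = 1.
Proof. by rewrite absE /= cos2Dsin2 sqrtr1. Qed.

Lemma expi_neq0 a : expi a != 0.
Proof. by rewrite -abs_gt0 abs_expi. Qed.

Lemma expiN a : expi (- a) = (expi a)^-1.
Proof.
apply: (mulfI (expi_neq0 a)); rewrite -expiD subrr expi0 divff //; exact: expi_neq0.
Qed.

Lemma expi_pi : expi (pi : R) = -1.
Proof. by rewrite /expi cospi sinpi; apply: eq_ReIm; rewrite /= ?oppr0. Qed.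

Lemma cexpD z w : cexp (z + w) = cexp z * cexp w.
Proof. by rewrite /cexp cReD cImD expRD expiD rmorphM mulrACA. Qed.

Lemma cexp0 : cexp (0 : R[i]) = 1.
Proof. by rewrite /cexp /= expR0 expi0 mulr1. Qed.

Lemma abs_cexp z : abs (cexp z) = expR (cRe z).
Proof. by rewrite /cexp absM abs_expi mulr1 absR ger0_norm // expR_ge0. Qed.

Lemma cexp_neq0 z : cexp z != 0.
Proof. by rewrite -abs_gt0 abs_cexp expR_gt0. Qed.

Lemma cexpN z : cexp (- z) = (cexp z)^-1.
Proof. by apply: (mulfI (cexp_neq0 z)); rewrite -cexpD subrr cexp0 divff // cexp_neq0. Qed.

Lemma cexp_i a : cexp ('i * a%:C) = expi a.
Proof.
have -> : 'i * a%:C = 0 +i* a by rewrite -complexiE; apply: eq_ReIm; rewrite ?cReM ?cImM /=; ring.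
by rewrite /cexp /= expR0 mul1r.
Qed.

Lemma cexp_real a : cexp a%:C = (expR a)%:C.
Proof. by rewrite /cexp /= expi0 mulr1. Qed.

Lemma cexpMn z n : cexp (n%:R * z) = cexp z ^+ n.
Proof.
elim: n => [|n IH]; first by rewrite mul0r cexp0.
by rewrite -natr1 mulrDl mul1r cexpD IH exprSr.
Qed.

(** The double-angle formula turns cos a = 1 into sin (|a| / 2) = 0, whereas the sine is positive on
    ]0, pi[. *)
Lemma expi_eq1 a : expi a = 1 -> `|a| < 2 * pi -> a = 0.
Proof.
move=> e ha; have ca : cos a = 1 by move/(congr1 (fun z => cRe z)): e.
have s0 : sin (`|a| / 2) = 0.
  have c1 : cos `|a| = 1 by case: (ler0P a) => _ //; rewrite cosN.
  have := cos_mulr2n (`|a| / 2).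
  rewrite -[X in cos X]mulr_natr divfK ?pnatr_eq0 // c1 => h; have := cos2Dsin2 (`|a| / 2) => h'.
  by apply/eqP; rewrite -sqrf_eq0; apply/eqP; lra.
apply/eqP; rewrite -normr_le0 leNgt; apply/negP => n0.
by have := @sin_gt0_pi R (`|a| / 2); rewrite s0 ltxx => h; suff : false by []; apply: h; apply/andP; split; lra.
Qed.

Lemma expi_inj a b : expi a = expi b -> `|a - b| < 2 * pi -> a = b.
Proof.
move=> e ab; apply/eqP; rewrite -subr_eq0; apply/eqP/expi_eq1 => //.
by rewrite expiD expiN e divff // expi_neq0.
Qed.

End ComplexExponential.

(** * Derivatives of complex-valued curves *)

Section CurveDerivative.
Context {R : realType}.
Implicit Types (g : R -> R[i]) (t : R) (l z : R[i]).

(** Taken coordinatewise to agree with [rderiv]; the Caratheodory form of [cderiveP] then makes the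
    product and chain rules algebraic. *)
Definition cderive g t l : Prop :=
  is_derive t 1 (fun u => cRe (g u)) (cRe l) /\ is_derive t 1 (fun u => cIm (g u)) (cIm l).

Lemma cderiveP g t l : cderive g t l <->
  exists q : R -> R[i], [/\ forall u, g u - g t = (u - t)%:C * q u, q u @[u --> t] --> l & q t = l].
Proof.
split=> [[/is_derive1_caratheodory[q1 [e1 c1 h1]] /is_derive1_caratheodory[q2 [e2 c2 h2]]]|].
  exists (fun u => q1 u +i* q2 u); split.
  - by move=> u; apply: eq_ReIm; rewrite ?cReB ?cImB ?cReZ ?cImZ /= ?e1 ?e2 mulrC.
  - apply/cvg_ReImP; split => /=; [rewrite -h1; exact: c1 | rewrite -h2; exact: c2].
  - by apply: eq_ReIm; rewrite /= ?h1 ?h2.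
move=> [q [e /cvg_ReImP[c1 c2] ql]]; split; apply/is_derive1_caratheodory.
- exists (fun u => cRe (q u)); split; last by rewrite ql.
    by move=> u; rewrite -cReB e cReZ mulrC.
  by rewrite -ql in c1.
- exists (fun u => cIm (q u)); split; last by rewrite ql.
    by move=> u; rewrite -cImB e cImZ mulrC.
  by rewrite -ql in c2.
Qed.

Lemma cderive_rderiv g t l : cderive g t l -> rderiv g t = l.
Proof. by move=> [d1 d2]; rewrite /rderiv !derive1E !derive_val; case: l {d1 d2}. Qed.

Lemma cderive_continuous g t l : cderive g t l -> {for t, continuous g}.
Proof.
move=> [d1 d2]; apply/cvg_ReImP; split.
- by apply: (@differentiable_continuous _ R R); apply/derivable1_diffP; exact: ex_derive.
- by apply: (@differentiable_continuous _ R R); apply/derivable1_diffP; exact: ex_derive.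
Qed.

Lemma cderive_eq g t l l' : cderive g t l -> l = l' -> cderive g t l'.
Proof. by move=> ? <-. Qed.

Lemma cderive_cst c t : cderive (fun=> c) t 0.
Proof. by split; exact: is_derive_cst. Qed.

Lemma cderive_real (h : R -> R) t (a : R) : is_derive t 1 h a -> cderive (fun u => (h u)%:C) t a%:C.
Proof. by move=> dh; split => //=; exact: is_derive_cst. Qed.

Lemma cderiveD g h t l m : cderive g t l -> cderive h t m -> cderive (fun u => g u + h u) t (l + m).
Proof.
move=> [g1 g2] [h1 h2]; split.
- by rewrite cReD (_ : (fun u => _) = (fun u => cRe (g u)) \+ (fun u => cRe (h u)));
    [exact: is_deriveD | apply/funext => u; rewrite cReD].
- by rewrite cImD (_ : (fun u => _) = (fun u => cIm (g u)) \+ (fun u => cIm (h u)));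
    [exact: is_deriveD | apply/funext => u; rewrite cImD].
Qed.

Lemma cderiveM g h t l m : cderive g t l -> cderive h t m ->
  cderive (fun u => g u * h u) t (l * h t + g t * m).
Proof.
move=> /cderiveP[p [ep cp hp]] dh; have ch := cderive_continuous dh.
move: dh => /cderiveP[q [eq cq hq]]; apply/cderiveP.
exists (fun u => p u * h u + g t * q u); split; last by rewrite hp hq.
- by move=> u; have := ep u; have := eq u => e1 e2;
    rewrite mulrDr mulrA -e2 mulrCA -e1; ring.
- exact: (cvg_cD (cvg_cM cp ch) (cvg_cmul _ cq)).
Qed.

Lemma cderiveZ c h t m : cderive h t m -> cderive (fun u => c * h u) t (c * m).
Proof. by move=> dh; apply: cderive_eq (cderiveM (cderive_cst c t) dh) _; rewrite mul0r add0r. Qed.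

Lemma cderiveN h t m : cderive h t m -> cderive (fun u => - h u) t (- m).
Proof.
move=> dh; rewrite -mulN1r (_ : (fun u => _) = fun u => -1 * h u); first exact: cderiveZ.
by apply/funext => u; rewrite mulN1r.
Qed.

Lemma cderiveB g h t l m : cderive g t l -> cderive h t m -> cderive (fun u => g u - h u) t (l - m).
Proof. by move=> dg dh; apply: cderiveD dg _; exact: cderiveN. Qed.

Lemma complex_caratheodory (f : R[i] -> R[i]) z m : is_derive z 1 f m ->
  exists p : R[i] -> R[i], [/\ forall w, f w - f z = (w - z) * p w,
    p w @[w --> z] --> m & p z = m].
Proof.
move=> df; pose p (w : R[i]) : R[i] := if w == z then m else (f w - f z) / (w - z).
exists p; split.
- move=> w; rewrite /p; case: eqP => [->|/eqP gu]; first by rewrite !subrr mul0r.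
  by rewrite mulrC divfK // subr_eq0.
- have := @ex_derive _ _ _ _ _ _ _ df; rewrite /derivable => /cvg_ex[m' hm].
  have em : m' = m.
    by have := @derive_val _ _ _ _ _ _ _ df; rewrite /derive; move: (hm) => /norm_cvg_lim ->.
  move: hm; rewrite em => /cvgrPdist_lt hm.
  have FF : Filter (nbhs (z : R[i])) by exact: nbhs_filter.
  apply/(@cvgrPdist_lt _ _ _ _ FF) => e e0; have := hm e e0; rewrite near_withinE => /nbhs_normP[d /= d0 hd].
  apply/nbhs_normP; exists d => //= w wd; rewrite /p; case: eqP => [_|/eqP wz].
    by rewrite subrr normr0.
  have := hd (w - z); rewrite /= sub0r normrN distrC subr_eq0 => /(_ wd wz).
  by rewrite /= /GRing.scale /= mulr1 subrK mulrC.
- by rewrite /p eqxx.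
Qed.

Lemma cderive_comp (f : R[i] -> R[i]) g t l m : is_derive (g t) 1 f m -> cderive g t l ->
  cderive (fun u => f (g u)) t (m * l).
Proof.
move=> /complex_caratheodory[p [ep cp pm]] dg; have cg := cderive_continuous dg.
move: dg => /cderiveP[q [eq cq hq]]; apply/cderiveP; exists (fun u => p (g u) * q u); split.
- by move=> u; rewrite ep eq; ring.
- exact: (cvg_cM (cvg_ccomp cg cp) cq).
- by rewrite pm hq.
Qed.

Lemma derivable_seq_cvg (f : R[i] -> R[i]) (s : R[i]) (u : nat -> R[i]) :
  derivable f s 1 -> u n @[n --> \oo] --> 0 -> f (s + u n) @[n --> \oo] --> f s.
Proof.
move=> df u0; have [p [ep cp pm]] := complex_caratheodory (DeriveDef df erefl).
have su : s + u n @[n --> \oo] --> s.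
  have h : s + u n @[n --> \oo] --> s + 0 by exact: (cvg_cD (cvg_ccst s) u0).
  by rewrite addr0 in h.
have h : f s + u n * p (s + u n) @[n --> \oo] --> f s + 0 * 'D_1 f s.
  exact: (cvg_cD (cvg_ccst _) (cvg_cM u0 (cvg_ccomp su cp))).
rewrite mul0r addr0 in h; apply: cvg_trans h; apply: near_eq_cvg; apply: nearW => n.
by have := ep (s + u n); rewrite addrAC subrr add0r => <-; rewrite addrC subrK.
Qed.

Lemma cderive_expi (h : R -> R) t (a : R) : is_derive t 1 h a ->
  cderive (fun u => expi (h u)) t ('i * a%:C * expi (h t)).
Proof.
move=> dh; split => /=.
- by apply: is_derive_eq (is_derive1_comp (is_derive_cos _) dh) _ => /=; ring.
- by apply: is_derive_eq (is_derive1_comp (is_derive_sin _) dh) _ => /=; ring.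
Qed.

Lemma cderive_cexp g t l : cderive g t l -> cderive (fun u => cexp (g u)) t (l * cexp (g t)).
Proof.
move=> [d1 d2].
have e1 := cderive_real (is_derive1_comp (is_derive_expR (cRe (g t))) d1).
apply: cderive_eq (cderiveM e1 (cderive_expi d2)) _ => /=.
rewrite /cexp rmorphM /=.
have -> : l = (cRe l)%:C + 'i * (cIm l)%:C.
  by rewrite -complexiE; apply: eq_ReIm; rewrite ?cReD ?cImD ?cReM ?cImM /=; ring.
set x := cRe l; set y := cIm l.
have -> : cRe (x%:C + 'i * y%:C) = x by rewrite -complexiE cReD cReM /=; ring.
have -> : cIm (x%:C + 'i * y%:C) = y by rewrite -complexiE cImD cImM /=; ring.
ring.
Qed.

End CurveDerivative.

Section ComplexFTC.
Context {R : realType}.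
Local Notation leb := (@lebesgue_measure R).

Lemma cFTC2_line (f F : R -> R[i]) (s : seq R) (l L : R[i]) : cintegrable leb setT f ->
  continuous F -> (forall t, t \notin s -> {for t, continuous f} /\ cderive F t (f t)) ->
  F n%:R @[n --> \oo] --> L -> F (- n%:R) @[n --> \oo] --> l ->
  cintegral leb setT f = L - l.
Proof.
move=> [i1 i2] cF dF /cvg_ReImP[L1 L2] /cvg_ReImP[l1 l2].
rewrite /cintegral; apply: eq_ReIm; rewrite ?cReB ?cImB /=.
- apply: (@FTC2_line _ _ (fun t => cRe (F t)) s) => //.
  + by move=> t; apply: cvg_Re; exact: cF.
  + by move=> t /dF[c [d1 d2]]; split=> //; apply: cvg_Re; exact: c.
- apply: (@FTC2_line _ _ (fun t => cIm (F t)) s) => //.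
  + by move=> t; apply: cvg_Im; exact: cF.
  + by move=> t /dF[c [d1 d2]]; split=> //; apply: cvg_Im; exact: c.
Qed.

(** The mean value equality holds for real functions, so it is applied to Re (u F), where the unit
    number u rotates F b - F a to its modulus. *)
Lemma cmean_value_le (F f : R -> R[i]) (a b M : R) : a <= b ->
  (forall t, a <= t <= b -> cderive F t (f t)) -> (forall t, a <= t <= b -> abs (f t) <= M) ->
  abs (F b - F a) <= M * (b - a).
Proof.
move=> ab dF fM; set I := F b - F a; have [I0|I0] := eqVneq I 0.
  by rewrite I0 abs0 mulr_ge0 ?subr_ge0 // (le_trans (abs_ge0 _) (fM a _)) // lexx.
pose u : R[i] := Num.conj I / (abs I)%:C.
have aI : 0 < abs I by rewrite abs_gt0.
have uI : u * I = (abs I)%:C.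
  rewrite /u mulrAC [_ * I]mulrC mulJ_abs rmorphXn /= expr2 mulfK //.
  by apply/eqP => -[/eqP]; rewrite gt_eqF.
have au : abs u = 1.
  by rewrite /u absM absV absJ absR ger0_norm ?abs_ge0 // divff // gt_eqF.
have dG t : a <= t <= b -> is_derive t 1 (fun v => cRe (u * F v)) (cRe (u * f t)).
  by move=> /dF /(cderiveZ u)[].
have cG : {within `[a, b], continuous (fun v => cRe (u * F v))}.
  apply: derivable_within_continuous => t; rewrite in_itv /= => tab.
  by have := dG t tab => h; exact: ex_derive.
have dG' t : t \in `]a, b[ -> is_derive t 1 (fun v => cRe (u * F v)) (cRe (u * f t)).
  by rewrite in_itv /= => /andP[/ltW ? /ltW ?]; apply: dG; apply/andP.
have [t tab e] := MVT_segment ab dG' cG.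
have -> : abs I = cRe (u * I) by rewrite uI.
rewrite /I mulrBr cReB e ler_wpM2r ?subr_ge0 //.
rewrite (le_trans (ler_norm _)) // (le_trans (ler_Re_abs _)) // absM au mul1r fM //.
Qed.

(* Two mean value estimates along tau |-> exp (tau h). *)
Lemma cexp_taylor (h : R[i]) : abs (cexp h - 1 - h) <= abs h ^+ 2 * expR (abs h).
Proof.
have bexp (t : R) : 0 <= t <= 1 -> abs (cexp (t%:C * h)) <= expR (abs h).
  move=> /andP[t0 t1]; rewrite abs_cexp ler_expR (le_trans (ler_norm _)) //.
  by rewrite (le_trans (ler_Re_abs _)) // absM absR ger0_norm // ler_piMl ?abs_ge0.
have dexp (t : R) : cderive (fun u => cexp (u%:C * h)) t (h * cexp (t%:C * h)).
  apply: cderive_cexp; apply: cderive_eq.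
    by apply: cderiveM; [apply: cderive_real; exact: is_derive_id | exact: cderive_cst].
  by rewrite mulr0 addr0 mul1r.
have b1 (t : R) : 0 <= t <= 1 -> abs (cexp (t%:C * h) - 1) <= abs h * expR (abs h).
  move=> /andP[t0 t1].
  have := @cmean_value_le (fun u => cexp (u%:C * h)) (fun u => h * cexp (u%:C * h)) 0 t
    (abs h * expR (abs h)) t0.
  rewrite rmorph0 mul0r cexp0 subr0 => H; apply: le_trans (H _ _) _ => //.
  - move=> u /andP[u0 ut]; rewrite absM ler_wpM2l ?abs_ge0 // bexp // u0 (le_trans ut) //.
  - by rewrite ler_piMr // mulr_ge0 ?abs_ge0 ?expR_ge0.
have := @cmean_value_le (fun u => cexp (u%:C * h) - u%:C * h)
  (fun u => h * (cexp (u%:C * h) - 1)) 0 1 (abs h ^+ 2 * expR (abs h)) ler01.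
rewrite !rmorph0 rmorph1 !mul0r cexp0 !subr0 !mul1r mulr1 => H.
have -> : cexp h - 1 - h = cexp h - h - 1 by rewrite addrAC.
apply: H => [t t01|t t01].
- apply: cderive_eq; first apply: cderiveB (dexp t) _.
    by apply: cderiveM; [apply: cderive_real; exact: is_derive_id | exact: cderive_cst].
  by rewrite mulr0 addr0 mul1r mulrBr mulr1.
- by rewrite absM expr2 -mulrA ler_wpM2l ?abs_ge0 // b1.
Qed.

End ComplexFTC.

(** * Argument and logarithm on the slit plane *)

Section ComplexLogarithm.
Context {R : realType}.
Implicit Types (z w : R[i]) (t a b r phi : R).

(* tan (arg z / 2) = Im z / (|z| + Re z) *)
Definition carg z : R := 2 * atan (cIm z / (abs z + cRe z)).

Definition clog z : R[i] := ln (abs z) +i* carg z.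

(* the complement of the half-line ]-oo, 0] *)
Definition slit_plane z : Prop := 0 < abs z + cRe z.

Lemma slit_planeN z : ~ slit_plane z -> z = - (abs z)%:C.
Proof.
move=> /negP; rewrite -leNgt => h; have h1 := ler_Re_abs z; have := ler_norm (- cRe z).
rewrite normrN => h2; have e : cRe z = - abs z by lra.
have := abs_sqr z; rewrite e sqrrN => /eqP; rewrite -[X in X == _]addr0 (inj_eq (addrI _)).
rewrite eq_sym sqrf_eq0 => /eqP i0.
by apply: eq_ReIm; rewrite ?cReN ?cImN /= ?oppr0.
Qed.

Lemma slit_plane_Re z : 0 < cRe z -> slit_plane z.
Proof. by move=> h; rewrite /slit_plane ltr_wpDl ?abs_ge0. Qed.

Lemma slit_plane_Im z : cIm z != 0 -> slit_plane z.
Proof.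
move=> h; case: (pselect (slit_plane z)) => // /slit_planeN e.
by move: h; rewrite e cImN /= oppr0 eqxx.
Qed.

Lemma slit_plane_neq0 z : slit_plane z -> z != 0.
Proof. by move=> h; apply: contraTneq h => ->; rewrite /slit_plane abs0 addr0 ltxx. Qed.

Lemma carg_bound z : `|carg z| < pi.
Proof.
rewrite /carg normrM ger0_norm // mulrC -ltr_pdivlMr // ltr_norml.
by rewrite atan_gtNpi2 atan_ltpi2.
Qed.

Lemma sin_atanE a : sin (atan a) = a * cos (atan a).
Proof.
have c0 : cos (atan a) != 0 by rewrite gt_eqF // cos_gt0_pihalf // atan_gtNpi2 atan_ltpi2.
by rewrite -[X in X * _]atanK /tan divfK.
Qed.

Lemma cos_atan_sqr a : cos (atan a) ^+ 2 = (1 + a ^+ 2)^-1.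
Proof. by rewrite cos_atan exprVn sqr_sqrtr // addr_ge0 ?sqr_ge0. Qed.

(** With y the tangent of half the argument, 1 + y^2 = 2 |z| / (|z| + Re z), and the double-angle
    formulas give the cosine Re z / |z| and the sine Im z / |z|. *)
Lemma carg_polar z : slit_plane z -> z = (abs z)%:C * expi (carg z).
Proof.
move=> h; have z0 := slit_plane_neq0 h; have r0 : 0 < abs z by rewrite abs_gt0.
have e := abs_sqr z; rewrite /slit_plane in h.
set y := cIm z / (abs z + cRe z).
have yE : (1 + y ^+ 2)^-1 = (abs z + cRe z) / (2 * abs z).
  rewrite /y expr_div_n; have -> : cIm z ^+ 2 = (abs z - cRe z) * (abs z + cRe z).
    by rewrite -subr_sqr e addrC addKr.
  have -> : 1 + (abs z - cRe z) * (abs z + cRe z) / (abs z + cRe z) ^+ 2 =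
      2 * abs z / (abs z + cRe z) by field; rewrite gt_eqF.
  by rewrite invf_div.
have c2 : cos (carg z) = cRe z / abs z.
  rewrite /carg [2 * _]mulrC mulr_natr cos_mulr2n cos_atan_sqr yE.
  by field; rewrite gt_eqF.
have s2 : sin (carg z) = cIm z / abs z.
  rewrite /carg [2 * _]mulrC mulr_natr sin_mulr2n sin_atanE mulrCA -expr2 cos_atan_sqr yE /y.
  by field; rewrite !gt_eqF.
by apply: eq_ReIm; rewrite ?cReZ ?cImZ /= ?c2 ?s2 mulrC divfK // gt_eqF.
Qed.

Lemma cexp_clog z : slit_plane z -> cexp (clog z) = z.
Proof.
move=> h; rewrite /cexp /= lnK -?carg_polar // posrE abs_gt0; exact: slit_plane_neq0.
Qed.

Lemma slit_plane_polar r phi : 0 < r -> `|phi| < pi -> slit_plane (r%:C * expi phi).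
Proof.
move=> r0 hp; case: (pselect (slit_plane (r%:C * expi phi))) => // /slit_planeN.
rewrite absM abs_expi mulr1 absR gtr0_norm // => e; have : r%:C != 0 :> R[i].
  by rewrite (inj_eq (@complexI R)) gt_eqF.
move=> r0'; move: e; rewrite -mulrN1 => /(mulfI r0'); rewrite -expi_pi => e.
have := @expi_inj _ phi pi e; have := ltr_norml phi pi; rewrite hp => /esym/andP[h1 h2].
have p0 := pi_gt0 R; rewrite ltr_norml => H; move: (h2); rewrite H ?ltxx //.
by apply/andP; split; lra.
Qed.

Lemma carg_unique r phi : 0 < r -> `|phi| < pi -> carg (r%:C * expi phi) = phi.
Proof.
move=> r0 hp; have := carg_polar (slit_plane_polar r0 hp).
rewrite absM abs_expi mulr1 absR gtr0_norm //.
have r0' : r%:C != 0 :> R[i] by rewrite (inj_eq (@complexI R)) gt_eqF.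
move=> /(mulfI r0') /esym/expi_inj; apply.
have := carg_bound (r%:C * expi phi); move: hp; rewrite !ltr_norml => /andP[? ?] /andP[? ?].
by apply/andP; split; lra.
Qed.

Lemma cvg_clog (T : Type) (F : set_system T) (FF : Filter F) (f : T -> R[i]) (l : R[i]) :
  slit_plane l -> f x @[x --> F] --> l -> clog (f x) @[x --> F] --> clog l.
Proof.
move=> hl fl; have ha := cvg_abs FF fl; have l0 := slit_plane_neq0 hl.
move/cvg_ReImP: fl => [f1 f2]; apply/cvg_ReImP; split => /=.
  by apply: (continuous_cvg _ _ ha); apply: continuous_ln; rewrite abs_gt0.
apply: cvgM; first exact: cvg_cst.
apply: (continuous_cvg _ (@continuous_atan R _)); apply: cvgM => //.
by apply: cvgV; [rewrite gt_eqF | exact: cvgD].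
Qed.

Lemma is_derive_abs (g : R -> R[i]) t l : g t != 0 -> cderive g t l ->
  is_derive t 1 (fun u => abs (g u))
    ((cRe (g t) * cRe l + cIm (g t) * cIm l) / abs (g t)).
Proof.
move=> g0 [d1 d2]; have a0 : 0 < abs (g t) by rewrite abs_gt0.
pose A : R -> R := fun u => cRe (g u); pose B : R -> R := fun u => cIm (g u).
have -> : (fun u => abs (g u)) = Num.sqrt \o (A ^+ 2 + B ^+ 2) by apply/funext => u; rewrite absE.
have s0 : 0 < (A ^+ 2 + B ^+ 2) t.
  have -> : (A ^+ 2 + B ^+ 2) t = abs (g t) ^+ 2 by rewrite abs_sqr.
  by rewrite exprn_gt0.
have dN : is_derive t 1 (A ^+ 2 + B ^+ 2) _ := is_deriveD (is_deriveX 2 d1) (is_deriveX 2 d2).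
apply: is_derive_eq (is_derive1_comp (is_derive1_sqrt s0) dN) _.
have -> : Num.sqrt ((A ^+ 2 + B ^+ 2) t) = abs (g t) by rewrite absE.
rewrite /GRing.scale /= !expr1 /A /B; by field; rewrite gt_eqF.
Qed.

Lemma cderive_clog (g : R -> R[i]) t l : slit_plane (g t) -> cderive g t l ->
  cderive (fun u => clog (g u)) t (l / g t).
Proof.
move=> hg dg; have g0 := slit_plane_neq0 hg; have a0 : 0 < abs (g t) by rewrite abs_gt0.
have da := is_derive_abs g0 dg; have [d1 d2] := dg.
have e := abs_sqr (g t); rewrite /slit_plane in hg.
split.
- apply: is_derive_eq (is_derive1_comp (is_derive1_ln a0) da) _.
  by rewrite cReM cReV cImV; field; rewrite gt_eqF.
- have dd := is_deriveD da d1.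
  have dV := is_deriveV (f := (fun u => abs (g u)) + (fun u => cRe (g u))) (lt0r_neq0 hg) dd.
  have dq := is_deriveM d2 dV.
  apply: is_derive_eq (is_deriveZ 2 (is_derive1_comp (is_derive1_atan _) dq)) _.
  rewrite /GRing.scale /= !fctE cImM cReV cImV.
  move: e hg a0; set r := abs _; set a := cRe _; set b := cIm (g t); set a' := cRe l; set b' := cIm l.
  move=> e hg a0.
  have -> : (1 + (b / (r + a)) ^+ 2)^-1 = (r + a) / (2 * r).
    rewrite expr_div_n; have -> : b ^+ 2 = (r - a) * (r + a) by rewrite -subr_sqr e addrC addKr.
    have -> : 1 + (r - a) * (r + a) / (r + a) ^+ 2 = 2 * r / (r + a) by field; rewrite gt_eqF.
    by rewrite invf_div.
  have h : b' * (r + a) * r - b * ((a * a' + b * b') + a' * r) = (a * b' - b * a') * (r + a).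
    have -> : b' * (r + a) * r = b' * r ^+ 2 + b' * a * r by ring.
    by rewrite e; ring.
  transitivity ((b' * (r + a) * r - b * ((a * a' + b * b') + a' * r)) / (r ^+ 2 * (r + a))).
    by field; rewrite !gt_eqF.
  by rewrite h; field; rewrite !gt_eqF.
Qed.

(** Rotation by pi - theta carries the cut to the negative half-line, so the principal logarithm
    serves for the branch cut along [ray theta]. *)
Lemma slit_plane_ray theta z : ~ ray theta z -> slit_plane (expi (pi - theta) * z).
Proof.
move=> nz; case: (pselect (slit_plane (expi (pi - theta) * z))) => // /slit_planeN e.
exfalso; apply: nz; exists (abs z); first exact: abs_ge0.
apply: (mulfI (expi_neq0 (pi - theta))).
by rewrite e absM abs_expi mul1r mulrCA -expiD subrK expi_pi mulrN1.
Qed.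

(** [arg_cut] is a choice, but an open interval of length 2 pi determines it; the principal argument
    of the rotated point, shifted by theta - pi, lies in that interval. *)
Lemma arg_cutE theta z : ~ ray theta z ->
  arg_cut theta z = theta - pi + carg (expi (pi - theta) * z).
Proof.
move=> /slit_plane_ray hs; set w := expi _ * z; set a := theta - pi + carg w.
have aw : abs w = abs z by rewrite absM abs_expi mul1r.
have za : z = `|z| * expi a.
  rewrite normE; apply: (mulfI (expi_neq0 (pi - theta))).
  rewrite [LHS](carg_polar hs) -/w aw [RHS]mulrCA -expiD; congr (_ * expi _); rewrite /a; ring.
have cb := carg_bound w; have Pa : theta - 2 * pi < a < theta /\ z = `|z| * expi a.
  by split=> //; move: cb; rewrite ltr_norml /a => /andP[? ?]; apply/andP; split; lra.
have := @getPex _ [set phi : R | theta - 2 * pi < phi < theta /\ z = `|z| * expi phi] (ex_intro _ a Pa).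
rewrite -/(arg_cut theta z) /= => -[/andP[h1 h2] e]; have [/andP[a1 a2] _] := Pa.
apply: expi_inj; last by rewrite ltr_norml; apply/andP; split; lra.
have z0 : `|z| != 0 by rewrite normr_eq0 -abs_eq0 -aw abs_eq0 slit_plane_neq0.
by apply: (mulfI z0); rewrite -e -za.
Qed.

Lemma cpowE theta z s : ~ ray theta z -> cpow theta z s =
  cexp (s * (clog (expi (pi - theta) * z) + 'i * (theta - pi)%:C)).
Proof.
move=> nz; rewrite /cpow arg_cutE // /clog absM abs_expi mul1r; congr (cexp (_ * _)).
by rewrite -complexiE; apply: eq_ReIm; rewrite ?cReD ?cImD ?cReM ?cImM /=; ring.
Qed.

End ComplexLogarithm.

(** * Geometry of the contour *)

Section PositiveBound.
Context {R : realType}.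

Lemma positive_lower_bound (f : R -> R) (N m : R) : continuous f -> (forall t, 0 < f t) ->
  0 < m -> (forall t, N <= `|t| -> m <= f t) -> exists2 d, 0 < d & forall t, d <= f t.
Proof.
move=> cf f0 m0 fm; have h : - `|N| <= `|N| by rewrite ge0_cp.
have [c _ hc] := EVT_min h (continuous_subspaceT cf).
exists (Num.min m (f c)); first by rewrite lt_min m0 f0.
move=> t; have [tN|tN] := leP N `|t|; first by rewrite ge_min fm.
rewrite ge_min [X in _ || X]hc ?orbT // in_itv /= -ler_norml.
by rewrite (le_trans (ltW tN)) // ler_norm.
Qed.

(** Compactness of the segment, applied with natural numbers tending to infinity as candidates for a
    common bound; monotonicity in M lets them replace the local bounds. *)
Lemma locally_uniform_itv (P : R -> R -> Prop) (a b : R) :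
  (forall t M M', M <= M' -> P t M -> P t M') ->
  (forall t : R, exists M, \forall u \near t, P u M) ->
  exists M, forall t, a <= t <= b -> P t M.
Proof.
move=> mono hf; have /compact_near_coveringP h := @segment_compact R a b.
have [|] := h nat \oo (fun n t => P t n%:R) _.
  move=> t _; have [M hM] := hf t.
  exists ([set u | P u M], [set n | M <= n%:R]) => /=.
    split => //; exists (Num.bound M) => // n /= nM.
    rewrite (le_trans (ler_norm _)) // ltW // (lt_le_trans (archi_boundP (normr_ge0 M))) //.
    by rewrite /Num.bound normr_id ler_nat.
  by move=> [u n] /= [h1 h2]; exact: mono h2 h1.
by move=> N _ hN; exists N%:R => t tab; apply: (hN N) => //=; rewrite in_itv.
Qed.

Lemma locally_bounded_itv (f : R -> R) (a b : R) :
  (forall t : R, exists M, \forall u \near t, f u <= M) ->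
  exists M, forall t, a <= t <= b -> f t <= M.
Proof.
by apply: (@locally_uniform_itv (fun t M => f t <= M)) => t M M' MM' /le_trans; exact.
Qed.

Lemma measurable_off_finite (f : R -> R) (s : seq R) :
  (forall t, t \notin s -> {for t, continuous f}) -> measurable_fun setT f.
Proof.
move=> hf; have fs := finite_seq s.
have os : open (~` [set` s]).
  rewrite openC; have /accessible_finite_set_closed : accessible_space R.
    exact/hausdorff_accessible/Rhausdorff.
  exact.
have mf : measurable_fun (~` [set` s]) f.
  apply: open_continuous_measurable_fun => //.
  by move=> t; rewrite inE /= => /negP; exact: hf.
have ms : measurable [set` s] by exact: countable_measurable (finite_set_countable fs).
rewrite -(setUv [set` s]); apply/measurable_funU => //.
  exact: measurableC.
split=> // _ Y mY; apply: countable_measurable => //.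
by apply: finite_set_countable; exact: finite_setIl.
Qed.

End PositiveBound.

Section ContourGeometry.
Context {R : realType}.
Variable gamma : R -> R[i].
Hypotheses (smooth : piecewise_smooth gamma) (ends : straight_ends gamma).

Let cgamma : continuous gamma. Proof. by case: smooth. Qed.

Lemma contour_derive : exists s : seq R, forall t, t \notin s ->
  {for t, continuous (rderiv gamma)} /\ cderive gamma t (rderiv gamma t).
Proof.
case: smooth => _ [s [h _]]; exists s => t /h[d1 d2 c _]; split => //; split => /=.
- by apply: DeriveDef => //; rewrite derive1E.
- by apply: DeriveDef => //; rewrite derive1E.
Qed.

Lemma contour_ends : exists N : R, exists u v : R[i],
  [/\ 0 <= N, 0 < cRe u, 0 < cRe v, 0 <= cIm u & cIm v <= 0] /\
  [/\ forall t, t <= - N -> gamma t = gamma (- N) + (- N - t)%:C * u,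
      forall t, N <= t -> gamma t = gamma N + (t - N)%:C * v,
      0 < cIm (gamma (- N)) & cIm (gamma N) < 0].
Proof.
case: ends => a [b [u [v [ab u0 v0 ha hb]]]].
pose N := Num.max `|a| `|b|.
have Na : - N <= a.
  by rewrite lerNl (le_trans (ler_norm _)) // normrN le_max lexx.
have Nb : b <= N by rewrite (le_trans (ler_norm _)) // le_max lexx orbT.
(* If Im u were negative, this half-line would reach the real axis at the parameter a + Im (gamma a)
   / Im u, against the sign condition; the other end is treated in the same way. *)
have Ia : 0 <= cIm u.
  rewrite leNgt; apply/negP => un.
  have [|e] := ha (a + cIm (gamma a) / cIm u).
    have /ltW ia : 0 < cIm (gamma a) by case: (ha a (lexx _)).
    by rewrite gerDl mulr_ge0_le0 // invr_le0 ltW.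
  by rewrite e cImD cImZ opprD addrA subrr sub0r mulNr divfK ?lt_eqF // subrr ltxx.
have Ib : cIm v <= 0.
  rewrite leNgt; apply/negP => vp.
  have [|e] := hb (b - cIm (gamma b) / cIm v).
    have /ltW ib : cIm (gamma b) < 0 by case: (hb b (lexx _)).
    by rewrite lerDl oppr_ge0 mulr_le0_ge0 // invr_ge0 ltW.
  by rewrite e cImD cImZ addrAC subrr add0r mulNr divfK ?gt_eqF // subrr ltxx.
exists N, u, v; split; first by split => //; rewrite le_max normr_ge0.
split.
- move=> t tN; have [-> _] := ha t (le_trans tN Na); have [-> _] := ha _ Na.
  by rewrite -addrA -mulrDl -rmorphD /=; congr (_ + _%:C * _); ring.
- move=> t tN; have [-> _] := hb t (le_trans Nb tN); have [-> _] := hb _ Nb.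
  by rewrite -addrA -mulrDl -rmorphD /=; congr (_ + _%:C * _); ring.
- by case: (ha _ Na).
- by case: (hb _ Nb).
Qed.

Lemma contour_Re_growth (q : R) : exists N m, [/\ 0 <= N, 0 < m &
  forall t, N <= `|t| -> m * (1 + `|t|) <= cRe (gamma t) - q].
Proof.
have [N [u [v [[N0 u0 v0 _ _] [ha hb _ _]]]]] := contour_ends.
have core (p V : R) : 0 < V -> exists N' m, [/\ 0 <= N', 0 < m &
    forall t, N' <= t -> m * (1 + t) <= p + (t - N) * V].
  move=> V0; exists (2 * N + 1 + 2 * (`|p| / V)), (V / 2); split.
  - by rewrite addr_ge0 ?addr_ge0 ?mulr_ge0 ?invr_ge0 ?(ltW V0).
  - by rewrite divr_gt0.
  move=> t tN.
  have : (2 * N + 1 + 2 * (`|p| / V)) * V <= t * V by rewrite ler_pM2r.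
  rewrite mulrDl -[2 * (_ / _) * V]mulrA divfK ?gt_eqF // => h.
  have := ler_norm (- p); rewrite normrN; nra.
have [N1 [m1 [n1 m10 h1]]] := core (cRe (gamma (- N)) - q) _ u0.
have [N2 [m2 [n2 m20 h2]]] := core (cRe (gamma N) - q) _ v0.
exists (Num.max N (Num.max N1 N2)), (Num.min m1 m2); split.
- by rewrite le_max N0.
- by rewrite lt_min m10.
move=> t; rewrite !ge_max => /andP[tN /andP[t1 t2]].
have [t0|t0] := lerP 0 t.
- rewrite !ger0_norm // in tN t1 t2 *; rewrite hb // cReD cReZ addrAC.
  apply: le_trans (h2 _ t2); rewrite ler_wpM2r ?addr_ge0 //.
  by rewrite ge_min lexx orbT.
- rewrite !ltr0_norm // in tN t1 t2 *; rewrite ha; last by rewrite lerNr.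
  rewrite cReD cReZ addrAC.
  apply: le_trans (_ : m1 * (1 - t) <= _); last by have := h1 _ t1; rewrite [_ - N]addrC.
  by rewrite ler_wpM2r ?ge_min ?lexx // addr_ge0 // oppr_ge0 ltW.
Qed.

Lemma contour_Im_ends : exists N c : R, [/\ 0 <= N, 0 < c &
  forall t, N <= `|t| -> c <= `|cIm (gamma t)|].
Proof.
have [N [u [v [[N0 u0 v0 iu iv] [ha hb ga gb]]]]] := contour_ends.
exists N, (Num.min (cIm (gamma (- N))) (- cIm (gamma N))); split => //.
  by rewrite lt_min ga oppr_gt0.
move=> t; have [t0|t0] := lerP 0 t => tN.
- rewrite ger0_norm // in tN; rewrite (hb t) // cImD cImZ ge_min; apply/orP; right.
  have : (t - N) * cIm v <= 0 by rewrite mulr_ge0_le0 // subr_ge0.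
  by move=> h; rewrite ler0_norm; lra.
- rewrite ltr0_norm // in tN; rewrite (ha t) 1?lerNr // cImD cImZ ge_min; apply/orP; left.
  have : 0 <= (- N - t) * cIm u by rewrite mulr_ge0 // subr_ge0 lerNr.
  by move=> h; rewrite ger0_norm; lra.
Qed.

Lemma contour_Im_signs : exists N : R, forall t,
  (N <= t -> cIm (gamma t) < 0) /\ (t <= - N -> 0 < cIm (gamma t)).
Proof.
case: ends => a [b [u [v [_ _ _ ha hb]]]]; exists (Num.max `|a| `|b|) => t; split=> tN.
- apply: (proj2 (hb t _)); rewrite (le_trans _ tN) // (le_trans (ler_norm _)) //.
  by rewrite le_max lexx orbT.
- apply: (proj2 (ha t _)); rewrite (le_trans tN) // lerNl (le_trans (ler_norm _)) //.
  by rewrite normrN le_max lexx.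
Qed.

Lemma continuous_abs_contour (f : R -> R[i]) : continuous f -> continuous (fun t => abs (f t)).
Proof. by move=> cf t; apply: cvg_abs; exact: cf. Qed.

Lemma continuous_1norm : continuous (fun t : R => 1 + `|t|).
Proof. by move=> t; apply: cvgD; [exact: cvg_cst | exact: cvg_norm]. Qed.

Lemma contour_le : exists2 C, 0 < C & forall t, abs (gamma t) <= C * (1 + `|t|).
Proof.
have [N [u [v [[N0 _ _ _ _] [ha hb _ _]]]]] := contour_ends.
pose K := 1 + (abs (gamma N) + abs v + abs (gamma (- N)) + abs u) * (1 + N).
have a0 := @abs_ge0 R; have K0 : 0 < K by rewrite ltr_wpDr // mulr_ge0 ?addr_ge0.
have hK t : N <= `|t| -> abs (gamma t) <= K * (1 + `|t|).
  have core (p q : R) : 0 <= p -> 0 <= q ->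
      p + (`|t| + N) * q <= (p + q) * (1 + N) * (1 + `|t|).
    move=> p0 q0; rewrite -subr_ge0.
    have -> : (p + q) * (1 + N) * (1 + `|t|) - (p + (`|t| + N) * q) =
      p * N + p * `|t| + p * N * `|t| + q + q * N * `|t| by ring.
    by rewrite !addr_ge0 ?mulr_ge0.
  have [t0|t0] := lerP 0 t => tN.
  - rewrite ger0_norm // in tN core *; rewrite hb //.
    rewrite (le_trans (absD _ _)) // absM absR ger0_norm ?subr_ge0 //.
    apply: (@le_trans _ _ (abs (gamma N) + (t + N) * abs v)).
      by rewrite lerD2l ler_wpM2r // lerD2l ge0_cp.
    rewrite (le_trans (core _ _ (a0 _) (a0 v))) // ler_wpM2r ?addr_ge0 //.
    rewrite /K ler_wpDl // ler_wpM2r ?addr_ge0 // -addrA lerDl addr_ge0 //.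
  - rewrite ltr0_norm // in tN core *; rewrite (ha t); last by rewrite lerNr.
    rewrite (le_trans (absD _ _)) // absM absR [X in _ + X * _]ger0_norm; last by rewrite subr_ge0 lerNr.
    apply: (@le_trans _ _ (abs (gamma (- N)) + (- t + N) * abs u)).
      by rewrite lerD2l ler_wpM2r // addrC lerD2l ge0_cp.
    have t0' : 0 <= 1 - t by rewrite addr_ge0 // oppr_ge0 ltW.
    rewrite (le_trans (core _ _ (a0 _) (a0 u))) // ler_wpM2r //.
    rewrite /K ler_wpDl // ler_wpM2r ?addr_ge0 //.
    by have := a0 (gamma N); have := a0 v; lra.
have p1 t : 0 < 1 + `|t| :> R by rewrite ltr_pwDl.
(* An upper bound of |gamma t| by a multiple of 1 + |t| amounts to a positive lower bound of this
   quotient, to which compactness applies. *)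
have [|t||t tN|d d0 hd] := @positive_lower_bound _ (fun t => (1 + `|t|) / (1 + abs (gamma t))) N (1 + K)^-1.
- move=> t; apply: cvgM; first exact: continuous_1norm.
  apply: cvgV; first by rewrite gt_eqF // ltr_pwDl.
  by apply: cvgD; [exact: cvg_cst | exact: continuous_abs_contour].
- by rewrite divr_gt0 // ltr_pwDl.
- by rewrite invr_gt0 ltr_pwDl // ltW.
- have K1 : 0 < 1 + K by rewrite ltr_pwDl // ltW.
  have A1 : 0 < 1 + abs (gamma t) by rewrite ltr_pwDl.
  rewrite ler_pdivlMr // ler_pdivrMl //.
  rewrite mulrDl mul1r lerD //; first by rewrite lerDl.
  exact: hK.
exists d^-1; first by rewrite invr_gt0.
move=> t; have := hd t; rewrite ler_pdivlMr ?ltr_pwDl // => h.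
by rewrite ler_pdivlMl // (le_trans _ h) // ler_wpM2l ?ltW // ltrDr.
Qed.

Lemma contour_ge (w : R[i]) : ~ range gamma w ->
  exists2 d, 0 < d & forall t, d * (1 + `|t|) <= abs (gamma t - w).
Proof.
move=> nw; have [N [m [N0 m0 hm]]] := contour_Re_growth (cRe w).
have p1 t : 0 < 1 + `|t| :> R by rewrite ltr_pwDl.
have [|t||t tN|d d0 hd] := @positive_lower_bound _ (fun t => abs (gamma t - w) / (1 + `|t|)) N m.
- move=> t; apply: cvgM.
    by apply: continuous_abs_contour => u; apply: cvgB; [exact: cgamma | exact: cvg_cst].
  by apply: cvgV; [rewrite gt_eqF | exact: continuous_1norm].
- rewrite divr_gt0 // abs_gt0 subr_eq0; apply/eqP => e; apply: nw; by exists t.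
- exact: m0.
- rewrite ler_pdivlMr // (le_trans (hm _ tN)) // -cReB.
  by rewrite (le_trans (ler_norm _)) // ler_Re_abs.
by exists d => // t; rewrite -ler_pdivlMr.
Qed.

Lemma rderiv_contour_measurable : cmeasurable setT (rderiv gamma).
Proof.
have [s h] := contour_derive; split.
- by apply: (@measurable_off_finite _ _ s) => t /h[c _]; apply: cvg_Re.
- by apply: (@measurable_off_finite _ _ s) => t /h[c _]; apply: cvg_Im.
Qed.

(** The ends are affine, with derivatives - u and v. On the compact middle part local bounds
    suffice; at a break they come from the two one-sided limits. *)
Lemma rderiv_contour_bounded : exists2 M, 0 < M & forall t, abs (rderiv gamma t) <= M.
Proof.
have [N [u [v [[N0 _ _ _ _] [ha hb _ _]]]]] := contour_ends.
have [t|M hM] := @locally_bounded_itv _ (fun t => abs (rderiv gamma t)) (- N) N.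
  have [_ [s [h1 h2]]] := smooth.
  have near1 (F : set_system R) (l : R[i]) : Filter F -> rderiv gamma x @[x --> F] --> l ->
      \forall x \near F, abs (rderiv gamma x) <= abs l + 1.
    move=> FF /(cvg_abs FF)/cvgrPdist_lt/(_ 1 ltr01); apply: filterS => x hx.
    rewrite -lerBlDl (le_trans (ler_norm _)) // distrC ltW //.
  have [/h2[[l1 _ /near1 hl1] [l2 _ /near1 hl2]]|/h1[_ _ /near1 h _]] := boolP (t \in s); last first.
    by exists (abs (rderiv gamma t) + 1); apply: h; exact: nbhs_filter.
  exists (abs l1 + 1 + (abs l2 + 1) + abs (rderiv gamma t)).
  have [x0 y0 z0] : [/\ 0 <= abs l1, 0 <= abs l2 & 0 <= abs (rderiv gamma t)] by rewrite !abs_ge0.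
  near=> x; have [xt|xt|->] := ltgtP x t; last by rewrite lerDr; lra.
  - suff : abs (rderiv gamma x) <= abs l1 + 1 by move=> h; clear - h x0 y0 z0; lra.
    by move: (xt); near: x; move: hl1; rewrite near_withinE.
  - suff : abs (rderiv gamma x) <= abs l2 + 1 by move=> h; clear - h x0 y0 z0; lra.
    by move: (xt); near: x; move: hl2; rewrite near_withinE.
exists (`|M| + abs u + abs v + 1); first by rewrite ltr_wpDl ?addr_ge0 ?abs_ge0.
have hN := ler_norm M.
have [x0 y0 z0] : [/\ 0 <= abs u, 0 <= abs v & 0 <= `|M|] by rewrite !abs_ge0.
move=> t; have [tN|tN] := ltP t (- N).
  have e : rderiv gamma t = - u.
    apply: cderive_rderiv.
    have [d1 d2] : cderive (fun t => gamma (- N) + (- N - t)%:C * u) t (- u).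
      apply: cderive_eq; first apply: cderiveD (cderive_cst _ _) _.
        apply: cderiveM (cderive_cst u t); apply: cderive_real.
      by rewrite mulr0 addr0 !add0r mul1r rmorphN1 mulN1r.
    have nt : \forall x \near t, x < - N by exact: lt_nbhsl.
    split; [apply: near_eq_is_derive d1 | apply: near_eq_is_derive d2];
      by apply: filterS nt => x xN; rewrite (ha x (ltW xN)).
  by rewrite e absN; lra.
have [tN'|tN'] := ltP N t.
  have e : rderiv gamma t = v.
    apply: cderive_rderiv.
    have [d1 d2] : cderive (fun t => gamma N + (t - N)%:C * v) t v.
      apply: cderive_eq; first apply: cderiveD (cderive_cst _ _) _.
        apply: cderiveM (cderive_cst v t); apply: cderive_real.
      by rewrite mulr0 addr0 !add0r subr0 mul1r.
    have nt : \forall x \near t, N < x by exact: lt_nbhsr.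
    split; [apply: near_eq_is_derive d1 | apply: near_eq_is_derive d2];
      by apply: filterS nt => x xN; rewrite (hb x (ltW xN)).
  by rewrite e; lra.
by have := hM t; rewrite tN tN' => /(_ isT); lra.
Unshelve. all: end_near.
Qed.

End ContourGeometry.

(* Where cos k is the cosine of the angle between w and the positive axis,
   |w + r|^2 = (1 + cos k)/2 (|w| + r)^2 + (1 - cos k)/2 (|w| - r)^2. *)
Lemma slit_plane_dist (R : realType) (w : R[i]) (d r : R) : 0 < d -> w != 0 -> 0 <= r ->
  d * abs w <= abs w + cRe w -> d / 2 * (r + abs w) <= abs (r%:C + w).
Proof.
move=> d0 w0 r0 h; rewrite [r + _]addrC [r%:C + _]addrC.
have := abs_sqr w; have := ler_Re_abs w; have : 0 < abs w by rewrite abs_gt0.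
move: h; set g := abs w; set a := cRe w => h g0 ag e.
have {}ag : a <= g by rewrite (le_trans (ler_norm _)).
have d2 : d <= 2 by rewrite -(ler_pM2r g0); lra.
rewrite -(@ler_pXn2r _ 2) ?nnegrE ?abs_ge0 // ?mulr_ge0 ?invr_ge0 ?addr_ge0 ?(ltW d0) ?(ltW g0) //.
rewrite abs_sqr cReD cImD /= addr0 -/a.
have -> : (a + r) ^+ 2 + cIm w ^+ 2 = g ^+ 2 + 2 * a * r + r ^+ 2 by rewrite e; ring.
rewrite exprMn; apply: (@le_trans _ _ (d / 2 * (g + r) ^+ 2)).
  by rewrite ler_wpM2r ?sqr_ge0 // expr2 ler_piMr ?divr_ge0 ?(ltW d0) //; lra.
rewrite -(ler_pM2r g0) -subr_ge0.
have -> : (g ^+ 2 + 2 * a * r + r ^+ 2) * g - d / 2 * (g + r) ^+ 2 * g =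
  (g + a - d * g) / 2 * (g + r) ^+ 2 + (g - a) / 2 * (g - r) ^+ 2 by field.
by rewrite addr_ge0 // mulr_ge0 ?sqr_ge0 // divr_ge0 // subr_ge0.
Qed.

Section AdmissibleContour.
Context {R : realType}.
Variables (gamma : R -> R[i]) (theta : R) (sigma : set R[i]).
Hypotheses (htheta : pi / 2 < theta < pi) (hgamma : admissible_contour gamma theta sigma).

Let smooth : piecewise_smooth gamma. Proof. by case: hgamma. Qed.
Let ends : straight_ends gamma. Proof. by case: hgamma. Qed.

Lemma continuous_contour : continuous gamma.
Proof. by case: smooth. Qed.

Lemma ray_Nrange z : ray theta z -> ~ range gamma z.
Proof.
case: hgamma => _ _ _ [_ h _] rz gz; have : (range gamma `&` ray theta) z by [].
by rewrite h.
Qed.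

Lemma range_Nray t : ~ ray theta (gamma t).
Proof. by move=> /ray_Nrange; apply; exists t. Qed.

Lemma contour_neq0 t : gamma t != 0.
Proof.
apply/eqP => e; apply: (range_Nray (t := t)); exists 0 => //.
by rewrite e rmorph0 mul0r.
Qed.

Lemma contour_interior_Nrange z : contour_interior gamma z -> ~ range gamma z.
Proof. by move=> [r /(_ r (lexx r))] /connected_component_sub. Qed.

Lemma connected_contour_interior (C : set R[i]) z w : connected C -> C `<=` ~` range gamma ->
  C z -> C w -> contour_interior gamma z -> contour_interior gamma w.
Proof.
move=> cC sC Cz Cw [r hr]; exists r => x /hr h; apply: connected_component_trans h _.
exact: (connected_component_max Cz sC cC).
Qed.

(** The cut is connected, avoids gamma and contains 0, which is outside. *)
Lemma ray_Ninterior z : ray theta z -> ~ contour_interior gamma z.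
Proof.
move=> rz iz; case: hgamma => _ _ _ [_ _ [_ h0]]; apply: h0.
apply: connected_contour_interior rz _ iz.
- have -> : ray theta = [set t%:C * expi theta | t in `[0, +oo[].
    apply/seteqP; split=> w /=; first by move=> [t t0 ->]; exists t; rewrite //= in_itv /= t0.
    by move=> [t + <-]; rewrite /= in_itv /= andbT => t0; exists t.
  apply: connected_continuous_connected; first by apply/connected_intervalP; exact: interval_is_interval.
  apply: continuous_subspaceT => t; rewrite /continuous_at mulrC.
  under eq_fun do rewrite mulrC.
  by apply: cvg_cmul; apply: cvg_real; exact: cvg_id.
- by move=> w; exact: ray_Nrange.
- by exists 0 => //; rewrite rmorph0 mul0r.
Qed.

Lemma rayP t : 0 <= t -> ray theta (t%:C * expi theta).
Proof. by move=> t0; exists t. Qed.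

Lemma contour_compl_spectrum z : sigma z -> z != 0 -> contour_interior gamma z.
Proof. by case: hgamma => _ _ _ [h _ _] sz z0; apply: h; split => //; exact/eqP. Qed.

(** After rotation by pi - theta the cut is the negative half-line, and [slit_plane_dist] asks for a
    positive lower bound of 1 + cos (arg w). On the middle part this is compactness; at the ends Re
    (gamma t) >= 0 keeps the cosine above - |sin (pi - theta)| > -1. *)
Lemma contour_ray_dist : exists2 c, 0 < c & forall t r, 0 <= r ->
  c * (abs (gamma t) + r) <= abs (gamma t - r%:C * expi theta).
Proof.
pose w t := expi (pi - theta) * gamma t.
have sw t : slit_plane (w t) by apply: slit_plane_ray; exact: range_Nray.
have aw t : abs (w t) = abs (gamma t) by rewrite absM abs_expi mul1r.
have gp t : 0 < abs (gamma t) by rewrite abs_gt0 contour_neq0.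
have [N [m [N0 m0 hm]]] := contour_Re_growth ends 0.
pose k := pi - theta; have /andP[t1 t2] := htheta.
have ck : 0 < cos k by apply: cos_gt0_pihalf; have := pi_gt0 R; rewrite /k => p0; apply/andP; split; lra.
have sk : `|sin k| < 1.
  rewrite -(@ltr_pXn2r _ 2) ?nnegrE // expr1n -normrX ger0_norm ?sqr_ge0 //.
  by rewrite -[X in _ < X](cos2Dsin2 k) ltrDr exprn_gt0.
have cw : continuous w by move=> t; apply: cvg_cmul; exact: continuous_contour.
have caw : continuous (fun t => abs (w t)) by exact: continuous_abs_contour.
have [t|t||t tN|d d0 hd] := @positive_lower_bound _ (fun t => (abs (w t) + cRe (w t)) / abs (w t)) N (1 - `|sin k|).
- apply: cvgM; first by apply: cvgD; [exact: caw | apply: cvg_Re; exact: cw].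
  by apply: cvgV; [rewrite aw gt_eqF | exact: caw].
- by apply: divr_gt0; [exact: sw | rewrite aw; exact: gp].
- by rewrite subr_gt0.
- rewrite ler_pdivlMr ?aw // mulrBl mul1r lerD2l cReM /= lerNl opprB -/k.
  rewrite (@le_trans _ _ (sin k * cIm (gamma t))) //.
    rewrite gerDl oppr_le0 mulr_ge0 ?(ltW ck) //.
    by have := hm t tN; rewrite subr0; apply: le_trans; rewrite mulr_ge0 ?(ltW m0) // addr_ge0.
  by rewrite (le_trans (ler_norm _)) // normrM ler_wpM2l // ler_Im_abs.
exists (d / 2); first by rewrite divr_gt0.
move=> t r r0; have -> : abs (gamma t - r%:C * expi theta) = abs (w t + r%:C).
  rewrite -[LHS]mul1r -(abs_expi (pi - theta)) -absM mulrBr mulrCA -expiD subrK expi_pi.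
  by rewrite mulrN1 opprK.
have h : d * abs (w t) <= abs (w t) + cRe (w t).
  by have := hd t; rewrite ler_pdivlMr ?aw.
rewrite -(aw t) [_ + r]addrC [_ + r%:C]addrC; apply: slit_plane_dist => //.
by rewrite -abs_gt0 aw.
Qed.

End AdmissibleContour.

(** * Winding numbers and Cauchy's formula *)

Section PowerIntegrals.
Context {R : realType}.
Local Notation leb := (@lebesgue_measure R).
Implicit Types (a b d t M : R) (f F : R -> R).

Lemma one_powR a : 1 `^ a = 1 :> R.
Proof. by rewrite powR1. Qed.

(** Monotone convergence along [1 / (n + 1), n + 1], where the integral is a difference of two
    values of the primitive, hence at most 2 M. *)
Lemma integrable_bounded_primitive f F M : (forall t, 0 < t -> 0 <= f t) ->
  (forall t, 0 < t -> {for t, continuous f}) -> (forall t, 0 < t -> is_derive t 1 F (f t)) ->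
  (forall t, 0 < t -> `|F t| <= M) -> leb.-integrable `]0, +oo[ (EFin \o f).
Proof.
move=> f0 cf dF FM; pose D (n : nat) : set R := `[n.+1%:R^-1, n.+1%:R]%classic.
have p0 n : 0 < n.+1%:R :> R by rewrite ltr0n.
have i0 n : 0 < n.+1%:R^-1 :> R by rewrite invr_gt0.
have Dpos n t : D n t -> 0 < t.
  by rewrite /D /= in_itv /= => /andP[/(lt_le_trans (i0 n))].
have DU : \bigcup_n D n = `]0, +oo[%classic.
  apply/seteqP; split=> t /=.
    by move=> [n _ /Dpos t0]; rewrite in_itv /= t0.
  rewrite in_itv /= andbT => t0; exists (Num.bound t + Num.bound t^-1)%N => //.
  rewrite /D /= in_itv /=; apply/andP; split.
    rewrite invf_ple ?posrE //; apply: ltW.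
    have ti : 0 <= t^-1 by rewrite invr_ge0 ltW.
    by apply: lt_le_trans (archi_boundP ti) _; rewrite ler_nat leqW // leq_addl.
  by apply: ltW; apply: lt_le_trans (archi_boundP (ltW t0)) _; rewrite ler_nat leqW // leq_addr.
have mf : measurable_fun (`]0, +oo[%classic : set R) f.
  apply: open_continuous_measurable_fun => // t; rewrite inE /= in_itv /= andbT; exact: cf.
have sD n : D n `<=` `]0, +oo[%classic by move=> t /Dpos t0; rewrite /= in_itv /= t0.
apply/integrableP; split; first exact/measurable_EFinP.
have -> : (\int[leb]_(x in `]0%R, +oo[) `|(f x)%:E| = \int[leb]_(x in `]0%R, +oo[) (f x)%:E)%E.
  apply: eq_integral => t; rewrite inE /= in_itv /= andbT => t0.
  by rewrite ger0_norm // f0.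
have := @ge0_nondecreasing_set_cvg_integral _ (measurableTypeR R) _ D (EFin \o f) leb.
rewrite DU => H.
have {}H : (\int[leb]_(x in D i) (EFin \o f) x)%E @[i --> \oo] --> (\int[leb]_(x in `]0%R, +oo[) (f x)%:E)%E.
  apply: H.
  - move=> n m nm; apply/subsetPset => t; rewrite /D /= !in_itv /= => /andP[h1 h2].
    apply/andP; split; last by rewrite (le_trans h2) // ler_nat.
    by rewrite (le_trans _ h1) // lef_pV2 ?posrE // ler_nat.
  - by move=> n; exact: measurable_itv.
  - by move=> n; apply/measurable_EFinP; exact: measurable_funS (sD n) mf.
  - by move=> n t /Dpos t0; rewrite lee_fin f0.
have bd n : (\int[leb]_(x in D n) (f x)%:E <= (2 * M)%:E)%E.
  have [->|n0] := eqVneq n 0%N.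
    rewrite /D invr1 set_itv1 integral_set1 lee_fin mulr_ge0 //.
    by rewrite (le_trans (normr_ge0 _) (FM 1 _)).
  have nn : n.+1%:R^-1 < n.+1%:R :> R.
    by rewrite (@lt_trans _ _ 1) ?ltr1n ?invf_lt1 ?ltr1n // ltnS lt0n.
  rewrite (@continuous_FTC2 _ f F) //.
  - rewrite -EFinB lee_fin (le_trans (ler_norm _)) // (le_trans (ler_normB _ _)) //.
    by rewrite mulr2n mulrDl mul1r lerD // FM.
  - apply: continuous_in_subspaceT => t; rewrite inE => /Dpos; exact: cf.
  - have dd t : 0 < t -> derivable F t 1 by move=> /dF h; exact: ex_derive.
    have cF t : 0 < t -> {for t, continuous F}.
      by move=> /dd /derivable1_diffP; exact: differentiable_continuous.
    split.
    + by move=> t; rewrite in_itv /= => /andP[h _]; apply: dd; exact: lt_trans h.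
    + by apply: cvg_at_right_filter; apply: cF.
    + by apply: cvg_at_left_filter; apply: cF.
  - move=> t; rewrite in_itv /= => /andP[h _].
    by rewrite derive1E; apply: (@derive_val _ _ _ _ _ _ _ (dF t (lt_trans (i0 n) h))).
apply: (@le_lt_trans _ _ (2 * M)%:E); last exact: ltry.
rewrite -(cvg_lim _ H) //; apply: lime_le; first by apply/cvg_ex; eexists; exact: H.
by apply: nearW => n; exact: bd.
Qed.

Lemma is_derive_powR_comp (g : R -> R) t a b : 0 < g t -> is_derive t 1 g b ->
  is_derive t 1 (fun u => g u `^ a) (a * g t `^ (a - 1) * b).
Proof. by move=> g0 dg; exact: is_derive1_comp (is_derive1_powR a g0) dg. Qed.

Lemma continuous_powR_comp (g : R -> R) t a : 0 < g t -> {for t, continuous g} ->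
  {for t, continuous (fun u => g u `^ a)}.
Proof.
move=> g0 cg; have h : {for g t, continuous (fun x => x `^ a)}.
  apply: differentiable_continuous; apply/derivable1_diffP.
  by have := is_derive1_powR a g0 => h; exact: ex_derive.
exact: cvg_comp cg h.
Qed.

(** Comparison with t^(a - 1) (1 + t^a)^(- b / a - 1), whose primitive - (1 / b) (1 + t^a)^(- b / a)
    is bounded; the comparison rests on 1 + t^a <= 2 (1 + t)^a. *)
Lemma integrable_powR_ray a b : 0 < a -> 0 < b ->
  leb.-integrable `]0, +oo[ (EFin \o (fun t => t `^ (a - 1) * (1 + t) `^ (- (a + b)))).
Proof.
move=> a0 b0; pose f t := t `^ (a - 1) * (1 + t `^ a) `^ (- (b / a) - 1).
have p t : 0 < 1 + t `^ a by rewrite ltr_pwDl // powR_ge0.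
have cpow t c : 0 < t -> {for t, continuous (fun u => u `^ c)}.
  by move=> t0; apply: (@continuous_powR_comp id).
have intf : leb.-integrable `]0, +oo[ (EFin \o f).
  apply: (@integrable_bounded_primitive f (fun t => - b^-1 * (1 + t `^ a) `^ (- (b / a))) b^-1).
  - by move=> t t0; rewrite mulr_ge0 // powR_ge0.
  - move=> t t0; apply: cvgM; first exact: cpow.
    apply: (@continuous_powR_comp (fun t => 1 + t `^ a)) => //.
    by apply: cvgD; [exact: cvg_cst | exact: cpow].
  - move=> t t0; have d1 : is_derive t 1 (fun u => 1 + u `^ a) (a * t `^ (a - 1)).
      exact: is_derive_eq (is_deriveD (is_derive_cst (1 : R) t 1) (is_derive1_powR a t0)) (add0r _).
    have d2 := @is_derive_powR_comp (fun u => 1 + u `^ a) t (- (b / a)) _ (p t) d1.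
    apply: is_derive_eq (is_deriveZ (- b^-1) d2) _.
    rewrite /f /GRing.scale /=; field; by rewrite !gt_eqF.
  - move=> t t0; rewrite normrM normrN (gtr0_norm (_ : 0 < b^-1)) ?invr_gt0 //.
    apply: ler_piMr; first by rewrite invr_ge0 ltW.
    rewrite ger0_norm ?powR_ge0 // powRN invf_le1 ?powR_gt0 //.
    by rewrite -[leLHS](one_powR (b / a)) ge0_ler_powR ?nnegrE // ?(ltW (p t)) ?lerDl ?powR_ge0 ?divr_ge0 ?ltW.
have iK : leb.-integrable `]0, +oo[ (EFin \o (fun t => 2 `^ (b / a + 1) * f t)).
  have -> : EFin \o (fun t => 2 `^ (b / a + 1) * f t) = fun x => ((2 `^ (b / a + 1))%:E * (f x)%:E)%E.
    by apply/funext => x /=; rewrite EFinM.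
  exact: integrableZl.
apply: le_integrable iK => //.
  apply/measurable_EFinP; apply: open_continuous_measurable_fun => // t.
  rewrite inE /= in_itv /= andbT => t0; apply: cvgM; first exact: cpow.
  apply: (@continuous_powR_comp (fun t => 1 + t)); first by rewrite ltr_pwDl // ltW.
  by apply: cvgD; [exact: cvg_cst | exact: cvg_id].
move=> t /=; rewrite in_itv /= andbT => t0; rewrite lee_fin.
have q : 0 < 1 + t by rewrite ltr_pwDl // ltW.
rewrite !ger0_norm ?mulr_ge0 ?powR_ge0 // /f mulrCA ler_wpM2l ?powR_ge0 //.
rewrite -opprD !powRN -ler_pdivrMr ?invr_gt0 ?powR_gt0 // invrK mulrC.
rewrite ler_pdivrMr ?powR_gt0 //.
have -> : 2 `^ (b / a + 1) * (1 + t) `^ (a + b) = (2 * (1 + t) `^ a) `^ (b / a + 1).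
  rewrite powRM ?powR_ge0 // -powRrM; congr (_ * _ `^ _); field; by rewrite gt_eqF.
rewrite ge0_ler_powR ?nnegrE ?mulr_ge0 ?powR_ge0 ?(ltW (p t)) // ?addr_ge0 ?divr_ge0 ?(ltW a0) ?(ltW b0) //.
rewrite mulr2n mulrDl mul1r lerD //.
  by rewrite -[leLHS](one_powR a) ge0_ler_powR ?nnegrE ?(ltW q) ?(ltW a0) // lerDl ltW.
by rewrite ge0_ler_powR ?nnegrE ?(ltW q) ?(ltW a0) ?(ltW t0) // lerDr.
Qed.

Lemma integrable_powR_line d : 0 < d ->
  leb.-integrable setT (EFin \o (fun t => (1 + `|t|) `^ (- 1 - d))).
Proof.
move=> d0; set f := fun t => _; have f0 t : 0 <= f t by exact: powR_ge0.
have p t : 0 < 1 + `|t| by rewrite ltr_pwDl.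
have cf : continuous f.
  move=> t; apply: (@continuous_powR_comp (fun t => 1 + `|t|)) => //.
  by apply: cvgD; [exact: cvg_cst | exact: norm_continuous].
apply/integrableP; split; first by apply/measurable_EFinP; exact: continuous_measurable_fun.
have -> : (\int[leb]_x `|(f x)%:E| = \int[leb]_x (f x)%:E)%E.
  by apply: eq_integral => t _ /=; rewrite ger0_norm.
rewrite ge0_symfun_integralT //; last by move=> t; rewrite /f /= normrN.
have -> : [set x : R | (0 <= x)%R] = `[0, +oo[%classic.
  by apply/seteqP; split=> t /=; rewrite in_itv /= andbT.
pose F t := - d^-1 * (1 + t) `^ (- d).
have q t : 0 < t -> 0 < 1 + t by move=> t0; rewrite ltr_pwDl // ltW.
have dF t : 0 <= t -> is_derive t 1 F (f t).
  move=> t0; have q' : 0 < 1 + t by rewrite ltr_pwDl.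
  have d1 : is_derive t 1 (fun u => 1 + u) 1.
    exact: is_derive_eq (is_deriveD (is_derive_cst (1 : R) t 1) (is_derive_id t 1)) (add0r _).
  have d2 := @is_derive_powR_comp (fun u => 1 + u) t (- d) _ q' d1.
  apply: is_derive_eq (is_deriveZ (- d^-1) d2) _.
  rewrite /GRing.scale /= /f ger0_norm //.
  have -> : - d - 1 = - 1 - d by rewrite addrC.
  by field; rewrite gt_eqF.
have cF t : 0 <= t -> {for t, continuous F}.
  move=> /dF h; apply: differentiable_continuous; apply/derivable1_diffP; exact: ex_derive.
rewrite (@ge0_continuous_FTC2y _ f F 0 0) //.
- by rewrite -EFinB -EFinM ltry.
- exact: continuous_subspaceT.
- rewrite -[X in _ --> X](mulr0 (- d^-1)); apply: cvgM; first exact: cvg_cst.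
  apply/cvgrPdist_le => e e0; near=> t.
  rewrite sub0r normrN ger0_norm ?powR_ge0 //.
  have t1 : e `^ (- d^-1) <= t by near: t; apply: nbhs_pinfty_ge; exact: num_real.
  have e1 : 0 < e `^ (- d^-1) by rewrite powR_gt0.
  have -> : e = (e `^ (- d^-1)) `^ (- d).
    by rewrite -powRrM mulrNN mulVf ?gt_eqF // powRr1 // ltW.
  have t0 : 0 < t by exact: lt_le_trans e1 t1.
  rewrite [leLHS]powRN [leRHS]powRN lef_pV2 ?posrE ?powR_gt0 ?q //.
  apply: ge0_ler_powR; rewrite ?nnegrE ?(ltW d0) ?(ltW e1) ?(ltW (q _ t0)) //.
  by apply: le_trans t1 _; rewrite lerDr.
- by move=> t /ltW /dF h; exact: ex_derive.
- by apply: cvg_at_right_filter; apply: cF.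
- move=> t; rewrite in_itv /= andbT => /ltW t0.
  by rewrite derive1E; apply: (@derive_val _ _ _ _ _ _ _ (dF t t0)).
Unshelve. all: end_near.
Qed.

End PowerIntegrals.

Section LogarithmAddenda.
Context {R : realType}.
Implicit Types (z w a b : R[i]) (t : R).

Lemma cderiveV (g : R -> R[i]) t l : g t != 0 -> cderive g t l ->
  cderive (fun u => (g u)^-1) t (- (l / g t ^+ 2)).
Proof.
move=> g0 dg; have cg := cderive_continuous dg; move: dg => /cderiveP[q [eq cq hq]].
pose p u := if g u == 0 then - ((g t)^-1 / (u - t)%:C) else - (q u * (g u * g t)^-1).
apply/cderiveP; exists p; split.
- move=> u; rewrite /p; case: eqP => [gu|/eqP gu].
    have ut : (u - t)%:C != 0 :> R[i].
      apply: contraNneq g0 => ut; have := eq u; rewrite ut mul0r gu sub0r => /eqP.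
      by rewrite oppr_eq0.
    by rewrite gu invr0 sub0r mulrN mulrCA divff // mulr1.
  by rewrite mulrN mulrA -eq; field; rewrite g0 gu.
- have h : - (q u * (g u * g t)^-1) @[u --> t] --> - (l / g t ^+ 2).
    have cg' : g u * g t @[u --> t] --> g t ^+ 2 by rewrite expr2; exact: (cvg_cM cg (cvg_ccst (g t))).
    have g2 : g t ^+ 2 != 0 by rewrite expf_neq0.
    have h1 : q u * (g u * g t)^-1 @[u --> t] --> l * (g t ^+ 2)^-1.
      exact: (cvg_cM cq (cvg_cV g2 cg')).
    have h2 : -1 * (q u * (g u * g t)^-1) @[u --> t] --> -1 * (l / g t ^+ 2) by exact: cvg_cmul.
    by move: h2; rewrite mulN1r; under eq_fun do rewrite mulN1r.
  apply: cvg_trans h; apply: near_eq_cvg.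
  have : \forall u \near t, 0 < abs (g u).
    have ca : abs (g u) @[u --> t] --> abs (g t) by exact: (cvg_abs _ cg).
    move: ca => /cvgrPdist_lt/(_ (abs (g t))).
    rewrite abs_gt0 => /(_ g0); apply: filterS => u /(le_lt_trans (ler_norm _)).
    by rewrite ltrBlDr ltrDl.
  by apply: filterS => u gu; rewrite /p ifF //; apply/negbTE; rewrite -abs_gt0.
- by rewrite /p (negbTE g0) hq expr2.
Qed.

Lemma carg_Re z : 0 < cRe z -> `|carg z| < pi / 2.
Proof.
move=> z0; rewrite /carg normrM ger0_norm // mulrC -ltr_pdivlMr //.
have az : `|cIm z / (abs z + cRe z)| < 1.
  have p : 0 < abs z + cRe z by exact: slit_plane_Re.
  rewrite normrM normfV (gtr0_norm p) ltr_pdivrMr // mul1r.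
  by rewrite (le_lt_trans (ler_Im_abs z)) // ltrDl.
have -> : pi / 2 / 2 = atan 1 :> R by rewrite atan1; field.
move: az; rewrite ltr_norml => /andP[h1 h2]; rewrite ltr_norml; apply/andP; split.
- by rewrite -atanN; exact: lt_atan.
- exact: lt_atan.
Qed.

(** Both arguments lie in ]- pi / 2, pi / 2[, so their difference is still a principal argument. *)
Lemma clog_div a b : 0 < cRe a -> 0 < cRe b -> clog (a / b) = clog a - clog b.
Proof.
move=> a0 b0; have [sa sb] := (slit_plane_Re a0, slit_plane_Re b0).
have pa : 0 < abs a by rewrite abs_gt0 slit_plane_neq0.
have pb : 0 < abs b by rewrite abs_gt0 slit_plane_neq0.
have e : a / b = (abs a / abs b)%:C * expi (carg a - carg b).
  rewrite {1}(carg_polar sa) {1}(carg_polar sb) expiD expiN rmorphM fmorphV /= invfM.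
  by rewrite mulrACA.
apply: eq_ReIm => /=; first by rewrite absM absV lnM ?posrE ?invr_gt0 // lnV ?posrE.
rewrite e carg_unique //; first by rewrite divr_gt0.
have := carg_Re a0; have := carg_Re b0; rewrite !ltr_norml => /andP[? ?] /andP[? ?].
by apply/andP; split; lra.
Qed.

Lemma clogN_lt z : cIm z < 0 -> clog (- z) = clog z + 'i * pi%:C.
Proof.
move=> z0; have sz : slit_plane z by apply: slit_plane_Im; rewrite lt_eqF.
have pz : 0 < abs z by rewrite abs_gt0 slit_plane_neq0.
have e : - z = (abs z)%:C * expi (carg z + pi).
  by rewrite {1}(carg_polar sz) expiD expi_pi !mulrN1 mulrN.
have cb := carg_bound z; have p0 := pi_gt0 R.
have c0 : carg z < 0.
  rewrite /carg pmulr_rlt0 // -atan0; apply: lt_atan; rewrite pmulr_llt0 // invr_gt0.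
  exact: sz.
rewrite -complexiE; apply: eq_ReIm; rewrite ?cReD ?cImD ?cReM ?cImM /= ?absN; first by ring.
rewrite e carg_unique //; first by ring.
by move: cb; rewrite !ltr_norml => /andP[? ?]; apply/andP; split; lra.
Qed.

Lemma clogN_gt z : 0 < cIm z -> clog (- z) = clog z - 'i * pi%:C.
Proof.
move=> z0; have h := @clogN_lt (- z); rewrite opprK cImN oppr_lt0 in h.
by rewrite h // addrK.
Qed.

Lemma clog_rotate (phi : R) z : 0 < cRe z -> 0 <= phi <= pi / 2 ->
  clog (expi phi * z) = clog z + 'i * phi%:C.
Proof.
move=> z0 /andP[f0 f1]; have sz := slit_plane_Re z0.
have pz : 0 < abs z by rewrite abs_gt0 slit_plane_neq0.
have e : expi phi * z = (abs z)%:C * expi (carg z + phi).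
  by rewrite {1}(carg_polar sz) expiD mulrC mulrA.
have := carg_Re z0; rewrite ltr_norml => /andP[? ?].
rewrite -complexiE; apply: eq_ReIm; rewrite ?cReD ?cImD ?cReM ?cImM /=.
  by rewrite absM abs_expi mul1r; ring.
rewrite e carg_unique //; first by ring.
by rewrite ltr_norml; have := pi_gt0 R => ?; apply/andP; split; lra.
Qed.

End LogarithmAddenda.

Section Winding.
Context {R : realType}.
Variables (gamma : R -> R[i]) (theta : R) (sigma : set R[i]).
Hypotheses (htheta : pi / 2 < theta < pi) (hgamma : admissible_contour gamma theta sigma).
Local Notation leb := (@lebesgue_measure R).

Let smooth : piecewise_smooth gamma. Proof. by case: hgamma. Qed.
Let ends : straight_ends gamma. Proof. by case: hgamma. Qed.
Let cgamma : continuous gamma. Proof. exact: continuous_contour hgamma. Qed.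

Lemma integrable_powR_lineZ (C d : R) : 0 < d ->
  leb.-integrable setT (EFin \o (fun t => C * (1 + `|t|) `^ (- 1 - d))).
Proof.
move=> d0; rewrite (_ : _ \o _ = fun t => (C%:E * ((1 + `|t|) `^ (- 1 - d))%:E)%E).
  exact: integrableZl (integrable_powR_line d0).
by apply/funext => t /=; rewrite EFinM.
Qed.

Lemma contour_measurable : cmeasurable setT gamma.
Proof.
split; apply: continuous_measurable_fun => t; [apply: cvg_Re | apply: cvg_Im]; exact: cgamma.
Qed.

Lemma contour_integrable_le (f : R[i] -> R[i]) (C d : R) : 0 < d ->
  cmeasurable setT (fun t => f (gamma t)) ->
  (forall t, abs (f (gamma t)) <= C * (1 + `|t|) `^ (- 1 - d)) -> contour_integrable gamma f.
Proof.
move=> d0 mf fC; have [M M0 hM] := rderiv_contour_bounded smooth ends.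
apply: (le_cintegrable measurableT _ (integrable_powR_lineZ (C * M) d0)).
  by apply: cmeasurableM => //; exact: rderiv_contour_measurable.
by move=> t _; rewrite absM mulrAC ler_pM ?abs_ge0.
Qed.

Lemma powR_line2 (t : R) : (1 + `|t|) `^ (- 1 - 1) = ((1 + `|t|) ^+ 2)^-1.
Proof.
have p : 0 <= 1 + `|t| by rewrite addr_ge0.
by rewrite -opprD powRN -powR_mulrn.
Qed.

Lemma cauchy_kernel_integrable (w w' : R[i]) : ~ range gamma w -> ~ range gamma w' ->
  contour_integrable gamma (fun z => ((z - w) * (z - w'))^-1).
Proof.
move=> /(contour_ge smooth ends)[d d0 hd] /(contour_ge smooth ends)[e e0 he].
apply: (@contour_integrable_le _ (d * e)^-1 1) => //.
  by apply: cmeasurableV; apply: cmeasurableM; apply: cmeasurableB (cmeasurable_cst _ _);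
    exact: contour_measurable.
move=> t; have p : 0 < 1 + `|t| by rewrite ltr_pwDl.
rewrite powR_line2 absV absM -invfM lef_pV2 ?posrE ?mulr_gt0 ?exprn_gt0 //.
- by rewrite expr2 mulrACA ler_pM ?mulr_ge0 // ?(ltW d0) ?(ltW e0) ?(ltW p).
- by rewrite (lt_le_trans _ (hd t)) // mulr_gt0.
- by rewrite (lt_le_trans _ (he t)) // mulr_gt0.
Qed.

(** Along an infinite contour a single Cauchy kernel decays too slowly to be integrable. The
    difference of two kernels is integrable, and represents 2 pi i times the difference of the
    winding numbers. *)
Definition winding (w w' : R[i]) : R[i] :=
  contour_integral gamma (fun z => (z - w)^-1 - (z - w')^-1).

Lemma subV_kernel (z w w' : R[i]) : z != w -> z != w' ->
  (z - w)^-1 - (z - w')^-1 = (w - w') * ((z - w) * (z - w'))^-1.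
Proof. by rewrite -subr_eq0 -[z == w']subr_eq0 => zw zw'; field; rewrite zw zw'. Qed.

Lemma contour_neq w t : ~ range gamma w -> gamma t != w.
Proof. by move=> h; apply/eqP => e; apply: h; exists t. Qed.

Lemma winding_integrable w w' : ~ range gamma w -> ~ range gamma w' ->
  contour_integrable gamma (fun z => (z - w)^-1 - (z - w')^-1).
Proof.
move=> h h'; have := cintegrableZ measurableT (w - w') (cauchy_kernel_integrable h h').
apply: (eq_cintegrable measurableT) => t _; rewrite mulrA subV_kernel //; exact: contour_neq.
Qed.

Lemma winding_chain w w' w'' : ~ range gamma w -> ~ range gamma w' -> ~ range gamma w'' ->
  winding w w' + winding w' w'' = winding w w''.
Proof.
move=> h h' h''; rewrite /winding /contour_integral -(cintegralD measurableT);
  [|exact: winding_integrable..].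
by apply: eq_cintegral => t _; rewrite -mulrDl addrA subrK.
Qed.

Lemma cvg_inv_contour (w : R[i]) (s : R -> R) : ~ range gamma w -> (forall t, `|s t| = `|t|) ->
  (gamma (s n%:R) - w)^-1 @[n --> \oo] --> 0.
Proof.
move=> /(contour_ge smooth ends)[d d0 hd] hs.
apply: (@abs_squeeze _ _ _ _ _ _ (fun n => d^-1 * n.+1%:R^-1)).
  by rewrite -(mulr0 d^-1); apply: cvgM; [exact: cvg_cst | exact: cvg_harmonic].
apply: nearW => n; rewrite subr0 absV -invfM.
have h := hd (s n%:R); rewrite hs normr_nat -natr1 addrC in h *.
by rewrite lef_pV2 ?posrE ?(lt_le_trans _ h) ?mulr_gt0 // ltr_pwDl.
Qed.

(** For w near w' the quotient (gamma - w) / (gamma - w') stays in the right half-plane and tends to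
    1 at both ends. Its logarithm is a primitive of the integrand with equal limits, so the winding
    is locally constant. *)
Lemma winding_near (w' : R[i]) : ~ range gamma w' -> exists2 d : R, 0 < d & forall w : R[i], abs (w - w') < d ->
  ~ range gamma w /\ winding w w' = 0.
Proof.
move=> hw'; have [d d0 hd] := contour_ge smooth ends hw'; exists d => // w wd.
have hd' t : d <= abs (gamma t - w').
  by apply: le_trans (hd t); rewrite ler_peMr ?(ltW d0) // lerDl.
have hw : ~ range gamma w.
  by move=> [t _ e]; move: (hd' t); rewrite leNgt e wd.
split=> //; pose q t := 1 - (w - w') * (gamma t - w')^-1.
have n0 t : gamma t - w' != 0 by rewrite -abs_gt0 (lt_le_trans d0).
have qE t : q t = (gamma t - w) / (gamma t - w').
  by rewrite /q; field.
have q0 t : slit_plane (q t).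
  apply: slit_plane_Re; rewrite cReB /= subr_gt0 (le_lt_trans (ler_norm _)) //.
  rewrite (le_lt_trans (ler_Re_abs _)) // absM absV ltr_pdivrMr ?mul1r ?(lt_le_trans d0) //.
  exact: lt_le_trans (hd' t).
have cq : continuous (q : R -> R[i]).
  move=> t; have h1 : gamma u - w' @[u --> t] --> gamma t - w'.
    exact: (cvg_cB (@cgamma t) (cvg_ccst w')).
  exact: (cvg_cB (cvg_ccst 1) (cvg_cmul _ (cvg_cV (n0 t) h1))).
have [s hs] := contour_derive smooth.
have lim (e : R -> R) : (forall t, `|e t| = `|t|) -> clog (q (e n%:R)) @[n --> \oo] --> (0 : R[i]).
  move=> he; have h : q (e n%:R) @[n --> \oo] --> (1 : R[i]).
    have h0 : 1 - (w - w') * (gamma (e n%:R) - w')^-1 @[n --> \oo] --> 1 - (w - w') * 0.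
      exact: (cvg_cB (cvg_ccst 1) (cvg_cmul _ (cvg_inv_contour hw' he))).
    by rewrite mulr0 subr0 in h0.
  have c1 : clog (1 : R[i]) = 0.
    have := @clog_div R 1 1; rewrite divr1 subrr; apply; exact: ltr01.
  rewrite -c1; apply: cvg_clog h; apply: slit_plane_Re; exact: ltr01.
rewrite /winding /contour_integral -[RHS](subrr (0 : R[i])).
apply: (@cFTC2_line _ _ (fun t => clog (q t)) s 0 0).
- exact: winding_integrable.
- by move=> t; apply: cvg_clog (cq t); exact: q0.
- move=> t /hs[c dg]; split.
    have h1 (v : R[i]) : ~ range gamma v -> (gamma u - v)^-1 @[u --> t] --> (gamma t - v)^-1.
      move=> hv; apply: cvg_cV; first by rewrite subr_eq0 contour_neq.
      exact: (cvg_cB (@cgamma t) (cvg_ccst v)).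
    exact: (cvg_cM (cvg_cB (h1 _ hw) (h1 _ hw')) c).
  have dq : cderive q t ((w - w') * (rderiv gamma t / (gamma t - w') ^+ 2)).
    have d1 := cderiveB dg (cderive_cst w' t); rewrite subr0 in d1.
    have := cderiveB (cderive_cst 1 t) (cderiveZ (w - w') (cderiveV (n0 t) d1)).
    by move=> H; apply: cderive_eq H _; ring.
  apply: cderive_eq (cderive_clog (q0 t) dq) _; rewrite qE.
  have nw : gamma t - w != 0 by rewrite subr_eq0 contour_neq.
  by field; rewrite n0 nw.
- exact: (lim id).
- by apply: (lim -%R) => t; rewrite normrN.
Qed.

Lemma contour_real_bound : exists X : R, forall (x : R) t, X <= x -> slit_plane (x%:C - gamma t).
Proof.
have [N [c [N0 c0 hc]]] := contour_Im_ends ends; have [C C0 hC] := contour_le smooth ends.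
exists (C * (1 + N) + 1) => x t xX.
case: (pselect (slit_plane (x%:C - gamma t))) => // /slit_planeN e.
have {e}e : gamma t = x%:C + (abs (x%:C - gamma t))%:C by rewrite -[RHS]opprK opprD -e; ring.
have i0 : cIm (gamma t) = 0 by rewrite e cImD /= addr0.
have [tN|tN] := leP N `|t|.
  by have := hc t tN; rewrite i0 normr0 leNgt c0.
have := hC t; have := ler_Re_abs (gamma t).
have h : x <= cRe (gamma t) by rewrite e cReD /= lerDl abs_ge0.
have h2 : C * (1 + `|t|) <= C * (1 + N) by rewrite ler_pM2l // lerD2l ltW.
by have := ler_norm (cRe (gamma t)) => h3 h4 h5; exfalso; lra.
Qed.

(** An explicit primitive: the difference of a logarithm cut along [x, +oo[ and one cut along the
    ray of direction theta from p. Neither cut meets gamma; at the lower and the upper end the first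
    logarithm contributes i pi and - i pi. *)
Lemma winding_far_ray : exists X : R, forall (x : R) p, X <= x -> ray theta p ->
  ~ range gamma x%:C /\ winding x%:C p = 2 * pi%:C * 'i.
Proof.
have [X hX] := contour_real_bound; exists X => x p xX rp.
have np := ray_Nrange hgamma rp.
have nx : ~ range gamma x%:C.
  by move=> [t _ e]; have := slit_plane_neq0 (hX x t xX); rewrite e subrr eqxx.
split=> //; pose w t := expi (pi - theta) * (gamma t - p).
(* The ray issuing from p is part of the cut, since lengths along the same direction add up. *)
have sw t : slit_plane (w t).
  apply: slit_plane_ray => -[r r0 e]; have [r' r'0 ep] := rp.
  apply: (range_Nray hgamma (t := t)); exists (r + r'); first exact: addr_ge0.
  by rewrite rmorphD mulrDl -e -ep subrK.
have cgw (v : R[i]) : continuous (fun t => gamma t - v).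
  by move=> t; exact: (cvg_cB (@cgamma t) (cvg_ccst v)).
have [N1 [m1 [N10 m10 h1]]] := contour_Re_growth ends (cRe p).
have [N2 [m2 [N20 m20 h2]]] := contour_Re_growth ends x.
pose L t := clog (x%:C - gamma t) - clog (w t).
have th : 0 <= pi - theta <= pi / 2 by have /andP[? ?] := htheta; apply/andP; split; lra.
have [s hs] := contour_derive smooth.
have limq (e : R -> R) : (forall t, `|e t| = `|t|) ->
    clog (gamma (e n%:R) - x%:C) - clog (gamma (e n%:R) - p) @[n --> \oo] --> (0 : R[i]).
  move=> he; have hq : 1 - (x%:C - p) * (gamma (e n%:R) - p)^-1 @[n --> \oo] --> 1 - (x%:C - p) * 0.
    exact: (cvg_cB (cvg_ccst 1) (cvg_cmul _ (cvg_inv_contour np he))).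
  have c1 : clog (1 : R[i]) = 0.
    have := @clog_div R 1 1; rewrite divr1 subrr; apply; exact: ltr01.
  rewrite mulr0 subr0 in hq.
  have hl : clog (1 - (x%:C - p) * (gamma (e n%:R) - p)^-1) @[n --> \oo] --> clog (1 : R[i]).
    by apply: cvg_clog hq; apply: slit_plane_Re; exact: ltr01.
  rewrite c1 in hl; apply: cvg_trans hl; apply: near_eq_cvg.
  near=> n; have n1 : N1 <= `|e n%:R|.
    by rewrite he normr_nat; near: n; exact: nbhs_infty_ger.
  have n2 : N2 <= `|e n%:R|.
    by rewrite he normr_nat; near: n; exact: nbhs_infty_ger.
  have a1 : 0 < cRe (gamma (e n%:R) - p).
    by rewrite cReB (lt_le_trans _ (h1 _ n1)) // mulr_gt0 // ltr_pwDl.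
  have a2 : 0 < cRe (gamma (e n%:R) - x%:C).
    by rewrite cReB (lt_le_trans _ (h2 _ n2)) // mulr_gt0 // ltr_pwDl.
  rewrite -clog_div //; congr clog.
  have : gamma (e n%:R) - p != 0 by rewrite -abs_gt0 (lt_le_trans a1) // (le_trans (ler_norm _)) // ler_Re_abs.
  by move=> ?; field.
have lim (e : R -> R) (b : R) : (forall t, `|e t| = `|t|) ->
    (\forall n \near \oo, clog (x%:C - gamma (e n%:R)) = clog (gamma (e n%:R) - x%:C) + 'i * b%:C) ->
    L (e n%:R) @[n --> \oo] --> 'i * (b - (pi - theta))%:C.
  move=> he hb; have hl : clog (gamma (e n%:R) - x%:C) - clog (gamma (e n%:R) - p) +
      'i * (b - (pi - theta))%:C @[n --> \oo] --> 0 + 'i * (b - (pi - theta))%:C.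
    exact: (cvg_cD (limq _ he) (cvg_ccst _)).
  rewrite add0r in hl; apply: cvg_trans hl; apply: near_eq_cvg; near=> n.
  have n1 : N1 <= `|e n%:R|.
    by rewrite he normr_nat; near: n; exact: nbhs_infty_ger.
  have a1 : 0 < cRe (gamma (e n%:R) - p).
    by rewrite cReB (lt_le_trans _ (h1 _ n1)) // mulr_gt0 // ltr_pwDl.
  rewrite /L /w clog_rotate // rmorphB /=.
  have -> : clog (x%:C - gamma (e n%:R)) = clog (gamma (e n%:R) - x%:C) + 'i * b%:C by near: n.
  by ring.
have [M hM] := contour_Im_signs ends.
have L1 : L n%:R @[n --> \oo] --> 'i * (pi - (pi - theta))%:C.
  apply: (lim id) => //; near=> n; rewrite -opprB clogN_lt // cImB /= subr0.
  by apply: (proj1 (hM _)); near: n; exact: nbhs_infty_ger.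
have L2 : L (- n%:R) @[n --> \oo] --> 'i * (- pi - (pi - theta))%:C.
  apply: (lim -%R); first by move=> t; rewrite normrN.
  near=> n; rewrite -opprB clogN_gt ?rmorphN ?mulrN // cImB /= subr0.
  by apply: (proj2 (hM _)); rewrite lerN2; near: n; exact: nbhs_infty_ger.
have -> : 2 * pi%:C * 'i = 'i * (pi - (pi - theta))%:C - 'i * (- pi - (pi - theta))%:C :> R[i].
  by rewrite !rmorphB !rmorphN /=; ring.
rewrite /winding /contour_integral; apply: (@cFTC2_line _ _ L s); last exact: L2; last exact: L1.
- exact: winding_integrable.
- move=> t; have k1 : clog (x%:C - gamma u) @[u --> (t : R)] --> clog (x%:C - gamma t).
    by apply: cvg_clog; [exact: hX | exact: (cvg_cB (cvg_ccst _) (@cgamma t))].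
  have k2 : clog (w u) @[u --> (t : R)] --> clog (w t).
    by apply: cvg_clog; [exact: sw | apply: cvg_cmul; exact: cgw].
  exact: (cvg_cB k1 k2).
- move=> t /hs[c dg]; split.
    have h (v : R[i]) : ~ range gamma v -> (gamma u - v)^-1 @[u --> t] --> (gamma t - v)^-1.
      move=> hv; apply: cvg_cV; first by rewrite subr_eq0 contour_neq.
      exact: cgw.
    exact: (cvg_cM (cvg_cB (h _ nx) (h _ np)) c).
  have d1 := cderive_clog (hX x t xX) (cderiveB (cderive_cst x%:C t) dg).
  have d2 := cderive_clog (sw t) (cderiveZ (expi (pi - theta)) (cderiveB dg (cderive_cst p t))).
  apply: cderive_eq (cderiveB d1 d2) _.
  have n1 : gamma t - x%:C != 0 by rewrite subr_eq0 contour_neq.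
  have n2 : gamma t - p != 0 by rewrite subr_eq0 contour_neq.
  have n3 : x%:C - gamma t != 0 by rewrite subr_eq0 eq_sym contour_neq.
  have n4 := expi_neq0 (pi - theta).
  by rewrite /w; field; rewrite n1 n2 n3 n4.
Unshelve. all: end_near.
Qed.

(** For real x far to the right, the winding of v relative to x is locally constant in v and is 0 at
    v = x; so it is 0 on the component of x, which contains w, and only the explicit value for x and
    p remains. *)
Lemma winding_interior w p : contour_interior gamma w -> ray theta p ->
  winding w p = 2 * pi%:C * 'i.
Proof.
move=> iw rp; have [X hX] := winding_far_ray; have [r hr] := iw.
pose x := Num.max X r; have [nx wx] : ~ range gamma x%:C /\ winding x%:C p = 2 * pi%:C * 'i.
  by apply: hX => //; rewrite le_max lexx.
have np := ray_Nrange hgamma rp; have nw := contour_interior_Nrange iw.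
suff wx0 : winding w x%:C = 0 by rewrite -(winding_chain nw nx np) wx0 add0r.
pose C := connected_component (~` range gamma) x%:C.
have Cw : C w by apply: hr; rewrite le_max lexx orbT.
have op (P : R[i] -> Prop) : (forall v, ~ range gamma v -> P (winding v x%:C) ->
    exists2 d : R, 0 < d & forall v', abs (v' - v) < d -> ~ range gamma v' /\ P (winding v' x%:C)) ->
    open [set v | ~ range gamma v /\ P (winding v x%:C)].
  move=> h; rewrite openE => v /= [nv Pv]; have [d d0 hd] := h v nv Pv.
  apply/nbhs_normP; exists d%:C; first by rewrite /= ltcR.
  by move=> v' /=; rewrite normE ltcR absBC => /hd.
have loc (P : R[i] -> Prop) : open [set v | ~ range gamma v /\ P (winding v x%:C)].
  apply: op => v nv Pv; have [d d0 hd] := winding_near nv; exists d => // v' /hd[nv' e].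
  by split => //; rewrite -(winding_chain nv' nv nx) e add0r.
have sC : C `<=` ~` range gamma by exact: connected_component_sub.
have hC : C `&` [set v | ~ range gamma v /\ winding v x%:C = 0] = C.
  apply: (@component_connected _ _ _).
  - exists x%:C; split; first exact: connected_component_refl.
    split => //; rewrite /winding /contour_integral.
    rewrite -[RHS](cintegral0 leb setT); apply: eq_cintegral => t _.
    by rewrite subrr mul0r.
  - by exists [set v | ~ range gamma v /\ winding v x%:C = 0] => //; exact: (loc (fun v => v = 0)).
  - exists (~` [set v | ~ range gamma v /\ winding v x%:C <> 0]).
      by rewrite closedC; exact: (loc (fun v => v <> 0)).
    apply/seteqP; split=> v [Cv /=]; first by move=> [nv e]; split => //=; move=> [].
    by move=> h; split => //; split; [exact: sC | apply: contrapT => e; apply: h; split => //; exact: sC].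
have : (C `&` [set v | ~ range gamma v /\ winding v x%:C = 0]) w by rewrite hC.
by case=> _ [].
Qed.

Lemma cauchy_interior l p : contour_interior gamma l -> ray theta p ->
  contour_integral gamma (fun z => ((l - z) * (z - p))^-1) = - (2 * pi%:C * 'i / (l - p)).
Proof.
move=> il rp; have nl := contour_interior_Nrange il; have np := ray_Nrange hgamma rp.
have lp : l - p != 0.
  by rewrite subr_eq0; apply/eqP => e; apply: (ray_Ninterior hgamma rp); rewrite -e.
rewrite -(winding_interior il rp) /winding mulrC -mulNr.
rewrite -(cintegralZ measurableT); last exact: winding_integrable.
apply: eq_cintegral => t _; rewrite mulrA; congr (_ * _).
have n1 : gamma t - l != 0 by rewrite subr_eq0 contour_neq.
have n2 : gamma t - p != 0 by rewrite subr_eq0 contour_neq.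
have n3 : l - gamma t != 0 by rewrite subr_eq0 eq_sym contour_neq.
by field; rewrite n1 n2 n3 lp.
Qed.

End Winding.

(** * Cauchy's formula for limits of simple fractions *)

Section CauchyFormula.
Context {R : realType}.
Variables (gamma : R -> R[i]) (theta : R) (sigma : set R[i]).
Hypotheses (htheta : pi / 2 < theta < pi) (hgamma : admissible_contour gamma theta sigma).
Local Notation leb := (@lebesgue_measure R).

Let smooth : piecewise_smooth gamma. Proof. by case: hgamma. Qed.
Let ends : straight_ends gamma. Proof. by case: hgamma. Qed.

(** Uniform bounds on the resolvents are available only away from 0, which may belong to the
    spectrum; hence tails of the cut. *)
Definition ray_from (d : R) : set R[i] := [set z | exists2 t, d <= t & z = t%:C * expi theta].

Lemma ray_from_ray d z : 0 < d -> ray_from d z -> ray theta z.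
Proof. by move=> d0 [t dt ->]; exists t => //; rewrite (le_trans (ltW d0)). Qed.

(* The approximants of F, with the properties that survive for the partial sums
   of a trace of resolvents. *)
Variables (F : R[i] -> R[i]) (Fn : nat -> R[i] -> R[i]).
Hypotheses
  (Fn_cvg : forall d z, 0 < d -> (range gamma `|` ray_from d) z -> Fn n z @[n --> \oo] --> F z)
  (Fn_le : forall d, 0 < d -> exists C, forall n z, (range gamma `|` ray_from d) z ->
     abs (Fn n z) <= C * (1 + abs z) ^+ 2)
  (Fn_approx : forall d n, 0 < d -> approximable (range gamma `|` ray_from d)
     [set l | contour_interior gamma l%:C] (Fn n)).

Lemma simple_fractions_measurable d (T : measurableType d) (g : T -> R[i]) (A : set T) r :
  cmeasurable A g -> cmeasurable A (fun t => simple_fractions r (g t)).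
Proof.
move=> mg; apply: cmeasurable_sum => x; apply: cmeasurableM; first exact: cmeasurable_cst.
by apply: cmeasurableV; apply: cmeasurableB => //; exact: cmeasurable_cst.
Qed.

(** Measurability is inherited from simple fractions by a pointwise limit; the partial sums, and
    then F itself, become measurable functions of the parameter in this way. *)
Lemma approximable_measurable d (T : measurableType d) (g : T -> R[i]) (A : set T) U P G :
  cmeasurable A g -> (forall t, A t -> U (g t)) -> approximable U P G ->
  cmeasurable A (fun t => G (g t)).
Proof.
move=> mg AU aG; have /choice[r hr] : forall n : nat, exists s : seq (R * R),
    forall z, U z -> abs (G z - simple_fractions s z) <= n.+1%:R^-1.
  by move=> n; have [|s [_ h]] := aG n.+1%:R^-1; [rewrite invr_gt0 | exists s].
apply: (@cmeasurable_cvg _ _ _ _ (fun n t => simple_fractions (r n) (g t))).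
  by move=> n; exact: simple_fractions_measurable.
move=> t At; apply: (@abs_squeeze _ _ _ _ _ _ (fun n => n.+1%:R^-1)).
  exact: cvg_harmonic.
by apply: nearW => n; rewrite absBC; apply: hr; exact: AU.
Qed.

Lemma Fn_contour_measurable n : cmeasurable setT (fun t => Fn n (gamma t)).
Proof.
apply: (approximable_measurable (contour_measurable hgamma)) (Fn_approx n ltr01).
by move=> t _; left; exists t.
Qed.

Lemma F_contour_measurable : cmeasurable setT (fun t => F (gamma t)).
Proof.
apply: cmeasurable_cvg Fn_contour_measurable _ => t _.
by apply: (Fn_cvg ltr01); left; exists t.
Qed.

Section Kernel.
Variables (s : seq (R[i] * R[i])) (d A : R).
Hypotheses (d0 : 0 < d) (sd : forall x, x \in s -> ray_from d x.2).

Let k (z : R[i]) : R[i] := \sum_(x <- s) x.1 / (z - x.2).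

Hypothesis kA : forall t, abs (k (gamma t)) <= A * (1 + `|t|) `^ (- 1 - 3).

(** All poles of the kernel are on the cut and all poles of the fractions are inside, so each
    product of two simple poles is covered by [cauchy_interior]. *)
Lemma kernel_simple_fractions r : (forall y, y \in r -> contour_interior gamma (y.2%:C)) ->
  contour_integrable gamma (fun z => k z * simple_fractions r z) /\
  contour_integral gamma (fun z => k z * simple_fractions r z) =
  - (2 * pi%:C * 'i) * \sum_(x <- s) x.1 * simple_fractions r x.2.
Proof.
move=> hr.
pose G (i : 'I_(size s)) (j : 'I_(size r)) (t : R) : R[i] :=
  let x := tnth (in_tuple s) i in let y := tnth (in_tuple r) j in
  (x.1 * y.1%:C) * (((y.2%:C - gamma t) * (gamma t - x.2))^-1 * rderiv gamma t).
have kE t : k (gamma t) * simple_fractions r (gamma t) * rderiv gamma t = \sum_i \sum_j G i j t.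
  rewrite /k /simple_fractions (big_tnth _ _ s) (big_tnth _ _ r) !mulr_suml.
  apply: eq_bigr => i _; rewrite mulr_sumr mulr_suml; apply: eq_bigr => j _.
  by rewrite /G /= invfM; ring.
have sP i : ray theta (tnth (in_tuple s) i).2 by apply: ray_from_ray d0 (sd _); exact: mem_tnth.
have rP j : contour_interior gamma (tnth (in_tuple r) j).2%:C by apply: hr; exact: mem_tnth.
have iB i j := cauchy_kernel_integrable hgamma (contour_interior_Nrange (rP j)) (ray_Nrange hgamma (sP i)).
have iG i j : cintegrable leb setT (G i j).
  apply: (cintegrableZ measurableT); have := cintegrableZ measurableT (-1) (iB i j).
  apply: (eq_cintegrable measurableT) => t _; rewrite mulrA; congr (_ * _).
  by rewrite mulN1r -[X in _ = (X * _)^-1]opprB mulNr invrN.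
have iGG i : cintegrable leb setT (fun t => \sum_j G i j t) by exact: cintegrable_sum.
have iS : cintegrable leb setT (fun t => \sum_i \sum_j G i j t) by exact: cintegrable_sum.
split; first by apply: (eq_cintegrable measurableT _ iS) => t _; rewrite -kE.
transitivity (cintegral leb setT (fun t => \sum_i \sum_j G i j t)).
  by apply: eq_cintegral => t _; rewrite -kE.
rewrite cintegral_sum // (big_tnth _ _ s) mulr_sumr; apply: eq_bigr => i _.
rewrite cintegral_sum // /simple_fractions (big_tnth _ _ r) !mulr_sumr; apply: eq_bigr => j _.
rewrite cintegralZ //; last first.
  have := cintegrableZ measurableT (-1) (iB i j).
  apply: (eq_cintegrable measurableT) => t _; rewrite mulrA; congr (_ * _).
  by rewrite mulN1r -[X in _ = (X * _)^-1]opprB mulNr invrN.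
have := cauchy_interior htheta hgamma (rP j) (sP i); rewrite /contour_integral => ->.
by ring.
Qed.

Lemma powR_lineD (t a b : R) : (1 + `|t|) `^ a * (1 + `|t|) `^ b = (1 + `|t|) `^ (a + b).
Proof. by rewrite -powRD //; apply/implyP => _; rewrite gt_eqF // ltr_pwDl. Qed.

Lemma powR_line_sqr (t : R) : (1 + `|t|) ^+ 2 = (1 + `|t|) `^ 2.
Proof. by rewrite -powR_mulrn // addr_ge0. Qed.

Lemma kernel_measurable : cmeasurable setT (fun t => k (gamma t)).
Proof.
apply: cmeasurable_sum => x; apply: cmeasurableM; first exact: cmeasurable_cst.
apply: cmeasurableV; apply: cmeasurableB; last exact: cmeasurable_cst.
exact: (contour_measurable hgamma).
Qed.

Let A0 : 0 <= A.
Proof. by have := kA 0; rewrite normr0 addr0 one_powR mulr1; apply: le_trans; exact: abs_ge0. Qed.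

(** The kernel decays with exponent -4 and the partial sums grow with exponent at most 2, which
    leaves the integrable exponent -2. *)
Lemma kernel_Fn_le : exists C, forall n t, abs (k (gamma t) * Fn n (gamma t)) <= C * (1 + `|t|) `^ (- 1 - 1).
Proof.
have [C hC] := Fn_le d0; have [G G0 hG] := contour_le smooth ends.
exists (A * (`|C| * (1 + G) ^+ 2)) => n t; rewrite absM.
have h : abs (Fn n (gamma t)) <= `|C| * (1 + G) ^+ 2 * (1 + `|t|) ^+ 2.
  apply: (le_trans (hC _ _ _)); first by left; exists t.
  apply: (@le_trans _ _ (`|C| * (1 + abs (gamma t)) ^+ 2)).
    by rewrite ler_wpM2r ?sqr_ge0 // ler_norm.
  rewrite -mulrA ler_wpM2l // -exprMn ler_pXn2r ?nnegrE ?mulr_ge0 ?addr_ge0 ?abs_ge0 ?(ltW G0) //.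
  by have := hG t; have := normr_ge0 t; lra.
apply: (le_trans (ler_pM (abs_ge0 _) (abs_ge0 _) (kA t) h)).
rewrite powR_line_sqr mulrACA powR_lineD.
by have -> : - 1 - 3 + 2 = - 1 - 1 :> R by ring.
Qed.

Lemma kernel_Fn_integrable n : contour_integrable gamma (fun z => k z * Fn n z).
Proof.
have [C hC] := kernel_Fn_le; apply: (contour_integrable_le hgamma ltr01 _ (hC n)).
by apply: cmeasurableM; [exact: kernel_measurable | exact: Fn_contour_measurable].
Qed.

(** Replacing [Fn n] by fractions within [eta] of it changes the two sides by at most [eta * E]
    together, where E depends on the kernel and on gamma but not on the fractions. *)
Lemma kernel_formula_Fn n : contour_integral gamma (fun z => k z * Fn n z) =
  - (2 * pi%:C * 'i) * \sum_(x <- s) x.1 * Fn n x.2.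
Proof.
set I := contour_integral _ _; set V := _ * _; apply/eqP; rewrite -subr_eq0 -abs_eq0.
have [M M0 hM] := rderiv_contour_bounded smooth ends.
have i3 : 0 < (3 : R) by [].
pose g (t : R) := A * M * (1 + `|t|) `^ (- 1 - 3).
have ig : leb.-integrable setT (EFin \o g) by exact: integrable_powR_lineZ.
pose E := \int[leb]_t g t + abs (2 * pi%:C * 'i : R[i]) * \sum_(x <- s) abs x.1.
have E0 : 0 <= E.
  rewrite addr_ge0 ?mulr_ge0 ?abs_ge0 ?sumr_ge0 //; last by move=> x _; exact: abs_ge0.
  by apply: Rintegral_ge0 => t _; rewrite !mulr_ge0 ?(ltW M0) ?powR_ge0.
have key eta : 0 < eta -> abs (I - V) <= eta * E.
  move=> eta0; have [r [hr ha]] := Fn_approx n d0 eta0.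
  have [ir vr] := kernel_simple_fractions hr.
  have -> : I - V = (I - contour_integral gamma (fun z => k z * simple_fractions r z)) -
      (2 * pi%:C * 'i) * \sum_(x <- s) x.1 * (simple_fractions r x.2 - Fn n x.2).
    have -> : \sum_(x <- s) x.1 * (simple_fractions r x.2 - Fn n x.2) =
        \sum_(x <- s) x.1 * simple_fractions r x.2 - \sum_(x <- s) x.1 * Fn n x.2.
      by rewrite -sumrB; apply: eq_bigr => x _; rewrite mulrBr.
    by rewrite vr /V; ring.
  apply: (le_trans (absB _ _)); rewrite /E mulrDr lerD //.
    rewrite /I /contour_integral -(cintegralB measurableT) //; last exact: kernel_Fn_integrable.
    have -> : eta * \int[leb]_t g t = \int[leb]_t (eta * g t).
      by symmetry; apply: RintegralZl.
    apply: (le_abs_cintegral measurableT).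
    - apply: (cintegrableD measurableT); first exact: kernel_Fn_integrable.
      have := cintegrableZ measurableT (-1) ir; apply: (eq_cintegrable measurableT) => t _.
      by rewrite mulN1r.
    - rewrite (_ : _ \o _ = fun t => (eta%:E * (g t)%:E)%E); first exact: integrableZl.
      by apply/funext => t /=; rewrite EFinM.
    - move=> t _; rewrite -mulrBl -mulrBr !absM /g.
      have -> : eta * (A * M * (1 + `|t|) `^ (- 1 - 3)) = A * (1 + `|t|) `^ (- 1 - 3) * eta * M by ring.
      rewrite ler_pM ?mulr_ge0 ?abs_ge0 // ler_pM ?abs_ge0 //.
      by apply: ha; left; exists t.
  rewrite absM mulrCA ler_wpM2l ?abs_ge0 // (le_trans (abs_sum _ _ _)) // mulr_sumr.
  rewrite big_seq [leRHS]big_seq; apply: ler_sum => x xs.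
  rewrite absM mulrC ler_wpM2r ?abs_ge0 // absBC; apply: ha; right; exact: sd.
rewrite eq_le abs_ge0 andbT leNgt; apply/negP => IV.
(* For this [eta] the estimate would give |I - V| <= |I - V| E / (2 (E + 1)), which is impossible
   unless I = V. *)
have := key (abs (I - V) / (2 * (E + 1))); rewrite divr_gt0 ?mulr_gt0 ?ltr_wpDl //.
move=> /(_ isT); rewrite mulrAC ler_pdivlMr ?mulr_gt0 ?ltr_wpDl // ler_pM2l //.
by move=> h; lra.
Qed.

Lemma kernel_formula : contour_integral gamma (fun z => k z * F z) =
  - (2 * pi%:C * 'i) * \sum_(x <- s) x.1 * F x.2.
Proof.
have [C hC] := kernel_Fn_le; have [M M0 hM] := rderiv_contour_bounded smooth ends.
have [||||_ h1] := @cdominated_cvg _ _ _ leb setT measurableT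
  (fun n t => k (gamma t) * Fn n (gamma t) * rderiv gamma t)
  (fun t => k (gamma t) * F (gamma t) * rderiv gamma t)
  (fun t => C * M * (1 + `|t|) `^ (- 1 - 1)).
- by move=> n; exact: cintegrable_measurable (kernel_Fn_integrable n).
- exact: integrable_powR_lineZ.
- move=> t _; apply: cvg_cM (cvg_ccst _); apply: cvg_cmul.
  by apply: (Fn_cvg ltr01); left; exists t.
- by move=> n t _; rewrite absM mulrAC ler_pM ?abs_ge0.
have h2 : - (2 * pi%:C * 'i) * (\sum_(x <- s) x.1 * Fn n x.2) @[n --> \oo] -->
    - (2 * pi%:C * 'i) * \sum_(x <- s) x.1 * F x.2.
  apply: cvg_cmul.
  have h i : i \in s -> i.1 * Fn n i.2 @[n --> \oo] --> i.1 * F i.2.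
    by move=> /sd xs; apply: cvg_cmul; apply: (Fn_cvg d0); right.
  elim: s h => [|x r IH] h; first by rewrite big_nil; under eq_fun do rewrite big_nil; exact: cvg_cst.
  rewrite big_cons; under eq_fun do rewrite big_cons.
  apply: cvg_cD; first by apply: h; rewrite inE eqxx.
  by apply: IH => i ir; apply: h; rewrite inE ir orbT.
apply: (norm_cvg_unique _ h2); move: h1; apply: cvg_trans; apply: near_eq_cvg; apply: nearW => n.
exact: kernel_formula_Fn.
Qed.

End Kernel.
Variables (C0 eps : R).
Hypotheses (eps0 : 0 < eps)
  (F_contour_le : forall t, abs (F (gamma t)) <= C0 * (1 + `|t|) `^ (- 1 - eps))
  (F_ray_le : forall t, 0 < t -> abs (F (t%:C * expi theta)) <= C0 * (1 + t) `^ (- 1 - eps)).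

(** Cutoff points running to infinity on the cut; the shift by a keeps them, and their multiples by
    2 and 3, farther out than the point at distance a. *)
Let q (a : R) (n : nat) : R[i] := (n.+1%:R + a)%:C * expi theta.

Lemma cvg_inv_q (a : R) (j : R) : 0 <= a -> 0 < j -> (j%:C * q a n)^-1 @[n --> \oo] --> 0.
Proof.
move=> a0 j0; apply: (@abs_squeeze _ _ _ _ _ _ (fun n => j^-1 * n.+1%:R^-1)).
  by rewrite -(mulr0 j^-1); apply: cvgM; [exact: cvg_cst | exact: cvg_harmonic].
apply: nearW => n; rewrite subr0 absV !absM abs_expi !absR mulr1 (gtr0_norm j0).
have p : 0 < n.+1%:R + a by rewrite ltr_pwDl.
by rewrite gtr0_norm // -invfM lef_pV2 ?posrE ?mulr_gt0 // ler_wpM2l ?(ltW j0) // lerDl.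
Qed.

Lemma q_neq0 a j n : 0 <= a -> 0 < j -> j%:C * q a n != 0.
Proof.
move=> a0 j0; rewrite /q mulf_neq0 ?mulf_neq0 ?expi_neq0 //; apply/eqP => -[/eqP]; apply/negP.
- by rewrite gt_eqF.
- by rewrite gt_eqF // ltr_pwDl.
Qed.

Lemma cvg_ratio_q a j z : 0 <= a -> 0 < j ->
  (j%:C * q a n) / (j%:C * q a n - z) @[n --> \oo] --> (1 : R[i]).
Proof.
move=> a0 j0.
have h : 1 - z * (j%:C * q a n)^-1 @[n --> \oo] --> 1 - z * 0.
  exact: (cvg_cB (cvg_ccst 1) (cvg_cmul _ (cvg_inv_q a0 j0))).
rewrite mulr0 subr0 in h.
have h1 : (1 - z * (j%:C * q a n)^-1)^-1 @[n --> \oo] --> (1 : R[i])^-1.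
  by apply: cvg_cV h; exact: oner_neq0.
rewrite invr1 in h1.
apply: cvg_trans h1; apply: near_eq_cvg; apply: nearW => n.
have n0 := q_neq0 n a0 j0; rewrite -[X in X - z * _](divff n0) -mulrBl invfM invrK.
by rewrite mulrC.
Qed.

Lemma F_ray_cvg0 a j (m : nat) : 0 <= a -> 0 < j -> m%:R < 1 + eps ->
  (j%:C * q a n) ^+ m * F (j%:C * q a n) @[n --> \oo] --> 0.
Proof.
move=> a0 j0 me; pose b := 1 + eps - m%:R; have b0 : 0 < b by rewrite subr_gt0.
have C00 : 0 <= C0.
  by have := F_contour_le 0; rewrite normr0 addr0 one_powR mulr1; apply: le_trans; exact: abs_ge0.
apply: (@abs_squeeze _ _ _ _ _ _ (fun n => C0 * ((j * n.+1%:R) `^ (- b)))).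
  rewrite -(mulr0 C0); apply: cvgM; first exact: cvg_cst.
  apply/cvgrPdist_le => e e0; near=> n; rewrite sub0r normrN ger0_norm ?powR_ge0 //.
  have e1 : 0 < e `^ (- b^-1) by rewrite powR_gt0.
  have n1 : e `^ (- b^-1) <= j * n.+1%:R.
    rewrite -ler_pdivrMl // (@le_trans _ _ n%:R) ?ler_nat //.
    by near: n; exact: nbhs_infty_ger.
  have -> : e = (e `^ (- b^-1)) `^ (- b).
    by rewrite -powRrM mulrNN mulVf ?gt_eqF // powRr1 // ltW.
  have jn : 0 < j * n.+1%:R by rewrite mulr_gt0.
  rewrite [leLHS]powRN [leRHS]powRN lef_pV2 ?posrE ?powR_gt0 //.
  by apply: ge0_ler_powR; rewrite ?nnegrE ?(ltW b0) ?(ltW e1) ?(ltW jn).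
apply: nearW => n; rewrite subr0.
have qE : j%:C * q a n = (j * (n.+1%:R + a))%:C * expi theta by rewrite rmorphM /= mulrA.
set r := j * (n.+1%:R + a) in qE; have r0 : 0 < r by rewrite mulr_gt0 // ltr_pwDl.
rewrite qE absM absX absM abs_expi mulr1 absR gtr0_norm //.
apply: (@le_trans _ _ ((1 + r) `^ m%:R * (C0 * (1 + r) `^ (- 1 - eps)))).
  rewrite ler_pM ?exprn_ge0 ?abs_ge0 ?(ltW r0) ?F_ray_le // powR_mulrn ?addr_ge0 ?(ltW r0) //.
  by apply: lerXn2r; rewrite ?nnegrE ?addr_ge0 ?(ltW r0) // lerDr.
have r1 : 0 < 1 + r by rewrite ltr_pwDl // ltW.
rewrite mulrCA ler_wpM2l // -powRD; last by apply/implyP => _; rewrite gt_eqF.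
have -> : m%:R + (- 1 - eps) = - b by rewrite /b; ring.
have jn : 0 < j * n.+1%:R by rewrite mulr_gt0.
rewrite !powRN lef_pV2 ?posrE ?powR_gt0 //.
apply: ge0_ler_powR; rewrite ?nnegrE ?(ltW b0) ?(ltW jn) ?(ltW r1) //.
by rewrite /r mulrDr ler_wpDl // lerDl mulr_ge0 ?(ltW j0).
Unshelve. all: end_near.
Qed.

(** The factors are j u / (j u - z) for j = 1, 2, 3: three simple poles rather than a triple one,
    because the kernels treated above have simple poles. The coefficients 3, -3, 1 come from
    expanding 1 / ((1 - x) (1 - x / 2) (1 - x / 3)). *)
Lemma kernel_partial_fractions (z p u : R[i]) : z != p -> z != u -> z != 2 * u -> z != 3 * u ->
  u != p -> 2 * u != p -> 3 * u != p -> u != 0 ->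
  u / (u - p) * (2 * u / (2 * u - p)) * (3 * u / (3 * u - p)) / (z - p)
  + (- 3 * (u / (u - p))) / (z - u) + (3 * (2 * u / (2 * u - p))) / (z - 2 * u)
  + (- (3 * u / (3 * u - p))) / (z - 3 * u)
  = (z - p)^-1 * (u / (u - z) * (2 * u / (2 * u - z)) * (3 * u / (3 * u - z))).
Proof.
move=> h1 h2 h3 h4 h5 h6 h7 u0.
rewrite -subr_eq0 in h1; rewrite -subr_eq0 in h2; rewrite -subr_eq0 in h3; rewrite -subr_eq0 in h4.
rewrite -subr_eq0 in h5; rewrite -subr_eq0 in h6; rewrite -subr_eq0 in h7.
have k2 : u - z != 0 by rewrite -oppr_eq0 opprB.
have k3 : 2 * u - z != 0 by rewrite -oppr_eq0 opprB.
have k4 : 3 * u - z != 0 by rewrite -oppr_eq0 opprB.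
by field; rewrite h1 h2 h3 h4 h5 h6 h7 k2 k3 k4.
Qed.

(** Both estimates follow from [contour_ray_dist] and are uniform in r; they dominate the cutoff
    factors while their poles run to infinity. *)
Lemma ratio_bound : exists2 c, 0 < c & forall t r, 0 < r ->
  abs (r%:C * expi theta / (r%:C * expi theta - gamma t)) <= c /\
  abs ((gamma t - r%:C * expi theta)^-1) <= c * (1 + `|t|)^-1.
Proof.
have [c c0 hc] := contour_ray_dist htheta hgamma.
have n0 : ~ range gamma 0.
  by apply: (ray_Nrange hgamma); exists 0; rewrite ?rmorph0 ?mul0r.
have [d d0 hd] := contour_ge smooth ends n0.
exists (Num.max c^-1 (c * d)^-1); first by rewrite lt_max invr_gt0 c0.
move=> t r r0; have h := hc t r (ltW r0); have hd' := hd t; rewrite subr0 in hd'.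
have p : 0 < 1 + `|t| by rewrite ltr_pwDl.
have a0 := abs_ge0 (gamma t).
have h1 : c * r <= abs (gamma t - r%:C * expi theta).
  by rewrite (le_trans _ h) // ler_wpM2l ?(ltW c0) // lerDr.
have h2 : c * d * (1 + `|t|) <= abs (gamma t - r%:C * expi theta).
  rewrite (le_trans _ h) // -mulrA ler_wpM2l ?(ltW c0) // (le_trans hd') // lerDl ltW //.
have g0 : 0 < abs (gamma t - r%:C * expi theta) by rewrite (lt_le_trans _ h1) // mulr_gt0.
split.
- rewrite absM absV absM abs_expi mulr1 absR (gtr0_norm r0) absBC ler_pdivrMr //.
  rewrite (@le_trans _ _ (c^-1 * abs (gamma t - r%:C * expi theta))) //.
    by rewrite ler_pdivlMl.
  by rewrite ler_wpM2r ?(ltW g0) // le_max lexx.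
- rewrite absV (@le_trans _ _ ((c * d)^-1 * (1 + `|t|)^-1)) //.
    by rewrite -invfM lef_pV2 ?posrE // !mulr_gt0.
  by rewrite ler_wpM2r ?invr_ge0 ?(ltW p) // le_max lexx orbT.
Qed.

Lemma inv_powR_line (t : R) : (1 + `|t|)^-1 = (1 + `|t|) `^ (- 1).
Proof. by rewrite powRN powRr1 // addr_ge0. Qed.

Lemma F_cauchy_integrable (m : nat) (r : R) : m%:R < 1 + eps -> 0 < r ->
  exists C, (forall t r, 0 < r ->
    abs ((gamma t - r%:C * expi theta)^-1 * gamma t ^+ m * F (gamma t)) <=
     C * (1 + `|t|) `^ (- 1 - (1 + eps - m%:R))) /\
  contour_integrable gamma (fun z => (z - r%:C * expi theta)^-1 * z ^+ m * F z).
Proof.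
move=> me r0; have [c c0 hc] := ratio_bound; have [G G0 hG] := contour_le smooth ends.
have e : forall t r, 0 < r -> abs ((gamma t - r%:C * expi theta)^-1 * gamma t ^+ m * F (gamma t)) <=
     c * G ^+ m * C0 * (1 + `|t|) `^ (- 1 - (1 + eps - m%:R)).
  move=> t v v0; rewrite !absM absX; have [_ h] := hc t v v0.
  have p : 0 < 1 + `|t| by rewrite ltr_pwDl.
  apply: (@le_trans _ _ ((c * (1 + `|t|)^-1) * (G * (1 + `|t|)) ^+ m * (C0 * (1 + `|t|) `^ (- 1 - eps)))).
    rewrite ler_pM ?mulr_ge0 ?exprn_ge0 ?abs_ge0 // ler_pM ?exprn_ge0 ?abs_ge0 //.
    by apply: lerXn2r; rewrite ?nnegrE ?abs_ge0 ?mulr_ge0 ?(ltW G0) ?(ltW p).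
  rewrite exprMn -(powR_mulrn m (ltW p)) inv_powR_line.
  have -> : - 1 - (1 + eps - m%:R) = - 1 + m%:R + (- 1 - eps) :> R by ring.
  rewrite -!powR_lineD le_eqVlt; apply/orP; left; apply/eqP; ring.
exists (c * G ^+ m * C0); split => //.
apply: (contour_integrable_le hgamma _ _ (fun t => e t r r0)); first by rewrite subr_gt0.
apply: cmeasurableM F_contour_measurable; apply: cmeasurableM.
  apply: cmeasurableV; apply: cmeasurableB (cmeasurable_cst _ _).
  exact: (contour_measurable hgamma).
by apply: cmeasurableX; exact: (contour_measurable hgamma).
Qed.

(** [kernel_formula] for the truncated kernel, then n to infinity: on gamma the cutoff factors stay
    below c and tend to 1, and on the cut the values of F at the three auxiliary poles tend to 0. *)
Let F_cauchy0 (a : R) : 0 < a ->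
  contour_integral gamma (fun z => (z - a%:C * expi theta)^-1 * F z) =
  - (2 * pi%:C * 'i) * F (a%:C * expi theta).
Proof.
move=> a0; set p := a%:C * expi theta.
have [c c0 hc] := ratio_bound; have a0' := ltW a0.
pose k n (z : R[i]) := (z - p)^-1 * (q a n / (q a n - z) *
  (2 * q a n / (2 * q a n - z)) * (3 * q a n / (3 * q a n - z))).
pose c0' n := q a n / (q a n - p) * (2 * q a n / (2 * q a n - p)) * (3 * q a n / (3 * q a n - p)).
pose s n := [:: (c0' n, p); (- 3 * (q a n / (q a n - p)), q a n);
  (3 * (2 * q a n / (2 * q a n - p)), 2 * q a n); (- (3 * q a n / (3 * q a n - p)), 3 * q a n)].
have Cn (n : nat) : n%:R = (n%:R : R)%:C :> R[i] by rewrite rmorph_nat.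
have jq (j n : nat) : (0 < j)%N -> j%:R * q a n = (j%:R * (n.+1%:R + a))%:C * expi theta.
  by move=> j0; rewrite Cn rmorphM /= mulrA.
have jqp (j n : nat) : (0 < j)%N -> j%:R * q a n != p.
  move=> j0; rewrite jq // -subr_eq0 -mulrBl mulf_neq0 ?expi_neq0 // -rmorphB /=.
  apply/eqP => -[/eqP]; rewrite subr_eq0 gt_eqF //.
  by rewrite (@lt_le_trans _ _ (n.+1%:R + a)) ?ltrDr // ler_peMl ?addr_ge0 // ler1n.
have jr (j n : nat) : (0 < j)%N -> 0 < j%:R * (n.+1%:R + a).
  by move=> j0; rewrite mulr_gt0 ?ltr0n // ltr_pwDl.
have zj t (j n : nat) : (0 < j)%N -> gamma t != j%:R * q a n.
  move=> j0; apply: contour_neq; apply: (ray_Nrange hgamma); rewrite jq //.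
  by apply: rayP; apply: ltW; exact: jr.
have rp : ray theta p by exact: rayP.
have zp t : gamma t != p by apply: contour_neq; exact: (ray_Nrange hgamma).
have kE n t : \sum_(x <- s n) x.1 / (gamma t - x.2) = k n (gamma t).
  rewrite /s !big_cons big_nil addr0 /= !addrA; apply: kernel_partial_fractions => //.
  - by have := zj t 1 n isT; rewrite mul1r.
  - exact: (zj t 2 n).
  - exact: (zj t 3 n).
  - by have := jqp 1 n isT; rewrite mul1r.
  - exact: (jqp 2 n).
  - exact: (jqp 3 n).
  - by have := q_neq0 n a0' ltr01; rewrite mul1r.
have qE n : q a n = (n.+1%:R + a)%:C * expi theta by [].
have r0 n : 0 < n.+1%:R + a by rewrite ltr_pwDl.
have hF n : contour_integral gamma (fun z => k n z * F z) =
    - (2 * pi%:C * 'i) * \sum_(x <- s n) x.1 * F x.2.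
  have d0 : 0 < Num.min a 1 by rewrite lt_min a0 ltr01.
  have sd x : x \in s n -> ray_from (Num.min a 1) x.2.
    have rj (j : nat) : (0 < j)%N -> ray_from (Num.min a 1) (j%:R * q a n).
      move=> j0; exists (j%:R * (n.+1%:R + a)); last exact: jq.
      rewrite ge_min; apply/orP; left.
      by rewrite (@le_trans _ _ (n.+1%:R + a)) ?lerDr // ler_peMl ?addr_ge0 ?ler1n.
    rewrite !inE => /or4P[]/eqP -> /=.
    - by exists a => //; rewrite ge_min lexx.
    - by have := rj 1%N isT; rewrite mul1r.
    - exact: (rj 2%N).
    - exact: (rj 3%N).
  pose A := c * ((n.+1%:R + a) * c) * (2 * (n.+1%:R + a) * c) * (3 * (n.+1%:R + a) * c).
  have kA t : abs (\sum_(x <- s n) x.1 / (gamma t - x.2)) <= A * (1 + `|t|) `^ (- 1 - 3).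
    have hj (j : nat) : (0 < j)%N -> abs (j%:R * q a n / (j%:R * q a n - gamma t)) <=
        j%:R * (n.+1%:R + a) * c * (1 + `|t|)^-1.
      move=> j0; have [_ h] := hc t _ (jr j n j0).
      rewrite jq // absM absM abs_expi mulr1 absR gtr0_norm ?jr // -[leRHS]mulrA.
      by rewrite ler_wpM2l ?(ltW (jr j n j0)) // -absN -invrN opprB.
    rewrite kE !absM; have [_ h0] := hc t a a0.
    have -> : A * (1 + `|t|) `^ (- 1 - 3) = (c * (1 + `|t|)^-1) *
       ((((n.+1%:R + a) * c * (1 + `|t|)^-1) * (2 * (n.+1%:R + a) * c * (1 + `|t|)^-1)) *
       (3 * (n.+1%:R + a) * c * (1 + `|t|)^-1)).
      have -> : - 1 - 3 = - 1 + - 1 + (- 1 + - 1) :> R by ring.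
      by rewrite -!powR_lineD -!inv_powR_line /A; ring.
    rewrite -!absM; apply: le_trans (_ : _ <= _) => //.
    rewrite absM ler_pM ?abs_ge0 // absM ler_pM ?abs_ge0 ?(hj 3%N) // absM ler_pM ?abs_ge0 ?(hj 2%N) //.
    by have := hj 1%N isT; rewrite !mul1r.
  rewrite -(kernel_formula d0 sd kA); apply: eq_cintegral => t _.
  by rewrite kE.
have [M M0 hM] := rderiv_contour_bounded smooth ends.
have [|C [hC _]] := @F_cauchy_integrable 0 a _ a0; first by rewrite addr_gt0.
have rat (j n : nat) t : (0 < j)%N -> abs (j%:R * q a n / (j%:R * q a n - gamma t)) <= c.
  by move=> j0; rewrite jq //; case: (hc t _ (jr j n j0)).
have rat1 n t : abs (q a n / (q a n - gamma t)) <= c by have := rat 1%N n t isT; rewrite mul1r.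
have crat z (j : nat) : (0 < j)%N -> (j%:R * q a n) / (j%:R * q a n - z) @[n --> \oo] --> (1 : R[i]).
  by move=> j0; have := @cvg_ratio_q a j%:R z a0'; rewrite ltr0n rmorph_nat; apply.
have crat1 z : (q a n) / (q a n - z) @[n --> \oo] --> (1 : R[i]).
  by have := crat z 1%N isT; under eq_fun do rewrite mul1r.
have [||||_ h1] := @cdominated_cvg _ _ _ leb setT measurableT
  (fun n t => k n (gamma t) * F (gamma t) * rderiv gamma t)
  (fun t => (gamma t - p)^-1 * F (gamma t) * rderiv gamma t)
  (fun t => c ^+ 3 * C * M * (1 + `|t|) `^ (- 1 - (1 + eps))).
- move=> n; apply: cmeasurableM (rderiv_contour_measurable smooth).
  apply: cmeasurableM F_contour_measurable.
  have -> : (fun t => k n (gamma t)) = (fun t => \sum_(x <- s n) x.1 / (gamma t - x.2)).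
    by apply/funext => t; rewrite kE.
  exact: kernel_measurable.
- by apply: integrable_powR_lineZ; rewrite addr_gt0.
- move=> t _; apply: cvg_cM (cvg_ccst _); apply: cvg_cM (cvg_ccst _).
  rewrite -[X in _ --> X]mulr1; apply: cvg_cmul.
  have h := cvg_cM (cvg_cM (crat1 (gamma t)) (crat (gamma t) 2%N isT)) (crat (gamma t) 3%N isT).
  by have := h _ _; rewrite !mulr1; apply.
- move=> n t _; have := hC t a a0; rewrite expr0 mulr1 subr0 => h.
  have -> : k n (gamma t) * F (gamma t) * rderiv gamma t =
    (q a n / (q a n - gamma t) * (2 * q a n / (2 * q a n - gamma t)) *
    (3 * q a n / (3 * q a n - gamma t))) * ((gamma t - p)^-1 * F (gamma t)) * rderiv gamma t.
    by rewrite /k; ring.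
  rewrite !(absM _ (rderiv gamma t)) absM.
  have -> : c ^+ 3 * C * M * (1 + `|t|) `^ (- 1 - (1 + eps)) =
    (c * c * c) * (C * (1 + `|t|) `^ (- 1 - (1 + eps))) * M by ring.
  have ba := abs_ge0; rewrite ler_pM ?mulr_ge0 ?ba // ler_pM ?ba // absM ler_pM ?ba ?(rat 3%N) //.
  by rewrite absM ler_pM ?ba ?(rat 2%N).
have F0 (j : nat) : (0 < j)%N -> F (j%:R * q a n) @[n --> \oo] --> 0.
  move=> j0; have jj : 0 < j%:R :> R by rewrite ltr0n.
  have me : 0%:R < 1 + eps :> R by exact: addr_gt0.
  have := @F_ray_cvg0 a j%:R 0 a0' jj me; rewrite rmorph_nat.
  by under eq_fun do rewrite expr0 mul1r.
have F01 : F (q a n) @[n --> \oo] --> 0.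
  by have := F0 1%N isT; under eq_fun do rewrite mul1r.
have h2 : - (2 * pi%:C * 'i) * (\sum_(x <- s n) x.1 * F x.2) @[n --> \oo] -->
    - (2 * pi%:C * 'i) * (1 * 1 * 1 * F p + - 3 * 1 * 0 + 3 * 1 * 0 + - 1 * 0).
  apply: cvg_cmul; under eq_fun do rewrite /s !big_cons big_nil addr0 /= !addrA.
  apply: cvg_cD; last by apply: cvg_cM (F0 3%N isT); apply: cvgN; exact: (crat _ 3%N).
  apply: cvg_cD; last by apply: cvg_cM (F0 2%N isT); apply: cvg_cmul; exact: (crat _ 2%N).
  apply: cvg_cD; last by apply: cvg_cM F01; apply: cvg_cmul; exact: crat1.
  apply: cvg_cM (cvg_ccst _).
  exact: (cvg_cM (cvg_cM (crat1 _) (crat _ 2%N isT)) (crat _ 3%N isT)).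
rewrite !mulr0 !addr0 !mul1r in h2.
apply: (norm_cvg_unique _ h2); move: h1; apply: cvg_trans; apply: near_eq_cvg; apply: nearW => n.
exact: hF.
Qed.

(** Multiplied by - q, the formula at p = q has the bounded factor q / (q - z) in place of the
    kernel. This factor tends to 1, while the right side, 2 pi i q^(m + 1) F(q), tends to 0 because
    m + 1 < 1 + eps. *)
Lemma F_moment0 (m : nat) : m%:R < eps ->
  (forall a, 0 < a -> contour_integral gamma (fun z => (z - a%:C * expi theta)^-1 * z ^+ m * F z) =
     - (2 * pi%:C * 'i) * ((a%:C * expi theta) ^+ m * F (a%:C * expi theta))) ->
  contour_integrable gamma (fun z => z ^+ m * F z) /\
  contour_integral gamma (fun z => z ^+ m * F z) = 0.
Proof.
move=> me IH; have m1 : m%:R < 1 + eps by rewrite (lt_trans me) // ltrDr.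
have m1' : m.+1%:R < 1 + eps by rewrite -natr1 addrC ltrD2l.
have [c c0 hc] := ratio_bound; have [G G0 hG] := contour_le smooth ends.
have [M M0 hM] := rderiv_contour_bounded smooth ends.
have gm := contour_measurable hgamma.
have em : 0 < eps - m%:R by rewrite subr_gt0.
have qE n : q 0 n = (n.+1%:R)%:C * expi theta by rewrite /q addr0.
have b t : abs (gamma t ^+ m * F (gamma t)) <= G ^+ m * C0 * (1 + `|t|) `^ (- 1 - (eps - m%:R)).
  have p : 0 < 1 + `|t| by rewrite ltr_pwDl.
  rewrite absM absX; apply: (@le_trans _ _ ((G * (1 + `|t|)) ^+ m * (C0 * (1 + `|t|) `^ (- 1 - eps)))).
    rewrite ler_pM ?exprn_ge0 ?abs_ge0 //.
    by apply: lerXn2r; rewrite ?nnegrE ?abs_ge0 ?mulr_ge0 ?(ltW G0) ?(ltW p).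
  rewrite exprMn -(powR_mulrn m (ltW p)).
  have -> : - 1 - (eps - m%:R) = m%:R + (- 1 - eps) :> R by ring.
  by rewrite -!powR_lineD le_eqVlt; apply/orP; left; apply/eqP; ring.
have im : contour_integrable gamma (fun z => z ^+ m * F z).
  apply: (contour_integrable_le hgamma em _ b).
  by apply: cmeasurableM F_contour_measurable; exact: cmeasurableX.
split=> //.
have hI n : contour_integral gamma (fun z => q 0 n / (q 0 n - z) * (z ^+ m * F z)) =
    (2 * pi%:C * 'i) * (q 0 n ^+ m.+1 * F (q 0 n)).
  have n0 : 0 < n.+1%:R :> R by [].
  have [_ [_ ii]] := F_cauchy_integrable m1 n0.
  have -> : (2 * pi%:C * 'i) * (q 0 n ^+ m.+1 * F (q 0 n)) =
      - q 0 n * (- (2 * pi%:C * 'i) * (q 0 n ^+ m * F (q 0 n))) by rewrite exprS; ring.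
  rewrite qE -IH // -(cintegralZ measurableT) //; apply: eq_cintegral => t _.
  by rewrite -[_ - gamma t]opprB invrN; ring.
have [||||_ h1] := @cdominated_cvg _ _ _ leb setT measurableT
  (fun n t => q 0 n / (q 0 n - gamma t) * (gamma t ^+ m * F (gamma t)) * rderiv gamma t)
  (fun t => gamma t ^+ m * F (gamma t) * rderiv gamma t)
  (fun t => c * (G ^+ m * C0) * M * (1 + `|t|) `^ (- 1 - (eps - m%:R))).
- move=> n; apply: cmeasurableM (rderiv_contour_measurable smooth).
  apply: cmeasurableM; last by apply: cmeasurableM F_contour_measurable; exact: cmeasurableX.
  apply: cmeasurableM; first exact: cmeasurable_cst.
  by apply: cmeasurableV; apply: cmeasurableB => //; exact: cmeasurable_cst.
- exact: integrable_powR_lineZ.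
- move=> t _; apply: cvg_cM (cvg_ccst _); rewrite -[X in _ --> X]mul1r.
  apply: cvg_cM (cvg_ccst _); have := @cvg_ratio_q 0 1 (gamma t) (lexx 0) ltr01.
  by under eq_fun do rewrite mul1r.
- move=> n t _; rewrite !absM -!absM !(absM _ (rderiv gamma t)) absM.
  have -> : c * (G ^+ m * C0) * M * (1 + `|t|) `^ (- 1 - (eps - m%:R)) =
    c * (G ^+ m * C0 * (1 + `|t|) `^ (- 1 - (eps - m%:R))) * M by ring.
  have ba := abs_ge0; rewrite ler_pM ?mulr_ge0 ?ba // ler_pM ?ba //.
  by have [h _] := hc t n.+1%:R (ltr0Sn _ n); rewrite -qE in h.
have h2 : (2 * pi%:C * 'i) * (q 0 n ^+ m.+1 * F (q 0 n)) @[n --> \oo] --> (2 * pi%:C * 'i) * 0.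
  apply: cvg_cmul; have := @F_ray_cvg0 0 1 m.+1 (lexx 0) ltr01 m1'.
  by under eq_fun do rewrite mul1r.
rewrite mulr0 in h2; apply: (norm_cvg_unique _ h2); move: h1; apply: cvg_trans.
by apply: near_eq_cvg; apply: nearW => n; exact: hI.
Qed.

(** Induction through z^(m + 1) / (z - p) = z^m + p z^m / (z - p); the first term integrates to 0 by
    [F_moment0]. *)
Lemma cauchy_moment (m : nat) (a : R) : m%:R < 1 + eps -> 0 < a ->
  contour_integral gamma (fun z => (z - a%:C * expi theta)^-1 * z ^+ m * F z) =
  - (2 * pi%:C * 'i) * ((a%:C * expi theta) ^+ m * F (a%:C * expi theta)).
Proof.
elim: m a => [|m IH] a m1 a0.
  rewrite expr0 mul1r -F_cauchy0 //; apply: eq_cintegral => t _.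
  by rewrite expr0 mulr1.
have m1' : m%:R < eps by move: m1; rewrite -natr1 addrC ltrD2l.
have m2 : m%:R < 1 + eps by rewrite (lt_trans m1') // ltrDr.
have [im zm] := F_moment0 m1' (fun a => IH a m2).
have [_ [_ ic]] := F_cauchy_integrable m2 a0.
set p := a%:C * expi theta in ic *.
have -> : - (2 * pi%:C * 'i) * (p ^+ m.+1 * F p) =
    contour_integral gamma (fun z => z ^+ m * F z) + p * (- (2 * pi%:C * 'i) * (p ^+ m * F p)).
  by rewrite zm exprS; ring.
rewrite -IH // -(cintegralZ measurableT) // -(cintegralD measurableT) //; last first.
  exact: cintegrableZ.
apply: eq_cintegral => t _.
have zp : gamma t - p != 0.
  by rewrite subr_eq0; apply: contour_neq; apply: (ray_Nrange hgamma); apply: rayP; exact: ltW.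
by rewrite -/p exprS; field.
Qed.

End CauchyFormula.

(** * Mellin integrals and the reflection formula *)

Section ParameterDerivative.
Context {R : realType} {d : measure_display} {T : measurableType d}.
Variables (mu : {measure set T -> \bar R}) (A : set T).
Hypothesis mA : measurable A.

Lemma sqr_le_expR (x : R) : 0 <= x -> x ^+ 2 <= 4 * expR x.
Proof.
move=> x0; have h := expR_ge1Dx (x / 2).
have -> : expR x = expR (x / 2) ^+ 2 by rewrite -expRM_natl; congr expR; field.
have h2 : (x / 2) ^+ 2 <= expR (x / 2) ^+ 2.
  by apply: lerXn2r; rewrite ?nnegrE ?expR_ge0 ?divr_ge0 //; lra.
by move: h2; rewrite expr_div_n ler_pdivrMr //; lra.
Qed.

Variables (l f : T -> R[i]) (g : T -> R) (s0 : R[i]) (e : R).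
Hypotheses (ml : cmeasurable A l) (mf : cmeasurable A f) (e0 : 0 < e)
  (ig : mu.-integrable A (EFin \o g))
  (fg : forall x, A x -> abs (cexp (s0 * l x) * f x) * expR (e * abs (l x)) <= g x).

Let mcexp s : cmeasurable A (fun x => cexp (s * l x) * f x).
Proof.
by apply: cmeasurableM => //; apply: cmeasurable_cexp; apply: cmeasurableM.
Qed.

Lemma mellin_integrable s : abs (s - s0) <= e ->
  cintegrable mu A (fun x => cexp (s * l x) * f x).
Proof.
move=> se; apply: (le_cintegrable mA _ ig) => [|x Ax]; first exact: mcexp.
apply: le_trans (fg Ax); have -> : s * l x = s0 * l x + (s - s0) * l x by ring.
rewrite cexpD mulrAC (absM (cexp (s0 * l x) * f x)) ler_wpM2l ?abs_ge0 // abs_cexp ler_expR.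
rewrite (le_trans (ler_norm _)) // (le_trans (ler_Re_abs _)) // absM.
by rewrite ler_wpM2r ?abs_ge0.
Qed.

(** The margin e in the exponent is used in two halves: one dominates exp |h l| in the Taylor
    remainder of the exponential, the other the factor |l|^2. The difference quotient is then within
    |h| B of the expected derivative. *)
Lemma mellin_derivable :
  derivable (fun s : R[i] => cintegral mu A (fun x => cexp (s * l x) * f x)) s0 1.
Proof.
pose eta := e / 2; have eta0 : 0 < eta by rewrite divr_gt0.
have eta_e : eta <= e by have := e0; rewrite /eta; lra.
pose I s := cintegral mu A (fun x => cexp (s * l x) * f x).
pose B := 4 / eta ^+ 2 * \int[mu]_(x in A) g x.
have bnd (h : R[i]) x : A x -> abs h <= eta ->
    abs (cexp (s0 * l x) * f x * (cexp (h * l x) - 1 - h * l x)) <= abs h ^+ 2 * (4 / eta ^+ 2) * g x.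
  move=> Ax he; rewrite absM.
  apply: (@le_trans _ _ (abs (cexp (s0 * l x) * f x) * (abs h ^+ 2 * (4 / eta ^+ 2) * expR (e * abs (l x))))).
    rewrite ler_wpM2l ?abs_ge0 // (le_trans (cexp_taylor _)) // absM exprMn -[leLHS]mulrA -[leRHS]mulrA.
    apply: ler_wpM2l; first exact: sqr_ge0.
    have l0 := abs_ge0 (l x); have q0 : 0 <= eta * abs (l x) by rewrite mulr_ge0 // ltW.
    have h1 := sqr_le_expR q0.
    have -> : expR (e * abs (l x)) = expR (eta * abs (l x)) * expR (eta * abs (l x)).
      by rewrite -expRD; congr expR; rewrite /eta; field.
    rewrite mulrA ler_pM ?sqr_ge0 ?expR_ge0 //.
      by rewrite mulrAC ler_pdivlMr ?exprn_gt0 // mulrC -exprMn.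
    by rewrite ler_expR ler_wpM2r.
  rewrite mulrCA ler_wpM2l ?fg //.
  by rewrite mulr_ge0 ?sqr_ge0 // divr_ge0 ?sqr_ge0.
have ilf : cintegrable mu A (fun x => l x * (cexp (s0 * l x) * f x)).
  have ig' : mu.-integrable A (EFin \o (fun x => eta^-1 * g x)).
    rewrite (_ : _ \o _ = fun x => ((eta^-1)%:E * (g x)%:E)%E); first exact: integrableZl.
    by apply/funext => x /=; rewrite EFinM.
  apply: (le_cintegrable mA _ ig') => [|x Ax]; first exact: cmeasurableM.
  rewrite ler_pdivlMl // (le_trans _ (fg Ax)) // absM mulrA mulrC ler_wpM2l ?abs_ge0 //.
  have l0 := abs_ge0 (l x).
  apply: (@le_trans _ _ (e * abs (l x))); first exact: ler_wpM2r.
  by rewrite (le_trans _ (expR_ge1Dx _)) // lerDr.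
pose D := cintegral mu A (fun x => l x * (cexp (s0 * l x) * f x)).
have key (h : R[i]) : h != 0 -> abs h <= eta -> abs (h^-1 * (I (h + s0) - I s0) - D) <= abs h * B.
  move=> h0 he; have i1 : cintegrable mu A (fun x => cexp ((h + s0) * l x) * f x).
    by apply: mellin_integrable; rewrite addrK (le_trans he).
  have i0 : cintegrable mu A (fun x => cexp (s0 * l x) * f x).
    by apply: mellin_integrable; rewrite subrr abs0 ltW.
  have ih : cintegrable mu A (fun x => h * (l x * (cexp (s0 * l x) * f x))).
    exact: cintegrableZ.
  have -> : h^-1 * (I (h + s0) - I s0) - D = h^-1 * (I (h + s0) - I s0 - h * D).
    by field.
  rewrite /I /D -(cintegralZ mA) // -(cintegralB mA) // -(cintegralB mA) //; last first.
    by apply: (cintegrableD mA) => //; have := cintegrableZ mA (-1) i0;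
       apply: (eq_cintegrable mA) => x _; rewrite mulN1r.
  rewrite absM absV ler_pdivrMl ?abs_gt0 // mulrA -expr2 /B mulrA.
  have ig2 : mu.-integrable A (EFin \o (fun x => abs h ^+ 2 * (4 / eta ^+ 2) * g x)).
    rewrite (_ : _ \o _ = fun x => ((abs h ^+ 2 * (4 / eta ^+ 2))%:E * (g x)%:E)%E); first exact: integrableZl.
    by apply/funext => x /=; rewrite EFinM.
  have -> : abs h ^+ 2 * (4 / eta ^+ 2) * \int[mu]_(x in A) g x =
      \int[mu]_(x in A) (abs h ^+ 2 * (4 / eta ^+ 2) * g x).
    by symmetry; apply: RintegralZl.
  apply: (le_abs_cintegral mA) => //.
    do ?[apply: (cintegrableD mA) => //].
    - by have := cintegrableZ mA (-1) i0; apply: (eq_cintegrable mA) => x _; rewrite mulN1r.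
    - by have := cintegrableZ mA (-1) ih; apply: (eq_cintegrable mA) => x _; rewrite mulN1r.
  move=> x Ax; apply: le_trans (bnd h x Ax he); rewrite le_eqVlt; apply/orP; left; apply/eqP.
  by congr abs; rewrite mulrDl cexpD; ring.
apply/cvg_ex; exists D; apply/cvgrPdist_le => eps eps0.
have [er er0] := ge0_Re (ltW eps0); have {}er0 : 0 < cRe eps by move: eps0; rewrite er ltcR.
have hs (b : R) : 0 < b -> \forall h \near (0 : R[i])^', abs h < b.
  move=> b0; apply: cvg_within; apply/nbhs_normP; exists b%:C; first by rewrite /= ltcR.
  by move=> v /=; rewrite sub0r normrN normE ltcR.
near=> h.
have h0 : h != 0 by near: h; exact: nbhs_dnbhs_neq.
rewrite distrC normE er lecR /= /GRing.scale /= mulr1.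
have B0 : 0 < `|B| + 1 by rewrite ltr_wpDl.
have h1 : abs h < Num.min eta (cRe eps / (`|B| + 1)).
  by near: h; apply: hs; rewrite lt_min eta0 divr_gt0.
move: h1; rewrite lt_min => /andP[h1 h2]; apply: le_trans (key h h0 (ltW h1)) _.
apply: (@le_trans _ _ (abs h * (`|B| + 1))).
  by rewrite ler_wpM2l ?abs_ge0 // (le_trans (ler_norm _)) // lerDl.
by rewrite -ler_pdivlMr // ltW.
Unshelve. all: end_near.
Qed.

End ParameterDerivative.

Section RayIntegrals.
Context {R : realType}.
Local Notation leb := (@lebesgue_measure R).
Local Notation pos := (`]0, +oo[%classic : set R).
Implicit Types (t : R) (s z w : R[i]).

(** The right end n + 2 keeps the interval nondegenerate for every n, including n = 0. *)
Lemma Rintegral_ray_cvg (f : R -> R) : leb.-integrable pos (EFin \o f) ->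
  \int[leb]_(t in `[n.+1%:R^-1, n.+2%:R]) f t @[n --> \oo] --> \int[leb]_(t in pos) f t.
Proof.
move=> intf; have mf : measurable_fun pos f by case/integrableP : intf => /measurable_EFinP.
pose D (n : nat) : set R := `[n.+1%:R^-1, n.+2%:R]%classic.
have mD n : measurable (D n) by exact: measurable_itv.
have Dp n : D n `<=` pos.
  move=> t; rewrite /D /= !in_itv /= andbT => /andP[h _]; rewrite (lt_le_trans _ h) //.
pose h n t := ((f \_ (D n)) t)%:E.
have [|||||_ _ h1] := @dominated_convergence _ _ _ leb pos (measurable_itv _) h (EFin \o f) (fun t => `|f t|%:E).
- move=> n; apply/measurable_EFinP; apply/measurable_restrict => //.
    exact: mD.
  by apply: measurable_funS mf => // t [].
- exact/measurable_EFinP.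
- apply/aeW => t /=; rewrite in_itv /= andbT => t0; apply: cvg_near_cst.
  exists (Num.bound t + Num.bound t^-1)%N => // n /= nt.
  rewrite /h patchE ifT // inE /D /= in_itv /=; apply/andP; split.
    rewrite invf_ple ?posrE //; apply: ltW.
    have ti : 0 <= t^-1 by rewrite invr_ge0 ltW.
    apply: lt_le_trans (archi_boundP ti) _; rewrite ler_nat.
    by rewrite (leq_trans (leq_addl _ _) (leq_trans nt _)).
  apply: ltW; apply: lt_le_trans (archi_boundP (ltW t0)) _; rewrite ler_nat.
  by rewrite (leq_trans (leq_addr _ _) (leq_trans nt _)) // ltnW.
- by have := integrable_norm intf.
- apply/aeW => t n _; rewrite /h patchE; case: ifP => _ //=.
  by rewrite lee_fin normr0.
have := @fine_cvg _ _ _ _ _ (\int[leb]_(t in pos) f t) _.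
rewrite /Rintegral fineK; last exact: integrable_fin_num.
move=> /(_ _ _ _ _ h1); apply: cvg_trans; apply: near_eq_cvg; apply: nearW => n.
rewrite /h /=; congr fine; rewrite integral_mkcond [RHS]integral_mkcond; apply: eq_integral => t _.
rewrite !patchE; case: ifPn => [tp|]; case: ifPn => // tD.
by rewrite inE in tD; move/Dp: tD; rewrite -inE => ->.
Qed.

Lemma FTC2_ray (f F : R -> R) (l L : R) : leb.-integrable pos (EFin \o f) ->
  (forall t, 0 < t -> {for t, continuous f} /\ is_derive t 1 F (f t)) ->
  F n.+2%:R @[n --> \oo] --> L -> F (n.+1%:R^-1) @[n --> \oo] --> l ->
  \int[leb]_(t in pos) f t = L - l.
Proof.
move=> intf dF FL Fl; have h1 := Rintegral_ray_cvg intf.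
have h2 : F n.+2%:R - F (n.+1%:R^-1) @[n --> \oo] --> L - l by exact: cvgB.
suff h3 : \int[leb]_(t in `[n.+1%:R^-1, n.+2%:R]) f t @[n --> \oo] --> L - l.
  exact: (@cvg_unique _ (@Rhausdorff R) _ _ _ _ h1 h3).
move: h2; apply: cvg_trans; apply: near_eq_cvg; apply: nearW => n.
have i0 : 0 < n.+1%:R^-1 :> R by rewrite invr_gt0.
have nn : n.+1%:R^-1 < n.+2%:R :> R.
  by rewrite (@le_lt_trans _ _ 1) ?invf_le1 ?ler1n ?ltr1n.
apply/esym; apply: (FTC2_off_finite (s := [::])) => //.
- apply: integrableS intf => // t; rewrite /= !in_itv /= andbT => /andP[h _].
  exact: lt_le_trans h.
- apply: continuous_in_subspaceT => t; rewrite inE /= in_itv /= => /andP[h _].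
  have [_ d] := dF t (lt_le_trans i0 h).
  by apply: differentiable_continuous; apply/derivable1_diffP; exact: ex_derive.
- by move=> t /andP[h _] _; apply: dF; exact: lt_trans h.
Qed.

Lemma cFTC2_ray (f F : R -> R[i]) (l L : R[i]) : cintegrable leb pos f ->
  (forall t, 0 < t -> {for t, continuous f} /\ cderive F t (f t)) ->
  F n.+2%:R @[n --> \oo] --> L -> F (n.+1%:R^-1) @[n --> \oo] --> l ->
  cintegral leb pos f = L - l.
Proof.
move=> [i1 i2] dF /cvg_ReImP[L1 L2] /cvg_ReImP[l1 l2].
rewrite /cintegral; apply: eq_ReIm; rewrite ?cReB ?cImB /=.
- apply: (@FTC2_ray _ (fun t => cRe (F t))) => //.
  by move=> t /dF[c [d1 d2]]; split=> //; apply: cvg_Re; exact: c.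
- apply: (@FTC2_ray _ (fun t => cIm (F t))) => //.
  by move=> t /dF[c [d1 d2]]; split=> //; apply: cvg_Im; exact: c.
Qed.

Lemma abs_rcpow t s : 0 < t -> abs (rcpow t s) = t `^ cRe s.
Proof. by move=> t0; rewrite /rcpow abs_cexp mulrC cReZ /powR gt_eqF // mulrC. Qed.

Lemma rcpowD t s w : rcpow t (s + w) = rcpow t s * rcpow t w.
Proof. by rewrite /rcpow mulrDl cexpD. Qed.

Lemma rcpowR t (n : nat) : 0 < t -> rcpow t n%:R = (t ^+ n)%:C.
Proof. by move=> t0; rewrite /rcpow cexpMn cexp_real lnK // rmorphXn. Qed.

Lemma rcpowVn t (n : nat) : 0 < t -> rcpow t (- n%:R) = ((t ^+ n)%:C)^-1.
Proof. by move=> t0; rewrite -rcpowR // /rcpow mulNr cexpN. Qed.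

Lemma rcpow1 s : rcpow 1 s = 1.
Proof. by rewrite /rcpow ln1 mulr0 cexp0. Qed.

Lemma cderive_rcpow t s : 0 < t -> cderive (fun u => rcpow u s) t (s * (t^-1)%:C * rcpow t s).
Proof.
move=> t0; rewrite /rcpow; apply: cderive_cexp; apply: cderiveZ; apply: cderive_real.
exact: is_derive1_ln.
Qed.

Lemma measurable_ln_ray : measurable_fun pos (@ln R).
Proof. exact: measurable_funTS. Qed.

Lemma rcpow_measurable s : cmeasurable pos (fun t => rcpow t s).
Proof.
apply: cmeasurable_cexp; apply: cmeasurableM; first exact: cmeasurable_cst.
by apply: cmeasurable_real; exact: measurable_ln_ray.
Qed.

End RayIntegrals.

(** * The Stieltjes transform of t^(-s) and the reflection formula *)

Section BetaIntegral.
Context {R : realType}.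
Local Notation leb := (@lebesgue_measure R).
Local Notation pos := (`]0, +oo[%classic : set R).
Implicit Types (t : R) (z w : R[i]).

Lemma measurable_pos : measurable (pos : set (measurableTypeR R)).
Proof. exact: measurable_itv. Qed.

Lemma posP t : pos t <-> 0 < t.
Proof. by rewrite /= in_itv /= andbT. Qed.

Lemma integrable_ray_powR (C a b : R) : -1 < a -> a + b < -1 ->
  leb.-integrable pos (EFin \o (fun t => C * (t `^ a * (1 + t) `^ b))).
Proof.
move=> a1 ab; have h := @integrable_powR_ray R (a + 1) (- b - (a + 1)).
rewrite (_ : _ \o _ = fun t => (C%:E * (t `^ a * (1 + t) `^ b)%:E)%E); last first.
  by apply/funext => t /=; rewrite EFinM.
apply: integrableZl => //; have -> : (fun t => (t `^ a * (1 + t) `^ b)%:E) =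
    EFin \o (fun t => t `^ (a + 1 - 1) * (1 + t) `^ (- (a + 1 + (- b - (a + 1))))).
  by apply/funext => t /=; congr ((_ `^ _ * _ `^ _)%:E); ring.
by apply: h; lra.
Qed.

Lemma slit_plane_ray_dist z : slit_plane z -> exists2 c, 0 < c &
  forall t, 0 <= t -> c * (1 + t) <= abs (t%:C + z).
Proof.
move=> sz; have z0 := slit_plane_neq0 sz; have a0 : 0 < abs z by rewrite abs_gt0.
pose d := (abs z + cRe z) / abs z; have d0 : 0 < d by rewrite divr_gt0.
have m0 : 0 < Num.min 1 (abs z) by rewrite lt_min ltr01.
exists (d / 2 * Num.min 1 (abs z)); first by rewrite mulr_gt0 ?divr_gt0.
move=> t t0; have h := @slit_plane_dist R z d t d0 z0 t0.
rewrite {1}/d divfK ?gt_eqF // lexx in h; apply: le_trans (h isT).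
rewrite -[leLHS]mulrA; apply: ler_wpM2l; first by rewrite ltW // divr_gt0.
rewrite mulrDr mulr1 addrC lerD //.
- by rewrite ler_piMl // ge_min lexx.
- by rewrite ge_min lexx orbT.
Qed.

Variable s : R[i].
Hypothesis hs : 0 < cRe s < 1.

Let s0 : 0 < cRe s. Proof. by case/andP: hs. Qed.
Let s1 : cRe s < 1. Proof. by case/andP: hs. Qed.

Definition stieltjes z : R[i] := cintegral leb pos (fun t => rcpow t (- s) * (t%:C + z)^-1).

Let g t := t `^ (- cRe s) * (1 + t) `^ (- 1).

Lemma stieltjes_integrable_pow z (m : nat) : slit_plane z ->
  cintegrable leb pos (fun t => rcpow t (- s) * (t%:C + z) ^- m.+1).
Proof.
move=> /slit_plane_ray_dist[c c0 hc].
have ig : leb.-integrable pos (EFin \o (fun t => c ^- m.+1 * g t)).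
  by apply: integrable_ray_powR; rewrite ?ltrN2 //; have := s0; have := s1; lra.
apply: (le_cintegrable measurable_pos _ ig).
  apply: cmeasurableM; first exact: rcpow_measurable.
  apply: cmeasurableV; apply: cmeasurableX; apply: cmeasurableD; last exact: cmeasurable_cst.
  by apply: cmeasurable_real; exact: measurable_id.
move=> t /posP t0; have p : 0 < 1 + t by rewrite ltr_pwDl // ltW.
rewrite absM abs_rcpow // cReN /g mulrCA ler_wpM2l ?powR_ge0 //.
rewrite absV absX powRN powRr1 ?(ltW p) //.
rewrite -invfM lef_pV2 ?posrE ?exprn_gt0 ?mulr_gt0 ?exprn_gt0 //; last first.
  by rewrite (lt_le_trans _ (hc t (ltW t0))) // mulr_gt0.
apply: (@le_trans _ _ ((c * (1 + t)) ^+ m.+1)); last first.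
  by apply: lerXn2r; rewrite ?nnegrE ?abs_ge0 ?mulr_ge0 ?(ltW c0) ?(ltW p) ?hc ?(ltW t0).
rewrite exprMn ler_wpM2l ?exprn_ge0 ?(ltW c0) // exprS ler_peMr ?(ltW p) //.
by rewrite exprn_ege1 // lerDl ltW.
Qed.

Lemma stieltjes_integrable z : slit_plane z ->
  cintegrable leb pos (fun t => rcpow t (- s) * (t%:C + z)^-1).
Proof. by move=> /(@stieltjes_integrable_pow z 0). Qed.

Definition stieltjes' z : R[i] := - cintegral leb pos (fun t => rcpow t (- s) * (t%:C + z) ^- 2).

Lemma is_derive_stieltjes z : slit_plane z -> is_derive z 1 stieltjes (stieltjes' z).
Proof.
move=> sz; have [c c0 hc] := slit_plane_ray_dist sz.
pose B := \int[leb]_(t in pos) (2 * c ^- 3 * g t).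
have ig : leb.-integrable pos (EFin \o (fun t => 2 * c ^- 3 * g t)).
  by apply: integrable_ray_powR; rewrite ?ltrN2 //; have := s0; have := s1; lra.
have c2 : 0 < c / 2 by rewrite divr_gt0.
(* For |h| <= c / 2 at least half of the bound c (1 + t) survives at z + h, uniformly in t. *)
have hc2 h t : abs h <= c / 2 -> 0 <= t -> c / 2 * (1 + t) <= abs (t%:C + (h + z)).
  move=> hh t0; have := hc t t0; have := abs_triangle (t%:C + z) (- h).
  rewrite absN opprK -addrA [z + h]addrC => h1 h2; nra.
have sh h : abs h <= c / 2 -> slit_plane (h + z).
  move=> hh; case: (pselect (slit_plane (h + z))) => // /slit_planeN e; exfalso.
  have e' : (abs (h + z))%:C + (h + z) = 0 by rewrite {2}e subrr.
  have := hc2 h (abs (h + z)) hh (abs_ge0 _); rewrite e' abs0 leNgt => /negP; apply.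
  by rewrite mulr_gt0 // ltr_pwDl // abs_ge0.
have key (h : R[i]) : h != 0 -> abs h <= c / 2 ->
    abs (h^-1 * (stieltjes (h + z) - stieltjes z) - stieltjes' z) <= abs h * B.
  move=> h0 hh; have i1 := stieltjes_integrable (sh h hh); have i0 := stieltjes_integrable sz.
  have i2 := @stieltjes_integrable_pow z 1 sz; have mp := measurable_pos.
  rewrite /stieltjes /stieltjes' opprK -(cintegralB mp) // -(cintegralZ mp); last first.
    apply: (cintegrableD mp) => //; have := cintegrableZ mp (-1) i0.
    by apply: (eq_cintegrable mp) => t _; rewrite mulN1r.
  have i3 : cintegrable leb pos (fun t => h^-1 * (rcpow t (- s) * (t%:C + (h + z))^-1 -
      rcpow t (- s) * (t%:C + z)^-1)).
    apply: (cintegrableZ mp); apply: (cintegrableD mp) => //; have := cintegrableZ mp (-1) i0.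
    by apply: (eq_cintegrable mp) => t _; rewrite mulN1r.
  rewrite -(cintegralD mp) //.
  have -> : abs h * B = \int[leb]_(t in pos) (abs h * (2 * c ^- 3 * g t)).
    by symmetry; apply: RintegralZl.
  have igh : leb.-integrable pos (EFin \o (fun t => abs h * (2 * c ^- 3 * g t))).
    rewrite (_ : _ \o _ = fun x => ((abs h)%:E * (2 * c ^- 3 * g x)%:E)%E); first exact: integrableZl.
    by apply/funext => x /=; rewrite EFinM.
  apply: (le_abs_cintegral mp) => //; first exact: (cintegrableD mp).
  move=> t /posP t0; have p : 0 < 1 + t by rewrite ltr_pwDl // ltW.
  have n1 : 0 < abs (t%:C + z) by rewrite (lt_le_trans _ (hc t (ltW t0))) // mulr_gt0.
  have n2 : 0 < abs (t%:C + (h + z)) by rewrite (lt_le_trans _ (hc2 h t hh (ltW t0))) // mulr_gt0.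
  have -> : h^-1 * (rcpow t (- s) * (t%:C + (h + z))^-1 - rcpow t (- s) * (t%:C + z)^-1) +
      rcpow t (- s) * (t%:C + z) ^- 2 =
      h * (rcpow t (- s) * ((t%:C + z) ^- 2 * (t%:C + (h + z))^-1)).
    move: n1 n2; rewrite !abs_gt0 => n1 n2; field; by rewrite h0 n1 n2.
  rewrite absM ler_wpM2l ?abs_ge0 // absM abs_rcpow // cReN /g mulrCA ler_wpM2l ?powR_ge0 //.
  rewrite absM !absV absX powRN powRr1 ?(ltW p) //.
  have -> : 2 * c ^- 3 * (1 + t)^-1 = (c ^+ 2 * (c / 2 * (1 + t)))^-1.
    by field; rewrite !gt_eqF.
  rewrite -invfM lef_pV2 ?posrE ?mulr_gt0 ?exprn_gt0 //.
  rewrite ler_pM ?exprn_ge0 ?mulr_ge0 ?(ltW c2) ?(ltW c0) ?(ltW p) ?hc2 ?(ltW t0) //.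
  apply: lerXn2r; rewrite ?nnegrE ?abs_ge0 ?(ltW c0) // (le_trans _ (hc t (ltW t0))) //.
  by rewrite ler_peMr ?(ltW c0) // lerDl ltW.
have lim : h^-1 *: ((stieltjes \o shift z) (h *: 1) - stieltjes z) @[h --> (0 : R[i])^'] --> stieltjes' z.
  have hsm (b : R) : 0 < b -> \forall h \near (0 : R[i])^', abs h < b.
    move=> b0; apply: cvg_within; apply/nbhs_normP; exists b%:C; first by rewrite /= ltcR.
    by move=> v /=; rewrite sub0r normrN normE ltcR.
  have B0 : 0 < `|B| + 1 by rewrite ltr_wpDl.
  apply/cvgrPdist_le => eps eps0.
  have [er er0] := ge0_Re (ltW eps0); have {}er0 : 0 < cRe eps by move: eps0; rewrite er ltcR.
  near=> h; have h0 : h != 0 by near: h; exact: nbhs_dnbhs_neq.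
  rewrite distrC normE er lecR /= /GRing.scale /= mulr1.
  have h1 : abs h < Num.min (c / 2) (cRe eps / (`|B| + 1)).
    by near: h; apply: hsm; rewrite lt_min c2 divr_gt0.
  move: h1; rewrite lt_min => /andP[h1 h2]; apply: le_trans (key h h0 (ltW h1)) _.
  apply: (@le_trans _ _ (abs h * (`|B| + 1))).
    by rewrite ler_wpM2l ?abs_ge0 // (le_trans (ler_norm _)) // lerDl.
  by rewrite -ler_pdivlMr // ltW.
apply: DeriveDef; first by apply/cvg_ex; exists (stieltjes' z).
exact: norm_cvg_lim.
Unshelve. all: end_near.
Qed.

(* The derivative of t^(1-s) / (t + z) has integral 0. *)
Lemma stieltjes_ode z : slit_plane z -> s * stieltjes z + z * stieltjes' z = 0.
Proof.
move=> sz; have [c c0 hc] := slit_plane_ray_dist sz; have mp := measurable_pos.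
have i0 := stieltjes_integrable sz; have i2 := @stieltjes_integrable_pow z 1 sz.
pose f t := - s * (rcpow t (- s) * (t%:C + z)^-1) + z * (rcpow t (- s) * (t%:C + z) ^- 2).
have if_ : cintegrable leb pos f.
  by rewrite /f; apply: (cintegrableD mp); apply: (cintegrableZ mp).
suff h : cintegral leb pos f = 0 - 0.
  rewrite subrr /f (cintegralD mp) in h; [|exact: cintegrableZ..].
  rewrite !(cintegralZ mp) // in h; rewrite /stieltjes' mulrN /stieltjes.
  by apply/eqP; rewrite -oppr_eq0 opprB addrC -mulNr h.
have tz t : 0 < t -> t%:C + z != 0.
  move=> t0; have p : 0 < 1 + t by rewrite ltr_pwDl // ltW.
  by rewrite -abs_gt0 (lt_le_trans _ (hc t (ltW t0))) // mulr_gt0.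
pose F t := t%:C * rcpow t (- s) * (t%:C + z)^-1.
have bF t : 0 < t -> abs (F t) <= c^-1 * (t `^ (1 - cRe s) * (1 + t)^-1).
  move=> t0; have p : 0 < 1 + t by rewrite ltr_pwDl // ltW.
  rewrite /F absM absM absR gtr0_norm // abs_rcpow // cReN absV.
  rewrite powRD ?powRr1 ?(ltW t0) //; last by apply/implyP => _; rewrite gt_eqF.
  rewrite mulrCA ler_wpM2l ?mulr_ge0 ?powR_ge0 ?(ltW t0) // -invfM lef_pV2 ?posrE ?mulr_gt0 //.
    exact: hc (ltW t0).
  by rewrite abs_gt0 tz.
apply: (@cFTC2_ray _ f F).
- exact: if_.
- move=> t t0; have ct : {for t, continuous (fun u : R => u%:C + z)}.
    exact: (cderive_continuous (cderiveD (cderive_real (is_derive_id t 1)) (cderive_cst z t))).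
  have d1 := cderive_rcpow (- s) t0; have cr := cderive_continuous d1.
  have k1 : (u%:C + z)^-1 @[u --> t] --> (t%:C + z)^-1 by apply: cvg_cV; [exact: tz | exact: ct].
  split.
    have k2 : (u%:C + z) ^- 2 @[u --> t] --> (t%:C + z) ^- 2.
      by have := cvg_cM k1 k1; under eq_fun do rewrite -invfM -expr2; rewrite -invfM -expr2; apply.
    exact: (cvg_cD (cvg_cmul _ (cvg_cM cr k1)) (cvg_cmul _ (cvg_cM cr k2))).
  have d2 := cderive_real (is_derive_id t 1).
  have d3 := cderiveV (tz t t0) (cderiveD d2 (cderive_cst z t)).
  apply: cderive_eq (cderiveM (cderiveM d2 d1) d3) _.
  have t0' : t%:C != 0 :> R[i] by rewrite (inj_eq (@complexI R)) gt_eqF.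
  rewrite /f fmorphV /=; field; by rewrite t0' tz.
- apply: (@abs_squeeze _ _ _ _ _ _ (fun n => c^-1 * (n.+1%:R `^ (- cRe s)))).
    rewrite -(mulr0 c^-1); apply: cvgM; first exact: cvg_cst.
    apply/cvgrPdist_le => e e0; near=> n; rewrite sub0r normrN ger0_norm ?powR_ge0 //.
    have e1 : 0 < e `^ (- (cRe s)^-1) by rewrite powR_gt0.
    have n1 : e `^ (- (cRe s)^-1) <= n.+1%:R.
      by rewrite (@le_trans _ _ n%:R) ?ler_nat //; near: n; exact: nbhs_infty_ger.
    have -> : e = (e `^ (- (cRe s)^-1)) `^ (- cRe s).
      by rewrite -powRrM mulrNN mulVf ?gt_eqF ?s0 // powRr1 // ltW.
    rewrite [leLHS]powRN [leRHS]powRN lef_pV2 ?posrE ?powR_gt0 //.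
    by apply: ge0_ler_powR; rewrite ?nnegrE ?(ltW s0) ?(ltW e1).
  apply: nearW => n; rewrite subr0 (le_trans (bF _ _)) // ler_wpM2l ?invr_ge0 ?(ltW c0) //.
  have n0 : 0 < n.+2%:R :> R by [].
  rewrite ler_pdivrMr ?ltr_pwDl // powRD ?powRr1 ?(ltW n0) //; last by apply/implyP => _; rewrite gt_eqF.
  rewrite mulrC ler_pM ?powR_ge0 //.
    rewrite !powRN lef_pV2 ?posrE ?powR_gt0 //.
    by apply: ge0_ler_powR; rewrite ?nnegrE ?(ltW s0) // ler_nat.
  by rewrite lerDr.
- apply: (@abs_squeeze _ _ _ _ _ _ (fun n => c^-1 * (n.+1%:R `^ (- (1 - cRe s))))).
    have r0 : 0 < 1 - cRe s by rewrite subr_gt0 s1.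
    rewrite -(mulr0 c^-1); apply: cvgM; first exact: cvg_cst.
    apply/cvgrPdist_le => e e0; near=> n; rewrite sub0r normrN ger0_norm ?powR_ge0 //.
    have e1 : 0 < e `^ (- (1 - cRe s)^-1) by rewrite powR_gt0.
    have n1 : e `^ (- (1 - cRe s)^-1) <= n.+1%:R.
      by rewrite (@le_trans _ _ n%:R) ?ler_nat //; near: n; exact: nbhs_infty_ger.
    have -> : e = (e `^ (- (1 - cRe s)^-1)) `^ (- (1 - cRe s)).
      by rewrite -powRrM mulrNN mulVf ?gt_eqF // powRr1 // ltW.
    rewrite [leLHS]powRN [leRHS]powRN lef_pV2 ?posrE ?powR_gt0 //.
    by apply: ge0_ler_powR; rewrite ?nnegrE ?(ltW r0) ?(ltW e1).
  have i0' n : 0 < n.+1%:R^-1 :> R by rewrite invr_gt0.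
  apply: nearW => n; rewrite subr0 (le_trans (bF _ (i0' n))) // ler_wpM2l ?invr_ge0 ?(ltW c0) //.
  have -> : n.+1%:R^-1 `^ (1 - cRe s) = n.+1%:R `^ (- (1 - cRe s)) :> R.
    by rewrite -[X in X^-1]powRr1 // -powRN -powRrM mulN1r.
  rewrite ler_piMr ?powR_ge0 // invf_le1 ?ltr_pwDl ?(ltW (i0' n)) //.
  by rewrite lerDl ltW.
Unshelve. all: end_near.
Qed.

(** By [stieltjes_ode] the product of e^(s u w) and the transform at e^(u w) has derivative 0 in u
    on [0, 1]; the condition on Im w keeps e^(u w) in the slit plane. *)
Lemma stieltjes_cexp w : `|cIm w| < pi -> cexp (s * w) * stieltjes (cexp w) = stieltjes 1.
Proof.
move=> hw; pose V (u : R) := cexp (s * (u%:C * w)) * stieltjes (cexp (u%:C * w)).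
have sl (u : R) : 0 <= u <= 1 -> slit_plane (cexp (u%:C * w)).
  move=> /andP[u0 u1]; apply: slit_plane_polar; first exact: expR_gt0.
  by rewrite cImZ normrM ger0_norm // (le_lt_trans _ hw) // ler_piMl.
have dV (u : R) : 0 <= u <= 1 -> cderive V u 0.
  move=> u01; have d1 : cderive (fun u : R => u%:C * w) u w.
    apply: cderive_eq (cderiveM (cderive_real (is_derive_id u 1)) (cderive_cst w u)) _.
    by rewrite mulr0 addr0 mul1r.
  have d2 := cderive_cexp d1; have d3 := cderive_cexp (cderiveZ s d1).
  have d4 := cderive_comp (is_derive_stieltjes (sl u u01)) d2.
  apply: cderive_eq (cderiveM d3 d4) _.
  set z := cexp (u%:C * w); set a := cexp (s * _).
  have -> : s * w * a * stieltjes z + a * (stieltjes' z * (w * z)) =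
    w * a * (s * stieltjes z + z * stieltjes' z) by ring.
  by rewrite stieltjes_ode ?mulr0 //; exact: sl.
have := @cmean_value_le _ V (fun=> 0) 0 1 0 ler01 dV.
rewrite mul0r => /(_ (fun _ _ => _)) h.
have {}h : abs (V 1 - V 0) <= 0 by apply: h; rewrite abs0.
have /eqP : V 1 - V 0 == 0 by rewrite -abs_eq0 eq_le h abs_ge0.
by rewrite /V rmorph0 rmorph1 !mul0r !mul1r mulr0 cexp0 mul1r => /eqP; rewrite subr_eq0 => /eqP.
Qed.

Section Reflection.
Variable phi : R.
Hypothesis hphi : 0 < phi < pi.

Let np : `|phi| < pi.
Proof. by case/andP: hphi => p0 p1; rewrite gtr0_norm. Qed.

Let npN : `|- phi| < pi. Proof. by rewrite normrN. Qed.

Let slp a : `|a| < pi -> slit_plane (expi a : R[i]).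
Proof. by move=> ha; have := slit_plane_polar ltr01 ha; rewrite rmorph1 mul1r. Qed.

Let clp a : `|a| < pi -> clog (expi a : R[i]) = 'i * a%:C.
Proof.
move=> ha; have c := carg_unique ltr01 ha; rewrite rmorph1 mul1r in c.
rewrite -complexiE; apply: eq_ReIm; rewrite ?cReM ?cImM /= ?c ?abs_expi ?ln1; ring.
Qed.

Lemma stieltjes_expi a : `|a| < pi -> stieltjes (expi a) = cexp (- (s * ('i * a%:C))) * stieltjes 1.
Proof.
move=> ha; have h := @stieltjes_cexp ('i * a%:C); rewrite cexp_i in h.
rewrite -h; last by rewrite -complexiE cImM /= mul0r add0r mul1r.
by rewrite mulrA -cexpD addNr cexp0 mul1r.
Qed.

(** The jump of the Cauchy kernel between two points of the unit circle close to -1 on either side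
    of the cut; as phi tends to pi it approaches 2 pi i times the Dirac mass at t = 1. *)
Definition jump_kernel t : R[i] := (t%:C + expi (- phi))^-1 - (t%:C + expi phi)^-1.

Let tz a t : `|a| < pi -> 0 <= t -> t%:C + expi a != 0 :> R[i].
Proof.
move=> ha t0; have [c c0 hc] := slit_plane_ray_dist (slp ha).
by rewrite -abs_gt0 (lt_le_trans _ (hc t t0)) // mulr_gt0 // ltr_pwDl.
Qed.

Lemma jump_kernelE t : 0 <= t ->
  jump_kernel t = (expi phi - expi (- phi)) * ((t%:C + expi (- phi)) * (t%:C + expi phi))^-1.
Proof.
by move=> t0; rewrite /jump_kernel; have h1 := tz np t0; have h2 := tz npN t0; field; rewrite h1 h2.
Qed.

Lemma jump_kernel_measurable : cmeasurable pos jump_kernel.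
Proof.
have h a : cmeasurable pos (fun t : R => (t%:C + expi a)^-1 : R[i]).
  apply: cmeasurableV; apply: cmeasurableD; last exact: cmeasurable_cst.
  by apply: cmeasurable_real; exact: measurable_id.
exact: cmeasurableB.
Qed.

Lemma jump_kernel_integral : cintegrable leb pos jump_kernel /\
  cintegral leb pos jump_kernel = 2 * 'i * phi%:C.
Proof.
have [c c0 hc] := slit_plane_ray_dist (slp np); have [d d0 hd] := slit_plane_ray_dist (slp npN).
have ij : cintegrable leb pos jump_kernel.
  have ig : leb.-integrable pos (EFin \o (fun t => 2 / (d * c) * (t `^ 0 * (1 + t) `^ (- 2)))).
    by apply: integrable_ray_powR; lra.
  apply: (le_cintegrable measurable_pos jump_kernel_measurable ig) => t /posP t0.
  have p : 0 < 1 + t by rewrite ltr_pwDl // ltW.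
  rewrite jump_kernelE ?(ltW t0) // absM absV absM powRr0 mul1r powRN powR_mulrn ?(ltW p) //.
  rewrite -[leRHS]mulrA ler_pM ?abs_ge0 ?invr_ge0 ?mulr_ge0 ?abs_ge0 //.
    by rewrite (le_trans (absB _ _)) // !abs_expi.
  rewrite -invfM lef_pV2 ?posrE ?mulr_gt0 ?exprn_gt0 ?abs_gt0 ?tz ?(ltW t0) //.
  rewrite expr2 mulrACA ler_pM ?mulr_ge0 ?(ltW c0) ?(ltW d0) ?(ltW p) ?hc ?hd ?(ltW t0) //.
split=> //.
pose F t := clog (t%:C + expi (- phi)) - clog (t%:C + expi phi).
have sl a t : `|a| < pi -> 0 <= t -> slit_plane (t%:C + expi a).
  move=> ha t0; have [e e0 he] := slit_plane_ray_dist (slp ha).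
  case: (pselect (slit_plane (t%:C + expi a))) => // /slit_planeN e1; exfalso.
  have := he (t + abs (t%:C + expi a)) (addr_ge0 t0 (abs_ge0 _)).
  rewrite rmorphD /= addrAC {2}e1 addNr abs0 leNgt => /negP; apply.
  by rewrite mulr_gt0 // ltr_pwDl // addr_ge0 ?abs_ge0.
have -> : 2 * 'i * phi%:C = 0 - (clog (0%:C + expi (- phi)) - clog (0%:C + expi phi)) :> R[i].
  by rewrite !rmorph0 !add0r !clp // rmorphN /=; ring.
apply: (@cFTC2_ray _ jump_kernel F); first exact: ij.
- move=> t t0; have d1 a := cderiveD (cderive_real (is_derive_id t 1)) (cderive_cst (expi a) t).
  split.
    have k a : `|a| < pi -> (u%:C + expi a)^-1 @[u --> t] --> (t%:C + expi a)^-1.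
      move=> ha; apply: cvg_cV; first by apply: tz => //; exact: ltW.
      exact: (cderive_continuous (d1 a)).
    exact: (cvg_cB (k _ npN) (k _ np)).
  apply: cderive_eq (cderiveB (cderive_clog (sl _ _ npN (ltW t0)) (d1 _))
    (cderive_clog (sl _ _ np (ltW t0)) (d1 _))) _.
  by rewrite addr0 !mul1r.
- have hq : 1 + (expi (- phi) - expi phi) * (n.+2%:R%:C + expi phi)^-1 @[n --> \oo] -->
      1 + (expi (- phi) - expi phi) * 0.
    apply: cvg_cD; first exact: cvg_ccst.
    apply: cvg_cmul; apply: (@abs_squeeze _ _ _ _ _ _ (fun n => c^-1 * n.+1%:R^-1)).
      by rewrite -(mulr0 c^-1); apply: cvgM; [exact: cvg_cst | exact: cvg_harmonic].
    apply: nearW => n; rewrite subr0 absV -invfM lef_pV2 ?posrE ?mulr_gt0 ?abs_gt0 ?tz //.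
    apply: le_trans (hc n.+2%:R _) => //; rewrite ler_wpM2l ?(ltW c0) // -[n.+2%:R]natr1.
    by rewrite addrCA lerDl.
  rewrite mulr0 addr0 in hq.
  have hl : clog (1 + (expi (- phi) - expi phi) * (n.+2%:R%:C + expi phi)^-1) @[n --> \oo] --> clog (1 : R[i]).
    by apply: cvg_clog hq; apply: slit_plane_Re; exact: ltr01.
  have c1 : clog (1 : R[i]) = 0.
    have := @clog_div R 1 1; rewrite divr1 subrr; apply; exact: ltr01.
  rewrite c1 in hl; apply: cvg_trans hl; apply: near_eq_cvg; apply: nearW => n.
  have re a : 0 < cRe (n.+2%:R%:C + expi a : R[i]).
    rewrite cReD /=; have := cos_geN1 a; have : 0 <= n%:R :> R by [].
    by rewrite -natr1 -[n.+1%:R]natr1; lra.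
  rewrite /F -clog_div //; congr clog; have h1 := @tz phi n.+2%:R np (ler0n _ _).
  rewrite -{1}(divff h1) -mulrDl; congr (_ / _); ring.
- have k (a : R) : `|a| < pi -> clog ((n.+1%:R^-1)%:C + expi a) @[n --> \oo] --> clog (0%:C + expi a).
    move=> ha; apply: cvg_clog; first by apply: sl.
    apply: cvg_cD (cvg_ccst _); apply: cvg_real; exact: cvg_harmonic.
  exact: (cvg_cB (k _ npN) (k _ np)).
Qed.

(** The subtracted 1 is the value of t^(-s) at t = 1, where the kernel concentrates; the integral
    will then vanish in the limit, and the mass 2 i phi appears explicitly. *)
Lemma stieltjes_jump :
  cintegrable leb pos (fun t => (rcpow t (- s) - 1) * jump_kernel t) /\
  cintegral leb pos (fun t => (rcpow t (- s) - 1) * jump_kernel t) =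
    (cexp (s * ('i * phi%:C)) - cexp (- (s * ('i * phi%:C)))) * stieltjes 1 - 2 * 'i * phi%:C.
Proof.
have [ij vj] := jump_kernel_integral; have mp := measurable_pos.
have i1 := stieltjes_integrable (slp np); have i2 := stieltjes_integrable (slp npN).
have m1 f : cintegrable leb pos f -> cintegrable leb pos (fun t => - f t).
  by move=> i; have := cintegrableZ mp (-1) i; apply: (eq_cintegrable mp) => t _; rewrite mulN1r.
have iB f h : cintegrable leb pos f -> cintegrable leb pos h -> cintegrable leb pos (fun t => f t - h t).
  by move=> if_ ih; apply: (cintegrableD mp) => //; exact: m1.
have E t : (rcpow t (- s) - 1) * jump_kernel t = rcpow t (- s) * (t%:C + expi (- phi))^-1 -
    rcpow t (- s) * (t%:C + expi phi)^-1 - jump_kernel t.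
  by rewrite {1}/jump_kernel mulrBl mul1r mulrBr.
split; first by apply: (eq_cintegrable mp) (iB _ _ (iB _ _ i2 i1) ij) => t _; rewrite E.
transitivity (cintegral leb pos (fun t => rcpow t (- s) * (t%:C + expi (- phi))^-1 -
    rcpow t (- s) * (t%:C + expi phi)^-1 - jump_kernel t)).
  by apply: eq_cintegral => t _; rewrite E.
rewrite (cintegralB mp) //; last exact: iB.
rewrite (cintegralB mp) // vj -/(stieltjes _) -/(stieltjes _) !stieltjes_expi //.
by rewrite rmorphN /= !mulrN opprK; ring.
Qed.

(* |t + exp (i phi)| is at least both |t - 1| and sin phi. *)
Lemma jump_kernel_le t : 0 < t -> t != 1 ->
  abs (jump_kernel t) <= 2 / `|t - 1| /\ abs (jump_kernel t) <= 2 * sin phi / `|t - 1| ^+ 2.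
Proof.
move=> t0 t1; have p1 : 0 < `|t - 1| by rewrite normr_gt0 subr_eq0.
have sp : 0 < sin phi by exact: sin_gt0_pi.
have ge1 a : `|t - 1| <= abs (t%:C + expi a : R[i]).
  have h1 := abs_triangle t%:C (- expi a : R[i]); have h2 := abs_triangle (expi a : R[i]) (- t%:C).
  rewrite !opprK !absN abs_expi absR gtr0_norm // in h1 h2.
  by rewrite [_ + t%:C]addrC in h2; rewrite ler_norml; apply/andP; split; lra.
have ges : sin phi <= abs (t%:C + expi phi : R[i]).
  by apply: le_trans (ler_norm _) _; have := ler_Im_abs (t%:C + expi phi : R[i]); rewrite cImD /= add0r.
have num : abs (expi phi - expi (- phi) : R[i]) = 2 * sin phi.
  rewrite absE cReB cImB /= cosN sinN subrr expr0n /= add0r opprK sqrtr_sqr gtr0_norm ?addr_gt0 //.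
  by rewrite mulr2n mulrDl mul1r.
rewrite jump_kernelE ?(ltW t0) // absM absV absM num; split.
- rewrite -mulrA; apply: ler_wpM2l => //; rewrite ler_pdivrMr ?mulr_gt0 ?(lt_le_trans p1) ?ge1 //.
  by rewrite ler_pdivlMl // ler_pM ?ge1 ?(ltW p1) ?(ltW sp).
- apply: ler_wpM2l; first by rewrite mulr_ge0 // ltW.
  rewrite lef_pV2 ?posrE ?mulr_gt0 ?exprn_gt0 ?(lt_le_trans p1) ?ge1 //.
  by rewrite expr2 ler_pM ?ge1 ?(ltW p1).
Qed.

End Reflection.

(** This zero at t = 1 cancels the singular bound 2 / |t - 1| of the kernel. For x >= 1 / 2 both 1 /
    x and x^(- Re s) are at most 2, whence the constant 4. *)
Lemma rcpow_sub1_le t : 0 < t -> `|t - 1| < 1 / 2 -> abs (rcpow t (- s) - 1) <= 4 * abs s * `|t - 1|.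
Proof.
rewrite ltr_norml => t0 /andP[h1 h2].
have s0' := s0; have s1' := s1.
have der x : 1 / 2 <= x -> abs (- s * (x^-1)%:C * rcpow x (- s)) <= 4 * abs s.
  move=> hx; have x0 : 0 < x by lra.
  rewrite absM abs_rcpow // absM absN absR gtr0_norm ?invr_gt0 // cReN.
  have b1 : x^-1 <= 2 by rewrite invf_ple ?posrE //; lra.
  have b2 : x `^ (- cRe s) <= 2.
    have -> : x `^ (- cRe s) = x^-1 `^ cRe s.
      by rewrite -[X in X^-1]powRr1 ?(ltW x0) // -powRN -powRrM mulN1r.
    apply: (@le_trans _ _ (2 `^ cRe s)).
      by apply: ge0_ler_powR; rewrite ?nnegrE ?invr_ge0 ?(ltW x0) ?(ltW s0).
    by rewrite -[leRHS]powRr1 // ler_powR ?(ltW s1) // ler1n.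
  rewrite -mulrA mulrC; apply: ler_wpM2r; first exact: abs_ge0.
  have -> : 4 = 2 * 2 :> R by ring.
  by apply: ler_pM => //; rewrite ?invr_ge0 ?powR_ge0 ?(ltW x0).
have [t1|t1] := leP 1 t.
- have := @cmean_value_le _ (fun x => rcpow x (- s)) (fun x => - s * (x^-1)%:C * rcpow x (- s)) 1 t (4 * abs s) t1.
  rewrite rcpow1 (ger0_norm (_ : 0 <= t - 1)) ?subr_ge0 //; apply.
  + by move=> x /andP[x1 _]; apply: cderive_rcpow; exact: lt_le_trans x1.
  + by move=> x /andP[x1 _]; apply: der; lra.
- have := @cmean_value_le _ (fun x => rcpow x (- s)) (fun x => - s * (x^-1)%:C * rcpow x (- s)) t 1 (4 * abs s) (ltW t1).
  rewrite rcpow1 absBC distrC (ger0_norm (_ : 0 <= 1 - t)) ?subr_ge0 ?(ltW t1) //; apply.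
  + by move=> x /andP[x1 _]; apply: cderive_rcpow; exact: lt_le_trans x1.
  + by move=> x /andP[x1 _]; apply: der; lra.
Qed.

(** As phi tends to pi in [stieltjes_jump], the integrand tends to 0 at every t, under a majorant
    independent of phi; so the limit of the right side, 2 i sin (pi s) [stieltjes 1] - 2 i pi, is
    0. *)
Lemma csin_stieltjes : csin (pi%:C * s) * stieltjes 1 = pi%:C.
Proof.
pose phi (n : nat) : R := pi - n.+2%:R^-1.
have p2 := pi_gt0 R; have p1 := pihalf_ge1 R.
have hphi n : 0 < phi n < pi.
  have i0 : 0 < n.+2%:R^-1 :> R by rewrite invr_gt0.
  have i1 : n.+2%:R^-1 <= 1 :> R by rewrite invf_le1 // ler1n.
  by rewrite /phi; move: i0 i1; set y := n.+2%:R^-1 => i0 i1; apply/andP; split; lra.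
have cphi : phi n @[n --> \oo] --> (pi : R).
  rewrite -[X in _ --> X]subr0; apply: cvgB; first exact: cvg_cst.
  apply: (@squeeze_cvgr _ _ _ _ (fun=> 0) (fun n => n.+1%:R^-1)).
  - by apply: nearW => n; rewrite invr_ge0 ler0n /= lef_pV2 ?posrE // ler_nat.
  - exact: cvg_cst.
  - exact: cvg_harmonic.
(* Near 1 the integrand is at most 8 |s| and (1 + t)^2 <= 25 / 4, which gives 50 |s|; elsewhere (1 +
   t)^2 <= 25 |t - 1|^2 meets the bound 2 / |t - 1|^2, which gives 50. *)
pose C := 50 * (1 + abs s).
pose G t := C * (t `^ (- cRe s) * (1 + t) `^ (- 2)) + C * (t `^ 0 * (1 + t) `^ (- 2)).
have iG : leb.-integrable pos (EFin \o G).
  have b1 : -1 < - cRe s by have := s1; lra.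
  have b2 : - cRe s + - 2 < -1 by have := s0; lra.
  have i1 := integrable_ray_powR C b1 b2.
  have i2 : leb.-integrable pos (EFin \o (fun t => C * (t `^ 0 * (1 + t) `^ (- 2)))).
    by apply: integrable_ray_powR; lra.
  exact: (integrableD measurable_pos i1 i2).
have GE t : 0 < t -> G t = C * (t `^ (- cRe s) + 1) / (1 + t) ^+ 2.
  move=> t0; have p : 0 <= 1 + t by rewrite addr_ge0 // ltW.
  by rewrite /G powRr0 (powRN (1 + t)) powR_mulrn //; ring.
have C0 : 50 <= C by rewrite /C mulrDr mulr1 lerDl mulr_ge0 ?abs_ge0.
have [||||_ h1] := @cdominated_cvg _ _ _ leb pos measurable_pos
  (fun n t => (rcpow t (- s) - 1) * jump_kernel (phi n) t) (fun=> 0) G.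
- move=> n; apply: cmeasurableM; last exact: jump_kernel_measurable.
  by apply: cmeasurableB; [exact: rcpow_measurable | exact: cmeasurable_cst].
- exact: iG.
- move=> t /posP t0; have [->|t1] := eqVneq t 1.
    by under eq_fun do rewrite rcpow1 subrr mul0r; exact: cvg_cst.
  apply: (@abs_squeeze _ _ _ _ _ _ (fun n => abs (rcpow t (- s) - 1) * (2 * sin (phi n) / `|t - 1| ^+ 2))).
    rewrite -(mulr0 (abs (rcpow t (- s) - 1))); apply: cvgM; first exact: cvg_cst.
    rewrite -(mul0r (`|t - 1| ^+ 2)^-1); apply: cvgM; last exact: cvg_cst.
    rewrite -(mulr0 2) -sinpi; apply: cvgM; first exact: cvg_cst.
    exact: continuous_cvg (@continuous_sin R _) cphi.
  apply: nearW => n; rewrite subr0 absM; apply: ler_wpM2l; first exact: abs_ge0.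
  by have [_] := jump_kernel_le (hphi n) t0 t1.
- move=> n t /posP t0; have p : 0 < 1 + t by rewrite ltr_pwDl // ltW.
  have r0 : 0 <= t `^ (- cRe s) by exact: powR_ge0.
  have [->|t1] := eqVneq t 1.
    rewrite rcpow1 subrr mul0r abs0 GE // !divr_ge0 ?exprn_ge0 // mulr_ge0 ?addr_ge0 ?powR_ge0 //.
    exact: le_trans C0.
  have q0 : 0 < `|t - 1| by rewrite normr_gt0 subr_eq0.
  have [k1 k2] := jump_kernel_le (hphi n) t0 t1.
  rewrite GE // absM ler_pdivlMr ?exprn_gt0 //.
  have [tn|tf] := ltP `|t - 1| (1 / 2).
    have b := rcpow_sub1_le t0 tn.
    have h2 : abs (rcpow t (- s) - 1) * abs (jump_kernel (phi n) t) <= 8 * abs s.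
      have -> : 8 * abs s = (4 * abs s * `|t - 1|) * (2 / `|t - 1|) by field; rewrite gt_eqF.
      by apply: ler_pM => //; exact: abs_ge0.
    have h3 : (1 + t) ^+ 2 <= 25 / 4.
      have -> : 25 / 4 = (5 / 2) ^+ 2 :> R by field.
      by apply: lerXn2r; rewrite ?nnegrE ?(ltW p) //; move: tn; rewrite ltr_norml => /andP[? ?]; lra.
    apply: (@le_trans _ _ (8 * abs s * (25 / 4))).
      by apply: ler_pM; [rewrite mulr_ge0 ?abs_ge0 | exact: sqr_ge0 | exact: h2 | exact: h3].
    apply: (@le_trans _ _ (C * 1)); first by rewrite /C; have := abs_ge0 s; lra.
    by apply: ler_wpM2l; [exact: le_trans C0 | rewrite lerDr].
  have h2 : abs (rcpow t (- s) - 1) <= t `^ (- cRe s) + 1.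
    by rewrite (le_trans (absB _ _)) // abs_rcpow // abs1 cReN.
  have h3 : abs (jump_kernel (phi n) t) <= 2 / `|t - 1| ^+ 2.
    apply: le_trans k2 _; apply: ler_wpM2r; first by rewrite invr_ge0 exprn_ge0.
    by rewrite ler_piMr // (le_trans (ler_norm _)) // ler_norml sin_le1 sin_geN1.
  have h4 : (1 + t) ^+ 2 <= 25 * `|t - 1| ^+ 2.
    have -> : 25 * `|t - 1| ^+ 2 = (5 * `|t - 1|) ^+ 2 by ring.
    apply: lerXn2r; rewrite ?nnegrE ?(ltW p) ?mulr_ge0 //.
    by have := ler_norm (t - 1); lra.
  apply: (@le_trans _ _ ((t `^ (- cRe s) + 1) * (2 / `|t - 1| ^+ 2) * (25 * `|t - 1| ^+ 2))).
    apply: ler_pM; [by rewrite mulr_ge0 ?abs_ge0 | exact: sqr_ge0 | | exact: h4].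
    by apply: ler_pM; [exact: abs_ge0 | exact: abs_ge0 | exact: h2 | exact: h3].
  have -> : (t `^ (- cRe s) + 1) * (2 / `|t - 1| ^+ 2) * (25 * `|t - 1| ^+ 2) =
    50 * (t `^ (- cRe s) + 1) by field; rewrite gt_eqF.
  by apply: ler_wpM2r => //; exact: addr_ge0.
rewrite cintegral0 in h1.
have h2 : (cexp (s * ('i * (phi n)%:C)) - cexp (- (s * ('i * (phi n)%:C)))) * stieltjes 1 -
    2 * 'i * (phi n)%:C @[n --> \oo] -->
    (cexp (s * ('i * pi%:C)) - cexp (- (s * ('i * pi%:C)))) * stieltjes 1 - 2 * 'i * pi%:C.
  have k1 : s * ('i * (phi n)%:C) @[n --> \oo] --> s * ('i * pi%:C).
    by apply: cvg_cmul; apply: cvg_cmul; exact: cvg_real.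
  have k2 : - (s * ('i * (phi n)%:C)) @[n --> \oo] --> - (s * ('i * pi%:C)).
    exact: cvgN.
  have k3 : 2 * 'i * (phi n)%:C @[n --> \oo] --> 2 * 'i * pi%:C.
    by apply: cvg_cmul; exact: cvg_real.
  exact: (cvg_cB (cvg_cM (cvg_cB (cvg_cexp k1) (cvg_cexp k2)) (cvg_ccst _)) k3).
have e : (cexp (s * ('i * pi%:C)) - cexp (- (s * ('i * pi%:C)))) * stieltjes 1 - 2 * 'i * pi%:C = 0.
  apply: (norm_cvg_unique h2); move: h1; apply: cvg_trans; apply: near_eq_cvg.
  by apply: nearW => n; have [_ ->] := stieltjes_jump (hphi n).
have i2 : 2 * 'i != 0 :> R[i] by rewrite mulf_neq0 // ?pnatr_eq0 // neq0Ci.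
apply: (mulfI i2); move/eqP: e; rewrite subr_eq0 => /eqP <-.
by rewrite /csin mulrA mulrCA mulfV // mulr1; congr ((cexp _ - cexp (- _)) * _); ring.
Qed.

Lemma csin_stieltjes_clog z : slit_plane z ->
  csin (pi%:C * s) * stieltjes z = pi%:C * cexp (- (s * clog z)).
Proof.
move=> sz; have := @stieltjes_cexp (clog z) (carg_bound z); rewrite cexp_clog // => h.
have -> : stieltjes z = cexp (- (s * clog z)) * stieltjes 1.
  by rewrite -h mulrA -cexpD addNr cexp0 mul1r.
by rewrite mulrCA csin_stieltjes mulrC.
Qed.

End BetaIntegral.

(** * The relative zeta function *)

Section FubiniBound.
Context {R : realType} {d1 d2 : measure_display} {T1 : measurableType d1} {T2 : measurableType d2}.
Variables (m1 : {sigma_finite_measure set T1 -> \bar R}) (m2 : {sigma_finite_measure set T2 -> \bar R}).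

Lemma cfubini_le (f : T1 * T2 -> R[i]) (A : T1 -> R) (B : T2 -> R) :
  cmeasurable setT f -> m1.-integrable setT (EFin \o A) -> m2.-integrable setT (EFin \o B) ->
  (forall x y, abs (f (x, y)) <= A x * B y) ->
  cintegral m1 setT (fun x => cintegral m2 setT (fun y => f (x, y))) =
  cintegral m2 setT (fun y => cintegral m1 setT (fun x => f (x, y))).
Proof.
move=> mf iA iB fAB; have [mf1 mf2] := mf.
have iAx x : m2.-integrable setT (EFin \o (fun y => A x * B y)).
  rewrite (_ : _ \o _ = fun y => ((A x)%:E * (B y)%:E)%E); first exact: integrableZl.
  by apply/funext => y /=; rewrite EFinM.
have iBy y : m1.-integrable setT (EFin \o (fun x => A x * B y)).
  rewrite (_ : _ \o _ = fun x => ((B y)%:E * (A x)%:E)%E); first exact: integrableZl.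
  by apply/funext => x /=; rewrite -EFinM mulrC.
have m2f x : cmeasurable setT (fun y => f (x, y)).
  by split; [exact: (measurableT_comp mf1 (pair1_measurable x)) |
             exact: (measurableT_comp mf2 (pair1_measurable x))].
have m1f y : cmeasurable setT (fun x => f (x, y)).
  by split; [exact: (measurableT_comp mf1 (pair2_measurable y)) |
             exact: (measurableT_comp mf2 (pair2_measurable y))].
have c2 x : cintegrable m2 setT (fun y => f (x, y)).
  by apply: (le_cintegrable measurableT _ (iAx x)) => // y _; exact: fAB.
apply: (@cfubini _ _ _ _ _ _ _ _ (fun x => A x * \int[m2]_(y in setT) B y)) => //.
- by move=> y; apply: (le_cintegrable measurableT _ (iBy y)) => // x _; exact: fAB.
- move=> x; have -> : A x * \int[m2]_(y in setT) B y = \int[m2]_(y in setT) (A x * B y).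
    by symmetry; apply: RintegralZl.
  by apply: le_Rintegral => //; exact: (integrable_abs measurableT).
- rewrite (_ : _ \o _ = fun x => ((\int[m2]_(y in setT) B y)%:E * (A x)%:E)%E).
    exact: integrableZl.
  by apply/funext => x /=; rewrite -EFinM mulrC.
Qed.

End FubiniBound.

Lemma piC_neq0 (R : realType) : (pi : R)%:C != 0 :> R[i].
Proof. by rewrite (inj_eq (@complexI R)) gt_eqF // pi_gt0. Qed.

Lemma two_pi_i_neq0 (R : realType) : 2 * (pi : R)%:C * 'i != 0 :> R[i].
Proof.
apply: mulf_neq0; last exact: neq0Ci.
by apply: mulf_neq0; [rewrite pnatr_eq0 | exact: piC_neq0].
Qed.

(** * Algebraic identities of the final computation, with powers and integrals as atoms *)

Section FieldIdentities.
Variable K : fieldType.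
Implicit Types (a b c e f g r x y z : K).

Lemma ray_side a r e b c x : e != 0 -> r != 0 ->
  a / r * (- c * (r * b * x)) = c * b / e * (a * - (e * x)).
Proof. by move=> e0 r0; field; rewrite e0 r0. Qed.

Lemma kernel_side a b f g e y : e != 0 -> y != 0 ->
  a * (y^-1 * b * f * g) = b * f * g * e * (a * (e * y)^-1).
Proof. by move=> e0 y0; field; rewrite e0 y0. Qed.

Lemma power_side a b f g c e x : c != 0 ->
  b * f * g * (e * (a * x)) = a * e * c^-1 * (b * (x * c) * f * g).
Proof. by move=> c0; field. Qed.

Lemma solve_zeta a b c e f g x y p : p != 0 -> c != 0 -> b != 0 -> e != 0 -> f != 0 -> g != 0 ->
  a * (c * b / e * x) = p * - e^-1 * (f * g / b)^-1 * (- c * y) -> y = f * p^-1 * (a * g) * x.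
Proof.
move=> p0 c0 b0 e0 f0 g0 h.
have -> : y = (p * - e^-1 * (f * g / b)^-1 * (- c * y)) * (e * f * g / (p * c * b)).
  by field; rewrite p0 c0 b0 e0 f0 g0.
by rewrite -h; field; rewrite p0 c0 b0 e0.
Qed.

Lemma mulNK c x : c != 0 -> - c * (- c^-1 * x) = x.
Proof. by move=> c0; field. Qed.

Lemma div_eq a c x z : c != 0 -> c * x = a * z -> c^-1 * a * z = x.
Proof. by move=> c0 h; rewrite -mulrA -h mulKf. Qed.

End FieldIdentities.

(** * The zeta function as an integral over the cut *)

Section Representation.
Context {R : realType}.
Variables (gamma : R -> R[i]) (theta : R) (sigma : set R[i]).
Hypotheses (htheta : pi / 2 < theta < pi) (hgamma : admissible_contour gamma theta sigma).
Local Notation leb := (@lebesgue_measure R).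
Local Notation pos := (`]0, +oo[%classic : set R).

Let smooth : piecewise_smooth gamma. Proof. by case: hgamma. Qed.
Let ends : straight_ends gamma. Proof. by case: hgamma. Qed.

Variables (F : R[i] -> R[i]) (C0 eps : R).
Hypotheses (eps0 : 0 < eps)
  (mFc : cmeasurable setT (fun t => F (gamma t)))
  (mFr : cmeasurable pos (fun t => F (t%:C * expi theta)))
  (F_contour_le : forall t, abs (F (gamma t)) <= C0 * (1 + `|t|) `^ (- 1 - eps))
  (F_ray_le : forall t, 0 < t -> abs (F (t%:C * expi theta)) <= C0 * (1 + t) `^ (- 1 - eps))
  (F_moment : forall (m : nat) (a : R), m%:R < 1 + eps -> 0 < a ->
    contour_integrable gamma (fun z => (z - a%:C * expi theta)^-1 * z ^+ m * F z) /\
    contour_integral gamma (fun z => (z - a%:C * expi theta)^-1 * z ^+ m * F z) =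
    - (2 * pi%:C * 'i) * ((a%:C * expi theta) ^+ m * F (a%:C * expi theta))).

Let C00 : 0 <= C0.
Proof. by have := F_contour_le 0; rewrite normr0 addr0 one_powR mulr1; apply: le_trans; exact: abs_ge0. Qed.

(** The logarithm along gamma with argument in ]theta - 2 pi, theta[, the branch that defines
    [cpow theta]. *)
Definition log_contour t : R[i] := clog (expi (pi - theta) * gamma t) + 'i * (theta - pi)%:C.

Lemma cpow_contour t s : cpow theta (gamma t) s = cexp (s * log_contour t).
Proof. by rewrite cpowE //; exact: (range_Nray hgamma (t := t)). Qed.

Lemma cexp_log_contour t : cexp (log_contour t) = gamma t.
Proof.
rewrite cexpD cexp_clog; last by apply: slit_plane_ray; exact: (range_Nray hgamma (t := t)).
by rewrite cexp_i mulrAC -expiD (_ : pi - theta + (theta - pi) = 0) ?expi0 ?mul1r //; ring.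
Qed.

Lemma log_contour_measurable : cmeasurable setT log_contour.
Proof.
apply: cmeasurableD; last exact: cmeasurable_cst.
have h t : {for t, continuous (fun u : R => clog (expi (pi - theta) * gamma u))}.
  apply: cvg_clog; first by apply: slit_plane_ray; exact: (range_Nray hgamma (t := t)).
  by apply: cvg_cmul; exact: (continuous_contour hgamma).
by split; apply: continuous_measurable_fun => t; [apply: cvg_Re | apply: cvg_Im]; exact: h.
Qed.

Lemma cRe_log_contour : exists2 L, 0 <= L & forall t, `|cRe (log_contour t) - ln (1 + `|t|)| <= L.
Proof.
have [G G0 hG] := contour_le smooth ends.
have n0 : ~ range gamma 0 by apply: (ray_Nrange hgamma); exists 0; rewrite ?rmorph0 ?mul0r.
have [d d0 hd] := contour_ge smooth ends n0.
exists (`|ln d| + `|ln G|); first by rewrite addr_ge0.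
move=> t; have p : 0 < 1 + `|t| by rewrite ltr_pwDl.
have -> : cRe (log_contour t) = ln (abs (gamma t)).
  by rewrite cReD -complexiE cReM /= !mul0r mulr0 subr0 addr0 absM abs_expi mul1r.
have h1 := hd t; have h2 := hG t; rewrite subr0 in h1.
have g0 : 0 < abs (gamma t) by rewrite (lt_le_trans _ h1) // mulr_gt0.
have l1 : ln d + ln (1 + `|t|) <= ln (abs (gamma t)).
  by rewrite -lnM ?posrE // ler_ln ?posrE ?mulr_gt0.
have l2 : ln (abs (gamma t)) <= ln G + ln (1 + `|t|).
  by rewrite -lnM ?posrE // ler_ln ?posrE ?mulr_gt0.
have := ler_norm (- ln d); have := ler_norm (ln G); have := normr_ge0 (ln G).
have := normr_ge0 (ln d); rewrite normrN => ? ? ? ?; rewrite ler_norml; apply/andP; split; lra.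
Qed.

Lemma cIm_log_contour t : `|cIm (log_contour t)| <= 2 * pi.
Proof.
rewrite cImD -complexiE cImM /= mul0r add0r mul1r.
have := carg_bound (expi (pi - theta) * gamma t); have /andP[? ?] := htheta; have := pi_gt0 R.
by rewrite ltr_norml => ? /andP[? ?]; rewrite ler_norml; apply/andP; split; lra.
Qed.

Lemma zeta_integrand_le s : - eps < cRe s -> exists d K, [/\ 0 < d, 0 < (cRe s + eps) / 2 &
  forall t, abs (cexp (s * - log_contour t) * (F (gamma t) * rderiv gamma t)) *
    expR (d * abs (- log_contour t)) <= K * (1 + `|t|) `^ (- 1 - (cRe s + eps) / 2)].
Proof.
move=> hs; have [L L0 hL] := cRe_log_contour; have [M M0 hM] := rderiv_contour_bounded smooth ends.
have d0 : 0 < (cRe s + eps) / 2 by rewrite divr_gt0 // -(opprK (cRe s)) addrC subr_gt0 ltrNl.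
set d := (cRe s + eps) / 2 in d0 *.
pose L' := L + 2 * pi; pose E := `|cRe s| * L + `|cIm s| * (2 * pi) + d * L'.
exists d, (expR E * C0 * M); split => // t.
have p : 0 < 1 + `|t| by rewrite ltr_pwDl.
have pl : 0 <= ln (1 + `|t|) by rewrite ln_ge0 // lerDl.
rewrite absM absN abs_cexp absM mulrAC -expRD.
have ex : cRe (s * - log_contour t) + d * abs (log_contour t) <= E + (d - cRe s) * ln (1 + `|t|).
  have a1 : abs (log_contour t) <= ln (1 + `|t|) + L'.
    rewrite (le_trans (ler_abs_ReIm _)) // /L' addrA lerD ?cIm_log_contour //.
    have := hL t; have := ler_norm (cRe (log_contour t) - ln (1 + `|t|)); move=> h1 h2.
    rewrite ler_norml; have := ler_norm (- (cRe (log_contour t) - ln (1 + `|t|))).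
    by rewrite normrN => h3; apply/andP; split; lra.
  have a2 : d * abs (log_contour t) <= d * (ln (1 + `|t|) + L') by rewrite ler_wpM2l ?(ltW d0).
  have a3 : - cRe s * (cRe (log_contour t) - ln (1 + `|t|)) <= `|cRe s| * L.
    rewrite (le_trans (ler_norm _)) // normrM normrN ler_wpM2l //; exact: hL.
  have a4 : cIm s * cIm (log_contour t) <= `|cIm s| * (2 * pi).
    rewrite (le_trans (ler_norm _)) // normrM ler_wpM2l //; exact: cIm_log_contour.
  by rewrite mulrN cReN cReM /E; lra.
have e1 : expR (cRe (s * - log_contour t) + d * abs (log_contour t)) <= expR E * (1 + `|t|) `^ (d - cRe s).
  by rewrite /powR (gt_eqF p) -expRD ler_expR.
have -> : expR E * C0 * M * (1 + `|t|) `^ (- 1 - d) =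
    expR E * (1 + `|t|) `^ (d - cRe s) * (C0 * (1 + `|t|) `^ (- 1 - eps) * M).
  have -> : - 1 - d = (d - cRe s) + (- 1 - eps) by rewrite /d; field.
  by rewrite -powR_lineD; ring.
by rewrite ler_pM ?expR_ge0 ?mulr_ge0 ?abs_ge0 // ler_pM ?abs_ge0.
Qed.

Definition zeta (s : R[i]) : R[i] :=
  - (2 * pi%:C * 'i)^-1 * contour_integral gamma (fun z => cpow theta z (- s) * F z).

Let zetaE s : contour_integral gamma (fun z => cpow theta z (- s) * F z) =
  cintegral leb setT (fun t => cexp (s * - log_contour t) * (F (gamma t) * rderiv gamma t)).
Proof. by apply: eq_cintegral => t _; rewrite cpow_contour mulrN mulNr mulrA. Qed.

Let mf : cmeasurable setT (fun t => F (gamma t) * rderiv gamma t).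
Proof. by apply: cmeasurableM => //; exact: rderiv_contour_measurable. Qed.

Let ml : cmeasurable setT (fun t => - log_contour t).
Proof. by apply: cmeasurableN; exact: log_contour_measurable. Qed.

Lemma zeta_integrable s : - eps < cRe s ->
  contour_integrable gamma (fun z => cpow theta z (- s) * F z).
Proof.
move=> hs; have [d [K [d0 e0 h]]] := zeta_integrand_le hs.
have ss : abs (s - s) <= d by rewrite subrr abs0 ltW.
have := @mellin_integrable R _ (measurableTypeR R) leb setT measurableT _ _ _ _ _ ml mf
  (integrable_powR_lineZ K e0) (fun t _ => h t) s ss.
by apply: (eq_cintegrable measurableT) => t _; rewrite cpow_contour mulrN mulNr mulrA.
Qed.

Lemma zeta_derivable s : - eps < cRe s -> derivable zeta s 1.
Proof.
move=> hs; have [d [K [d0 e0 h]]] := zeta_integrand_le hs.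
have D := @mellin_derivable R _ (measurableTypeR R) leb setT measurableT _ _ _ _ _ ml mf d0
  (integrable_powR_lineZ K e0) (fun t _ => h t).
rewrite (_ : zeta = (- (2 * pi%:C * 'i)^-1) \*: (fun s : R[i] => cintegral leb setT
  (fun t => cexp (s * - log_contour t) * (F (gamma t) * rderiv gamma t)))).
  exact: derivableZ.
by apply/funext => w; rewrite /zeta zetaE.
Qed.

Definition ray_integral (s : R[i]) : R[i] :=
  cintegral leb pos (fun t => rcpow t (- s) * (- (expi theta * F (t%:C * expi theta)))).

Lemma rcpowN (t : R) (s : R[i]) : rcpow t (- s) = cexp (s * - (ln t)%:C).
Proof. by rewrite /rcpow mulrN mulNr. Qed.

(** exp (d |ln t|) is at most t^d + t^(-d). With this d the exponents of t stay above -1, which Re s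
    < 1 allows, and below eps, which Re s > - eps allows. *)
Lemma ray_integrand_le s : - eps < cRe s < 1 -> exists d g, [/\ 0 < d,
  leb.-integrable pos (EFin \o g) & forall t, pos t ->
  abs (cexp (s * - (ln t)%:C) * (- (expi theta * F (t%:C * expi theta)))) *
    expR (d * abs (- (ln t)%:C : R[i])) <= g t].
Proof.
move=> /andP[h1 h2]; pose d := Num.min (1 - cRe s) (cRe s + eps) / 2.
have m0 : 0 < Num.min (1 - cRe s) (cRe s + eps).
  by rewrite lt_min subr_gt0 h2 -(opprK (cRe s)) addrC subr_gt0 ltrNl.
have d0 : 0 < d by rewrite divr_gt0.
have [m1 m2] : 2 * d <= 1 - cRe s /\ 2 * d <= cRe s + eps.
  by rewrite /d mulrC divfK ?pnatr_eq0 // !ge_min !lexx orbT.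
pose G (a t : R) := C0 * (t `^ a * (1 + t) `^ (- 1 - eps)).
have iG a : -1 < a -> a < eps -> leb.-integrable pos (EFin \o G a).
  by move=> a1 a2; apply: integrable_ray_powR => //; lra.
exists d, (fun t => G (- cRe s + d) t + G (- cRe s - d) t); split => //.
  have i1 : leb.-integrable pos (EFin \o G (- cRe s + d)) by apply: iG; lra.
  have i2 : leb.-integrable pos (EFin \o G (- cRe s - d)) by apply: iG; lra.
  exact: (integrableD measurable_pos i1 i2).
move=> t /posP t0; rewrite absN absR absM.
rewrite -rcpowN.
rewrite abs_rcpow // cReN absN absM abs_expi mul1r mulrAC.
have p : 0 < 1 + t by rewrite ltr_pwDl // ltW.
have e1 : expR (d * `|ln t|) <= t `^ d + t `^ (- d).
  rewrite /powR (gt_eqF t0); have [l0|l0] := leP 0 (ln t).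
    by rewrite ger0_norm // lerDl expR_ge0.
  by rewrite ltr0_norm // mulrN mulNr lerDr expR_ge0.
apply: (@le_trans _ _ (t `^ (- cRe s) * (t `^ d + t `^ (- d)) * (C0 * (1 + t) `^ (- 1 - eps)))).
  apply: ler_pM; rewrite ?mulr_ge0 ?powR_ge0 ?expR_ge0 ?abs_ge0 ?F_ray_le //.
  by apply: ler_wpM2l => //; exact: powR_ge0.
have D a b : t `^ (a + b) = t `^ a * t `^ b.
  by rewrite powRD //; apply/implyP => _; rewrite gt_eqF.
by rewrite /G !D le_eqVlt; apply/orP; left; apply/eqP; ring.
Qed.

Let mfr : cmeasurable pos (fun t => - (expi theta * F (t%:C * expi theta))).
Proof. by apply: cmeasurableN; apply: cmeasurableM => //; exact: cmeasurable_cst. Qed.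

Let mlr : cmeasurable pos (fun t => - (ln t)%:C : R[i]).
Proof. by apply: cmeasurableN; apply: cmeasurable_real; exact: measurable_ln_ray. Qed.

Lemma ray_integrable s : - eps < cRe s < 1 ->
  cintegrable leb pos (fun t => rcpow t (- s) * (- (expi theta * F (t%:C * expi theta)))).
Proof.
move=> hs; have [d [g [d0 ig h]]] := ray_integrand_le hs.
have ss : abs (s - s) <= d by rewrite subrr abs0 ltW.
have := @mellin_integrable R _ (measurableTypeR R) leb pos measurable_pos _ _ _ _ _ mlr mfr ig h s ss.
by apply: (eq_cintegrable measurable_pos) => t _; rewrite rcpowN.
Qed.

Lemma ray_derivable s : - eps < cRe s < 1 -> derivable ray_integral s 1.
Proof.
move=> hs; have [d [g [d0 ig h]]] := ray_integrand_le hs.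
have := @mellin_derivable R _ (measurableTypeR R) leb pos measurable_pos _ _ _ _ _ mlr mfr d0 ig h.
suff -> : ray_integral = (fun s : R[i] => cintegral leb pos
  (fun t => cexp (s * - (ln t)%:C) * (- (expi theta * F (t%:C * expi theta))))) by [].
by apply/funext => w; apply: eq_cintegral => t _; rewrite rcpowN.
Qed.

(** The sign (-1)^k is kept as [expi (k%:R * pi)], the form in which the exponentials produce it. *)
Lemma csin_shift (s : R[i]) (k : nat) :
  csin (pi%:C * (s + k%:R)) * expi (k%:R * pi) = csin (pi%:C * s).
Proof.
have e2 : expi (k%:R * pi) * expi (k%:R * pi) = 1 :> R[i].
  rewrite -cexp_i -cexpD.
  have -> : 'i * (k%:R * pi)%:C + 'i * (k%:R * pi)%:C = k%:R * ('i * pi%:C + 'i * pi%:C) :> R[i].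
    by rewrite rmorphM rmorph_nat; ring.
  by rewrite cexpMn cexpD cexp_i expi_pi mulrNN mulr1 expr1n.
have e3 : expi (- (k%:R * pi)) = expi (k%:R * pi) :> R[i].
  by apply: (mulfI (expi_neq0 (k%:R * pi))); rewrite e2 -expiD subrr expi0.
rewrite /csin.
have -> : 'i * (pi%:C * (s + k%:R)) = 'i * (pi%:C * s) + 'i * (k%:R * pi)%:C.
  by rewrite rmorphM rmorph_nat; ring.
rewrite opprD !cexpD cexp_i.
have -> : - ('i * (k%:R * pi)%:C) = 'i * (- (k%:R * pi))%:C :> R[i] by rewrite rmorphN mulrN.
rewrite cexp_i e3 -mulrBl.
by rewrite mulrAC -[_ * _ * expi _]mulrA e2 mulr1.
Qed.

Section NonInteger.
Variables (s : R[i]) (k : nat).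
Let s' := s + k%:R.
Hypotheses (hs : - eps < cRe s < 1) (s'01 : 0 < cRe s' < 1).

Let rp t := if t \in pos then rcpow t (- s') else 0.
Let K (t u : R) := (gamma u - t%:C * expi theta)^-1 * gamma u ^+ k * F (gamma u) * rderiv gamma u.

Let mrp : @cmeasurable R _ (measurableTypeR R) setT rp.
Proof.
have h (f : R -> R) : measurable_fun pos f -> @measurable_fun _ _ (measurableTypeR R) _ setT (fun t => if t \in pos then f t else 0).
  move=> mf_; have := (@measurable_restrictT _ _ (measurableTypeR R) _ pos f measurable_pos).1 mf_.
  by congr (measurable_fun _ _); apply/funext => t; rewrite patchE.
have [m1 m2] := rcpow_measurable (R := R) (- s').
split; [have := h _ m1 | have := h _ m2]; congr (measurable_fun _ _);
  by apply/funext => t; rewrite /rp; case: ifP.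
Qed.

Let s'E : cRe s' = cRe s + k%:R.
Proof. by rewrite cReD -(rmorph_nat (@real_complex R)). Qed.

Let k1 : k%:R < 1 + eps.
Proof. by move: hs s'01; rewrite s'E => /andP[? ?] /andP[? ?]; lra. Qed.

Let mK : @cmeasurable R _ (measurableTypeR R * measurableTypeR R)%type setT (fun tu => rp tu.1 * K tu.1 tu.2).
Proof.
have comp1 (f : R -> R[i]) : @cmeasurable R _ (measurableTypeR R) setT f ->
    @cmeasurable R _ (measurableTypeR R * measurableTypeR R)%type setT (fun tu => f tu.1).
  by move=> [f1 f2]; split; [exact: measurableT_comp f1 _ | exact: measurableT_comp f2 _].
have comp2 (f : R -> R[i]) : @cmeasurable R _ (measurableTypeR R) setT f ->
    @cmeasurable R _ (measurableTypeR R * measurableTypeR R)%type setT (fun tu => f tu.2).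
  by move=> [f1 f2]; split; [exact: measurableT_comp f1 _ | exact: measurableT_comp f2 _].
have mg := contour_measurable hgamma.
apply: cmeasurableM; first exact: comp1.
apply: cmeasurableM; last by apply: comp2; exact: rderiv_contour_measurable.
apply: cmeasurableM; last exact: comp2 mFc.
apply: cmeasurableM; last by apply: cmeasurableX; exact: comp2 mg.
apply: cmeasurableV; apply: cmeasurableB; first exact: comp2 mg.
apply: (comp1 (fun t => t%:C * expi theta)); apply: cmeasurableM; last exact: cmeasurable_cst.
by apply: cmeasurable_real; exact: measurable_id.
Qed.

(** The distance is at least a multiple of 1 + |u| + t, hence of (1 + |u|)^(1 - al) (1 + t)^al. The
    weight al shares the decay between the two variables, giving Fubini a majorant of product
    form. *)
Lemma contour_ray_dist_powR (al : R) : 0 <= al <= 1 -> exists2 c, 0 < c & forall u t, 0 < t ->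
  abs (gamma u - t%:C * expi theta)^-1 <= c * ((1 + `|u|) `^ (- (1 - al)) * (1 + t) `^ (- al)).
Proof.
move=> /andP[a0 a1]; have [c c0 hc] := contour_ray_dist htheta hgamma.
have n0 : ~ range gamma 0 by apply: (ray_Nrange hgamma); exists 0; rewrite ?rmorph0 ?mul0r.
have [d d0 hd] := contour_ge smooth ends n0.
have m0 : 0 < Num.min d 1 by rewrite lt_min d0 ltr01.
exists (c * Num.min d 1)^-1; first by rewrite invr_gt0 mulr_gt0.
move=> u t t0; set X := 1 + `|u|; set Y := 1 + t.
have X1 : 1 <= X by rewrite lerDl.
have Y0 : 0 < Y by rewrite ltr_pwDl // ltW.
have X0 : 0 < X by exact: lt_le_trans X1.
have [mx my] : X <= X + t /\ Y <= X + t by rewrite lerDl ltW // /Y lerD2r.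
have XY0 : 0 < X + t by rewrite addr_gt0.
have h1 : X `^ (1 - al) * Y `^ al <= X + t.
  apply: (@le_trans _ _ ((X + t) `^ (1 - al) * (X + t) `^ al)).
    apply: ler_pM; rewrite ?powR_ge0 //; apply: ge0_ler_powR;
      by rewrite ?nnegrE ?subr_ge0 ?(ltW X0) ?(ltW Y0) ?(ltW XY0).
  by rewrite -powRD ?subrK ?powRr1 ?(ltW XY0) //; apply/implyP => _; rewrite gt_eqF.
have h2 : Num.min d 1 * (X + t) <= abs (gamma u) + t.
  have := hd u; rewrite subr0 -/X => hu; rewrite mulrDr lerD //.
    by apply: le_trans hu; rewrite ler_wpM2r ?(ltW X0) // ge_min lexx.
  by rewrite ler_piMl ?(ltW t0) // ge_min lexx orbT.
have h3 := hc u t (ltW t0).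
have P0 : 0 < X `^ (1 - al) * Y `^ al by rewrite mulr_gt0 ?powR_gt0.
have h4 : c * Num.min d 1 * (X `^ (1 - al) * Y `^ al) <= abs (gamma u - t%:C * expi theta).
  apply: le_trans h3; rewrite -mulrA ler_wpM2l ?(ltW c0) //; apply: le_trans h2.
  by rewrite ler_wpM2l ?(ltW m0).
rewrite absV !powRN -!invfM lef_pV2 ?posrE //.
- by rewrite (lt_le_trans _ h4) // !mulr_gt0 ?powR_gt0.
- by rewrite !mulr_gt0 ?powR_gt0.
Qed.

Let swap : cintegral leb setT (fun t => cintegral leb setT (fun u => rp t * K t u)) =
  cintegral leb setT (fun u => cintegral leb setT (fun t => rp t * K t u)).
Proof.
have /andP[p0 p1] := s'01; have /andP[q0 q1] := hs.
(* [al] is the midpoint of 1 - Re s' and [m]: above the former the integral in t converges at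
   infinity, and below 1 + eps - k the integral along gamma converges. *)
pose m := Num.min 1 (1 + eps - k%:R); pose al := ((1 - cRe s') + m) / 2.
have mm : 1 - cRe s' < m.
  by have e := s'E; rewrite /m lt_min; apply/andP; split; lra.
have [m1 m2] : m <= 1 /\ m <= 1 + eps - k%:R by rewrite /m !ge_min !lexx orbT.
have al01 : 0 <= al <= 1 by rewrite /al; apply/andP; split; lra.
have [c c0 hc] := contour_ray_dist_powR al01.
have [G G0 hG] := contour_le smooth ends; have [M M0 hM] := rderiv_contour_bounded smooth ends.
pose A (t : R) := if t \in pos then t `^ (- cRe s') * (1 + t) `^ (- al) else 0.
pose be := 1 + eps - k%:R - al.
pose B (u : R) := c * G ^+ k * C0 * M * (1 + `|u|) `^ (- 1 - be).
have iA : leb.-integrable setT (EFin \o A).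
  have i1 : leb.-integrable pos (EFin \o (fun t => t `^ (- cRe s') * (1 + t) `^ (- al))).
    have := @integrable_ray_powR R 1 (- cRe s') (- al); rewrite (_ : (fun t => 1 * _) =
      (fun t => t `^ (- cRe s') * (1 + t) `^ (- al))); last by apply/funext => t; rewrite mul1r.
    by apply; rewrite /al; lra.
  have := (@integrable_mkcond _ (measurableTypeR R) _ leb pos _ measurable_pos).1 i1.
  congr (leb.-integrable _ _); apply/funext => t.
  by rewrite patchE /A /=; case: ifP.
have iB : leb.-integrable setT (EFin \o B).
  by apply: integrable_powR_lineZ; rewrite /be /al; lra.
apply: (@cfubini_le _ _ _ (measurableTypeR R) (measurableTypeR R) leb leb
  (fun tu => rp tu.1 * K tu.1 tu.2) A B mK iA iB) => t u /=.
rewrite /rp /A; case: ifPn => [|_]; last by rewrite mul0r abs0 mul0r.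
rewrite inE => /posP t0; have p : 0 < 1 + `|u| by rewrite ltr_pwDl.
rewrite absM abs_rcpow // cReN -mulrA ler_wpM2l ?powR_ge0 //.
rewrite absM absM absM absX.
have -> : (1 + t) `^ (- al) * B u = c * ((1 + `|u|) `^ (- (1 - al)) * (1 + t) `^ (- al)) *
    (G * (1 + `|u|)) ^+ k * (C0 * (1 + `|u|) `^ (- 1 - eps)) * M.
  rewrite exprMn -(powR_mulrn k (ltW p)) /B.
  have -> : - 1 - be = - (1 - al) + k%:R + (- 1 - eps) by rewrite /be; ring.
  by rewrite -!powR_lineD; ring.
have a0 := @abs_ge0 R.
apply: ler_pM => //; rewrite ?mulr_ge0 ?exprn_ge0 //.
apply: ler_pM => //; rewrite ?mulr_ge0 ?exprn_ge0 //.
apply: ler_pM => //; rewrite ?exprn_ge0 //; first exact: hc.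
by apply: lerXn2r; rewrite ?nnegrE ?mulr_ge0 ?(ltW G0) ?(ltW p).
Qed.

Lemma zeta_noninteger : zeta s =
  cexp ('i * s * (pi - theta)%:C) * pi%:C^-1 * csin (pi%:C * s) * ray_integral s.
Proof.
have mp := @measurable_pos R; have Ci := two_pi_i_neq0 R; have pi0 := piC_neq0 R.
set e := expi theta; have e0 : e != 0 by exact: expi_neq0.
have iR := ray_integrable hs.
(* Inner integral along gamma. Since t^(-s') (t e^(i theta))^k = e^(i k theta) t^(-s), the shift by
   k leaves the power of t. *)
have L : cintegral leb setT (fun t => cintegral leb setT (fun u => rp t * K t u)) =
    2 * pi%:C * 'i * e ^+ k / e * ray_integral s.
  rewrite /ray_integral -(cintegralZ mp _ iR) [RHS]cintegral_mkcond; apply: eq_cintegral => t _.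
  rewrite /rp; case: ifPn => [|_]; last first.
    by rewrite -[RHS](cintegral0 leb setT); apply: eq_cintegral => u _; rewrite mul0r.
  rewrite inE => /posP t0; have [iK vK] := F_moment k1 t0.
  have -> : cintegral leb setT (fun u => rcpow t (- s') * K t u) =
    rcpow t (- s') * contour_integral gamma (fun z => (z - t%:C * e)^-1 * z ^+ k * F z).
    exact: (cintegralZ measurableT _ iK).
  rewrite vK /s' opprD rcpowD -/e exprMn.
  rewrite (rcpowVn k t0).
  have tk : t%:C ^+ k != 0 :> R[i].
    by apply: expf_neq0; rewrite (inj_eq (@complexI R)); apply: lt0r_neq0.
  by rewrite rmorphXn /= -/e; exact: ray_side.
have W u : cintegral leb setT (fun t => rp t * K t u) =
    gamma u ^+ k * F (gamma u) * rderiv gamma u * (expi (pi - theta) * stieltjes s' (expi (pi - theta) * gamma u)).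
  have sw : slit_plane (expi (pi - theta) * gamma u).
    by apply: slit_plane_ray; exact: (range_Nray hgamma (t := u)).
  have is_ := stieltjes_integrable s'01 sw.
  rewrite mulrA /stieltjes -(cintegralZ mp _ is_) [RHS]cintegral_mkcond; apply: eq_cintegral => t _.
  rewrite /rp; case: ifPn => [|_]; last by rewrite mul0r.
  rewrite inE => /posP t0.
  (* Since e^(i pi) = -1, the denominator of the Stieltjes transform is a rotation of gamma u - t
     e^(i theta). *)
  have -> : t%:C + expi (pi - theta) * gamma u = expi (pi - theta) * (gamma u - t%:C * e).
    rewrite mulrBr mulrCA -expiD subrK expi_pi; ring.
  have ne := expi_neq0 (pi - theta); rewrite /K -/e.
  have nz : gamma u - t%:C * e != 0.
    rewrite subr_eq0; apply: contour_neq; apply: (ray_Nrange hgamma); exact: rayP (ltW t0).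
  exact: kernel_side.
have cE u : csin (pi%:C * s') * cintegral leb setT (fun t => rp t * K t u) =
    (pi%:C * expi (pi - theta) * cexp (- ('i * s' * (pi - theta)%:C))) *
    (cpow theta (gamma u) (- s) * F (gamma u) * rderiv gamma u).
  have sw : slit_plane (expi (pi - theta) * gamma u).
    by apply: slit_plane_ray; exact: (range_Nray hgamma (t := u)).
  rewrite W; have h := csin_stieltjes_clog s'01 sw.
  rewrite [LHS]mulrCA [X in _ * X]mulrCA h cpow_contour.
  have -> : - s * log_contour u = k%:R * log_contour u + (- (s' * clog (expi (pi - theta) * gamma u)) +
      'i * s' * (pi - theta)%:C).
    by rewrite /log_contour /s' !rmorphB /=; ring.
  rewrite cexpD cexpMn cexp_log_contour cexpD [cexp (- ('i * s' * _))]cexpN.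
  by apply: power_side; exact: cexp_neq0.
have Rr : csin (pi%:C * s') * cintegral leb setT (fun u => cintegral leb setT (fun t => rp t * K t u)) =
    (pi%:C * expi (pi - theta) * cexp (- ('i * s' * (pi - theta)%:C))) * (- (2 * pi%:C * 'i) * zeta s).
  have iz := zeta_integrable (s := s) (proj1 (andP hs)).
  have -> : - (2 * pi%:C * 'i) * zeta s = contour_integral gamma (fun z => cpow theta z (- s) * F z).
    exact: mulNK Ci.
  set c1 := _ * _ * cexp _.
  rewrite /contour_integral -(cintegralZ measurableT c1 iz).
  (* If the sine vanishes, [cE] makes the integrand on the right vanish identically; otherwise
     dividing [cE] by the sine shows that the inner integral is integrable along gamma. *)
  have [cs0|cs0] := eqVneq (csin (pi%:C * s')) 0.
    rewrite cs0 mul0r -[LHS](cintegral0 leb setT); apply: eq_cintegral => u _.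
    by rewrite -cE cs0 mul0r.
  have iI : cintegrable leb setT (fun u => cintegral leb setT (fun t => rp t * K t u)).
    have := cintegrableZ measurableT ((csin (pi%:C * s'))^-1 * c1) iz.
    by apply: (eq_cintegrable measurableT) => u _; exact: div_eq cs0 (cE u).
  rewrite -(cintegralZ measurableT (csin (pi%:C * s')) iI).
  by apply: eq_cintegral => u _; rewrite cE.
rewrite -swap L in Rr.
have eq1 : expi (pi - theta) = - e^-1 by rewrite addrC expiD expi_pi expiN mulrN1.
have eq2 : expi (k%:R * theta) = e ^+ k.
  by rewrite -cexp_i rmorphM rmorph_nat /= mulrCA cexpMn cexp_i.
have eq3 : cexp ('i * s' * (pi - theta)%:C) = cexp ('i * s * (pi - theta)%:C) * expi (k%:R * pi) * (e ^+ k)^-1.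
  rewrite -eq2 -expiN -!cexp_i -!cexpD; congr cexp.
  by rewrite /s' rmorphN !rmorphB !rmorphM !rmorph_nat /=; ring.
rewrite -(csin_shift s k) -/s'.
have ek0 : e ^+ k != 0 by rewrite expf_neq0.
have n1 := cexp_neq0 ('i * s * (pi - theta)%:C); have n2 := expi_neq0 (k%:R * pi : R).
rewrite eq1 cexpN eq3 in Rr.
exact: solve_zeta Rr.
Qed.

End NonInteger.

(* When Re s is an integer, by continuity in s. *)
Lemma zeta_representation s : - eps < cRe s < 1 -> zeta s =
  cexp ('i * s * (pi - theta)%:C) * pi%:C^-1 * csin (pi%:C * s) * ray_integral s.
Proof.
move=> hs.
have nonint w : - eps < cRe w < 1 -> (forall n : nat, cRe w + n%:R != 0) -> zeta w =
    cexp ('i * w * (pi - theta)%:C) * pi%:C^-1 * csin (pi%:C * w) * ray_integral w.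
  move=> /andP[w1 w2] wn; have [k hk] : exists k : nat, 0 < cRe w + k%:R < 1.
    have e : exists n : nat, 0 < cRe w + n%:R.
      exists (Num.bound (cRe w)); have := archi_boundP (normr_ge0 (cRe w)).
      rewrite /Num.bound normr_id => h; have := ler_norm (- cRe w); rewrite normrN; lra.
    (* The least k with Re w + k > 0 also satisfies Re w + k < 1: for k = 0 this is the assumption
       on w, and otherwise Re w + k - 1 is not positive by minimality and not 0 by
       nonintegrality. *)
    case: (ex_minnP e) => -[|m] hm mmin; first by exists 0%N; rewrite hm addr0.
    exists m.+1; rewrite hm /=; have : ~~ (0 < cRe w + m%:R) by apply/negP => /mmin; rewrite ltnn.
    rewrite -leNgt le_eqVlt (negbTE (wn m)) /= -natr1; lra.
  apply: (@zeta_noninteger w k); first by rewrite w1.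
  by rewrite cReD -(rmorph_nat (@real_complex R)).
have /andP[s1 s2] := hs.
(* When Re s is an integer, adding 0 < r n <= 1 / 2 moves it off the integers, and r n <= (1 - Re s)
   / 2 keeps it below 1. *)
pose r (n : nat) : R := (Num.min 1 (1 - cRe s) / 2) * n.+1%:R^-1.
have m0 : 0 < Num.min 1 (1 - cRe s) by rewrite lt_min ltr01 subr_gt0.
have [m1 m2] : Num.min 1 (1 - cRe s) <= 1 /\ Num.min 1 (1 - cRe s) <= 1 - cRe s.
  by rewrite !ge_min !lexx orbT.
have r0 n : 0 < r n by rewrite mulr_gt0 ?divr_gt0 ?invr_gt0.
have rm n : r n <= Num.min 1 (1 - cRe s) / 2.
  by rewrite ler_piMr ?divr_ge0 ?(ltW m0) // invf_le1 // ler1n.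
have rc : (r n)%:C @[n --> \oo] --> (0 : R[i]).
  apply: (@cvg_real _ _ _ _ r 0); rewrite -(mulr0 (Num.min 1 (1 - cRe s) / 2)).
  by apply: cvgM; [exact: cvg_cst | exact: cvg_harmonic].
have [[n0 hn0]|nz] := pselect (exists n : nat, cRe s + n%:R = 0); last first.
  by apply: nonint => // n; apply/eqP => h; apply: nz; exists n.
pose G w := cexp ('i * w * (pi - theta)%:C) * pi%:C^-1 * csin (pi%:C * w) * ray_integral w.
have e n : zeta (s + (r n)%:C) = G (s + (r n)%:C).
  have := r0 n; have := rm n => h1 h2; apply: nonint.
    by rewrite cReD /=; apply/andP; split; lra.
  move=> m; rewrite cReD /=; have -> : cRe s = - n0%:R by lra.
  apply/eqP => h3; have h4 : r n = n0%:R - m%:R by lra.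
  have [mn|nm] := leqP n0 m.
    have h5 : n0%:R <= m%:R :> R by rewrite ler_nat.
    by lra.
  have h5 : m.+1%:R <= n0%:R :> R by rewrite ler_nat.
  by rewrite -natr1 in h5; lra.
have l1 := derivable_seq_cvg (zeta_derivable s1) rc.
have l2 : G (s + (r n)%:C) @[n --> \oo] --> G s.
  have su : s + (r n)%:C @[n --> \oo] --> s.
    have h : s + (r n)%:C @[n --> \oo] --> s + 0 by exact: (cvg_cD (cvg_ccst s) rc).
    by rewrite addr0 in h.
  have k1 : cexp ('i * (s + (r n)%:C) * (pi - theta)%:C) @[n --> \oo] --> cexp ('i * s * (pi - theta)%:C).
    by apply: cvg_cexp; apply: (cvg_cM (cvg_cmul _ su) (cvg_ccst _)).
  have k2 : 'i * (pi%:C * (s + (r n)%:C)) @[n --> \oo] --> 'i * (pi%:C * s).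
    exact: (cvg_cmul _ (cvg_cmul _ su)).
  have k3 : - ('i * (pi%:C * (s + (r n)%:C))) @[n --> \oo] --> - ('i * (pi%:C * s)).
    exact: cvgN.
  have k4 : csin (pi%:C * (s + (r n)%:C)) @[n --> \oo] --> csin (pi%:C * s).
    exact: (cvg_cM (cvg_cB (cvg_cexp k2) (cvg_cexp k3)) (cvg_ccst _)).
  have k5 := derivable_seq_cvg (ray_derivable hs) rc.
  exact: (cvg_cM (cvg_cM (cvg_cM k1 (cvg_ccst _)) k4) k5).
apply: (norm_cvg_unique l1); move: l2; apply: cvg_trans; apply: near_eq_cvg; apply: nearW => n.
by rewrite e.
Qed.

End Representation.

(** * Resolvents on the contour and on the cut *)

Section ContourResolvent.
Context {R : realType} {H : completeNormedModType R[i]}.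
Variable dot : {dot H for @Num.conj R[i]}.
Hypothesis hH : hilbert dot.
Variables (gamma : R -> R[i]) (theta : R) (sigma : set R[i]).
Hypotheses (htheta : pi / 2 < theta < pi) (hgamma : admissible_contour gamma theta sigma).

Let smooth : piecewise_smooth gamma. Proof. by case: hgamma. Qed.
Let ends : straight_ends gamma. Proof. by case: hgamma. Qed.

Lemma sin_theta_gt0 : 0 < sin theta.
Proof. by have /andP[h1 h2] := htheta; apply: sin_gt0_pi; have := pi_gt0 R => p0; apply/andP; split; lra. Qed.

Lemma contour_ray_neq0 d z : 0 < d -> (range gamma `|` ray_from theta d) z -> z != 0.
Proof.
move=> d0 [[t _ <-]|[t dt ->]]; first exact: (contour_neq0 hgamma).
rewrite mulf_neq0 ?expi_neq0 //; apply/eqP => -[t0].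
by move: dt; rewrite t0 leNgt d0.
Qed.

Lemma contour_ray_Ninterior d z : 0 < d -> (range gamma `|` ray_from theta d) z ->
  ~ contour_interior gamma z.
Proof.
move=> d0 [gz|/(ray_from_ray d0) /(ray_Ninterior hgamma) //].
by move=> /contour_interior_Nrange.
Qed.

Lemma contour_ray_abs_ge d : 0 < d -> exists2 m, 0 < m &
  forall z, (range gamma `|` ray_from theta d) z -> m <= abs z.
Proof.
move=> d0; have n0 : ~ range gamma 0 by apply: (ray_Nrange hgamma); exists 0; rewrite ?rmorph0 ?mul0r.
have [m m0 hm] := contour_ge smooth ends n0.
exists (Num.min m d); first by rewrite lt_min m0.
move=> z [[t _ <-]|[t dt ->]]; rewrite ge_min; apply/orP.
  by left; have := hm t; rewrite subr0; apply: le_trans; rewrite ler_peMr ?(ltW m0) // lerDl.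
by right; rewrite absM abs_expi absR mulr1 (le_trans dt) // ler_norm.
Qed.

Variable S : operator H.
Hypotheses (saS : self_adjoint dot S) (sS : spectrum S `<=` sigma).

Lemma contour_ray_resolvent_set d z : 0 < d -> (range gamma `|` ray_from theta d) z ->
  resolvent_set S z.
Proof.
move=> d0 Uz; apply: contrapT => nz; apply: (contour_ray_Ninterior d0 Uz).
by apply: (contour_compl_spectrum hgamma); [exact: sS | exact: contour_ray_neq0 Uz].
Qed.

Lemma op_le_Im z c : 0 < c -> c <= `|cIm z| -> resolvent_set S z -> op_le (resolvent S z) c^-1.
Proof.
move=> c0 cz rz y; rewrite ler_pdivlMl //.
by apply: le_trans (resolvent_Im_le hH saS rz y); rewrite ler_wpM2r ?vnorm_ge0.
Qed.

(** At the ends of gamma and on the tail of the cut |Im z| is bounded below, by c and by d sin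
    theta; on the compact middle part of gamma the local bounds of [resolvent_local_bound] are made
    uniform. *)
Lemma contour_ray_resolvent_bound d : 0 < d -> exists2 B, 0 <= B &
  forall z, (range gamma `|` ray_from theta d) z -> op_le (resolvent S z) B.
Proof.
move=> d0; have [N [c [N0 c0 hc]]] := contour_Im_ends ends.
have rg t : resolvent_set S (gamma t).
  by apply: (contour_ray_resolvent_set d0); left; exists t.
have le_op (A : H -> H) (M M' : R) : M <= M' -> op_le A M -> op_le A M'.
  by move=> MM' h x; rewrite (le_trans (h x)) // ler_wpM2r ?vnorm_ge0.
have [|t|M hM] := @locally_uniform_itv _ (fun t M => op_le (resolvent S (gamma t)) M) (- N) N.
- by move=> t M M'; exact: le_op.
- have [_ [M M0 hM]] := bounded_opP (resolvent_bounded (rg t)); exists (2 * M).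
  have h : abs (gamma u - gamma t) * M @[u --> t] --> 0 * M.
    apply: cvgM; last exact: cvg_cst.
    by apply/cvg_absP; exact: (continuous_contour hgamma).
  rewrite mul0r in h; have /cvgrPdist_lt/(_ (1 / 2)) := h.
  rewrite divr_gt0 // => /(_ isT); apply: filterS => u hu.
  apply: (resolvent_local_bound saS M0 (rg u) (rg t) hM).
  by move: hu; rewrite sub0r normrN => /ltW; apply: le_trans; exact: ler_norm.
have s0 := sin_theta_gt0; have ds0 : 0 < d * sin theta by rewrite mulr_gt0.
have [i1 i2] : 0 <= c^-1 /\ 0 <= (d * sin theta)^-1 by rewrite !invr_ge0 !ltW.
have hM' := ler_norm M; have M0 := normr_ge0 M.
exists (`|M| + c^-1 + (d * sin theta)^-1); first by rewrite !addr_ge0.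
move=> z Uz; have rz := contour_ray_resolvent_set d0 Uz.
case: Uz => [[t _ e]|[t dt e]]; last first.
  apply: (le_op _ (d * sin theta)^-1); first by lra.
  apply: op_le_Im => //; rewrite e cImZ /=.
  by rewrite (le_trans _ (ler_norm _)) // ler_wpM2r // ltW.
rewrite -e; have [tN|/ltW tN] := leP `|t| N.
  by apply: (le_op _ M); [lra | apply: hM; rewrite -ler_norml].
by apply: (le_op _ c^-1); [lra | apply: op_le_Im => //; exact: hc].
Qed.

End ContourResolvent.

Lemma approximable_sub (R : realType) (U : set R[i]) (P Q : set R) G : P `<=` Q ->
  approximable U P G -> approximable U Q G.
Proof.
move=> PQ h eta eta0; have [s [Ps hs]] := h _ eta0.
by exists s; split => // p /Ps /PQ.
Qed.

(** * Decay of the reduced trace on the contour and on the whole cut *)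

Section RayDecay.
Context {R : realType}.
Variables (gamma : R -> R[i]) (theta : R) (sigma : set R[i]).
Hypotheses (htheta : pi / 2 < theta < pi) (hgamma : admissible_contour gamma theta sigma).
Local Notation pos := (`]0, +oo[%classic : set R).
Variables (F : R[i] -> R[i]) (Fn : nat -> R[i] -> R[i]).
Hypotheses
  (Fn_cvg : forall d z, 0 < d -> (range gamma `|` ray_from theta d) z -> Fn n z @[n --> \oo] --> F z)
  (Fn_le : forall d, 0 < d -> exists C, forall n z, (range gamma `|` ray_from theta d) z ->
     abs (Fn n z) <= C * (1 + abs z) ^+ 2)
  (Fn_approx : forall d n, 0 < d -> approximable (range gamma `|` ray_from theta d)
     [set l | contour_interior gamma l%:C] (Fn n)).
Variable eps : R.
Hypotheses (eps0 : 0 < eps)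
  (Finfty : exists K r : R, forall z, ~ contour_interior gamma z -> r <= abs z ->
     abs (F z) <= K * abs z `^ (- 1 - eps))
  (Fzero : exists K r : R, 0 < r /\ forall z, ~ contour_interior gamma z ->
     z != 0 -> abs z < r -> abs (F z) <= K).

(** Merges the decay for large arguments with a plain bound M on the remaining range: there X <= Y,
    so (Y / X)^(1 + eps) >= 1 turns M into a multiple of X^(-1 - eps). *)
Lemma decay_of_cases (K M Y d X a f : R) : 0 < d -> 0 < X -> 0 <= Y -> 0 <= K -> 0 <= M ->
  (d * X <= a /\ f <= K * a `^ (- 1 - eps)) \/ (X <= Y /\ f <= M) ->
  f <= (K * d `^ (- 1 - eps) + M * Y `^ (1 + eps)) * X `^ (- 1 - eps).
Proof.
move=> d0 X0 Y0 K0 M0; have e1 : 0 <= 1 + eps by rewrite addr_ge0 // ltW.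
have -> : - 1 - eps = - (1 + eps) :> R by ring.
rewrite mulrDl; case=> -[h1 h2].
  apply: (le_trans h2); rewrite -[leLHS]addr0; apply: lerD; last by rewrite !mulr_ge0 ?powR_ge0.
  rewrite -mulrA ler_wpM2l // -powRM ?(ltW d0) ?(ltW X0) // !powRN.
  have dX0 : 0 < d * X by rewrite mulr_gt0.
  rewrite lef_pV2 ?posrE ?powR_gt0 ?(lt_le_trans dX0) //.
  by apply: ge0_ler_powR; rewrite ?nnegrE ?(ltW dX0) // (le_trans (ltW dX0)).
apply: (le_trans h2); rewrite -[leLHS]add0r; apply: lerD; first by rewrite !mulr_ge0 ?powR_ge0.
rewrite -mulrA ler_peMr // powRN ler_pdivlMr ?powR_gt0 // mul1r.
by apply: ge0_ler_powR; rewrite ?nnegrE ?(ltW X0).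
Qed.

Lemma F_le d : 0 < d -> exists2 C, 0 <= C & forall z, (range gamma `|` ray_from theta d) z ->
  abs (F z) <= C * (1 + abs z) ^+ 2.
Proof.
move=> d0; have [C hC] := Fn_le d0; exists `|C| => // z Uz.
apply: (ler_cvg_to (cvg_abs _ (Fn_cvg d0 Uz)) (cvg_cst _)); apply: nearW => n.
by rewrite (le_trans (hC n z Uz)) // ler_wpM2r ?sqr_ge0 // ler_norm.
Qed.

(** Beyond radius r the assumption at infinity applies, and on the cut near 0 the assumption at 0;
    in between the bound is the limit of the bounds on the partial sums. *)
Lemma F_decay : exists C0, (forall t, abs (F (gamma t)) <= C0 * (1 + `|t|) `^ (- 1 - eps)) /\
  (forall t, 0 < t -> abs (F (t%:C * expi theta)) <= C0 * (1 + t) `^ (- 1 - eps)).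
Proof.
have [K [r1 h1]] := Finfty; have [M0 [r0 [r00 h0]]] := Fzero.
have [C1 C10 hC1] := F_le r00.
have n0 : ~ range gamma 0 by apply: (ray_Nrange hgamma); exists 0; rewrite ?rmorph0 ?mul0r.
have smooth : piecewise_smooth gamma by case: hgamma.
have ends : straight_ends gamma by case: hgamma.
have [d d0 hd] := contour_ge smooth ends n0.
pose r := `|r1| + 1; have r1r : r1 <= r by rewrite (le_trans (ler_norm _)) // lerDl.
have r_ge1 : 1 <= r by rewrite lerDr.
have r_ge0 : 0 <= r by exact: le_trans r_ge1.
have h1' z : ~ contour_interior gamma z -> r <= abs z -> abs (F z) <= `|K| * abs z `^ (- 1 - eps).
  by move=> iz rz; rewrite (le_trans (h1 _ iz (le_trans r1r rz))) // ler_wpM2r ?powR_ge0 // ler_norm.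
pose M := C1 * (1 + r) ^+ 2; have M_ge0 : 0 <= M by rewrite mulr_ge0 ?sqr_ge0.
have hM z : (range gamma `|` ray_from theta r0) z -> abs z <= r -> abs (F z) <= M.
  move=> Uz zr; rewrite (le_trans (hC1 _ Uz)) // ler_wpM2l // lerXn2r ?nnegrE ?addr_ge0 ?abs_ge0 //.
  by rewrite lerD2l.
pose P1 := `|K| * d `^ (- 1 - eps) + M * (r / d) `^ (1 + eps).
(* The factor 1 / 2 passes from t to 1 + t on the cut: for t >= r >= 1 one has (1 + t) / 2 <= t. *)
pose P2 := `|K| * (1 / 2) `^ (- 1 - eps) + (M + `|M0|) * (1 + r) `^ (1 + eps).
have [p1 p2] : 0 <= P1 /\ 0 <= P2.
  by split; rewrite addr_ge0 // mulr_ge0 ?powR_ge0 // addr_ge0.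
exists (P1 + P2); split=> t.
  have Ut : (range gamma `|` ray_from theta r0) (gamma t) by left; exists t.
  have hdt := hd t; rewrite subr0 in hdt.
  apply: (@le_trans _ _ (P1 * (1 + `|t|) `^ (- 1 - eps))); last first.
    by rewrite ler_wpM2r ?powR_ge0 // lerDl.
  apply: (@decay_of_cases _ _ _ _ _ (abs (gamma t))) => //; rewrite ?ltr_pwDl ?divr_ge0 ?(ltW d0) //.
  have [zr|/ltW zr] := leP r (abs (gamma t)).
    by left; split => //; apply: h1' => //; exact: (contour_ray_Ninterior hgamma r00 Ut).
  by right; split; [rewrite ler_pdivlMr // mulrC (le_trans hdt) | exact: hM].
move=> t0; have at_ : abs (t%:C * expi theta) = t by rewrite absM abs_expi absR mulr1 gtr0_norm.
have it : ~ contour_interior gamma (t%:C * expi theta).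
  by apply: (ray_Ninterior hgamma); exact: rayP (ltW t0).
apply: (@le_trans _ _ (P2 * (1 + t) `^ (- 1 - eps))); last first.
  by rewrite ler_wpM2r ?powR_ge0 // lerDr.
apply: (@decay_of_cases _ _ _ _ _ t) => //; rewrite ?addr_ge0 ?ltr_pwDl ?(ltW t0) //.
have [tr|/ltW tr] := leP r t.
  left; split; last by have := h1' _ it; rewrite at_; apply.
  by have := le_trans r_ge1 tr => t1; lra.
right; split; first by rewrite lerD2l.
have [t1|t1] := ltP t r0.
  have := h0 _ it; rewrite at_ -abs_eq0 at_ gt_eqF // => /(_ isT t1); have := ler_norm M0; lra.
have := hM (t%:C * expi theta); rewrite at_ => /(_ _ tr) h; have := normr_ge0 M0.
by have := h (or_intror (ex_intro2 _ _ t t1 erefl)); lra.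
Qed.

(** The partial sums are controlled on tails of the cut, so the open ray is exhausted by the sets t
    >= 1 / (n + 1). *)
Lemma F_ray_measurable : cmeasurable pos (fun t => F (t%:C * expi theta)).
Proof.
pose D (n : nat) : set R := [set t | n.+1%:R^-1 <= t].
have mD n : measurable (D n).
  rewrite (_ : D n = `[n.+1%:R^-1, +oo[%classic) //.
  by apply/seteqP; split=> t; rewrite /D /= in_itv /= andbT.
have m1 n : cmeasurable (D n) (fun t => F (t%:C * expi theta)).
  have d0 : 0 < n.+1%:R^-1 :> R by rewrite invr_gt0.
  apply: (@cmeasurable_cvg R _ _ (D n) (fun k (t : R) => Fn k (t%:C * expi theta))
    (fun t : R => F (t%:C * expi theta))) => [k|t Dt]; last first.
    by apply: (Fn_cvg d0); right; exists t.
  apply: approximable_measurable (Fn_approx k d0).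
    by apply: cmeasurableM; [apply: cmeasurable_real; exact: measurable_id | exact: cmeasurable_cst].
  by move=> t Dt; right; exists t.
have e : pos = \bigcup_n D n.
  apply/seteqP; split=> t /=; rewrite in_itv /= andbT; last first.
    by move=> [n _]; apply: lt_le_trans; rewrite invr_gt0.
  move=> t0; exists (Num.bound t^-1) => //; rewrite /D /= invf_ple ?posrE //.
  have := archi_boundP (ltW (etrans (invr_gt0 t) t0)); move=> /ltW /le_trans; apply.
  by rewrite ler_nat.
by rewrite e; split; apply/measurable_fun_bigcup => // n; case: (m1 n).
Qed.

End RayDecay.

(** * Logarithmic derivatives along the cut *)

Section LogarithmicDerivative.
Context {R : realType}.
Implicit Types (f g : R -> R[i]) (a b : R[i]) (t : R).

Definition log_derivative g t a : Prop := g t != 0 /\ cderive g t (g t * a).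

Lemma log_derivativeM f g t a b : log_derivative f t a -> log_derivative g t b ->
  log_derivative (fun u => f u * g u) t (a + b).
Proof.
move=> [f0 df] [g0 dg]; split; first by rewrite mulf_neq0.
by apply: cderive_eq (cderiveM df dg) _; ring.
Qed.

Lemma log_derivativeV g t a : log_derivative g t a -> log_derivative (fun u => (g u)^-1) t (- a).
Proof.
move=> [g0 dg]; split; first by rewrite invr_neq0.
by apply: cderive_eq (cderiveV g0 dg) _; field.
Qed.

Lemma log_derivativeX g t a n : log_derivative g t a ->
  log_derivative (fun u => g u ^+ n) t (n%:R * a).
Proof.
move=> h; elim: n => [|n IH].
  split; first by rewrite expr0 oner_neq0.
  by apply: cderive_eq (cderive_cst _ _) _; rewrite mul0r mulr0.
rewrite (_ : (fun u => _) = fun u => g u * g u ^+ n).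
  by rewrite -natr1 mulrDl mul1r addrC; exact: log_derivativeM.
by apply/funext => u; rewrite exprS.
Qed.

Lemma near_log_derivative f g t a : (\forall u \near t, f u = g u) ->
  log_derivative f t a -> log_derivative g t a.
Proof.
move=> fg [f0 [d1 d2]]; have e := nbhs_singleton fg; split; first by rewrite -e.
by rewrite -e; split; [apply: near_eq_is_derive d1 | apply: near_eq_is_derive d2];
  apply: filterS fg => u ->.
Qed.

Lemma log_derivativeE g t a : log_derivative g t a -> rderiv g t / g t = a.
Proof. by move=> [g0 dg]; rewrite (cderive_rderiv dg) mulrC mulKf. Qed.

Lemma log_derivative_ray_determinant (D : R[i] -> R[i]) (m1 m2 : nat) (e : R[i]) t :
  e != 0 -> 0 < t -> derivable D (e * t%:C) 1 -> D (e * t%:C) != 0 ->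
  log_derivative (fun u => (e * u%:C) ^ (m1%:Z - m2%:Z) * D (e * u%:C)) t
    ((m1%:R - m2%:R) / t%:C + e * (derive1 D (e * t%:C) / D (e * t%:C))).
Proof.
move=> e0 t0 dD D0; have tc : t%:C != 0 :> R[i] by apply/eqP => -[h]; rewrite h ltxx in t0.
have dl : cderive (fun u : R => e * u%:C) t e.
  apply: cderive_eq (cderiveZ e (cderive_real (is_derive_id t 1))) _.
  by rewrite mulr1.
have h1 : log_derivative (fun u : R => e * u%:C) t (t%:C^-1).
  split; first by rewrite mulf_neq0.
  by apply: cderive_eq dl _; rewrite mulfK.
have h2 : log_derivative (fun u : R => D (e * u%:C)) t (e * (derive1 D (e * t%:C) / D (e * t%:C))).
  split => //; have dD' : is_derive (e * t%:C) 1 D (derive1 D (e * t%:C)).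
    exact: (DeriveDef dD (esym (derive1E D (e * t%:C)))).
  by apply: cderive_eq (cderive_comp dD' dl) _; field.
have h3 := log_derivativeM (log_derivativeM (log_derivativeX m1 h1) (log_derivativeV (log_derivativeX m2 h1))) h2.
rewrite mulrBl; apply: near_log_derivative h3.
(* Splitting the integer power into a natural power and an inverse one needs a nonzero base, hence u
   > 0, which holds near t. *)
have : \forall u \near t, 0 < u by exact: lt_nbhsr.
apply: filterS => u u0; rewrite expfzDr; first by rewrite exprnN.
by rewrite mulf_neq0 //; apply/eqP => -[h]; rewrite h ltxx in u0.
Qed.

End LogarithmicDerivative.

Section RelativeZeta.
Context {R : realType} {H : completeNormedModType R[i]}.
Variable dot : {dot H for @Num.conj R[i]}.
Hypothesis hH : hilbert dot.
Variables (S1 S2 : operator H) (E1 E2 : projection_measure dot) (m1 m2 : nat).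
Hypotheses (saS1 : self_adjoint dot S1) (saS2 : self_adjoint dot S2).
Hypotheses (hE1 : spectral_measure_of E1 S1) (hE2 : spectral_measure_of E2 S2).
Hypotheses (hm1 : has_dim (ker S1) m1) (hm2 : has_dim (ker S2) m2).
Hypothesis htc : exists2 z, (resolvent_set S1 `&` resolvent_set S2) z &
  trace_class dot (fun x => resolvent S2 z x - resolvent S1 z x).
Variables (gamma : R -> R[i]) (theta : R).
Hypotheses (htheta : pi / 2 < theta < pi)
  (hgamma : admissible_contour gamma theta (spectrum S1 `|` spectrum S2)).
Local Notation F := (reduced_trace S1 S2 E1 E2).

Lemma reduced_trace_approximation : exists Fn : nat -> R[i] -> R[i],
  [/\ forall d z, 0 < d -> (range gamma `|` ray_from theta d) z -> Fn n z @[n --> \oo] --> F z,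
    forall d, 0 < d -> exists C, forall n z, (range gamma `|` ray_from theta d) z ->
      abs (Fn n z) <= C * (1 + abs z) ^+ 2,
    forall d n, 0 < d -> approximable (range gamma `|` ray_from theta d)
      [set l | contour_interior gamma l%:C] (Fn n) &
    forall t, 0 < t -> F (t%:C * expi theta) =
      tr dot (fun x => resolvent S2 (t%:C * expi theta) x - resolvent S1 (t%:C * expi theta) x) +
      (m2%:R - m1%:R) / (t%:C * expi theta)].
Proof.
have [z0 [r01 r02] tc0] := htc.
have [C [e [C0 he hC]]] := reduced_trace_exists hH saS1 saS2 hE1 hE2 hm1 hm2 r01 r02 tc0.
have s1 : spectrum S1 `<=` spectrum S1 `|` spectrum S2 by left.
have s2 : spectrum S2 `<=` spectrum S1 `|` spectrum S2 by right.
have bound d : 0 < d -> exists2 B, 0 <= B & forall z, (range gamma `|` ray_from theta d) z ->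
    [/\ resolvent_set S1 z, resolvent_set S2 z, z != 0,
        op_le (resolvent S1 z) B & op_le (resolvent S2 z) B].
  move=> d0; have [B1 B10 hB1] := contour_ray_resolvent_bound hH htheta hgamma saS1 s1 d0.
  have [B2 B20 hB2] := contour_ray_resolvent_bound hH htheta hgamma saS2 s2 d0.
  exists (B1 + B2) => [|z Uz]; first exact: addr_ge0.
  split; [exact: (contour_ray_resolvent_set hgamma s1 d0)|exact: (contour_ray_resolvent_set hgamma s2 d0)|
    exact: (contour_ray_neq0 hgamma d0)| |] => x.
    by rewrite (le_trans (hB1 z Uz x)) // ler_wpM2r ?vnorm_ge0 // lerDl.
  by rewrite (le_trans (hB2 z Uz x)) // ler_wpM2r ?vnorm_ge0 // lerDr.
(* Partial sums of the trace in one basis for all z. The poles of their approximants are nonzero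
   points of the spectrum, so the admissibility of gamma puts them inside. *)
exists (fun n z => series (fun k => reduced_term S1 S2 E1 E2 e k z) n); split.
- move=> d z d0 Uz; have [B B0 /(_ z Uz)[? ? ? ? ?]] := bound d d0.
  by have [] := hC z B.
- move=> d d0; have [B B0 hB] := bound d d0.
  have [m m0 hm] := contour_ray_abs_ge hgamma d0.
  exists (C * ((1 + B * (1 + abs z0)) ^+ 2 + m^-1)) => n z Uz.
  have [? ? ? ? ?] := hB z Uz; have [] // := hC z B; move=> _ /(_ n) h _; apply: (le_trans h).
  rewrite -mulrA ler_wpM2l // mulrDl; have z_ge0 := abs_ge0 z; have z0_ge0 := abs_ge0 z0.
  apply: lerD.
    rewrite -exprMn lerXn2r ?nnegrE ?mulr_ge0 ?addr_ge0 ?mulr_ge0 ?abs_ge0 ?addr_ge0 //.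
    have hz : abs (z - z0) * B <= (abs z + abs z0) * B by rewrite ler_wpM2r // absB.
    have := mulr_ge0 (mulr_ge0 B0 z0_ge0) z_ge0; lra.
  apply: (@le_trans _ _ m^-1); first by rewrite lef_pV2 ?posrE ?hm // (lt_le_trans m0 (hm z Uz)).
  by rewrite ler_peMr ?invr_ge0 ?(ltW m0) // exprn_ege1 // lerDl.
- move=> d n d0; have [B B0 hB] := bound d d0.
  apply: approximable_sub (reduced_term_approximable hH saS1 saS2 hE1 hE2 e n B0 hB).
  move=> l [l0 sl _]; apply: (contour_compl_spectrum hgamma sl).
  by rewrite (inj_eq (@complexI R)).
- move=> t t0; have [B B0 hB] := bound t t0.
  have [] := hB (t%:C * expi theta); first by right; exists t.
  by move=> ? ? ? ? ?; have [] := hC (t%:C * expi theta) B.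
Qed.

Lemma ray_cut_plane t : 0 < t -> cut_plane S1 S2 (t%:C * expi theta).
Proof.
move=> t0 [h _]; move: h; rewrite cImZ /= => /eqP.
by rewrite mulf_eq0 !gt_eqF // (sin_theta_gt0 htheta).
Qed.

End RelativeZeta.

Theorem theorem2p8 (R : realType) (H : completeNormedModType R[i])
  (dot : {dot H for @Num.conj R[i]})
  (S1 S2 : operator H) (E1 E2 : projection_measure dot)
  (m1 m2 : nat) (lambda1 theta eps : R) (gamma : R -> R[i])
  (b : R[i] -> R) (D : R[i] -> R[i])
  (hH : hilbert dot) (sepH : separable H)
  (saS1 : self_adjoint dot S1) (saS2 : self_adjoint dot S2)
  (bbS1 : bounded_below dot S1) (bbS2 : bounded_below dot S2)
  (hE1 : spectral_measure_of E1 S1) (hE2 : spectral_measure_of E2 S2)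
  (hm1 : has_dim (ker S1) m1) (hm2 : has_dim (ker S2) m2)
  (htc : exists2 z, (resolvent_set S1 `&` resolvent_set S2) z &
     trace_class dot (fun x => resolvent S2 z x - resolvent S1 z x))
  (hlambda1 : 0 < lambda1)
  (hess : ess_spectrum S1 `|` ess_spectrum S2
            `<=` [set l%:C | l in `[lambda1, +oo[])
  (hD : forall z, cut_plane S1 S2 z -> symmetrized_det S1 E2 (b z) z (D z))
  (htr : forall z, cut_plane S1 S2 z ->
     [/\ derivable D z 1, D z != 0 &
         tr dot (fun x => resolvent S2 z x - resolvent S1 z x)
           = - (derive1 D z / D z)])
  (htheta : pi / 2 < theta < pi)
  (hgamma : admissible_contour gamma theta (spectrum S1 `|` spectrum S2))
  (heps : 0 < eps)
  (hinfty : exists K r : R, forall z, ~ contour_interior gamma z ->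
     r <= abs z ->
     abs (reduced_trace S1 S2 E1 E2 z) <= K * abs z `^ (- 1 - eps))
  (hzero : exists K r : R, 0 < r /\ forall z, ~ contour_interior gamma z ->
     z != 0 -> abs z < r -> abs (reduced_trace S1 S2 E1 E2 z) <= K) :
  exists Z : R[i] -> R[i],
    is_relative_zeta gamma theta (reduced_trace S1 S2 E1 E2) eps Z /\
    forall s : R[i], - eps < complex.Re s < 1 ->
      let g (t : R) : R[i] :=
        (expi theta * t%:C) ^ (m1%:Z - m2%:Z) * D (expi theta * t%:C) in
      cintegrable (@lebesgue_measure R) `]0, +oo[
        (fun t => rcpow t (- s) * (rderiv g t / g t)) /\
      Z s = cexp ('i * s * (pi - theta)%:C) * pi%:C^-1 * csin (pi%:C * s)
            * cintegral (@lebesgue_measure R) `]0, +oo[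
                (fun t => rcpow t (- s) * (rderiv g t / g t)).
Proof.
have [Fn [Fn_cvg Fn_le Fn_approx F_tr]] :=
  reduced_trace_approximation hH saS1 saS2 hE1 hE2 hm1 hm2 htc htheta hgamma.
have [C0 [F_contour_le F_ray_le]] := F_decay hgamma Fn_cvg Fn_le heps hinfty hzero.
have mFc := F_contour_measurable hgamma Fn_cvg Fn_approx.
have mFr := F_ray_measurable Fn_cvg Fn_approx.
have F_moment m (a : R) : m%:R < 1 + eps -> 0 < a ->
    contour_integrable gamma (fun z => (z - a%:C * expi theta)^-1 * z ^+ m * reduced_trace S1 S2 E1 E2 z) /\
    contour_integral gamma (fun z => (z - a%:C * expi theta)^-1 * z ^+ m * reduced_trace S1 S2 E1 E2 z) =
    - (2 * pi%:C * 'i) * ((a%:C * expi theta) ^+ m * reduced_trace S1 S2 E1 E2 (a%:C * expi theta)).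
  move=> me a0; split; last first.
    exact: (cauchy_moment htheta hgamma Fn_cvg Fn_le Fn_approx heps F_contour_le F_ray_le me a0).
  by have [C []] := F_cauchy_integrable htheta hgamma Fn_cvg Fn_approx F_contour_le me a0.
(* The contour integral already converges and is holomorphic for Re s > - eps, so it is its own
   continuation; accordingly s0 is - eps. *)
exists (zeta gamma theta (reduced_trace S1 S2 E1 E2)); split.
  split; first by move=> s hs; exact: (zeta_derivable htheta hgamma mFc F_contour_le hs).
  exists (- eps) => s hs; split => //.
  exact: (zeta_integrable htheta hgamma mFc F_contour_le hs).
move=> s hs g.
have gE (t : R) : `]0, +oo[%classic t ->
    rcpow t (- s) * (- (expi theta * reduced_trace S1 S2 E1 E2 (t%:C * expi theta))) =
    rcpow t (- s) * (rderiv g t / g t).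
  move=> /posP t0; congr (_ * _).
  have [dD D0 trE] := htr _ (ray_cut_plane htheta t0).
  have c := mulrC t%:C (expi theta); rewrite F_tr // trE c; rewrite c in dD D0.
  rewrite (log_derivativeE (log_derivative_ray_determinant m1 m2 (expi_neq0 theta) t0 dD D0)).
  have e0 := expi_neq0 theta.
  have tc : t%:C != 0 :> R[i] by apply/eqP => -[h]; rewrite h ltxx in t0.
  by field; rewrite e0 tc D0.
split.
  apply: (eq_cintegrable (@measurable_pos R) gE).
  exact: (ray_integrable mFr F_ray_le hs).
rewrite (zeta_representation htheta hgamma mFc mFr F_contour_le F_ray_le F_moment hs).
by congr (_ * _); exact: (eq_cintegral (@lebesgue_measure R) gE).
Qed.
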